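(* Let $\Gamma$ be a Fuchsian group, let $z\in\mathbb H$, and suppose that no point of the orbit $\Gamma(z)\subset\mathbb H$ is fixed by a non-identity element of $\Gamma$. Let $\alpha>-1$ be real. Then there is a non-zero function in $A^2_\alpha$ vanishing at every point of $\Gamma(z)$ if and only if $$\alpha>\frac{4\pi}{\mathrm{covolume}(\Gamma)}-1 .$$
   Context: A Fuchsian group is a discrete finite-covolume subgroup of $PSL_2(\mathbb R)$, acting on the upper half plane $\mathbb H$ by $g(z)=\frac{az+b}{cz+d}$. $\mathrm{covolume}(\Gamma)$ is the area of $\mathbb H/\Gamma$ for the hyperbolic metric of curvature $-1$, i.e. for the measure $dx\,dy/y^2$. For $\alpha>-1$ the weighted Bergman space $A^2_\alpha$ is the Hilbert space of holomorphic functions on the unit disc $\mathbb D$ that are square integrable for the measure $(1-r^2)^\alpha r\,dr\,d\theta$. With $s=\alpha+2$, it is identified with the space of holomorphic functions on $\mathbb H$ square integrable for $y^{s-2}dx\,dy$, via $f\mapsto\check f$, $\check f(z)=\left(\frac{2}{z+i}\right)^s f\left(\frac{z-i}{z+i}\right)$ (unitary up to normalization); zeros correspond under the Cayley transform $C(z)=\frac{z-i}{z+i}$, and the notation $A^2_\alpha$ is used for both models. *)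

(* Defs.v *)
From HB Require Import structures.
From mathcomp Require Import all_boot all_order all_algebra.
From mathcomp Require Import all_classical all_reals all_analysis.
From mathcomp Require Import complex.

Set Implicit Arguments.
Unset Strict Implicit.
Unset Printing Implicit Defensive.

Import Order.TTheory GRing.Theory Num.Theory.
Import numFieldNormedType.Exports.
Import ComplexField.

Local Open Scope classical_set_scope.
Local Open Scope ring_scope.
Local Open Scope complex_scope.
Local Open Scope quotient_scope.

Section SL2.
Variable R : realType.

Definition SL2 := {A : 'M[R]_2 | \det A == 1}.

HB.instance Definition _ := SubChoice.on SL2.
HB.instance Definition _ :=
  Topological.copy SL2 (initial_topology (val : SL2 -> 'M[R]_2)).

Fact SL2_one_subproof : \det (1%:M : 'M[R]_2) == 1.
Proof. by rewrite det1. Qed.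

Fact SL2_mul_subproof (A B : SL2) : \det (val A *m val B) == 1.
Proof. by rewrite det_mulmx (eqP (valP A)) (eqP (valP B)) mulr1. Qed.

Fact SL2_inv_subproof (A : SL2) : \det (invmx (val A)) == 1.
Proof. by rewrite det_inv (eqP (valP A)) invr1. Qed.

Definition SL2_one : SL2 := Sub 1%:M SL2_one_subproof.
Definition SL2_mul (A B : SL2) : SL2 := Sub (val A *m val B) (SL2_mul_subproof A B).
Definition SL2_inv (A : SL2) : SL2 := Sub (invmx (val A)) (SL2_inv_subproof A).

Lemma SL2_unitmx (A : SL2) : val A \in unitmx.
Proof. by rewrite unitmxE (eqP (valP A)) unitr1. Qed.

Lemma SL2_mulA : associative SL2_mul.
Proof. by move=> A B C; apply: val_inj; rewrite /= mulmxA. Qed.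

Lemma SL2_mul1 : left_id SL2_one SL2_mul.
Proof. by move=> A; apply: val_inj; rewrite /= mul1mx. Qed.

Lemma SL2_1mul : right_id SL2_one SL2_mul.
Proof. by move=> A; apply: val_inj; rewrite /= mulmx1. Qed.

Lemma SL2_mulV : left_inverse SL2_one SL2_inv SL2_mul.
Proof. by move=> A; apply: val_inj; rewrite /= mulVmx ?SL2_unitmx. Qed.

Lemma SL2_Vmul : right_inverse SL2_one SL2_inv SL2_mul.
Proof. by move=> A; apply: val_inj; rewrite /= mulmxV ?SL2_unitmx. Qed.

HB.instance Definition _ :=
  isGroup.Build SL2 SL2_mulA SL2_mul1 SL2_1mul SL2_mulV SL2_Vmul.

(* Equality up to sign: PSL2 is the quotient of SL2 by {1, -1}. *)
Definition SL2_eqpm (A B : SL2) : bool :=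
  (val A == val B) || (val A == - val B).

Lemma SL2_eqpm_refl : reflexive SL2_eqpm.
Proof. by move=> A; rewrite /SL2_eqpm eqxx. Qed.

Lemma SL2_eqpm_sym : symmetric SL2_eqpm.
Proof.
by move=> A B; rewrite /SL2_eqpm eq_sym -eqr_oppLR [- _ == _]eq_sym.
Qed.

Lemma SL2_eqpm_trans : transitive SL2_eqpm.
Proof.
move=> B A C; rewrite /SL2_eqpm => /orP[]/eqP-> /orP[]/eqP->;
  by rewrite ?opprK eqxx ?orbT.
Qed.

Canonical SL2_eqpm_equiv :=
  EquivRel SL2_eqpm SL2_eqpm_refl SL2_eqpm_sym SL2_eqpm_trans.

Definition PSL2 := quotient_topology {eq_quot SL2_eqpm}.

HB.instance Definition _ := Topological.on PSL2.
HB.instance Definition _ := Quotient.on PSL2.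

Lemma PSL2_eqP (A B : SL2) : reflect (\pi_PSL2 A = \pi_PSL2 B) (SL2_eqpm A B).
Proof. exact: (@eqmodP _ SL2_eqpm_equiv A B). Qed.

Definition PSL2_one : PSL2 := \pi_PSL2 SL2_one.
Definition PSL2_mul (g h : PSL2) : PSL2 := \pi_PSL2 (SL2_mul (repr g) (repr h)).
Definition PSL2_inv (g : PSL2) : PSL2 := \pi_PSL2 (SL2_inv (repr g)).

Lemma PSL2_repr (A : SL2) : SL2_eqpm (repr (\pi_PSL2 A)) A.
Proof. by apply/PSL2_eqP; rewrite reprK. Qed.

Lemma SL2_eqpmM (A A' B B' : SL2) :
  SL2_eqpm A A' -> SL2_eqpm B B' -> SL2_eqpm (SL2_mul A B) (SL2_mul A' B').
Proof.
rewrite /SL2_eqpm /= => /orP[]/eqP-> /orP[]/eqP->;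
  by rewrite ?(mulmxN, mulNmx) ?opprK eqxx ?orbT.
Qed.

Lemma SL2_eqpmV (A B : SL2) :
  SL2_eqpm A B -> SL2_eqpm (SL2_inv A) (SL2_inv B).
Proof.
rewrite /SL2_eqpm /= => /orP[]/eqP->; first by rewrite eqxx.
have uN : -1 *: val B \in unitmx by rewrite unitmxZ ?SL2_unitmx ?unitrN1.
by rewrite -scaleN1r invmxZ // invrN invr1 scaleN1r eqxx orbT.
Qed.

Lemma PSL2_piM (A B : SL2) :
  \pi_PSL2 (SL2_mul A B) = PSL2_mul (\pi_PSL2 A) (\pi_PSL2 B).
Proof.
by apply/PSL2_eqP; rewrite SL2_eqpm_sym; apply: SL2_eqpmM; exact: PSL2_repr.
Qed.

Lemma PSL2_piV (A : SL2) : \pi_PSL2 (SL2_inv A) = PSL2_inv (\pi_PSL2 A).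
Proof.
by apply/PSL2_eqP; rewrite SL2_eqpm_sym; apply: SL2_eqpmV; exact: PSL2_repr.
Qed.

Lemma PSL2_mulA : associative PSL2_mul.
Proof.
elim/quotW=> A; elim/quotW=> B; elim/quotW=> C.
by rewrite -(PSL2_piM A B) -(PSL2_piM B C) -(PSL2_piM A) -(PSL2_piM _ C) SL2_mulA.
Qed.

Lemma PSL2_mul1 : left_id PSL2_one PSL2_mul.
Proof. by elim/quotW=> A; rewrite -(PSL2_piM _ A) SL2_mul1. Qed.

Lemma PSL2_1mul : right_id PSL2_one PSL2_mul.
Proof. by elim/quotW=> A; rewrite -(PSL2_piM A) SL2_1mul. Qed.

Lemma PSL2_mulV : left_inverse PSL2_one PSL2_inv PSL2_mul.
Proof. by elim/quotW=> A; rewrite -PSL2_piV -(PSL2_piM _ A) SL2_mulV. Qed.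

Lemma PSL2_Vmul : right_inverse PSL2_one PSL2_inv PSL2_mul.
Proof. by elim/quotW=> A; rewrite -PSL2_piV -(PSL2_piM A) SL2_Vmul. Qed.

HB.instance Definition _ :=
  isGroup.Build PSL2 PSL2_mulA PSL2_mul1 PSL2_1mul PSL2_mulV PSL2_Vmul.

End SL2.

Section Action.
Variable R : realType.

Definition upper_half_plane : set R[i] := [set z | 0 < complex.Im z].

Definition mobius (A : 'M[R]_2) (z : R[i]) : R[i] :=
  ((A 0 0)%:C * z + (A 0 1)%:C) / ((A 1 0)%:C * z + (A 1 1)%:C).

Lemma mobiusN (A : 'M[R]_2) (z : R[i]) : mobius (- A) z = mobius A z.
Proof.
by rewrite /mobius !mxE !rmorphN !mulNr -!opprD invrN mulrNN.
Qed.

Definition psl2_act (g : PSL2 R) (z : R[i]) : R[i] := mobius (val (repr g)) z.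

Lemma psl2_act_pi (A : SL2 R) (z : R[i]) : psl2_act (\pi_(PSL2 R) A) z = mobius (val A) z.
Proof.
by rewrite /psl2_act; case/orP: (PSL2_repr A) => /eqP->; rewrite ?mobiusN.
Qed.

Definition psl2_orbit (G : set (PSL2 R)) (z : R[i]) : set R[i] :=
  [set psl2_act g z | g in G].

(* Lebesgue measure lives on [R * R]; sets and functions on [R[i]] are pulled
   back along this bijection. *)
Definition complex_of_pair (p : R * R) : R[i] := p.1 +i* p.2.

Local Notation dxdy := (@lebesgue_measure R \x @lebesgue_measure R)%E.

Definition hyperbolic_area (F : set R[i]) : \bar R :=
  (\int[dxdy]_(p in complex_of_pair @^-1` F) (p.2 ^- 2)%:E)%E.

Definition fundamental_domain (G : set (PSL2 R)) (F : set R[i]) : Prop :=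
  [/\ F `<=` upper_half_plane,
      measurable
        (complex_of_pair @^-1` F : set (measurableTypeR R * measurableTypeR R)) &
      forall z, upper_half_plane z -> exists! w, (F `&` psl2_orbit G z) w].

(* All measurable strict fundamental domains have the same area, that of the
   quotient of the half plane by [G]; the infimum only serves to make this
   common value a total function of [G]. *)
Definition covolume (G : set (PSL2 R)) : \bar R :=
  ereal_inf [set hyperbolic_area F | F in fundamental_domain G].

Definition discrete_subset (T : topologicalType) (G : set T) : Prop :=
  forall g, G g -> \forall h \near g, G h -> h = g.

Definition fuchsian (G : set (PSL2 R)) : Prop :=
  [/\ group_closed (mem G), discrete_subset G & (covolume G < +oo)%E].

Definition holomorphic_on (D : set R[i]) (f : R[i] -> R[i]) : Prop :=
  forall z, D z -> derivable (f : R[i]^o -> R[i]^o) z 1.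

(* The half-plane model of the weighted Bergman space: with s = alpha + 2, the
   weight y^(s-2) is y^alpha. Only the values of [f] on the half plane matter. *)
Definition bergman (alpha : R) (f : R[i] -> R[i]) : Prop :=
  holomorphic_on upper_half_plane f /\
  dxdy.-integrable (complex_of_pair @^-1` upper_half_plane)
    (fun p => (Normc.normc (f (complex_of_pair p)) ^+ 2 * p.2 `^ alpha)%:E).

End Action.

(* Main.v *)
(** Put s = alpha + 2, c = (s - 1) / 4 pi, so that c * covolume > 1 is the
    inequality to characterise, and let K_w be the reproducing kernel at w, with
    |K_w|^2 = c y^(-s).  Normalised evaluations on the orbit of z form a Bessel
    sequence with frame operator 0 <= T <= 1, whose kernel V consists of the
    functions vanishing on the orbit.  With S_n = 1 + B + ... + B^(n-1) and
    B = 1 - T one has T S_n = 1 - B^n, so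
      k_n(w) = y^s (T S_2n K_w, K_w) = c - y^s |B^n K_w|^2 <= c,
    and unfolding the sum over the group hidden in T shows that the integral of
    k_n over a fundamental domain is l (S_2n K_z, K_z) <= 1, where l is the
    weight of the evaluation at z.  If V = 0 then k_n tends to c, whence
    c * covolume <= 1.  If V contains f != 0, dividing f by a power of the
    Blaschke factor at z gives a function vanishing on the orbit except at z;
    it forces the integrals to tend to 1, whereas
    k_n <= c - y^s |f|^2 / |f|_2^2 and the group translates of this bound, so
    that c * covolume > 1. *)

From HB Require Import structures.
From mathcomp Require Import all_boot all_order all_algebra.
From mathcomp Require Import all_classical all_reals all_analysis.
From mathcomp Require Import measurable_realfun complex ring lra.
Require Import Defs.

Set Implicit Arguments.
Unset Strict Implicit.
Unset Printing Implicit Defensive.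

Import Order.TTheory GRing.Theory Num.Theory.
Import numFieldNormedType.Exports.

Local Open Scope classical_set_scope.
Local Open Scope ring_scope.

(** Behind the computation is a dimension count. If [P] projects onto the orthogonal complement of
    [V], the integral of [y^s (P K_w, K_w)] over a fundamental domain is the von Neumann dimension
    of that complement: at most 1, because one orbit spans it, and exactly 1 if [V] is nonzero. For
    the whole space the same integral is [c * covolume]. [P] itself is never built. The operator [T]
    need not be bounded below, so it cannot be inverted, and no spectral theorem is invoked: the
    products [T S_n] stand for [P], and all that is used about powers of [B] is that the moments
    [(B^n x, x)] are nonnegative and decrease. The even index [2n] turns [B^(2n)] into a square,
    which makes the bounds on [k_n] pointwise and opens the way to Fatou. The factors [(cz + d)^s]
    for real [s] have no global branch compatible with products. Operators are therefore asked to
    commute with every single automorphy factor, never with a representation of the group.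
    Membership in the space is encoded by the reproducing identity, which survives limits in norm;
    holomorphy is recovered from it afterwards. *)

Section ComplexParts.
Variable R : realType.
Implicit Types z w : R[i].
Local Notation Re := (@complex.Re R).
Local Notation Im := (@complex.Im R).
Local Open Scope complex_scope.

Lemma eqC z w : Re z = Re w -> Im z = Im w -> z = w.
Proof. by case: z w => [a b] [c d] /= -> ->. Qed.

(** The squared modulus is kept as a polynomial in the coordinates, so that identities between
    moduli fall to [ring] and [field] without square roots. *)
Definition nsq z : R := Re z ^+ 2 + Im z ^+ 2.

Lemma ReD z w : Re (z + w) = Re z + Re w. Proof. by case: z w => ? ? []. Qed.
Lemma ImD z w : Im (z + w) = Im z + Im w. Proof. by case: z w => ? ? []. Qed.
Lemma ReN z : Re (- z) = - Re z. Proof. by case: z. Qed.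
Lemma ImN z : Im (- z) = - Im z. Proof. by case: z. Qed.
Lemma ReM z w : Re (z * w) = Re z * Re w - Im z * Im w.
Proof. by case: z w => ? ? []. Qed.
Lemma ImM z w : Im (z * w) = Re z * Im w + Im z * Re w.
Proof. by case: z w => ? ? []. Qed.
Lemma ReV z : Re z^-1 = Re z / nsq z. Proof. by case: z. Qed.
Lemma ImV z : Im z^-1 = - Im z / nsq z.
Proof. by case: z => a b /=; rewrite mulNr. Qed.
Lemma ReJ z : Re z^* = Re z. Proof. by case: z. Qed.
Lemma ImJ z : Im z^* = - Im z. Proof. by case: z. Qed.
Lemma ReR (x : R) : Re x%:C = x. Proof. by []. Qed.
Lemma ImR (x : R) : Im x%:C = 0. Proof. by []. Qed.
Lemma Re0 : Re 0 = 0. Proof. by []. Qed.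
Lemma Im0 : Im 0 = 0. Proof. by []. Qed.
Lemma Re1 : Re 1 = 1. Proof. by []. Qed.
Lemma Im1 : Im 1 = 0. Proof. by []. Qed.
Lemma ReI (x y : R) : Re (x +i* y) = x. Proof. by []. Qed.
Lemma ImI (x y : R) : Im (x +i* y) = y. Proof. by []. Qed.

Definition cE := (ReI, ImI, ReR, ImR, Re0, Im0, Re1, Im1,
  ReD, ImD, ReN, ImN, ReM, ImM, ReV, ImV, ReJ, ImJ).

Lemma nsq_ge0 z : 0 <= nsq z. Proof. by rewrite addr_ge0 ?sqr_ge0. Qed.
Lemma nsqM z w : nsq (z * w) = nsq z * nsq w.
Proof. by rewrite /nsq !cE; ring. Qed.
Lemma nsq_eq0 z : (nsq z == 0) = (z == 0).
Proof.
by rewrite /nsq paddr_eq0 ?sqr_ge0// !sqrf_eq0; case: z => a b; rewrite eq_complex.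
Qed.
Lemma nsqJ z : nsq z^* = nsq z. Proof. by rewrite /nsq !cE sqrrN. Qed.
Lemma nsqN z : nsq (- z) = nsq z. Proof. by rewrite /nsq !cE !sqrrN. Qed.
Lemma nsqV z : nsq z^-1 = (nsq z)^-1.
Proof.
have [->|z0] := eqVneq z 0; first by rewrite invr0 /nsq !cE expr0n addr0 invr0.
apply: (mulfI (x := nsq z)); first by rewrite nsq_eq0.
rewrite -nsqM !divff ?nsq_eq0//; by rewrite /nsq !cE expr0n expr1n addr0.
Qed.
Lemma nsqR (x : R) : nsq x%:C = x ^+ 2. Proof. by rewrite /nsq !cE expr0n addr0. Qed.
Lemma normcE z : Normc.normc z = Num.sqrt (nsq z). Proof. by case: z. Qed.
Lemma normc_sqr z : Normc.normc z ^+ 2 = nsq z.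
Proof. by rewrite normcE sqr_sqrtr// nsq_ge0. Qed.
Lemma nsq_gt0 z : (0 < nsq z) = (z != 0).
Proof. by rewrite lt_neqAle nsq_ge0 andbT eq_sym nsq_eq0. Qed.
Lemma mulJ z : z * z^* = (nsq z)%:C.
Proof. by apply: eqC; rewrite /nsq !cE; ring. Qed.

End ComplexParts.

(** * Integrals on the line *)

Section Line.
Variable R : realType.

Lemma measurable_inv : measurable_fun [set: R] (@GRing.inv R).
Proof.
(* The inverse is not continuous at 0. Written as [x] times a power of [x ^+ 2] it is a product of
   measurable functions, and the convention [0^-1 = 0] makes the identity hold at 0 too. *)
rewrite (_ : @GRing.inv R = fun x => x * (x ^+ 2) `^ (- 1)); last first.
  apply/funext => x; have [->|x0] := eqVneq x 0; first by rewrite invr0 mul0r.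
  by rewrite powR_inv1 ?sqr_ge0// expr2 invfM mulrA divff// mul1r.
apply: measurable_funM => //.
by apply: measurableT_comp (measurable_powR _) _; exact: measurable_funX.
Qed.

Local Notation mu := (@lebesgue_measure R).
Local Open Scope ereal_scope.

(** The image of Lebesgue measure under the translation agrees with it on half-open intervals, hence
    everywhere by uniqueness. *)
Lemma ge0_integral_shift (f : R -> \bar R) (b : R) :
  measurable_fun setT f -> (forall x, 0 <= f x) ->
  \int[mu]_x f (x + b)%R = \int[mu]_x f x.
Proof.
move=> mf f0; pose phi (x : measurableTypeR R) : measurableTypeR R := (x + b)%R.
have mphi : measurable_fun [set: measurableTypeR R] phi by exact: measurable_funD.
pose m : {measure set (measurableTypeR R) -> \bar R} := pushforward mu phi.
rewrite [RHS](eq_measure_integral (m mphi)).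
  by rewrite ge0_integral_pushforward.
move=> A mA _; apply: (lebesgue_measure_unique (mu := m mphi)) => //.
move=> _ [[u v] _ <-]; rewrite /= /pushforward /=.
rewrite [X in _ = mu X](_ : _ = `](u - b)%R, (v - b)%R]%classic).
  rewrite !lebesgue_measure_itv /= !lte_fin ltrBlDr subrK.
  by case: ifP => // _; rewrite -!EFinB; congr EFin; ring.
apply/seteqP; split => x /=; rewrite !in_itv /= /phi => /andP[? ?];
  by apply/andP; split; lra.
Qed.

Lemma ge0_integral_scale (f : R -> \bar R) (a : R) : (0 < a)%R ->
  measurable_fun setT f -> (forall x, 0 <= f x) ->
  \int[mu]_x (a%:E * f (a * x)%R) = \int[mu]_x f x.
Proof.
move=> a0 mf f0; pose phi (x : measurableTypeR R) : measurableTypeR R := (a * x)%R.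
have mphi : measurable_fun [set: measurableTypeR R] phi by exact: measurable_funM.
pose m0 : {measure set (measurableTypeR R) -> \bar R} := pushforward mu phi.
pose m : {measure set (measurableTypeR R) -> \bar R} := mscale (NngNum (ltW a0)) (m0 mphi).
rewrite [RHS](eq_measure_integral m).
  rewrite ge0_integral_mscale // ge0_integral_pushforward //=.
  rewrite ge0_integralZl//=; last by rewrite lee_fin ltW.
  exact: (measurableT_comp mf mphi).
move=> A mA _; apply: (lebesgue_measure_unique (mu := m)) => //.
move=> _ [[u v] _ <-]; rewrite /= /m /mscale /= /pushforward /=.
rewrite [X in _ = _ * mu X](_ : _ = `](u / a)%R, (v / a)%R]%classic).
  rewrite !lebesgue_measure_itv /= !lte_fin ltr_pM2r ?invr_gt0//.
  case: ifP => // _; last by rewrite mule0.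
  rewrite -!EFinB -EFinM; congr EFin; field.
  by rewrite gt_eqF.
apply/seteqP; split => x /=; rewrite !in_itv /= /phi => /andP[h1 h2];
  by apply/andP; split; move: h1 h2;
     rewrite ?(ltr_pdivrMr,ler_pdivlMr)// mulrC.
Qed.

Lemma ge0_integral_reflect (f : R -> \bar R) :
  measurable_fun setT f -> (forall x, 0 <= f x) ->
  \int[mu]_x f (- x)%R = \int[mu]_x f x.
Proof.
move=> mf f0.
pose phi (x : measurableTypeR R) : measurableTypeR R := (- x)%R.
have mphi : measurable_fun [set: measurableTypeR R] phi by exact: oppr_measurable.
pose m : {measure set (measurableTypeR R) -> \bar R} := pushforward mu phi.
rewrite [RHS](eq_measure_integral (m mphi)).
  by rewrite ge0_integral_pushforward.
move=> A mA _; exact: esym (lebesgue_measureN mA).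
Qed.

Lemma tonelli_setX (f : R * R -> \bar R) (A B : set R) :
  measurable A -> measurable B ->
  measurable_fun setT f -> (forall x, 0 <= f x) ->
  \int[mu]_(x in A) \int[mu]_(y in B) f (x, y) =
  \int[mu]_(y in B) \int[mu]_(x in A) f (x, y).
Proof.
move=> mA mB mf f0.
pose g := f \_ (A `*` B).
have mAB : measurable (A `*` B) by exact: measurableX.
have mg : measurable_fun setT g.
  by apply/(measurable_restrictT _ mAB); exact: measurable_funS mf.
have g0 x : 0 <= g x by rewrite /g patchE; case: ifP.
have := fubini_tonelli (m1 := mu) (m2 := mu) g mg g0.
rewrite (_ : \int[mu]_x _ = \int[mu]_(x in A) \int[mu]_(y in B) f (x, y)); last first.
  rewrite [RHS]integral_mkcond; apply: eq_integral => x _; rewrite patchE.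
  case: ifPn => xA.
    rewrite [RHS]integral_mkcond; apply: eq_integral => y _.
    by rewrite /g !patchE in_setX xA.
  by rewrite integral0_eq// => y _; rewrite /g patchE in_setX (negbTE xA).
move=> ->; rewrite [RHS]integral_mkcond; apply: eq_integral => y _; rewrite patchE.
case: ifPn => yB.
  rewrite [RHS]integral_mkcond; apply: eq_integral => x _.
  by rewrite /g !patchE in_setX yB andbT.
by rewrite integral0_eq// => x _; rewrite /g patchE in_setX (negbTE yB) andbF.
Qed.

Lemma integral_setX (f : R * R -> \bar R) (A B : set R) :
  measurable A -> measurable B ->
  measurable_fun (A `*` B) f -> (forall x, (A `*` B) x -> 0 <= f x) ->
  \int[mu \x mu]_(p in A `*` B) f p =
  \int[mu]_(y in B) \int[mu]_(x in A) f (x, y).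
Proof.
move=> mA mB mf f0.
have mAB : measurable (A `*` B) by exact: measurableX.
rewrite integral_mkcond.
have mg : measurable_fun setT (f \_ (A `*` B)) by apply/(measurable_restrictT _ mAB).
have g0 x : 0 <= (f \_ (A `*` B)) x.
  by rewrite patchE; case: ifP => //; rewrite inE => /f0.
rewrite (fubini_tonelli2 (m1 := mu) (m2 := mu) (f \_ (A `*` B)) mg g0).
rewrite [RHS]integral_mkcond; apply: eq_integral => y _; rewrite patchE /fubini_G.
case: ifPn => yB.
  rewrite [RHS]integral_mkcond; apply: eq_integral => x _.
  by rewrite !patchE in_setX yB andbT.
by rewrite integral0_eq// => x _; rewrite patchE in_setX (negbTE yB) andbF.
Qed.

Local Notation pos :=
  ([set` Interval (@BSide R false 0%R) (@BInfty R false)]%classic).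

Lemma mem_itv_set (x : R) (i : interval R) :
  (x \in ([set` i]%classic : set R)) = (x \in i).
Proof. by apply/idP/idP => [/set_mem|h]; [|apply: mem_set]. Qed.

Lemma in_pos (x : R) : (x \in pos) = (0 < x)%R.
Proof. by apply/idP/idP => [/set_mem|h]; [|apply: mem_set]; rewrite /= in_itv /= andbT. Qed.

Lemma ge0_integral_scale_pos (f : R -> \bar R) (a : R) : (0 < a)%R ->
  measurable_fun [set: R] f -> (forall x, 0 <= f x) ->
  \int[mu]_(x in pos) (a%:E * f (a * x)%R) = \int[mu]_(x in pos) f x.
Proof.
move=> a0 mf f0; rewrite [LHS]integral_mkcond [RHS]integral_mkcond.
pose g := f \_ pos.
rewrite -[RHS](@ge0_integral_scale g a)//.
- apply: eq_integral => x _; rewrite /g !patchE. rewrite !in_pos.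
  by rewrite pmulr_rgt0//; case: ifP; rewrite ?mule0.
- have mpos : measurable pos by [].
  by apply/(measurable_restrictT _ mpos); exact: measurable_funS mf.
- by move=> x; rewrite /g patchE; case: ifP.
Qed.

Lemma ge0_integral_scale_haar (h : R -> R) (a : R) : (0 < a)%R ->
  measurable_fun [set: R] h -> (forall x, 0 <= h x)%R ->
  \int[mu]_(x in pos) (h x / x)%:E = \int[mu]_(x in pos) (h (a * x) / x)%:E.
Proof.
move=> a0 mh h0.
have mV : measurable_fun [set: R] (@GRing.inv R) by exact: measurable_inv.
(* The scaling rule wants an integrand that is nonnegative on the whole line, whereas [h x / x] is
   negative for [x < 0]; the absolute value changes nothing on the positive half. *)
transitivity (\int[mu]_(x in pos) (`|h x / x|)%:E).
  apply: eq_integral => x; rewrite in_pos => x0.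
  by rewrite ger0_norm// divr_ge0// ltW.
rewrite -(ge0_integral_scale_pos a0)//.
- apply: eq_integral => x; rewrite in_pos => x0; rewrite -EFinM.
  rewrite ger0_norm ?divr_ge0//; last by rewrite mulr_ge0 ?ltW.
  by congr EFin; field; rewrite !gt_eqF.
- apply/measurable_EFinP; apply: measurableT_comp => //.
  exact: measurable_funM.
Qed.

(* Invariance of the Haar measure [dy / y] of the multiplicative group under
   inversion; [g] is an auxiliary function of integral [1], and scaling is
   used three times under Tonelli's theorem. *)
Lemma ge0_integral_inv_haar (f : R -> R) :
  measurable_fun setT f -> (forall x, 0 <= f x)%R ->
  \int[mu]_(x in pos) (f x^-1 / x)%:E = \int[mu]_(x in pos) (f x / x)%:E.
Proof.
move=> mf f0.
have mV : measurable_fun [set: R] (@GRing.inv R) by exact: measurable_inv.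
(* The factor [y] cancels the Haar density, so that the integral is the length of [[1, 2]]. *)
pose g (y : R) : R := (y * \1_(`[1%R, 2%R]) y)%R.
have mg : measurable_fun setT g by apply: measurable_funM.
have g0 x : (0 <= g x)%R.
  rewrite /g indicE; case: (boolP (x \in _)); rewrite ?mulr0// mulr1.
  by rewrite inE/= in_itv/= => /andP[h _]; lra.
have g1 : \int[mu]_(x in pos) (g x / x)%:E = 1.
  transitivity (\int[mu]_(x in `[1%R, 2%R]) (cst 1) x).
    rewrite integral_mkcond [RHS]integral_mkcond; apply: eq_integral => x _.
    rewrite !patchE in_pos /g indicE !mem_itv_set in_itv/=.
    case: ifPn => x0.
      case: ifPn => _; last by rewrite mulr0 mul0r.
      by rewrite mulr1 divff// gt_eqF.
    by case: ifPn => // /andP[h _]; exfalso; move: x0; rewrite -leNgt; lra.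
  rewrite integral_cst//= lebesgue_measure_itv/= lte_fin ltr1n mul1e.
  by rewrite -EFinB; congr EFin; ring.
pose F1 (p : R * R) := (f p.1^-1 * g p.2 / (p.1 * p.2))%R.
pose F2 (p : R * R) := (f p.1^-1 * g (p.1 * p.2) / (p.1 * p.2))%R.
pose F3 (p : R * R) := (f (p.1^-1 * p.2) * g p.1 / (p.1 * p.2))%R.
have m1 : measurable_fun [set: R * R] (fst : R * R -> R) by [].
have m2 : measurable_fun [set: R * R] (snd : R * R -> R) by [].
have mi : measurable_fun [set: R * R] (fun p => p.1^-1 : R)%R.
  exact: measurableT_comp.
have mm : measurable_fun [set: R * R] (fun p => p.1 * p.2 : R)%R.
  exact: measurable_funM.
have mq : measurable_fun [set: R * R] (fun p => (p.1 * p.2)^-1 : R)%R.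
  exact: measurableT_comp.
have posE x : x \in pos -> (0 < x)%R by rewrite in_pos.
have Zl (k : R) (h : R -> R) : (0 <= k)%R -> measurable_fun setT h ->
    (forall x, 0 < x -> 0 <= h x)%R ->
    k%:E * \int[mu]_(x in pos) (h x)%:E = \int[mu]_(x in pos) (k * h x)%:E.
  move=> k0 mh h0; rewrite -ge0_integralZl//.
  - by apply/measurable_EFinP; exact: measurable_funS mh.
  - by move=> x /mem_set /posE x0; rewrite lee_fin h0.
have tonelli (F : R * R -> R) : measurable_fun setT F ->
    (forall p, 0 < p.1 -> 0 < p.2 -> 0 <= F p)%R ->
    \int[mu]_(x in pos) \int[mu]_(y in pos) (F (x, y))%:E =
    \int[mu]_(y in pos) \int[mu]_(x in pos) (F (x, y))%:E.
  move=> mF F0.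
  transitivity (\int[mu]_(x in pos) \int[mu]_(y in pos) (`|F (x, y)|)%:E).
    apply: eq_integral => x /posE x0; apply: eq_integral => y /posE y0.
    by rewrite ger0_norm// F0.
  rewrite (tonelli_setX (f := fun p => (`|F p|)%:E))//.
  - apply: eq_integral => x /posE x0; apply: eq_integral => y /posE y0.
    by rewrite ger0_norm// F0.
  - by apply/measurable_EFinP; exact: measurableT_comp.
have mdiv (h : R -> R) : measurable_fun setT h ->
    measurable_fun setT (fun x => h x / x)%R.
  by move=> mh; exact: measurable_funM.
have mf1 : measurable_fun setT (fun p : R * R => f p.1^-1)%R.
  exact: measurableT_comp.
(* A factor 1 is inserted in the form of the integral of [g (x * y)] against [dy / y]. *)
have step1 x : (0 < x)%R -> (f x^-1 / x)%:E =
    \int[mu]_(y in pos) (F2 (x, y))%:E.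
  move=> x0; rewrite -[LHS]mule1 -g1 (ge0_integral_scale_haar (a := x) (h := g))// Zl ?divr_ge0//; last 3 first.
  - exact: ltW.
  - by apply: mdiv; apply: measurableT_comp => //; exact: measurable_funM.
  - by move=> y y0; rewrite divr_ge0// ltW.
  apply: eq_integral => y /posE y0; rewrite /F2/=; congr EFin.
  by field; rewrite !gt_eqF.
transitivity (\int[mu]_(x in pos) \int[mu]_(y in pos) (F2 (x, y))%:E).
  by apply: eq_integral => x /posE; exact: step1.
rewrite tonelli; last 2 first.
- apply: measurable_funM => //; apply: measurable_funM => //.
  exact: measurableT_comp.
- by move=> p p1 p2; apply: divr_ge0; [exact: mulr_ge0|rewrite ltW// mulr_gt0].
(* Replacing [x] by [x / y] moves the dependence on [y] from [g] to [f], whose argument becomes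
   [y / x]: the inversion has disappeared, and a last scaling in [y] separates the variables. *)
transitivity (\int[mu]_(y in pos) \int[mu]_(x in pos) (F3 (x, y))%:E).
  apply: eq_integral => y /posE y0.
  transitivity (\int[mu]_(x in pos) ((fun x => f x^-1 * g (x * y) / y) x / x)%R%:E).
    apply: eq_integral => x /posE x0; congr EFin; rewrite /F2/=.
    by field; rewrite !gt_eqF.
  rewrite (ge0_integral_scale_haar (a := y^-1%R)) ?invr_gt0//.
  - apply: eq_integral => x /posE x0; congr EFin; rewrite /F3/=.
    rewrite (_ : (y^-1 * x)^-1 = x^-1 * y)%R; last by rewrite invfM invrK mulrC.
    rewrite (_ : (y^-1 * x * y) = x)%R; last by field; rewrite gt_eqF.
    by field; rewrite !gt_eqF.
  - apply: measurable_funM => //; apply: measurable_funM => //.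
      exact: measurableT_comp.
    by apply: measurableT_comp => //; exact: measurable_funM.
  - by move=> x; apply: divr_ge0; [exact: mulr_ge0|exact: ltW].
rewrite -tonelli; last 2 first.
- apply: measurable_funM => //; apply: measurable_funM => //.
    by apply: measurableT_comp => //; exact: measurable_funM.
  exact: measurableT_comp.
- by move=> p p1 p2; apply: divr_ge0; [exact: mulr_ge0|rewrite ltW// mulr_gt0].
transitivity (\int[mu]_(x in pos) ((g x / x)%:E *
    \int[mu]_(y in pos) (f y / y)%:E)).
  apply: eq_integral => x /posE x0.
  rewrite Zl; [|by rewrite divr_ge0// ltW|exact: mdiv
    |by move=> y y0; rewrite divr_ge0// ltW].
  transitivity (\int[mu]_(y in pos)
      ((fun y => f (x^-1 * y) * (g x / x)) y / y)%R%:E).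
    by apply: eq_integral => y /posE y0; rewrite /F3/=; congr EFin; field; rewrite !gt_eqF.
  rewrite (ge0_integral_scale_haar (a := x))//.
  - apply: eq_integral => y /posE y0; congr EFin.
    by rewrite mulKf ?gt_eqF//; ring.
  - by apply: measurable_funM => //; apply: measurableT_comp.
  - by move=> y; apply: mulr_ge0 => //; apply: divr_ge0 => //; exact: ltW.
rewrite ge0_integralZr//.
- by rewrite g1 mul1e.
- by apply/measurable_EFinP; apply: measurable_funS (mdiv _ mg).
- by move=> x /mem_set/posE x0; rewrite lee_fin divr_ge0// ltW.
- by apply: integral_ge0 => x /mem_set/posE x0; rewrite lee_fin divr_ge0// ltW.
Qed.

End Line.

(** * The hyperbolic integral *)

Section HyperbolicIntegral.
Variable R : realType.
Local Notation mu := (@lebesgue_measure R).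
Local Notation m2 := (@lebesgue_measure R \x @lebesgue_measure R)%E.
Local Notation pos :=
  ([set` Interval (@BSide R false 0%R) (@BInfty R false)]%classic).
Local Notation C2 := (@complex_of_pair R).
Local Open Scope complex_scope.

Definition UH : set (R * R) := C2 @^-1` @upper_half_plane R.

Lemma UHE : UH = setT `*` pos.
Proof.
by apply/seteqP; split => -[x y] /=; rewrite in_itv/= andbT => //; case.
Qed.

Lemma measurable_UH : measurable UH.
Proof. by rewrite UHE; apply: measurableX. Qed.

Definition mC (Phi : R[i] -> R) := measurable_fun [set: R * R] (Phi \o C2).

Definition hint (Phi : R[i] -> R) : \bar R :=
  (\int[m2]_(p in UH) (Phi (C2 p) * p.2 ^- 2)%:E)%E.

Lemma mC_comp (Phi : R[i] -> R) (T : R[i] -> R[i]) : mC Phi ->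
  mC (fun z => complex.Re (T z)) -> mC (fun z => complex.Im (T z)) ->
  mC (Phi \o T).
Proof.
move=> mP m1 m2'; rewrite /mC.
rewrite (_ : _ \o C2 = (Phi \o C2) \o
  (fun p => (complex.Re (T (C2 p)), complex.Im (T (C2 p))))); last first.
  by apply/funext => p /=; case: (T (C2 p)).
by apply: (measurableT_comp mP); exact: measurable_fun_pair.
Qed.

Lemma mC_Re : mC (@complex.Re R).
Proof. by rewrite /mC; apply: measurable_fst. Qed.

Lemma mC_Im : mC (@complex.Im R).
Proof. by rewrite /mC; apply: measurable_snd. Qed.

Lemma mC_M f g : mC f -> mC g -> mC (fun z => f z * g z).
Proof. by move=> mf mg; exact: (measurable_funM mf mg). Qed.

Lemma mC_D f g : mC f -> mC g -> mC (fun z => f z + g z).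
Proof. by move=> mf mg; exact: (measurable_funD mf mg). Qed.

Lemma mC_N f : mC f -> mC (fun z => - f z).
Proof. by move=> mf; exact: (measurable_funN mf). Qed.

Lemma mC_V f : mC f -> mC (fun z => (f z)^-1).
Proof. by move=> mf; exact: (measurableT_comp (@measurable_inv R) mf). Qed.

Lemma mC_cst (c : R) : mC (fun=> c).
Proof. exact: measurable_cst. Qed.

Lemma mC_X f n : mC f -> mC (fun z => f z ^+ n).
Proof. by move=> mf; exact: (measurable_funX n mf). Qed.

Lemma measurable_invsq (D : set (R * R)) : measurable_fun D (fun p => p.2 ^- 2).
Proof.
apply: (measurableT_comp (@measurable_inv R) (g := fun p : R * R => p.2 ^+ 2)).
by apply: measurable_funX; apply: measurable_funTS; exact: measurable_snd.
Qed.

Local Open Scope ereal_scope.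

Lemma hintE Phi : mC Phi -> (forall z, 0 <= Phi z)%R ->
  hint Phi = \int[mu]_(y in pos) \int[mu]_x (Phi (x +i* y) * y ^- 2)%:E.
Proof.
move=> mP P0; rewrite /hint UHE integral_setX//.
- apply/measurable_EFinP; apply: measurable_funM; first exact: measurable_funS mP.
  exact: measurable_invsq.
- by move=> p _; rewrite lee_fin mulr_ge0// invr_ge0 exprn_even_ge0.
Qed.

(** Substituting [x = t * y] turns [dx dy / y^2] into [dt dy / y]. Lines [t = const] are the rays
    from 0, on which inversion and dilation act through the multiplicative group. *)
Lemma hint_tilt Phi : mC Phi -> (forall z, 0 <= Phi z)%R ->
  hint Phi = \int[mu]_t \int[mu]_(y in pos) (Phi ((t * y) +i* y)%R / y)%:E.
Proof.
move=> mP P0; rewrite (hintE mP P0).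
pose F (p : R * R) : \bar R := (Phi ((p.1 * p.2) +i* p.2)%R * `|p.2|^-1)%:E.
have mtilt : measurable_fun setT (fun p : R * R => Phi ((p.1 * p.2) +i* p.2)%R).
  apply: (measurableT_comp mP (g := fun p : R * R => (p.1 * p.2, p.2)%R)).
  apply: measurable_fun_pair => //.
  exact: (measurable_funM measurable_fst measurable_snd).
have mF : measurable_fun setT F.
  apply/measurable_EFinP; apply: measurable_funM => //.
  apply: (measurableT_comp (@measurable_inv R)).
  exact: (measurableT_comp (@normr_measurable _ _) measurable_snd).
have F0 p : 0 <= F p by rewrite lee_fin mulr_ge0.
transitivity (\int[mu]_(y in pos) \int[mu]_(t in setT) F (t, y)).
  apply: eq_integral => y; rewrite in_pos => y0.
  rewrite -(ge0_integral_scale y0).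
  - apply: eq_integral => t _; rewrite /F/= -EFinM gtr0_norm// mulrC.
    by congr EFin; rewrite (mulrC y t); field; rewrite gt_eqF.
  - apply/measurable_EFinP; apply: measurable_funM => //.
    apply: (measurableT_comp mP (g := fun x : R => (x, y))).
    exact: measurable_fun_pair.
  - by move=> x; rewrite lee_fin mulr_ge0// invr_ge0 exprn_even_ge0.
rewrite -(tonelli_setX (f := F))//; apply: eq_integral => t _.
by apply: eq_integral => y; rewrite in_pos => y0; rewrite /F/= gtr0_norm.
Qed.

Lemma hint_affine Phi (a b : R) : (0 < a)%R -> mC Phi -> (forall z, 0 <= Phi z)%R ->
  hint (fun z => Phi (a%:C * z + b%:C)%R) = hint Phi.
Proof.
move=> a0 mP P0.
have aff z : (a%:C * z + b%:C = (a * complex.Re z + b) +i* (a * complex.Im z))%R.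
  by apply: eqC; rewrite !cE; ring.
have maff : mC (fun z => Phi (a%:C * z + b%:C)%R).
  apply: (mC_comp (T := fun z => a%:C * z + b%:C)%R) => //.
    rewrite (_ : (fun _ => _) = fun z => a * complex.Re z + b)%R; last first.
      by apply/funext => z; rewrite aff.
    by apply: mC_D; [apply: mC_M; [exact: mC_cst|exact: mC_Re]|exact: mC_cst].
  rewrite (_ : (fun _ => _) = fun z => a * complex.Im z)%R; last first.
    by apply/funext => z; rewrite aff.
  by apply: mC_M; [exact: mC_cst|exact: mC_Im].
rewrite (hintE maff (fun=> P0 _)) (hintE mP P0).
pose G y := \int[mu]_x (Phi (x +i* y) * y ^- 2)%:E.
have mG : measurable_fun [set: R] G.
  apply: (measurable_fun_fubini_tonelli_G (m1 := mu)
    (fun p => (Phi (C2 p) * p.2 ^- 2)%:E)).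
    apply/measurable_EFinP; apply: measurable_funM => //.
    exact: measurable_invsq.
  by move=> p; rewrite lee_fin mulr_ge0// invr_ge0 exprn_even_ge0.
have G0 y : 0 <= G y.
  by apply: integral_ge0 => x _; rewrite lee_fin mulr_ge0// invr_ge0 exprn_even_ge0.
rewrite -/(G _) -(ge0_integral_scale_pos a0 mG G0).
apply: eq_integral => y; rewrite in_pos => y0; rewrite /G.
have mrow (c : R) : measurable_fun [set: R]
    (fun x => (Phi (x +i* (a * y)) * c)%R%:E).
  apply/measurable_EFinP; apply: measurable_funM => //.
  apply: (measurableT_comp mP (g := fun x : R => (x, a * y)%R)).
  exact: measurable_fun_pair.
have row0 (c : R) : (0 <= c)%R -> forall x : R, 0 <= (Phi (x +i* (a * y))%R * c)%:E.
  by move=> c0 x; rewrite lee_fin mulr_ge0.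
rewrite -ge0_integralZl//; last 3 first.
- exact: mrow.
- by move=> x _; apply: row0; rewrite invr_ge0 exprn_even_ge0.
- by rewrite lee_fin ltW.
under [RHS]eq_integral do rewrite -EFinM.
pose H := (fun x : R => (Phi (x +i* (a * y)) * (a / (a * y) ^+ 2))%R%:E).
have c0 : (0 <= a / (a * y) ^+ 2)%R by rewrite divr_ge0 ?exprn_even_ge0// ltW.
transitivity (\int[mu]_x H x); last first.
  by apply: eq_integral => x _; rewrite /H; congr EFin; ring.
rewrite -(ge0_integral_shift b (mrow _) (row0 _ c0)).
rewrite -(ge0_integral_scale a0 (f := fun x => H (x + b)%R)).
- rewrite /H; apply: eq_integral => x _; rewrite aff/= -EFinM; congr EFin.
  by field; rewrite !gt_eqF.
- apply: (measurableT_comp (mrow _) (g := fun x : R => (x + b)%R)).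
  exact: measurable_funD.
- by move=> x; exact: row0.
Qed.

(** The map [- z^-1] is the reflection [- z^*] composed with [z / |z|^2]. The latter preserves every
    ray and acts on the ray of slope parameter [t] by [y] to [1 / ((1 + t^2) y)], which preserves
    [dy / y]; the reflection is treated on horizontal lines. *)
Lemma hint_inv Phi : mC Phi -> (forall z, 0 <= Phi z)%R ->
  hint (fun z => Phi (- z^-1)%R) = hint Phi.
Proof.
move=> mP P0.
have mnsq : mC (@nsq R).
  by apply: mC_D; apply: mC_X; [exact: mC_Re|exact: mC_Im].
have invE z : (- z^-1 = (- complex.Re z / nsq z) +i* (complex.Im z / nsq z))%R.
  by apply: eqC; rewrite !cE; ring.
have minv : mC (fun z => Phi (- z^-1)%R).
  apply: (mC_comp (T := fun z => - z^-1)%R) => //.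
    rewrite (_ : (fun _ => _) = fun z => - complex.Re z * (nsq z)^-1)%R; last first.
      by apply/funext => z; rewrite invE.
    by apply: mC_M; [apply: mC_N; exact: mC_Re|exact: mC_V].
  rewrite (_ : (fun _ => _) = fun z => complex.Im z * (nsq z)^-1)%R; last first.
    by apply/funext => z; rewrite invE.
  by apply: mC_M; [exact: mC_Im|exact: mC_V].
have mrefl : mC (fun z => Phi (- z^*)%R).
  apply: (mC_comp (T := fun z => - z^*)%R) => //.
    rewrite (_ : (fun _ => _) = fun z => - complex.Re z)%R; last first.
      by apply/funext => z; rewrite !cE.
    by apply: mC_N; exact: mC_Re.
  rewrite (_ : (fun _ => _) = fun z => complex.Im z)%R; last first.
    by apply/funext => z; rewrite !cE opprK.
  exact: mC_Im.
transitivity (hint (fun z => Phi (- z^*)%R)).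
  rewrite (hint_tilt minv (fun=> P0 _)) (hint_tilt mrefl (fun=> P0 _)).
  apply: eq_integral => t _.
  pose m := (1 + t ^+ 2)%R.
  have m0 : (0 < m)%R by rewrite ltr_pwDl// sqr_ge0.
  pose f (v : R) := Phi ((- t * (v / m)) +i* (v / m))%R.
  have mf : measurable_fun [set: R] f.
    apply: (measurableT_comp mP (g := fun v : R => (- t * (v / m), v / m)%R)).
    by apply: measurable_fun_pair; [apply: measurable_funM => //|];
      exact: measurable_funM.
  transitivity (\int[mu]_(y in pos) (f y^-1 / y)%:E).
    apply: eq_integral => y; rewrite in_pos => y0; rewrite /f invE/=.
    have -> : nsq ((t * y) +i* y)%R = (y ^+ 2 * m)%R by rewrite /nsq !cE /m; ring.
    by congr (Phi (_ +i* _) / y)%:E; field; rewrite !gt_eqF.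
  have f0 v : (0 <= f v)%R by exact: P0.
  rewrite (ge0_integral_inv_haar mf f0) (ge0_integral_scale_haar m0 mf f0).
  apply: eq_integral => y; rewrite in_pos => y0; rewrite /f.
  by congr (Phi _ / y)%:E; apply: eqC; rewrite !cE; field; rewrite gt_eqF.
rewrite (hintE mrefl (fun=> P0 _)) (hintE mP P0); apply: eq_integral => y; rewrite in_pos => y0.
rewrite -[RHS]ge0_integral_reflect.
- apply: eq_integral => x _; congr (Phi _ / _)%:E.
  by apply: eqC; rewrite !cE ?opprK.
- apply/measurable_EFinP; apply: measurable_funM => //.
  apply: (measurableT_comp mP (g := fun x : R => (x, y))).
  exact: measurable_fun_pair.
- by move=> x; rewrite lee_fin mulr_ge0// invr_ge0 exprn_even_ge0.
Qed.

End HyperbolicIntegral.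

(** * Invariance of the hyperbolic integral under Möbius maps *)

Section Mobius.
Variable R : realType.
Local Open Scope complex_scope.
Implicit Types (Phi : R[i] -> R) (T : R[i] -> R[i]) (A : 'M[R]_2).

Lemma mC_nsq : mC (@nsq R).
Proof. by apply: mC_D; apply: mC_X; [exact: mC_Re|exact: mC_Im]. Qed.

Definition mCC T := mC (fun z => complex.Re (T z)) /\ mC (fun z => complex.Im (T z)).

Lemma mCC_id : mCC id. Proof. by split; [exact: mC_Re|exact: mC_Im]. Qed.

Lemma mCC_cst c : mCC (fun=> c). Proof. by split; exact: mC_cst. Qed.

Lemma mC_eq Phi Psi : Phi =1 Psi -> mC Phi -> mC Psi.
Proof. by move=> /funext->. Qed.

Lemma mCC_D T U : mCC T -> mCC U -> mCC (fun z => T z + U z).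
Proof.
move=> [t1 t2] [u1 u2]; split; [apply: mC_eq (mC_D t1 u1)|apply: mC_eq (mC_D t2 u2)];
  by move=> z; rewrite /= !cE.
Qed.

Lemma mCC_M T U : mCC T -> mCC U -> mCC (fun z => T z * U z).
Proof.
move=> [t1 t2] [u1 u2]; split.
  by apply: mC_eq (mC_D (mC_M t1 u1) (mC_N (mC_M t2 u2))) => z /=; rewrite !cE.
by apply: mC_eq (mC_D (mC_M t1 u2) (mC_M t2 u1)) => z /=; rewrite !cE.
Qed.

Lemma mCC_V T : mCC T -> mCC (fun z => (T z)^-1).
Proof.
move=> [t1 t2]; have t3 := mC_V (mC_comp mC_nsq t1 t2); split.
  by apply: mC_eq (mC_M t1 t3) => z /=; rewrite !cE.
by apply: mC_eq (mC_M (mC_N t2) t3) => z /=; rewrite !cE.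
Qed.

Lemma mCC_J T : mCC T -> mCC (fun z => (T z)^*).
Proof.
move=> [t1 t2]; split; first by apply: mC_eq t1 => z /=; rewrite !cE.
by apply: mC_eq (mC_N t2) => z /=; rewrite !cE.
Qed.

Lemma det2 (K : comNzRingType) (A : 'M[K]_2) :
  \det A = A 0 0 * A 1 1 - A 0 1 * A 1 0.
Proof.
have e1 : lift 0 0 = 1 :> 'I_2 by exact: val_inj.
have e2 : lift 1 0 = 0 :> 'I_2 by exact: val_inj.
rewrite (expand_det_row _ 0) !big_ord_recl big_ord0 addr0 /cofactor !det_mx11 !mxE.
rewrite !e1 !e2.
by rewrite /= !addn0 expr0 mul1r expr1 mulN1r mulrN.
Qed.

Lemma mCC_mobius A : mCC (mobius A).
Proof.
have aff a b : mCC (fun z => a * z + b).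
  by apply: mCC_D (mCC_cst _); apply: mCC_M (mCC_cst _) mCC_id.
by apply: mCC_M; [exact: aff|apply: mCC_V; exact: aff].
Qed.

Lemma mC_mobius A Phi : mC Phi -> mC (Phi \o mobius A).
Proof. by move=> mP; have [m1 m2] := mCC_mobius A; exact: mC_comp. Qed.

Lemma eq_hint Phi Psi :
  (forall z, @upper_half_plane R z -> Phi z = Psi z) -> hint Phi = hint Psi.
Proof.
by move=> e; apply: eq_integral => p /set_mem pH; rewrite (e (complex_of_pair p)).
Qed.

(** For [c = 0] the map is affine with positive ratio [a^2]. Otherwise it is
    [a / c - c^-2 / (z + d / c)], a translation, an inversion and an affine map in succession. *)
Lemma hint_mobius A Phi : \det A = 1 -> mC Phi -> (forall z, 0 <= Phi z) ->
  hint (Phi \o mobius A) = hint Phi.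
Proof.
rewrite det2 => dA mP P0.
set a := A 0 0 in dA; set b := A 0 1 in dA; set c := A 1 0 in dA; set d := A 1 1 in dA.
have [c0|c0] := eqVneq c 0.
  have ad : a * d = 1 by rewrite -dA c0; ring.
  have a0 : a != 0 by apply/eqP => a0; move/eqP: ad; rewrite a0 mul0r eq_sym oner_eq0.
  have dE : d = a^-1 by rewrite -[LHS](mulKf a0) ad mulr1.
  have a2 : 0 < a ^+ 2 by rewrite exprn_even_gt0.
  rewrite -(hint_affine (a * b) a2 mP P0).
  apply: eq_hint => z _; congr Phi; rewrite /mobius -/a -/b -/c -/d c0 dE.
  rewrite mul0r add0r -fmorphV/= invrK mulrDl !rmorphM/=; ring.
have cp : 0 < c ^- 2 by rewrite invr_gt0 exprn_even_gt0.
pose P1 z := Phi ((c ^- 2)%:C * z + (a / c)%:C).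
have mP1 : mC P1.
  have [m1 m2] : mCC (fun z => (c ^- 2)%:C * z + (a / c)%:C).
    by apply: mCC_D (mCC_cst _); apply: mCC_M (mCC_cst _) mCC_id.
  exact: mC_comp.
pose P2 z := P1 (- z^-1).
have mP2 : mC P2.
  have [m1 m2] : mCC (fun z : R[i] => - z^-1).
    have := mCC_M (mCC_cst (-1)) (mCC_V mCC_id).
    by under eq_fun do rewrite mulN1r.
  exact: mC_comp.
rewrite -(hint_affine (a / c) cp mP P0) -/P1 -(hint_inv mP1)//; last first.
  by move=> z; exact: P0.
rewrite -/P2 -(hint_affine (d / c) ltr01 mP2); last by move=> z; exact: P0.
apply: eq_hint => z zH; congr Phi; rewrite /mobius -/a -/b -/c -/d.
have zi : 0 < complex.Im z by [].
have cC : c%:C != 0 :> R[i] by rewrite fmorph_eq0.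
have den : c%:C * z + d%:C != 0.
  apply/eqP => /(congr1 (@complex.Im R)); rewrite !cE mul0r !addr0 => /eqP.
  by rewrite mulf_eq0 (negbTE c0) gt_eqF.
have den' : 1%:C * z + (d / c)%:C != 0.
  apply/eqP => h; move/eqP: den; apply.
  rewrite -(mulr0 c%:C) -h mulrDr; congr (_ + _); first by rewrite rmorph1 mul1r.
  by rewrite -rmorphM/= mulrCA divff// mulr1.
have -> : b%:C = (a%:C * d%:C - 1) / c%:C.
  by apply: (mulIf cC); rewrite divfK//; apply: eqC; rewrite !cE; lra.
move: den den'; rewrite rmorph1 mul1r !fmorph_div fmorphV rmorphXn/= => den den'.
have -> : z + d%:C / c%:C = (c%:C * z + d%:C) / c%:C by field.
by field; rewrite ?cC ?den.
Qed.

End Mobius.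

(** * The constant of the reproducing kernel *)

Section KernelNorm.
Variable R : realType.
Local Notation mu := (@lebesgue_measure R).
Local Notation pos :=
  ([set` Interval (@BSide R false 0%R) (@BInfty R false)]%classic).
Local Open Scope complex_scope.

Lemma integral_inv1sqr : (\int[mu]_t ((1 + t ^+ 2)^-1)%:E = (pi : R)%:E)%E.
Proof.
have c1 (x : R) : 1 + x ^+ 2 != 0 by rewrite gt_eqF// ltr_pwDl// sqr_ge0.
have cf : continuous (fun x : R => (1 + x ^+ 2)^-1).
  exact: continuous_oneDsqrV.
rewrite ge0_symfun_integralT//; last 2 first.
- by move=> x; rewrite invr_ge0 addr_ge0 ?sqr_ge0.
- by move=> x /=; rewrite sqrrN.
rewrite -set_itvcy (@ge0_continuous_FTC2y _ _ (@atan R) 0 (pi / 2)).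
- by rewrite atan0 -EFinB -EFinM subr0 mulrC divfK.
- by move=> x _; rewrite invr_ge0 addr_ge0 ?sqr_ge0.
- exact: continuous_subspaceT.
- exact: cvgy_atan.
- by move=> x _; exact: derivable_atan.
- by apply: cvg_at_right_filter; exact: continuous_atan.
- by move=> x _; rewrite derive1_atan.
Qed.

(** With [q = 1/4 - |z|^2] this is the mass density of the kernel in the disc of radius 1/2: [4 q]
    is [1 - |2 z|^2], and [q^-2] is the hyperbolic density there. *)
Definition bump (s q : R) : R := if 0 < q then (4 * q) `^ s / q ^+ 2 else 0.

Lemma bump_ge0 s q : 0 <= bump s q.
Proof. by rewrite /bump; case: ifP => // q0; rewrite divr_ge0 ?powR_ge0 ?sqr_ge0. Qed.

Lemma measurable_bump s : measurable_fun [set: R] (bump s).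
Proof.
rewrite (_ : bump s = fun q => ((4 * q) `^ s * (q ^+ 2)^-1) * \1_pos q).
  apply: measurable_funM; last exact: measurable_indic.
  apply: measurable_funM.
    apply: (@measurableT_comp _ _ _ _ _ _ (@powR R ^~ s) setT (fun q : R => 4 * q)).
      exact: measurable_powR.
    exact: measurable_funM.
  apply: (measurableT_comp (@measurable_inv R) (g := fun q : R => q ^+ 2)).
  exact: measurable_funX.
apply/funext => q; rewrite /bump indicE in_pos.
by case: ifP => _; rewrite ?mulr1 ?mulr0.
Qed.

(** The primitive is a multiple of [(1 - k^2)^(s-1)], but for [s < 2] the integrand blows up at
    [k = 1]. The substitution [k = 1 - 1/u] sends this endpoint to infinity, where only a limit of
    the primitive is required; it is carried out by a reflection, a shift and the inversion of Haar
    measure. *)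
Lemma integral_bump1 s : 1 < s ->
  (\int[mu]_(k in pos) (bump s ((1 - k ^+ 2) / 4) * k)%:E = (8 / (s - 1))%:E)%E.
Proof.
move=> s1.
have s10 : s - 1 != 0 by rewrite gt_eqF// subr_gt0.
pose b (u : R) := 2 * u^-1 - u^-1 ^+ 2.
have b0 u : 1 <= u -> 0 < b u.
  move=> u1; have u0 : 0 < u by apply: lt_le_trans u1.
  have -> : b u = (2 * u - 1) / u ^+ 2 by rewrite /b; field; rewrite gt_eqF.
  by rewrite divr_gt0 ?exprn_gt0//; lra.
pose f (u : R) := 16 * b u `^ (s - 1 - 1) * (u^-1 ^+ 2 - u^-1 ^+ 3).
pose F (u : R) := (- (8 / (s - 1))) * b u `^ (s - 1).
have dinv (u : R) : 0 < u -> is_derive u 1 (@GRing.inv R) (- u ^- 2).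
  move=> u0; have u1 : u != 0 by rewrite gt_eqF.
  apply: DeriveDef; first by apply: (@derivableV _ _ id).
  by rewrite (@deriveV _ _ id)// derive_id /GRing.scale/= mulr1.
have db (u : R) : 0 < u -> is_derive u 1 b (2 * (u^-1 ^+ 3 - u^-1 ^+ 2)).
  move=> u0; have du := dinv _ u0.
  have -> : b = (cst 2 * @GRing.inv R) - (@GRing.inv R) ^+ 2.
    by apply/funext => x; rewrite /b !fctE.
  apply: is_derive_eq; rewrite /GRing.scale/= -exprVn; ring.
have dF (u : R) : 1 <= u -> is_derive u 1 F (f u).
  move=> u1; have u0 : 0 < u by apply: lt_le_trans u1.
  have dbu := db _ u0; have dp := is_derive1_powR (s - 1) (b0 _ u1).
  have dc := is_derive1_comp dp dbu.
  have -> : F = cst (- (8 / (s - 1))) * ((@powR R ^~ (s - 1)) \o b).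
    by apply/funext => x; rewrite /F !fctE.
  apply: is_derive_eq; rewrite /GRing.scale/= /f; field.
  by rewrite s10 gt_eqF.
have contF (u : R) : 1 <= u -> {for u, continuous f}.
  move=> u1; have u0 : 0 < u by apply: lt_le_trans u1.
  have ci : {for u, continuous (@GRing.inv R)} by apply: inv_continuous; rewrite gt_eqF.
  apply: continuousM; last first.
    have cn n : {for u, continuous (fun x : R => x^-1 ^+ n)}.
      apply: (@continuous_comp _ _ _ (@GRing.inv R) (fun x => x ^+ n)) => //.
      exact: exprn_continuous.
    by apply: cvgB; exact: cn.
  apply: continuousM; first exact: cst_continuous.
  apply: (@continuous_comp _ _ _ b (@powR R ^~ (s - 1 - 1))).
    by apply/differentiable_continuous/derivable1_diffP; have [] := db _ u0.
  apply/differentiable_continuous/derivable1_diffP.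
  by have [] := is_derive1_powR (s - 1 - 1) (b0 _ u1).
have limF : F u @[u --> +oo] --> (0 : R).
  rewrite -(mulr0 (- (8 / (s - 1)))); apply: cvgM; first exact: cvg_cst.
  have cinv : u^-1 @[u --> +oo] --> (0 : R).
    by apply/gtr0_cvgV0 => //; exact: nbhs_pinfty_gt.
  have cb : b u @[u --> +oo] --> (0 : R).
    rewrite (_ : 0 = 2 * 0 - 0 * 0 :> R); last by rewrite !mulr0 subr0.
    rewrite /b; under eq_fun do rewrite expr2.
    by apply: cvgB; [apply: cvgM; [exact: cvg_cst|]|apply: cvgM].
  apply: (@cvg_comp _ _ _ b (@powR R ^~ (s - 1)) +oo%R 0^'+); last first.
    by apply: powR_cvg0; rewrite subr_gt0.
  move=> A; rewrite /at_right /within/= => /cb h.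
  near=> u; have : 0 < b u -> A (b u) by near: u.
  by apply; apply: b0; near: u; exact: nbhs_pinfty_ge.
have F1 : F 1 = - (8 / (s - 1)).
  by rewrite /F /b invr1 expr1n mulr1 (_ : 2 - 1 = 1 :> R) ?powR1 ?mulr1//; lra.
have FTC : (\int[mu]_(u in `[1%R, +oo[) (f u)%:E = (8 / (s - 1))%:E)%E.
  rewrite (@ge0_continuous_FTC2y _ f F 1 0).
  - by rewrite F1 -EFinB sub0r opprK.
  - move=> u u1; have u0 : 0 < u by apply: lt_le_trans u1.
    rewrite /f mulr_ge0// ?mulr_ge0 ?powR_ge0// subr_ge0 [leLHS]exprS ler_piMl//.
      by rewrite exprn_ge0// invr_ge0 ltW.
    by rewrite invf_le1.
  - apply: continuous_in_subspaceT => u; rewrite inE/= in_itv/= andbT.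
    exact: contF.
  - exact: limF.
  - by move=> u u1; have [] := dF _ (ltW u1).
  - apply: cvg_at_right_filter.
    apply/differentiable_continuous/derivable1_diffP.
    by have [] := dF _ (lexx 1).
  - move=> u; rewrite in_itv/= andbT => u1; rewrite derive1E.
    by have [_] := dF _ (ltW u1).
rewrite -FTC.
pose g (k : R) := bump s ((1 - k ^+ 2) / 4) * k * \1_pos k.
have mg : measurable_fun [set: R] g.
  apply: measurable_funM; last exact: measurable_indic.
  apply: measurable_funM => //.
  apply: (measurableT_comp (measurable_bump s) (g := fun k : R => (1 - k ^+ 2) / 4)).
  by apply: measurable_funM => //; apply: measurable_funB => //; exact: measurable_funX.
have g0 k : 0 <= g k.
  rewrite /g indicE in_pos; case: ltP => k0; last by rewrite mulr0.
  by rewrite mulr1 mulr_ge0 ?bump_ge0// ltW.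
transitivity (\int[mu]_k (g k)%:E)%E.
  rewrite integral_mkcond; apply: eq_integral => k _.
  by rewrite patchE in_pos /g indicE in_pos; case: ifP => _; rewrite ?mulr1 ?mulr0.
have mgE : measurable_fun [set: R] (EFin \o g) by exact/measurable_EFinP.
have gE0 k : (0 <= (EFin \o g) k)%E by rewrite lee_fin.
rewrite -(ge0_integral_reflect mgE gE0) -(ge0_integral_shift (- 1)); last 2 first.
- apply: (measurableT_comp mgE (g := fun x : R => - x)); exact: oppr_measurable.
- by move=> x; exact: gE0.
pose h (v : R) := v * \1_pos v * g (1 - v).
have mg1 : measurable_fun [set: R] (fun v => g (1 - v)).
  apply: (measurableT_comp mg (g := fun v : R => 1 - v)).
  exact: measurable_funB.
have mh : measurable_fun [set: R] h.
  by apply: measurable_funM => //; apply: measurable_funM => //; exact: measurable_indic.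
have h0 v : 0 <= h v.
  rewrite /h indicE in_pos; case: ltP => v0; last by rewrite mulr0 mul0r.
  by rewrite mulr1 mulr_ge0// ltW.
transitivity (\int[mu]_(v in pos) (h v / v)%:E)%E.
  rewrite [RHS]integral_mkcond; apply: eq_integral => v _.
  rewrite patchE in_pos /= (_ : - (v + -1) = 1 - v); last by ring.
  rewrite /h indicE in_pos; case: ifPn => v0.
    by rewrite v0 mulr1; congr EFin; field; rewrite gt_eqF.
  rewrite /g /bump; case: ifPn => [b4|]; last by rewrite !mul0r.
  exfalso; move: v0 b4; rewrite -leNgt => v0.
  rewrite pmulr_lgt0// subr_gt0 ltNge => /negP; apply.
  by rewrite -[leLHS](expr1n _ 2) ler_sqr ?nnegrE//; lra.
rewrite -(ge0_integral_inv_haar mh h0).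
rewrite integral_mkcond [RHS]integral_mkcond; apply: eq_integral => u _.
rewrite !patchE in_pos mem_itv_set in_itv/= andbT.
case: ifPn => u0; last first.
  case: ifPn => // u1; exfalso; move: u0; rewrite -leNgt; lra.
rewrite /h indicE in_pos invr_gt0 u0 mulr1 /g indicE in_pos subr_gt0.
have -> : (u^-1 < 1) = (1 < u) by rewrite invf_lt1.
case: (ltP 1 u) => u1; last first.
  rewrite !mulr0 mul0r; case: ifPn => // u1'.
  have -> : u = 1 by apply/eqP; rewrite eq_le u1 u1'.
  by rewrite /f invr1 !expr1n subrr mulr0.
rewrite (ltW u1) mulr1; congr EFin.
have e4 : (1 - (1 - u^-1) ^+ 2) / 4 = b u / 4 by rewrite /b; congr (_ / _); ring.
have bu := b0 _ (ltW u1).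
have e5 : 4 * (b u / 4) = b u by field.
rewrite e4 /bump divr_gt0// e5 /f.
have e6 : b u `^ (s - 1 - 1) = b u `^ s / b u ^+ 2.
  rewrite (_ : s - 1 - 1 = s - 2%:R); last by ring.
  rewrite powRB; last by apply/implyP => _; rewrite gt_eqF.
  by rewrite powR_mulrn// ltW.
rewrite e6.
by field; rewrite !gt_eqF.
Unshelve. all: by end_near. Qed.

End KernelNorm.

Section KernelNorm2.
Variable R : realType.
Local Notation mu := (@lebesgue_measure R).
Local Notation pos :=
  ([set` Interval (@BSide R false 0%R) (@BInfty R false)]%classic).
Local Notation Re := (@complex.Re R).
Local Notation Im := (@complex.Im R).
Local Open Scope complex_scope.

Lemma mC_powR (f : R[i] -> R) s : mC f -> mC (fun z => f z `^ s).
Proof. by move=> mf; exact: (measurableT_comp (@measurable_powR R s) mf). Qed.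

Lemma mC_comp1 (g : R -> R) (f : R[i] -> R) :
  measurable_fun [set: R] g -> mC f -> mC (fun z => g (f z)).
Proof. by move=> mg mf; exact: (measurableT_comp mg mf). Qed.

Lemma mC_indic (A : set R) (f : R[i] -> R) :
  measurable A -> mC f -> mC (fun z => \1_A (f z)).
Proof. by move=> mA; apply: mC_comp1; exact: measurable_indic. Qed.

Local Open Scope ereal_scope.

Definition rowint (Psi : R[i] -> R) (y : R) : \bar R :=
  \int[mu]_x (Psi (x +i* y)%C)%:E.

Lemma measurable_rowint Psi : mC Psi -> (forall z, 0 <= Psi z)%R ->
  measurable_fun [set: R] (rowint Psi).
Proof.
move=> mP P0; apply: (measurable_fun_fubini_tonelli_G (m1 := mu)
    (fun p => (Psi (complex_of_pair p))%:E)).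
  by apply/measurable_EFinP.
by move=> p; rewrite lee_fin.
Qed.

Lemma rowint_ge0 Psi y : (forall z, 0 <= Psi z)%R -> 0 <= rowint Psi y.
Proof. by move=> P0; apply: integral_ge0 => x _; rewrite lee_fin. Qed.

Lemma hint_rowint Psi : mC Psi -> (forall z, 0 <= Psi z)%R ->
  (forall z, Im z <= 0 -> Psi z = 0)%R ->
  \int[mu]_y rowint Psi y = hint (fun z => Psi z * Im z ^+ 2)%R.
Proof.
move=> mP P0 PN; rewrite hintE; last 2 first.
- by apply: mC_M => //; apply: mC_X; exact: mC_Im.
- by move=> z; rewrite mulr_ge0 ?sqr_ge0.
rewrite [RHS]integral_mkcond; apply: eq_integral => y _; rewrite patchE in_pos.
case: ltP => y0.
  by apply: eq_integral => x _; rewrite mulfK// gt_eqF ?exprn_gt0.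
by rewrite /rowint integral0_eq// => x _; rewrite PN.
Qed.

Lemma integral_rowint_shift Psi (b : R) : mC Psi -> (forall z, 0 <= Psi z)%R ->
  \int[mu]_y rowint Psi y = \int[mu]_y rowint (fun z => Psi (Re z +i* (Im z + b)))%R y.
Proof.
move=> mP P0; rewrite -(ge0_integral_shift b (measurable_rowint mP P0)) //.
by move=> x; exact: rowint_ge0.
Qed.

(** In the disc this is the integral of [(1 - r^2)^s] for the hyperbolic area. The change to the
    disc is made from elementary moves only: vertical shifts, inversion along rays, and a final
    passage to ray coordinates. *)
Lemma hint_kernel (s : R) : (1 < s)%R ->
  hint (fun z => (4 * Im z / (Re z ^+ 2 + (Im z + 1) ^+ 2)) `^ s)%R =
  (4 * pi / (s - 1))%:E.
Proof.
move=> s1; have s10 : (s - 1 != 0)%R by rewrite gt_eqF// subr_gt0.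
have mRe := @mC_Re R; have mIm := @mC_Im R; have mnsq := @mC_nsq R.
have c_ (c : R) : mC (fun=> c) by exact: mC_cst.
pose K1 z := ((4 * (Im z - 1) / nsq z) `^ s / (Im z - 1) ^+ 2 * \1_pos (Im z - 1))%R.
have mK1 : mC K1.
  apply: mC_M; last by apply: mC_indic => //; exact: mC_D.
  apply: mC_M.
    by apply: mC_powR; apply: mC_M; [apply: mC_M => //; exact: mC_D|exact: mC_V].
  by apply: mC_V; apply: mC_X; exact: mC_D.
have K10 z : (0 <= K1 z)%R.
  by rewrite /K1 mulr_ge0// divr_ge0 ?powR_ge0 ?sqr_ge0.
pose K0 z := ((4 * Im z / (Re z ^+ 2 + (Im z + 1) ^+ 2)) `^ s / Im z ^+ 2 * \1_pos (Im z))%R.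
have K0E z : K0 z = K1 (Re z +i* (Im z + 1)%R).
  by rewrite /K0 /K1 /nsq !cE addrK.
have mK0 : mC K0.
  apply: mC_M; last exact: mC_indic.
  apply: mC_M; last by apply: mC_V; exact: mC_X.
  apply: mC_powR; apply: mC_M; first exact: mC_M.
  by apply: mC_V; apply: mC_D; apply: mC_X => //; exact: mC_D.
pose bp (z : R[i]) := bump s (Im z - nsq z)%R.
have mbp : mC bp.
  by apply: mC_comp1; [exact: measurable_bump|apply: mC_D => //; exact: mC_N].
pose bq (z : R[i]) := bump s (4^-1 - nsq z)%R.
have mbq : mC bq.
  by apply: mC_comp1; [exact: measurable_bump|apply: mC_D => //; exact: mC_N].
(* Shifting up by 1 centres the denominator at 0; the half-plane becomes [Im z > 1]. *)
have step1 : hint (fun z => (4 * Im z / (Re z ^+ 2 + (Im z + 1) ^+ 2)) `^ s)%R =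
    hint (fun z => K1 z * Im z ^+ 2)%R.
  transitivity (hint (fun z => K0 z * Im z ^+ 2)%R).
    apply: eq_hint => z z0; rewrite /K0 indicE in_pos z0 mulr1 divfK//.
    by rewrite gt_eqF// exprn_gt0.
  have K1N z : (Im z <= 0 -> K1 z = 0)%R.
    by move=> z0; rewrite /K1 indicE in_pos ltNge (_ : (_ <= _)%R) ?mulr0//; lra.
  have K0N z : (Im z <= 0 -> K0 z = 0)%R.
    by move=> z0; rewrite /K0 indicE in_pos ltNge z0 mulr0.
  have K00 z : (0 <= K0 z)%R by rewrite K0E.
  rewrite -(hint_rowint mK0 K00 K0N) -(hint_rowint mK1 K10 K1N).
  rewrite (integral_rowint_shift 1 mK1 K10).
  by apply: eq_integral => y _; apply: eq_integral => x _; rewrite K0E.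
have mt t : (0 < 1 + t ^+ 2 :> R)%R by rewrite ltr_pwDl// sqr_ge0.
have nsqt (t y : R) : nsq ((t * y) +i* y)%R = ((1 + t ^+ 2) * y ^+ 2)%R.
  by rewrite /nsq !cE; ring.
(* The inversion [y] to [1 / (m y)] on each ray carries [Im z > 1] to the disc of diameter from 0 to
   [i], given by [Im z - |z|^2 > 0]. *)
have step2 : hint (fun z => K1 z * Im z ^+ 2)%R = hint (fun z => bp z * Im z ^+ 2)%R.
  rewrite !hint_tilt; first last.
  - by move=> z; rewrite mulr_ge0 ?sqr_ge0.
  - by apply: mC_M => //; exact: mC_X.
  - by move=> z; rewrite mulr_ge0 ?sqr_ge0 ?bump_ge0.
  - by apply: mC_M => //; exact: mC_X.
  apply: eq_integral => t _; set m := (1 + t ^+ 2)%R in nsqt.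
  have m0 : (0 < m)%R by exact: mt.
  pose f (y : R) := (K1 ((t * y) +i* y) * y ^+ 2)%R.
  have mf : measurable_fun [set: R] f.
    apply: measurable_funM; last exact: measurable_funX.
    apply: (measurableT_comp mK1 (g := fun y : R => (t * y, y)%R)).
    by apply: measurable_fun_pair => //; exact: measurable_funM.
  have f0 y : (0 <= f y)%R by rewrite /f mulr_ge0 ?sqr_ge0.
  have mfV : measurable_fun [set: R] (fun y : R => f y^-1%R).
    exact: (measurableT_comp mf (@measurable_inv R)).
  transitivity (\int[mu]_(y in pos) (f y / y)%:E); first by [].
  rewrite -(ge0_integral_inv_haar mf f0) (ge0_integral_scale_haar m0 mfV)//.
  apply: eq_integral => y; rewrite in_pos => y0; rewrite /f /bp nsqt /= -/m.
  congr (_ / _)%:E; rewrite /K1 nsqt -/m !cE indicE in_pos /bump.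
  have my0 : (0 < m * y)%R by rewrite mulr_gt0.
  have -> : (0 < (m * y)^-1 - 1)%R = (0 < y - m * y ^+ 2)%R.
    have -> : (y - m * y ^+ 2 = y * (m * y) * ((m * y)^-1 - 1))%R.
      by field; rewrite !gt_eqF.
    by rewrite pmulr_rgt0// mulr_gt0.
  case: ifPn => q0; last by rewrite mulr0 !mul0r.
  rewrite mulr1 (_ : 4 * _ / _ = 4 * (y - m * y ^+ 2))%R; last first.
    by field; rewrite !gt_eqF.
  have q1 : (1 - m * y != 0)%R.
    apply/eqP => q1; move: q0; rewrite (_ : y - _ = y * (1 - m * y))%R; last by ring.
    by rewrite q1 mulr0 ltxx.
  rewrite (_ : (m * y)^-1 - 1 = (1 - m * y) / (m * y))%R; last by field; rewrite !gt_eqF.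
  rewrite (_ : y - m * y ^+ 2 = y * (1 - m * y))%R; last by ring.
  by field; do ?[apply/andP; split]; rewrite ?q1 ?gt_eqF.
have bpN z : (Im z <= 0 -> bp z = 0)%R.
  move=> z0; rewrite /bp /bump ltNge (_ : (_ <= _)%R)//.
  by have := nsq_ge0 z; lra.
have step3 : hint (fun z => bp z * Im z ^+ 2)%R = \int[mu]_y rowint bq y.
  have bp0 z : (0 <= bp z)%R by exact: bump_ge0.
  rewrite -(hint_rowint mbp bp0 bpN) (integral_rowint_shift 2^-1%R mbp bp0).
  apply: eq_integral => y _; apply: eq_integral => x _; congr EFin.
  by rewrite /bp /bq /nsq !cE; congr bump; field.
have bq0 z : (0 <= bq z)%R by exact: bump_ge0.
(* The disc is now centred at 0, hence symmetric; its upper half is again accessible to ray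
   coordinates. *)
have step4 : \int[mu]_y rowint bq y = 2%:E * hint (fun z => bq z * Im z ^+ 2)%R.
  have mL := measurable_rowint mbq bq0.
  have L0 y := @rowint_ge0 bq y bq0.
  have hL : hint (fun z => bq z * Im z ^+ 2)%R = \int[mu]_(y in pos) rowint bq y.
    rewrite hintE.
    - apply: eq_integral => y; rewrite in_pos => y0.
      by apply: eq_integral => x _; rewrite mulfK// gt_eqF ?exprn_gt0.
    - by apply: mC_M => //; exact: mC_X.
    - by move=> z; rewrite mulr_ge0 ?sqr_ge0.
  have evenL y : rowint bq (- y) = rowint bq y.
    by apply: eq_integral => x _; congr EFin; rewrite /bq /nsq !cE sqrrN.
  have mpos : measurable (pos : set R) by [].
  rewrite hL -(setUv pos) ge0_integral_setU.
  - rewrite mule_natl mule2n; congr (_ + _).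
    transitivity (\int[mu]_(y in `[0%R, +oo[) rowint bq y); last first.
      by rewrite integral_itv_obnd_cbnd//; exact: measurable_funTS.
    rewrite integral_mkcond [RHS]integral_mkcond.
    rewrite -(ge0_integral_reflect (f := rowint bq \_ (~` pos))).
    + apply: eq_integral => y _; rewrite !patchE mem_itv_set in_setC in_pos in_itv/=.
      by rewrite andbT oppr_gt0 -leNgt evenL.
    + apply/(measurable_restrictT _ (measurableC mpos)); exact: measurable_funTS.
    + by move=> y; rewrite patchE; case: ifP.
  - exact: mpos.
  - exact: measurableC mpos.
  - by rewrite setUv.
  - by move=> y _.
  - by apply/disj_setPCl.
rewrite step1 step2 step3 step4 hint_tilt; last 2 first.
- by apply: mC_M => //; exact: mC_X.
- by move=> z; rewrite mulr_ge0 ?sqr_ge0.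
transitivity (2%:E * \int[mu]_t ((2 / (s - 1))%:E * ((1 + t ^+ 2)^-1)%:E)).
  congr (_ * _); apply: eq_integral => t _; set m := (1 + t ^+ 2)%R in nsqt *.
  have m0 : (0 < m)%R by exact: mt.
  pose h (y : R) := (bump s (4^-1 - m * y ^+ 2) * y ^+ 2)%R.
  have mh : measurable_fun [set: R] h.
    apply: measurable_funM; last exact: measurable_funX.
    apply: (measurableT_comp (measurable_bump s) (g := fun y : R => (4^-1 - m * y ^+ 2)%R)).
    by apply: measurable_funB => //; apply: measurable_funM => //; exact: measurable_funX.
  have h0 y : (0 <= h y)%R by rewrite mulr_ge0 ?bump_ge0 ?sqr_ge0.
  transitivity (\int[mu]_(y in pos) (h y / y)%:E).
    by apply: eq_integral => y _; rewrite /h /bq nsqt.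
  (* This is the height at which the ray leaves the disc of radius 1/2; after scaling by it, [t]
     enters only through the factor [1 / (4 m)], whose integral is a multiple of [pi]. *)
  pose a := ((2 * Num.sqrt m)^-1)%R.
  have a0 : (0 < a)%R by rewrite invr_gt0 mulr_gt0// sqrtr_gt0.
  have a2 : (a ^+ 2 = (4 * m)^-1)%R.
    by rewrite exprVn exprMn sqr_sqrtr ?ltW//; congr (_ * _)^-1%R; ring.
  rewrite (ge0_integral_scale_haar a0 mh h0).
  transitivity (\int[mu]_(y in pos) ((4 * m)^-1%:E * (bump s ((1 - y ^+ 2) / 4) * y)%:E)).
    apply: eq_integral => y; rewrite in_pos => y0; rewrite -EFinM; congr EFin.
    rewrite /h exprMn a2 (_ : 4^-1 - _ = (1 - y ^+ 2) / 4)%R; last by field; rewrite gt_eqF.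
    by field; rewrite !gt_eqF.
  rewrite ge0_integralZl//.
  - rewrite integral_bump1// -!EFinM; congr EFin; field; rewrite s10 gt_eqF//.
  - apply/measurable_EFinP; apply: measurable_funTS; apply: measurable_funM => //.
    apply: (measurableT_comp (measurable_bump s) (g := fun y : R => ((1 - y ^+ 2) / 4)%R)).
    by apply: measurable_funM => //; apply: measurable_funB => //; exact: measurable_funX.
  - by move=> y; rewrite /= in_itv/= andbT => y0; rewrite lee_fin mulr_ge0 ?bump_ge0 ?ltW.
  - by rewrite lee_fin invr_ge0 mulr_ge0// ltW.
rewrite ge0_integralZl//.
- by rewrite integral_inv1sqr -!EFinM; congr EFin; field.
- apply/measurable_EFinP.
  apply: (measurableT_comp (@measurable_inv R) (g := fun t : R => 1 + t ^+ 2)%R).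
  by apply: measurable_funD => //; exact: measurable_funX.
- by move=> t _; rewrite lee_fin invr_ge0 ltW.
- by rewrite lee_fin divr_ge0// subr_ge0 ltW.
Qed.

End KernelNorm2.

(** * Holomorphic functions and powers *)

Section Holomorphy.
Variable R : realType.
Local Notation C := R[i].
Local Open Scope complex_scope.
Local Notation N := (@Normc.normc R).
Definition hol (f : C -> C) (z : C) := derivable (f : C^o -> C^o) z 1.
Implicit Types f g : C -> C.
Lemma hol_cst c z : hol (fun=> c) z.
Proof. exact: derivable_cst. Qed.

Lemma hol_id z : hol id z.
Proof. exact: derivable_id. Qed.

Lemma hol_D f g z : hol f z -> hol g z -> hol (fun w => f w + g w) z.
Proof. exact: derivableD. Qed.

Lemma hol_M f g z : hol f z -> hol g z -> hol (fun w => f w * g w) z.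
Proof. exact: derivableM. Qed.

Lemma hol_V f z : f z != 0 -> hol f z -> hol (fun w => (f w)^-1) z.
Proof. exact: derivableV. Qed.

Lemma normE (z : C) : `|z| = (N z)%:C.
Proof. by []. Qed.

Lemma nearP (P : C -> Prop) (z : C) : (\forall t \near (z : C^o), P t) <->
  exists2 d : R, 0 < d & forall t, N (t - z) < d -> P t.
Proof.
split.
  move=> /nbhs_ballP[d /= d0 hd]; have dE : d = (complex.Re d)%:C.
    by rewrite RRe_real// realE ltW.
  exists (complex.Re d); first by rewrite -ltcR -dE.
  by move=> t td; apply: hd; rewrite -ball_normE /= distrC normE dE ltcR.
move=> [d d0 hd]; apply/nbhs_ballP; exists d%:C => /=; first by rewrite ltcR.
by move=> t; rewrite -ball_normE /= distrC normE ltcR; exact: hd.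
Qed.

Lemma hol_comp f g z : hol g z -> hol f (g z) -> hol (f \o g) z.
Proof.
rewrite /hol => /derivable1_diffP hg /derivable1_diffP hf; apply/derivable1_diffP.
exact: (@differentiable_comp _ C^o C^o C^o g f z hg hf).
Qed.

Lemma hol_ext f g z : (\forall w \near (z : C^o), f w = g w) -> hol f z -> hol g z.
Proof. by move=> fg; apply: near_eq_derivable; rewrite ?oner_eq0. Qed.

Definition cdiff f z L := forall e : R, 0 < e -> exists2 d, 0 < d &
   forall h, N h < d -> N (f (z + h) - f z - L * h) <= e * N h.

(** Neighbourhoods in [R[i]] have complex radii that positivity forces to be real, so real radii
    suffice; clearing the denominator of the quotient makes the case [h = 0] harmless. *)
Lemma holP f z : hol f z <-> exists L, cdiff f z L.
Proof.
have quot L h : h != 0 -> N (f (z + h) - f z - L * h) =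
    N (L - h^-1 * (f (h * 1 + z) - f z)) * N h.
  move=> h0; rewrite -Normc.normcM -normcN; congr N.
  by rewrite mulrBl mulrAC mulVf// mul1r mulr1 [h + z]addrC; ring.
have Npos h : h != 0 -> 0 < N h by move=> h0; rewrite normcE sqrtr_gt0 nsq_gt0.
split.
  rewrite /hol /derivable => /cvg_ex[/= L] /cvgrPdist_le /= H; exists L => e e0.
  have e0' : 0 < e%:C :> C by rewrite ltcR.
  have := H _ e0'; rewrite /dnbhs near_withinE => /nearP[d d0 hd].
  exists d => // h hd0; have [->|h0] := eqVneq h 0.
    by rewrite mulr0 addr0 !subrr Normc.normc0 mulr0.
  rewrite quot// ler_pM2r ?Npos// -lecR -normE; apply: hd => //.
  by rewrite subr0.
move=> [L cL]; rewrite /hol /derivable; apply/cvg_ex; exists L => /=.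
apply/cvgrPdist_le => /= e e0; rewrite /dnbhs near_withinE; apply/nearP.
have eE : e = (complex.Re e)%:C by rewrite RRe_real// realE ltW.
have e0' : 0 < complex.Re e by rewrite -ltcR -eE.
have [d d0 hd] := cL _ e0'; exists d => // h; rewrite subr0 => hd0 h0.
by rewrite normE eE lecR -(ler_pM2r (Npos _ h0)) -quot// hd.
Qed.

Definition ccont f z := forall e : R, 0 < e -> exists2 d, 0 < d &
   forall h, N h < d -> N (f (z + h) - f z) <= e.

Lemma hol_ccont f z : hol f z -> ccont f z.
Proof.
move=> /holP[L cL] e e0; have [d d0 hd] := cL 1 ltr01.
have l0 : 0 <= N L by rewrite normcE sqrtr_ge0.
exists (Num.min d (e / (1 + N L))).
  by rewrite lt_min d0 divr_gt0// ltr_pwDl.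
move=> h; rewrite lt_min => /andP[h1 h2].
have -> : f (z + h) - f z = (f (z + h) - f z - L * h) + L * h by rewrite subrK.
apply: le_trans (le_normcD _ _) _; rewrite Normc.normcM.
apply: le_trans (lerD (hd _ h1) (lexx _)) _.
move: h2; rewrite ltr_pdivlMr ?ltr_pwDl// => h2; lra.
Qed.
End Holomorphy.

Section RealDiff.
Variable R : realType.

Lemma is_derive_eps (f : R -> R) (x df : R) : is_derive x 1 f df ->
  forall e, 0 < e -> exists2 d, 0 < d &
    forall h, `|h| < d -> `|f (x + h) - f x - df * h| <= e * `|h|.
Proof.
move=> [dv <-] e e0; move: dv => /cvg_ex[/= L cL].
have -> : 'D_1 f x = L by apply: cvg_lim cL; exact: Rhausdorff.
move: cL => /cvgrPdist_le /= /(_ e e0).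
rewrite /dnbhs near_withinE => /nbhs_ballP[d /= d0 hd]; exists d => // h hd0.
have [->|h0] := eqVneq h 0; first by rewrite mulr0 addr0 !subrr normr0 mulr0.
have : `|L - h^-1 * (f (h * 1 + x) - f x)| <= e.
  by apply: hd => //; rewrite -ball_normE/= sub0r normrN.
rewrite -(ler_pM2r (x := `|h|)) ?normr_gt0// -normrM; apply: le_trans.
rewrite -normrN le_eqVlt; apply/orP; left; apply/eqP; congr `|_|.
by rewrite mulrBl mulrAC mulVf// mul1r mulr1 [h + x]addrC; ring.
Qed.

End RealDiff.

(** * The exponential, the principal logarithm and real powers *)

Section ExpLog.
Variable R : realType.
Local Notation C := R[i].
Local Notation Re := (@complex.Re R).
Local Notation Im := (@complex.Im R).
Local Notation N := (@Normc.normc R).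
Local Open Scope complex_scope.

Lemma normc_ge0 (z : C) : 0 <= N z.
Proof. by rewrite normcE sqrtr_ge0. Qed.

Lemma Re_le_normc (z : C) : `|Re z| <= N z.
Proof. by rewrite normcE -sqrtr_sqr ler_wsqrtr// lerDl sqr_ge0. Qed.

Lemma Im_le_normc (z : C) : `|Im z| <= N z.
Proof. by rewrite normcE -sqrtr_sqr ler_wsqrtr// lerDr sqr_ge0. Qed.

Lemma normc_le (z : C) : N z <= `|Re z| + `|Im z|.
Proof.
rewrite normcE -[leRHS]ger0_norm ?addr_ge0// -sqrtr_sqr ler_wsqrtr// /nsq.
rewrite -(real_normK (num_real (Re z))) -(real_normK (num_real (Im z))).
by rewrite sqrrD -addrA [X in _ <= _ + X]addrC addrA lerDl mulrn_wge0// mulr_ge0.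
Qed.

Definition cexp (z : C) : C := (expR (Re z) * cos (Im z)) +i* (expR (Re z) * sin (Im z)).

Lemma cexpD z w : cexp (z + w) = cexp z * cexp w.
Proof.
by apply: eqC; rewrite /cexp !cE expRD ?cosD ?sinD; ring.
Qed.

Lemma cexp0 : cexp 0 = 1.
Proof. by apply: eqC; rewrite /cexp !cE expR0 ?cos0 ?sin0 ?mul1r. Qed.

Lemma nsq_cexp z : nsq (cexp z) = expR (Re z) ^+ 2.
Proof. by rewrite /nsq /cexp !cE !exprMn -mulrDr cos2Dsin2 mulr1. Qed.

Lemma cexp_neq0 z : cexp z != 0.
Proof. by rewrite -nsq_gt0 nsq_cexp exprn_gt0 ?expR_gt0. Qed.

(** First order expansions of the real exponential, cosine and sine at 0 suffice here; the addition
    formula then carries differentiability to every point. *)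
Lemma hol_cexp0 : hol cexp 0.
Proof.
apply/holP; exists 1 => e e0.
(* The errors in the two coordinates come to 3 and 5 times [e / 12 * N h]; the bound 1 keeps the
   exponential below 3. *)
have e6 : 0 < Num.min (e / 12) 1 by rewrite lt_min ltr01 divr_gt0.
have [d1 d10 h1] := is_derive_eps (is_derive_expR (0 : R)) e6.
have [d2 d20 h2] := is_derive_eps (is_derive_cos (0 : R)) e6.
have [d3 d30 h3] := is_derive_eps (is_derive_sin (0 : R)) e6.
set g := Num.min (e / 12) 1 in e6 h1 h2 h3.
have g1 : g <= e / 12 by rewrite /g ge_min lexx.
have g2 : g <= 1 by rewrite /g ge_min lexx orbT.
exists (Num.min (Num.min d1 d2) (Num.min d3 (Num.min 1 (e / 12)))).
  by rewrite !lt_min d10 d20 d30 ltr01 divr_gt0.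
move=> h; rewrite !lt_min => /andP[/andP[hd1 hd2] /andP[hd3 /andP[hd4 hd5]]].
have := Re_le_normc h; have := Im_le_normc h.
set a := Re h; set b := Im h; set n := N h in hd1 hd2 hd3 hd4 hd5 * => bn an.
have {h1} := h1 a (le_lt_trans an hd1); have {h2} := h2 b (le_lt_trans bn hd2).
have {h3} := h3 b (le_lt_trans bn hd3).
rewrite !add0r expR0 cos0 sin0 subr0 oppr0 !mul1r mul0r subr0 => h3 h2 h1.
have -> : cexp h - cexp 0 - h = (expR a * cos b - 1 - a) +i* (expR a * sin b - b).
  by apply: eqC; rewrite cexp0 /cexp !cE -/a -/b; ring.
apply: le_trans (normc_le _) _; rewrite !cE.
have n0 : 0 <= n by exact: normc_ge0.
have ca : `|cos b| <= 1 by rewrite ler_norml cos_geN1 cos_le1.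
have gg : 0 <= g by exact: ltW.
have gn : g * `|b| <= e / 12 * n by apply: ler_pM.
have gn' : g * `|a| <= e / 12 * n by apply: ler_pM.
have ga : g * `|a| <= `|a| by rewrite ler_piMl.
have e1a : `|expR a - 1| <= 2 * `|a|.
  rewrite (_ : expR a - 1 = (expR a - 1 - a) + a); last by ring.
  by apply: le_trans (ler_normD _ _) _; lra.
have ea : `|expR a| <= 3.
  rewrite (_ : expR a = (expR a - 1) + 1); last by ring.
  by apply: le_trans (ler_normD _ _) _; rewrite normr1; lra.
have p1 : `|expR a * cos b - 1 - a| <= 3 * (e / 12 * n).
  rewrite (_ : _ - _ = (expR a - 1 - a) * cos b + (1 + a) * (cos b - 1)); last by ring.
  apply: le_trans (ler_normD _ _) _; rewrite !normrM.
  have : `|expR a - 1 - a| * `|cos b| <= e / 12 * n.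
    by rewrite -[leRHS]mulr1; apply: ler_pM; rewrite ?normr_ge0//; lra.
  have : `|1 + a| * `|cos b - 1| <= 2 * (e / 12 * n).
    apply: ler_pM; rewrite ?normr_ge0//; last by lra.
    by apply: le_trans (ler_normD _ _) _; rewrite normr1; lra.
  by lra.
have p2 : `|expR a * sin b - b| <= 5 * (e / 12 * n).
  rewrite (_ : _ - _ = expR a * (sin b - b) + (expR a - 1) * b); last by ring.
  apply: le_trans (ler_normD _ _) _; rewrite !normrM.
  have : `|expR a| * `|sin b - b| <= 3 * (e / 12 * n).
    by apply: ler_pM; rewrite ?normr_ge0//; lra.
  have : `|expR a - 1| * `|b| <= 2 * (e / 12 * n).
    rewrite mulrA; apply: ler_pM; rewrite ?normr_ge0//; lra.
  by lra.
apply: le_trans (lerD p1 p2) _; have : 0 <= e * n by apply: mulr_ge0 => //; exact: ltW.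
by lra.
Qed.

Lemma hol_cexp z : hol cexp z.
Proof.
have -> : cexp = (fun w => cexp z * cexp (w - z)).
  by apply/funext => w; rewrite -cexpD addrC subrK.
apply: hol_M; first exact: hol_cst.
apply: (@hol_comp _ cexp (fun w => w - z)).
  by apply: hol_D; [exact: hol_id|exact: hol_cst].
by rewrite subrr; exact: hol_cexp0.
Qed.

(** Half-angle formula: [1 - cos x] is twice the square of [sin (x / 2)], which is nonzero for
    [x / 2] strictly between 0 and [pi]. *)
Lemma cos_eq1 (x : R) : `|x| < 2 * pi -> cos x = 1 -> x = 0.
Proof.
wlog x0 : x / 0 <= x => [hw|] xpi cx.
  have [x0|x0] := leP 0 x; first exact: hw.
  by apply: oppr_inj; rewrite oppr0; apply: hw; rewrite ?normrN ?cosN// oppr_ge0 ltW.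
apply/eqP; rewrite eq_le x0 andbT leNgt; apply/negP => xp.
have : 0 < sin (x / 2).
  by apply: sin_gt0_pi; rewrite divr_gt0//= ltr_pdivrMr// mulrC -[x]ger0_norm.
have : cos x = 1 - 2 * sin (x / 2) ^+ 2.
  have -> : x = x / 2 + x / 2 by field.
  rewrite cosD (_ : (x / 2 + x / 2) / 2 = x / 2); last by field.
  by have := cos2Dsin2 (x / 2); rewrite -!expr2 => h; lra.
rewrite cx => h s0; have : 0 < sin (x / 2) ^+ 2 by rewrite exprn_gt0.
lra.
Qed.

Lemma cexp_inj z w : `|Im z - Im w| < 2 * pi -> cexp z = cexp w -> z = w.
Proof.
move=> hzw e; have rez : Re z = Re w.
  apply: expR_inj; have := congr1 (@nsq R) e; rewrite !nsq_cexp => /eqP.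
  by rewrite eqrXn2 ?expR_ge0// => /eqP.
apply: eqC => //; apply/eqP; rewrite -subr_eq0; apply/eqP; apply: cos_eq1 => //.
have e1 : cexp (z - w) = 1.
  have := congr1 (fun x => x * cexp (- w)) e.
  by rewrite -!cexpD subrr cexp0.
have := congr1 Re e1; rewrite /cexp !cE rez subrr expR0 mul1r => <-.
by congr cos; ring.
Qed.

(** The principal branch, meaningful for [Re z > 0] only. There the argument stays strictly within
    [pi / 2], so that the imaginary parts in a product of two, or even three, factors cannot differ
    by a full period. *)
Definition clog (z : C) : C := ln (N z) +i* atan (Im z / Re z).

Lemma cexp_clog z : 0 < Re z -> cexp (clog z) = z.
Proof.
move=> z0; have n0 : 0 < nsq z by rewrite ltr_pwDl ?exprn_gt0 ?sqr_ge0.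
have N0 : 0 < N z by rewrite normcE sqrtr_gt0.
have co : cos (atan (Im z / Re z)) = Re z / N z.
  rewrite cos_atan -[RHS]invrK invf_div; congr _^-1.
  have -> : 1 + (Im z / Re z) ^+ 2 = nsq z / Re z ^+ 2 by rewrite /nsq; field; rewrite gt_eqF.
  rewrite sqrtrM ?nsq_ge0// sqrtrV ?sqr_ge0// sqrtr_sqr gtr0_norm//.
  by rewrite normcE.
have si : sin (atan (Im z / Re z)) = Im z / N z.
  have := atanK (Im z / Re z); rewrite /tan co => h.
  have q0 : Re z / N z != 0 by rewrite mulf_neq0 ?invr_eq0 ?gt_eqF.
  by rewrite -[LHS](divfK q0) h; field; rewrite !gt_eqF.
by apply: eqC; rewrite /cexp /clog !cE lnK ?posrE// ?co ?si mulrC divfK// gt_eqF.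
Qed.

Lemma clog_Im z : `|Im (clog z)| < pi / 2.
Proof. by rewrite ltr_norml /= atan_gtNpi2 atan_ltpi2. Qed.

Lemma clogM z w : 0 < Re z -> 0 < Re w -> 0 < Re (z * w) ->
  clog (z * w) = clog z + clog w.
Proof.
move=> z0 w0 zw0; apply: cexp_inj; last by rewrite cexpD !cexp_clog.
have := clog_Im z; have := clog_Im w; have := clog_Im (z * w).
rewrite ImD !ltr_norml => /andP[a1 a2] /andP[b1 b2] /andP[c1 c2].
by have p0 := pi_gt0 R; apply/andP; split; lra.
Qed.

Lemma hol_clog1 : hol clog 1.
Proof.
apply/holP; exists 1 => e e0.
have g0 : 0 < Num.min (e / 12) 1 by rewrite lt_min ltr01 divr_gt0.
have [d1 d10 h1] := is_derive_eps (is_derive1_ln (@ltr01 R)) g0.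
have [d2 d20 h2] := is_derive_eps (is_derive1_atan (0 : R)) g0.
set g := Num.min (e / 12) 1 in g0 h1 h2.
have g1 : g <= e / 12 by rewrite /g ge_min lexx.
have g2 : g <= 1 by rewrite /g ge_min lexx orbT.
exists (Num.min (Num.min (d1 / 4) (d2 / 2)) (Num.min (1 / 2) (e / 12))).
  by rewrite !lt_min !divr_gt0.
move=> h; rewrite !lt_min => /andP[/andP[hd1 hd2] /andP[hd3 hd4]].
have := Re_le_normc h; have := Im_le_normc h.
have n2 := normc_sqr h; rewrite /nsq in n2.
set a := Re h in n2 *; set b := Im h in n2 *; set n := N h in n2 hd1 hd2 hd3 hd4 * => bn an.
have n0 : 0 <= n by exact: normc_ge0.
have [a1 a2] : -n <= a /\ a <= n by move: an; rewrite ler_norml => /andP.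
have nn : n ^+ 2 <= n / 2 by rewrite expr2; apply: ler_wpM2l => //; lra.
have nne : n ^+ 2 <= e / 12 * n by rewrite expr2 ; apply: ler_wpM2r => //; lra.
(* Here [1 + x] is [|1 + h|^2], so that the logarithm of the modulus is half of [ln (1 + x)]. *)
pose x := 2 * a + n ^+ 2.
have nsq0 : 0 <= n ^+ 2 by exact: sqr_ge0.
have xn : `|x| <= 3 * n by rewrite /x ler_norml; apply/andP; split; lra.
pose y := b / (1 + a).
have ap : 2^-1 <= 1 + a by lra.
have ap0 : 0 < 1 + a by lra.
have yb : `|y| <= 2 * n.
  rewrite /y normrM normfV (gtr0_norm ap0) ler_pdivrMr//.
  apply: le_trans bn _; rewrite (_ : 2 * n * (1 + a) = n * (2 * (1 + a))); last by ring.
  by rewrite ler_peMr//; lra.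
have yb2 : `|y - b| <= 2 * n ^+ 2.
  have -> : y - b = - (y * a) by rewrite /y; field; rewrite gt_eqF.
  by rewrite normrN normrM expr2 mulrA; apply: ler_pM; rewrite ?normr_ge0.
have L1 : ln (N (1 + h)) = 2^-1 * ln (1 + x).
  have -> : 1 + x = N (1 + h) ^+ 2.
    by rewrite normc_sqr /nsq !cE -/a -/b /x n2; ring.
  have N1 : 0 < N (1 + h).
    by rewrite normcE sqrtr_gt0 nsq_gt0; apply/eqP => /(congr1 Re); rewrite !cE -/a; lra.
  by rewrite lnXn// mulrnAr -mulr_natl mulrA divff// mul1r.
have {h1} := h1 x; rewrite ln1 subr0 invr1 !mul1r => h1.
have {}h1 : `|ln (1 + x) - x| <= e / 12 * (3 * n).
  apply: le_trans (h1 _) _; first by apply: le_lt_trans xn _; lra.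
  by apply: ler_pM => //; exact: ltW.
have {h2} := h2 y; rewrite atan0 subr0 add0r expr0n addr0 invr1 !mul1r => h2.
have {}h2 : `|atan y - y| <= e / 12 * (2 * n).
  apply: le_trans (h2 _) _; first by apply: le_lt_trans yb _; lra.
  by apply: ler_pM => //; exact: ltW.
apply: le_trans (normc_le _) _.
have -> : clog 1 = 0.
  by rewrite /clog !cE mul0r atan0 (_ : N 1 = 1) ?ln1// normcE /nsq !cE expr1n expr0n addr0 sqrtr1.
have -> : clog (1 + h) - 0 - h = (2^-1 * ln (1 + x) - a) +i* (atan y - b).
  by apply: eqC; rewrite /clog !cE ?L1 subr0 -/a -/b ?add0r.
rewrite !cE.
have p1 : `|2^-1 * ln (1 + x) - a| <= 2^-1 * (e / 12 * (3 * n)) + 2^-1 * (e / 12 * n).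
  have -> : 2^-1 * ln (1 + x) - a = 2^-1 * (ln (1 + x) - x) + 2^-1 * n ^+ 2.
    by rewrite /x; field.
  apply: le_trans (ler_normD _ _) _.
  rewrite (normrM _ (ln (1 + x) - x)) (normrM _ (n ^+ 2)) (ger0_norm nsq0).
  by rewrite gtr0_norm ?invr_gt0//; lra.
have p2 : `|atan y - b| <= e / 12 * (2 * n) + 2 * (e / 12 * n).
  have -> : atan y - b = (atan y - y) + (y - b) by ring.
  by apply: le_trans (ler_normD _ _) _; lra.
apply: le_trans (lerD p1 p2) _; have : 0 <= e * n by apply: mulr_ge0 => //; exact: ltW.
by lra.
Qed.

(** Near [z] one has [clog w = clog z + clog (z^-1 * w)], and [z^-1 * w] is near 1, where
    differentiability is known. *)
Lemma hol_clog z : 0 < Re z -> hol clog z.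
Proof.
move=> z0; have z1 : z != 0 by apply/eqP => e; move: z0; rewrite e ltxx.
apply: (@hol_ext _ (fun w => clog z + clog (z^-1 * w))).
  have [d d0 hd] : exists2 d : R, 0 < d & forall t, N (t - z) < d ->
      0 < Re t /\ 0 < Re (z^-1 * t).
    have Nz : 0 < N z by rewrite normcE sqrtr_gt0 nsq_gt0.
    exists (Num.min (Re z) (N z)); first by rewrite lt_min z0.
    move=> t; rewrite lt_min => /andP[h1 h2]; split.
      have := le_lt_trans (Re_le_normc _) h1; rewrite !cE ltr_norml => /andP[]; lra.
    have -> : z^-1 * t = 1 + z^-1 * (t - z) by rewrite mulrBr mulVf// addrC subrK.
    have : `|Re (z^-1 * (t - z))| < 1.
      apply: le_lt_trans (Re_le_normc _) _.
      by rewrite Normc.normcM Normc.normcV mulrC ltr_pdivrMr// mul1r.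
    by rewrite ReD Re1 ltr_norml => /andP[]; lra.
  apply/nearP; exists d => // t /hd[t1 t2].
  by rewrite -clogM// mulrA divff ?mul1r.
apply: hol_D; first exact: hol_cst.
apply: (@hol_comp _ clog (fun w => z^-1 * w)).
  by apply: hol_M; [exact: hol_cst|exact: hol_id].
by rewrite mulVf//; exact: hol_clog1.
Qed.

Definition cpow (a : R) (z : C) : C := cexp (a%:C * clog z).

Lemma cpowM a z w : 0 < Re z -> 0 < Re w -> 0 < Re (z * w) ->
  cpow a (z * w) = cpow a z * cpow a w.
Proof. by move=> *; rewrite /cpow clogM// mulrDr cexpD. Qed.

Lemma cpow_neq0 a z : cpow a z != 0. Proof. exact: cexp_neq0. Qed.

Lemma nsq_cpow a z : 0 < Re z -> nsq (cpow a z) = nsq z `^ a.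
Proof.
move=> z0; have n0 : 0 < nsq z by rewrite ltr_pwDl ?exprn_gt0 ?sqr_ge0.
have N0 : 0 < N z by rewrite normcE sqrtr_gt0.
rewrite nsq_cexp /clog !cE mul0r subr0 -normc_sqr /powR gt_eqF ?exprn_gt0//.
by rewrite lnXn// -expRM_natl; congr expR; rewrite mulr_natl mulrnAr.
Qed.

Lemma hol_cpow a z : 0 < Re z -> hol (cpow a) z.
Proof.
move=> z0; apply: (@hol_comp _ cexp (fun w => a%:C * clog w)).
  by apply: hol_M; [exact: hol_cst|exact: hol_clog].
exact: hol_cexp.
Qed.

Lemma cpow_real a (x : R) : 0 < x -> cpow a x%:C = (x `^ a)%:C.
Proof.
move=> x0; rewrite /cpow /clog !cE mul0r atan0.
have -> : N x%:C = x by rewrite normcE nsqR sqrtr_sqr gtr0_norm.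
have -> : a%:C * (ln x +i* 0) = (a * ln x)%:C by apply: eqC; rewrite !cE; ring.
by apply: eqC; rewrite /cexp !cE ?cos0 ?sin0 ?mulr0 ?mulr1// /powR gt_eqF.
Qed.

End ExpLog.

(** * Goursat and the mean value property *)

Section IntervalIntegral.
Variable R : realType.
Local Notation mu := (@lebesgue_measure R).
Implicit Types (f g : R -> R) (a b c d m : R).

Definition RI f a b : R := \int[mu]_(x in `[a, b]) f x.

Definition conton f a b := forall x, a <= x <= b -> {for x, continuous f}.

Lemma conton_integrable f a b : conton f a b ->
  mu.-integrable `[a, b] (EFin \o f).
Proof.
move=> cf; apply: continuous_compact_integrable; first exact: segment_compact.
apply: continuous_in_subspaceT => x; rewrite inE/= in_itv/=; exact: cf.
Qed.

Lemma RI_D f g a b : conton f a b -> conton g a b ->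
  RI (fun x => f x + g x) a b = RI f a b + RI g a b.
Proof. by move=> cf cg; rewrite /RI RintegralD//; exact: conton_integrable. Qed.

Lemma conton_B f g a b : conton f a b -> conton g a b ->
  conton (fun x => f x - g x) a b.
Proof. by move=> cf cg x xab; apply: (@cvgB _ R^o); [exact: cf|exact: cg]. Qed.

Lemma conton_sub f a b c d : a <= c -> d <= b -> conton f a b -> conton f c d.
Proof.
move=> ac db cf x /andP[cx xd]; apply: cf.
by rewrite (le_trans ac)//= (le_trans xd).
Qed.

Lemma RI_split f a m b : a <= m <= b -> conton f a b ->
  RI f a b = RI f a m + RI f m b.
Proof.
move=> /andP[am mb] cf; have itf := conton_integrable cf.
have := @Rintegral_itvB _ f (BLeft a) (BRight b) m itf.
rewrite !bnd_simp => /(_ am mb) e.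
have e2 : RI f m b = \int[mu]_(t in `]m, b]) f t.
  rewrite /RI -Rintegral_itv_obnd_cbnd//.
  by apply: integrableS itf => //; apply: subset_itvr; rewrite bnd_simp.
by rewrite e2 -e /RI; ring.
Qed.

Lemma RI_bound f a b k M : a <= b -> conton f a b ->
  (forall x, a <= x <= b -> `|f x - k| <= M) ->
  `|RI f a b - k * (b - a)| <= M * (b - a).
Proof.
move=> ab cf fk.
have cst r : RI (fun=> r) a b = r * (b - a).
  rewrite /RI Rintegral_cst//= lebesgue_measure_itv/= lte_fin.
  case: ltP => //= ba; have -> : b = a by apply/eqP; rewrite eq_le ab ba.
  by rewrite subrr.
have ck r : conton (fun=> r) a b by move=> x _; exact: cst_continuous.
have mono f1 f2 : conton f1 a b -> conton f2 a b ->
    (forall x, a <= x <= b -> f1 x <= f2 x) -> RI f1 a b <= RI f2 a b.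
  move=> c1 c2 h; apply: le_Rintegral.
  - by [].
  - exact: conton_integrable.
  - exact: conton_integrable.
  - by move=> x; rewrite /= in_itv/=; exact: h.
have h1 : RI f a b <= (k + M) * (b - a).
  rewrite -cst; apply: mono => // x /fk; rewrite ler_norml => /andP[]; lra.
have h2 : (k - M) * (b - a) <= RI f a b.
  rewrite -cst; apply: mono => // x /fk; rewrite ler_norml => /andP[]; lra.
by rewrite ler_norml; apply/andP; split; lra.
Qed.

Lemma contP f (x : R) : {for x, continuous f} <-> forall e, 0 < e ->
  exists2 d, 0 < d & forall y, `|y - x| < d -> `|f y - f x| <= e.
Proof.
split=> [cf e e0|H].
  have /cvgrPdist_le/(_ e e0) := cf; move=> /nbhs_ballP[d /= d0 hd]; exists d => // y yd.
  by rewrite distrC; apply: hd; rewrite -ball_normE/= distrC.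
apply/cvgrPdist_le => e e0; have [d d0 hd] := H e e0.
apply/nbhs_ballP; exists d => // y; rewrite /= distrC => /hd.
by rewrite distrC.
Qed.

End IntervalIntegral.

Section Goursat.
Lemma abs_between (K : realFieldType) (a p x y : K) :
  a <= x <= a + p -> a <= y <= a + p -> `|x - y| <= p.
Proof. by move=> /andP[? ?] /andP[? ?]; rewrite ler_norml; apply/andP; split; lra. Qed.

Lemma abs_sub_close (K : realFieldType) (x y z t k e : K) :
  `|x - z - t| <= e -> `|y - z - k| <= e -> `|x - y - (t - k)| <= 2 * e.
Proof.
move=> h1 h2; rewrite (_ : _ - _ = (x - z - t) - (y - z - k)); last by ring.
by apply: le_trans (ler_normB _ _) _; lra.
Qed.

Variable R : realType.
Variables (u v : R -> R -> R).

(** Real differentiability of [(u, v)] at one point, with derivative the multiplication by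
    [l + i m]. No continuity of the derivative is asked, which is why the rectangle theorem goes
    through bisection. *)
Definition CR x y := exists l m, forall e, 0 < e -> exists2 d, 0 < d &
  forall x' y', `|x' - x| < d -> `|y' - y| < d ->
  `|u x' y' - u x y - (l * (x' - x) - m * (y' - y))| <= e * (`|x' - x| + `|y' - y|) /\
  `|v x' y' - v x y - (m * (x' - x) + l * (y' - y))| <= e * (`|x' - x| + `|y' - y|).

Lemma CR_cont x y : CR x y -> [/\ {for y, continuous (u x)},
  {for x, continuous (u^~ y)}, {for y, continuous (v x)} & {for x, continuous (v^~ y)}].
Proof.
move=> [l [m H]]; have [d d0 hd] := H _ ltr01.
have P : 0 < 1 + `|l| + `|m| by rewrite -addrA ltr_pwDl// addr_ge0.
have d1 e : 0 < e -> 0 < Num.min d (e / (1 + `|l| + `|m|)).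
  by move=> e0; rewrite lt_min d0 divr_gt0.
have est e z : `|z| < Num.min d (e / (1 + `|l| + `|m|)) ->
    [/\ `|z| < d, `|z| + `|l| * `|z| <= e & `|z| + `|m| * `|z| <= e].
  rewrite lt_min => /andP[zd]; rewrite ltr_pdivlMr// => h.
  have zl : 0 <= `|l| * `|z| by rewrite mulr_ge0.
  have zm : 0 <= `|m| * `|z| by rewrite mulr_ge0.
  by split => //; lra.
have nn (A B k : R) : `|A - B| <= k -> `|A| <= k + `|B|.
  by have := ler_normD (A - B) B; rewrite subrK; lra.
have nM := normrM.
split; apply/contP => e e0; exists (Num.min d (e / (1 + `|l| + `|m|))); try exact: d1;
  move=> z /est[zd zl zm].
- have [||+ _] := hd x z; rewrite ?subrr ?normr0// => /nn h; apply: le_trans h _.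
  by rewrite !mulr0 add0r mul1r sub0r normrN nM.
- have [||+ _] := hd z y; rewrite ?subrr ?normr0// => /nn h; apply: le_trans h _.
  by rewrite !mulr0 addr0 mul1r subr0 nM.
- have [||_] := hd x z; rewrite ?subrr ?normr0// => /nn h; apply: le_trans h _.
  by rewrite !mulr0 !add0r mul1r nM.
- have [||_] := hd z y; rewrite ?subrr ?normr0// => /nn h; apply: le_trans h _.
  by rewrite !mulr0 !addr0 mul1r nM.
Qed.

Variables (a0 b0 c0 d0 : R).
Hypothesis ab0 : a0 <= b0.
Hypothesis cd0 : c0 <= d0.
Hypothesis HCR : forall x y, a0 <= x <= b0 -> c0 <= y <= d0 -> CR x y.

(** The imaginary part of the contour integral of [u + i v] around the rectangle. *)
Definition bdry a b c d :=
  RI (fun y => u b y - u a y) c d + RI (fun x => v x c - v x d) a b.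

Let cu x : a0 <= x <= b0 -> conton (u x) c0 d0.
Proof. by move=> hx y hy; have [] := CR_cont (HCR hx hy). Qed.

Let cv y : c0 <= y <= d0 -> conton (v^~ y) a0 b0.
Proof. by move=> hy x hx; have [] := CR_cont (HCR hx hy). Qed.

Let inside a b c d := [/\ a0 <= a, a <= b, b <= b0, c0 <= c & c <= d /\ d <= d0].

Let cuu a b c d x x' : inside a b c d -> a <= x <= b -> a <= x' <= b ->
  conton (fun y => u x y - u x' y) c d.
Proof.
move=> [h1 h2 h3 h4 [h5 h6]] /andP[? ?] /andP[? ?].
by apply: (conton_sub h4 h6); apply: conton_B; apply: cu; apply/andP; split; lra.
Qed.

Let cvv a b c d y y' : inside a b c d -> c <= y <= d -> c <= y' <= d ->
  conton (fun x => v x y - v x y') a b.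
Proof.
move=> [h1 h2 h3 h4 [h5 h6]] /andP[? ?] /andP[? ?].
by apply: (conton_sub h1 h3); apply: conton_B; apply: cv; apply/andP; split; lra.
Qed.

Lemma bdry_splitx a m b c d : inside a b c d -> a <= m <= b ->
  bdry a b c d = bdry a m c d + bdry m b c d.
Proof.
move=> ins mab; have [h1 h2 h3 h4 [h5 h6]] := ins.
rewrite /bdry (RI_split mab); last by apply: (cvv ins); rewrite ?lexx ?h5.
have -> : RI (fun y => u b y - u a y) c d =
    RI (fun y => u m y - u a y) c d + RI (fun y => u b y - u m y) c d.
  rewrite -RI_D; last 2 first.
  - by apply: (cuu ins) => //; rewrite lexx.
  - by apply: (cuu ins) => //; rewrite lexx h2.
  by congr RI; apply/funext => y; ring.
ring.
Qed.

Lemma bdry_splity a b c m d : inside a b c d -> c <= m <= d ->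
  bdry a b c d = bdry a b c m + bdry a b m d.
Proof.
move=> ins mcd; have [h1 h2 h3 h4 [h5 h6]] := ins.
rewrite /bdry (RI_split mcd); last by apply: (cuu ins); rewrite ?lexx ?h2.
have -> : RI (fun x => v x c - v x d) a b =
    RI (fun x => v x c - v x m) a b + RI (fun x => v x m - v x d) a b.
  rewrite -RI_D; last 2 first.
  - by apply: (cvv ins) => //; rewrite lexx.
  - by apply: (cvv ins) => //; rewrite lexx h5.
  by congr RI; apply/funext => y; ring.
ring.
Qed.

Let sq a c p q := bdry a (a + p) c (c + q).

(** The boundary terms of the four quarters add up to that of the rectangle, so one of them carries
    at least a quarter of its absolute value. *)
Lemma bdry_quarter a c p q : 0 <= p -> 0 <= q -> inside a (a + p) c (c + q) ->
  exists a' c', [/\ a <= a', a' + p / 2 <= a + p, c <= c', c' + q / 2 <= c + q &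
    `|sq a c p q| <= 4 * `|sq a' c' (p / 2) (q / 2)|].
Proof.
move=> p0 q0 ins; have [h1 h2 h3 h4 [h5 h6]] := ins.
have e : sq a c p q = sq a c (p / 2) (q / 2) + sq a (c + q / 2) (p / 2) (q / 2) +
   (sq (a + p / 2) c (p / 2) (q / 2) + sq (a + p / 2) (c + q / 2) (p / 2) (q / 2)).
  rewrite /sq.
  have -> : a + p / 2 + p / 2 = a + p by field.
  have -> : c + q / 2 + q / 2 = c + q by field.
  rewrite (@bdry_splitx a (a + p / 2)) //; last by apply/andP; split; lra.
  rewrite (@bdry_splity a _ c (c + q / 2)); last 2 first.
  - by split; [| | | |split]; lra.
  - by apply/andP; split; lra.
  rewrite (@bdry_splity (a + p / 2) _ c (c + q / 2)) //; last by apply/andP; split; lra.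
  by split; [| | | |split]; lra.
have [/andP[x1 /andP[x2 x3]]|] := boolP
  [&& 4 * `|sq a c (p / 2) (q / 2)| < `|sq a c p q|,
      4 * `|sq a (c + q / 2) (p / 2) (q / 2)| < `|sq a c p q| &
      4 * `|sq (a + p / 2) c (p / 2) (q / 2)| < `|sq a c p q|].
  exists (a + p / 2), (c + q / 2); split; try lra.
  rewrite leNgt; apply/negP => x4.
  have := ler_normD (sq a c (p / 2) (q / 2) + sq a (c + q / 2) (p / 2) (q / 2))
   (sq (a + p / 2) c (p / 2) (q / 2) + sq (a + p / 2) (c + q / 2) (p / 2) (q / 2)).
  rewrite -e; have := ler_normD (sq a c (p / 2) (q / 2)) (sq a (c + q / 2) (p / 2) (q / 2)).
  have := ler_normD (sq (a + p / 2) c (p / 2) (q / 2)) (sq (a + p / 2) (c + q / 2) (p / 2) (q / 2)).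
  lra.
rewrite !negb_and -!leNgt => /or3P[x|x|x].
- by exists a, c; split => //; lra.
- by exists a, (c + q / 2); split => //; lra.
- by exists (a + p / 2), c; split => //; lra.
Qed.

(** Bisection. The rectangles of step [n] shrink to one point, where the affine approximation has
    zero boundary term, while the error is [e] times the squared size, that is [4^-n], which the
    lost factor [4^n] exactly compensates. *)
Theorem goursat : bdry a0 b0 c0 d0 = 0.
Proof.
set w := b0 - a0; set h := d0 - c0.
have w0 : 0 <= w by rewrite subr_ge0.
have h0 : 0 <= h by rewrite subr_ge0.
pose p n := w / 2 ^+ n; pose q n := h / 2 ^+ n.
have p0 n : 0 <= p n by rewrite divr_ge0// exprn_ge0.
have q0 n : 0 <= q n by rewrite divr_ge0// exprn_ge0.
have pS n : p n.+1 = p n / 2.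
  by rewrite /p exprSr invfM mulrA.
have qS n : q n.+1 = q n / 2.
  by rewrite /q exprSr invfM mulrA.
pose K := `|bdry a0 b0 c0 d0|.
pose inv n (s : R * R) := [/\ a0 <= s.1, s.1 + p n <= b0, c0 <= s.2, s.2 + q n <= d0 &
  K <= 4 ^+ n * `|sq s.1 s.2 (p n) (q n)|].
pose nest n (s t : R * R) := [/\ s.1 <= t.1, t.1 + p n.+1 <= s.1 + p n,
  s.2 <= t.2 & t.2 + q n.+1 <= s.2 + q n].
have step n s : inv n s -> {t | inv n.+1 t /\ nest n s t}.
  move=> [i1 i2 i3 i4 i5]; apply: cid.
  have pn := p0 n; have qn := q0 n.
  have [|a' [c' [j1 j2 j3 j4 j5]]] := @bdry_quarter s.1 s.2 (p n) (q n) pn qn.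
    by split; [| | | |split]; lra.
  exists (a', c'); split; last by split => //=; rewrite ?pS ?qS.
  split => /=; rewrite ?pS ?qS; try lra.
  apply: le_trans i5 _; rewrite exprSr -mulrA ler_wpM2l// exprn_ge0//.
(* Dependent choice: the pair of a step and an admissible corner, with its invariant, is iterated as
   a single object. *)
pose X : Type := {ns : nat * (R * R) | inv ns.1 ns.2}.
pose rel (x y : X) := (sval y).1 = (sval x).1.+1 /\ nest (sval x).1 (sval x).2 (sval y).2.
have relE x : {y | rel x y}.
  case: x => -[n s] /= i; have [t [it nt]] := step n s i.
  by exists (exist _ (n.+1, t) it).
have i00 : inv 0 (a0, c0).
  rewrite /inv/= /sq /p /q expr0 !divr1 /w /h !subrKC mul1r; split => //.
have [f f0 fS] : exists2 f : nat -> X, (sval (f 0%N)).1 = 0%N & forall n, rel (f n) (f n.+1).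
  exists (fun n => iter n (fun x => sval (relE x)) (exist _ (0%N, (a0, c0)) i00)) => //.
  by move=> n; exact: (svalP (relE _)).
have fn n : (sval (f n)).1 = n.
  by elim: n => [|n ih]; [rewrite f0|have [-> _] := fS n; rewrite ih].
pose A n := (sval (f n)).2.1; pose B n := (sval (f n)).2.2.
have invn n : inv n (A n, B n).
  by have := svalP (f n); rewrite fn /A /B; case: (sval (f n)).2.
have nestn n : nest n (A n, B n) (A n.+1, B n.+1).
  by have [_] := fS n; rewrite fn /A /B; case: (sval (f n)).2 => ? ?; case: (sval (f n.+1)).2.
have mono n k : [/\ A n <= A (n + k)%N, A (n + k)%N + p (n + k)%N <= A n + p n,
    B n <= B (n + k)%N & B (n + k)%N + q (n + k)%N <= B n + q n].
  elim: k => [|k [k1 k2 k3 k4]]; first by rewrite addn0.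
  have [/= n1 n2 n3 n4] := nestn (n + k)%N; rewrite addnS.
  by split; [exact: le_trans n1|exact: le_trans k2|exact: le_trans n3|exact: le_trans k4].
(* The lower left corners increase and each upper right corner bounds them all, so the suprema give
   a point common to all rectangles. *)
pose x0 := sup (range A); pose y0 := sup (range B).
have ubA n : ubound (range A) (A n + p n).
  move=> _ [k _ <-]; have [nk|/ltnW kn] := leqP n k.
    have [_ h1 _ _] := mono n (k - n)%N; rewrite subnKC// in h1.
    by apply: le_trans h1; rewrite lerDl.
  have [h1 _ _ _] := mono k (n - k)%N; rewrite subnKC// in h1.
  by apply: le_trans h1 _; rewrite lerDl.
have ubB n : ubound (range B) (B n + q n).
  move=> _ [k _ <-]; have [nk|/ltnW kn] := leqP n k.
    have [_ _ _ h1] := mono n (k - n)%N; rewrite subnKC// in h1.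
    by apply: le_trans h1; rewrite lerDl.
  have [_ _ h1 _] := mono k (n - k)%N; rewrite subnKC// in h1.
  by apply: le_trans h1 _; rewrite lerDl.
have x0n n : A n <= x0 <= A n + p n.
  apply/andP; split; last by apply: ge_sup (ubA n); exists (A 0), 0.
  by apply: ub_le_sup; [exists (A 0 + p 0); exact: ubA|exists n].
have y0n n : B n <= y0 <= B n + q n.
  apply/andP; split; last by apply: ge_sup (ubB n); exists (B 0), 0.
  by apply: ub_le_sup; [exists (B 0 + q 0); exact: ubB|exists n].
have [l [m Hlm]] : CR x0 y0.
  have [/= i1 i2 i3 i4 _] := invn 0; apply: HCR.
    by have /andP[? ?] := x0n 0; apply/andP; split; lra.
  by have /andP[? ?] := y0n 0; apply/andP; split; lra.
have main e : 0 < e -> K <= e * (2 * (w + h) ^+ 2).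
  move=> e0; have [dl dl0 hd] := Hlm e e0.
  have [n nd] : exists n, w + h < dl * 2 ^+ n.
    have [n hn] : exists n : nat, (w + h) / dl < n%:R.
      exists (Num.truncn ((w + h) / dl)).+1.
      by rewrite truncnS_gt// divr_ge0// ?addr_ge0// ltW.
    exists n; rewrite mulrC -ltr_pdivrMr//; apply: lt_le_trans hn _.
    by rewrite -natrX ler_nat ltnW// ltn_expl.
  have pw : 0 < 2 ^+ n :> R by rewrite exprn_gt0.
  have pqd : p n + q n < dl by rewrite /p /q -mulrDl ltr_pdivrMr.
  have [/= i1 i2 i3 i4 i5] := invn n; have pn := p0 n; have qn := q0 n.
  have /andP[x1 x2] := x0n n; have /andP[y1 y2] := y0n n.
  have ins : inside (A n) (A n + p n) (B n) (B n + q n).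
    by split; [| | | |split] => //; rewrite lerDl.
  have absA x : A n <= x <= A n + p n -> `|x - x0| <= p n.
    by move=> h1; apply: abs_between h1 (x0n n).
  have absB y : B n <= y <= B n + q n -> `|y - y0| <= q n.
    by move=> h1; apply: abs_between h1 (y0n n).
  have An1 : A n <= A n <= A n + p n by rewrite lexx lerDl.
  have An2 : A n <= A n + p n <= A n + p n by rewrite lexx lerDl pn.
  have Bn1 : B n <= B n <= B n + q n by rewrite lexx lerDl.
  have Bn2 : B n <= B n + q n <= B n + q n by rewrite lexx lerDl qn.
  have loc x y : A n <= x <= A n + p n -> B n <= y <= B n + q n ->
     `|u x y - u x0 y0 - (l * (x - x0) - m * (y - y0))| <= e * (p n + q n) /\
     `|v x y - v x0 y0 - (m * (x - x0) + l * (y - y0))| <= e * (p n + q n).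
    move=> /absA hx /absB hy; have [||g1 g2] := hd x y.
    - by apply: le_lt_trans hx _; apply: le_lt_trans pqd; rewrite lerDl.
    - by apply: le_lt_trans hy _; apply: le_lt_trans pqd; rewrite lerDr.
    by split; [apply: le_trans g1 _|apply: le_trans g2 _];
      apply: ler_wpM2l; rewrite ?(ltW e0)//; exact: lerD.
  have I1 := @RI_bound _ (fun y => u (A n + p n) y - u (A n) y) (B n) (B n + q n) (l * p n)
    (2 * (e * (p n + q n))) _ (cuu ins An2 An1) _.
  have I2 := @RI_bound _ (fun x => v x (B n) - v x (B n + q n)) (A n) (A n + p n) (- (l * q n))
    (2 * (e * (p n + q n))) _ (cvv ins Bn1 Bn2) _.
  have {}I1 : `|RI (fun y => u (A n + p n) y - u (A n) y) (B n) (B n + q n) - l * p n * q n|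
      <= 2 * (e * (p n + q n)) * q n.
    move: I1; rewrite (_ : B n + q n - B n = q n); last by ring.
    apply; first by rewrite lerDl.
    move=> y hy; have [k1 _] := loc _ _ An2 hy; have [k2 _] := loc _ _ An1 hy.
    have := abs_sub_close k1 k2; congr (`|_ - _| <= _); ring.
  have {}I2 : `|RI (fun x => v x (B n) - v x (B n + q n)) (A n) (A n + p n) + l * q n * p n|
      <= 2 * (e * (p n + q n)) * p n.
    move: I2; rewrite (_ : A n + p n - A n = p n); last by ring.
    rewrite mulNr !opprK; apply; first by rewrite lerDl.
    move=> x hx; have [_ k1] := loc _ _ hx Bn1; have [_ k2] := loc _ _ hx Bn2.
    have := abs_sub_close k1 k2; rewrite (_ : _ - _ - _ = v x (B n) - v x (B n + q n) + l * q n) //.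
    by ring.
  (* The linear parts contribute [l p q] on the vertical sides and [- l p q] on the horizontal ones,
     and cancel. *)
  have D : `|sq (A n) (B n) (p n) (q n)| <= 2 * e * (p n + q n) ^+ 2.
    rewrite /sq /bdry (_ : _ + _ =
      (RI (fun y => u (A n + p n) y - u (A n) y) (B n) (B n + q n) - l * p n * q n) +
      (RI (fun x => v x (B n) - v x (B n + q n)) (A n) (A n + p n) + l * q n * p n)); last by ring.
    by apply: le_trans (ler_normD _ _) _; lra.
  apply: le_trans i5 _.
  have e4 : (p n + q n) ^+ 2 = (w + h) ^+ 2 / 4 ^+ n.
    rewrite /p /q -mulrDl exprMn exprVn -exprM mulnC exprM.
    by congr (_ / _ ^+ _); ring.
  rewrite e4 in D; have p4 : 0 < 4 ^+ n :> R by rewrite exprn_gt0.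
  apply: le_trans (ler_wpM2l (ltW p4) D) _; rewrite le_eqVlt; apply/orP; left; apply/eqP.
  by field; rewrite gt_eqF.
apply/eqP; rewrite -normr_eq0 -/K; apply/eqP/le_anti; rewrite normr_ge0 andbT.
apply/ler_addgt0Pl => e e0; rewrite addr0.
have d0' : 0 < 2 * (w + h) ^+ 2 + 1 by rewrite ltr_pwDr// mulr_ge0// sqr_ge0.
apply: le_trans (main (e / (2 * (w + h) ^+ 2 + 1)) _) _; first by rewrite divr_gt0.
by rewrite mulrAC ler_pdivrMr// ler_pM2l// lerDl.
Qed.

End Goursat.

(** * The Cayley transform and the mean value property *)

Section MeanValue.
Variable R : realType.
Local Notation C := R[i].
Local Notation Re := (@complex.Re R).
Local Notation Im := (@complex.Im R).
Local Notation N := (@Normc.normc R).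
Local Notation HP := (@upper_half_plane R).
Local Open Scope complex_scope.

Lemma HPE (w : C) : HP w = (0 < Im w). Proof. by []. Qed.

Definition cI : C := 0 +i* 1.

Definition cayley (w : C) : C := (w - cI) / (w + cI).

Definition cayleyV (t : C) : C := cI * (1 + t) / (1 - t).

Lemma nsq1B_gt0 (t : C) : nsq t < 1 -> 0 < nsq (1 - t).
Proof.
move=> t1; rewrite nsq_gt0 subr_eq0; apply/eqP => e; move: t1.
by rewrite -e /nsq !cE expr1n expr0n addr0 ltxx.
Qed.

Lemma Im_cayleyV t : nsq t < 1 -> Im (cayleyV t) = (1 - nsq t) / nsq (1 - t).
Proof.
move=> t1; have q0 : nsq (1 - t) != 0 by rewrite gt_eqF ?nsq1B_gt0.
rewrite /cayleyV /cI !cE; set q := nsq (1 - t) in q0 *.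
by rewrite /nsq; field.
Qed.

Lemma cayleyV_HP t : nsq t < 1 -> HP (cayleyV t).
Proof. by move=> t1; rewrite HPE Im_cayleyV// divr_gt0 ?nsq1B_gt0// subr_gt0. Qed.

Lemma addI_neq0 (w : C) : HP w -> w + cI != 0.
Proof. by rewrite HPE => w0; apply/eqP => /(congr1 Im); rewrite /cI !cE; lra. Qed.

Lemma cI_neq0 : cI != 0.
Proof. by apply/eqP => /(congr1 Im); rewrite /cI !cE => /eqP; rewrite oner_eq0. Qed.

Lemma cayleyVK t : nsq t < 1 -> cayley (cayleyV t) = t.
Proof.
move=> t1; have h := nsq1B_gt0 t1; rewrite nsq_gt0 in h.
have h2 : cI * (2 / (1 - t)) != 0 by rewrite !mulf_neq0 ?invr_eq0 ?cI_neq0// pnatr_eq0.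
rewrite /cayley /cayleyV.
have -> : cI * (1 + t) / (1 - t) - cI = t * (cI * (2 / (1 - t))) by field.
have -> : cI * (1 + t) / (1 - t) + cI = cI * (2 / (1 - t)) by field.
by rewrite mulfK.
Qed.

Lemma cayleyK w : HP w -> cayleyV (cayley w) = w.
Proof.
move=> /addI_neq0 h; rewrite /cayleyV /cayley.
have h2 : cI * 2 / (w + cI) != 0 by rewrite !mulf_neq0 ?invr_eq0 ?cI_neq0// pnatr_eq0.
have -> : cI * (1 + (w - cI) / (w + cI)) = w * (cI * 2 / (w + cI)) by field.
have -> : 1 - (w - cI) / (w + cI) = cI * 2 / (w + cI) by field.
by rewrite mulfK.
Qed.

Lemma nsq_cayley w : HP w -> nsq (cayley w) < 1.
Proof.
rewrite HPE => w0; have := addI_neq0 w0; rewrite -nsq_gt0 => h.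
rewrite /cayley nsqM nsqV ltr_pdivrMr// mul1r /nsq /cI !cE; nra.
Qed.

Lemma ccont_comp (f h : C -> C) z : ccont f (h z) -> ccont h z -> ccont (f \o h) z.
Proof.
move=> cf ch e e0; have [d d0 hd] := cf e e0.
have [d' d'0 hd'] := ch (d / 2) (divr_gt0 d0 (ltr0n _ 2)).
exists d' => // k /hd' kd /=.
have kd2 : N (h (z + k) - h z) < d by apply: le_lt_trans kd _; lra.
by have := hd _ kd2; rewrite [h z + _]addrC subrK.
Qed.

Lemma cdiff_CR (f : C -> C) x y L : cdiff f (x +i* y) L ->
  CR (fun x y => Re (f (x +i* y))) (fun x y => Im (f (x +i* y))) x y.
Proof.
move=> cL; exists (Re L), (Im L) => e e0; have [d d0 hd] := cL e e0.
exists (d / 2); first by rewrite divr_gt0.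
move=> x' y' hx hy; pose h : C := (x' - x) +i* (y' - y).
have hN : N h <= `|x' - x| + `|y' - y| by exact: normc_le.
have {hd} := hd h (le_lt_trans hN _).
have -> : (x +i* y) + h = x' +i* y' by apply: eqC; rewrite !cE; ring.
move=> /(_ _)H; have {}H := H ltac:(lra).
have {}H : N (f (x' +i* y') - f (x +i* y) - L * h) <= e * (`|x' - x| + `|y' - y|).
  by apply: le_trans H _; apply: ler_wpM2l => //; exact: ltW.
split; apply: le_trans H.
  by apply: le_trans (Re_le_normc _); rewrite !cE.
by apply: le_trans (Im_le_normc _); rewrite !cE [Re L * _ + _]addrC.
Qed.

Lemma ccont_x (f : C -> C) x y : ccont f (x +i* y) ->
  {for y, continuous (fun y => Re (f (x +i* y)))}.
Proof.
move=> cf; apply/contP => e /cf[d d0 hd]; exists d => // y' yd.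
have -> : x +i* y' = (x +i* y) + (0 +i* (y' - y)) :> C by apply: eqC; rewrite !cE; ring.
apply: le_trans (hd (0 +i* (y' - y)) _); first by rewrite -ReN -ReD Re_le_normc.
by apply: le_lt_trans (normc_le _) _; rewrite !cE normr0 add0r.
Qed.

Section Circle.
Variables (g : C -> C) (p z0 : C).
Hypothesis gc : forall w, HP w -> ccont g w.
Hypothesis gh : forall w, HP w -> w != p -> hol g w.
Hypothesis z01 : nsq z0 < 1.
Hypothesis z00 : z0 != 0.

(** Logarithmic coordinates in the disc: vertical segments of length [2 pi] are circles about 0, and
    the circle shrinks to the point [i] of the half-plane as [Re t] tends to minus infinity. *)
Let G t := g (cayleyV (cexp t * z0)).

Let nsqt x y : nsq (cexp (x +i* y) * z0) = expR x ^+ 2 * nsq z0.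
Proof. by rewrite nsqM nsq_cexp. Qed.

Let nsqt1 x y : x <= 0 -> nsq (cexp (x +i* y) * z0) < 1.
Proof.
move=> x0; rewrite nsqt; apply: le_lt_trans z01; rewrite ler_piMl ?nsq_ge0//.
by rewrite expr_le1// ?expR_ge0// -expR0 ler_expR.
Qed.

Let hol_arg x y : x <= 0 -> hol (fun t => cayleyV (cexp t * z0)) (x +i* y).
Proof.
move=> x0; have h := nsq1B_gt0 (nsqt1 y x0); rewrite nsq_gt0 in h.
have he : hol (fun t => cexp t * z0) (x +i* y).
  by apply: hol_M; [exact: hol_cexp|exact: hol_cst].
have h1 := @hol_D _ (fun=> 1) _ _ (@hol_cst R 1 _) he.
have h2 : hol (fun t => 1 - cexp t * z0) (x +i* y).
  have -> : (fun t => 1 - cexp t * z0) = (fun t => 1 + (-1) * (cexp t * z0)).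
    by apply/funext => w; rewrite mulN1r.
  exact: (@hol_D _ (fun=> 1) _ _ (@hol_cst R 1 _) (@hol_M _ (fun=> -1) _ _ (@hol_cst R (-1) _) he)).
have h3 := @hol_M _ (fun=> cI) _ _ (@hol_cst R cI _) h1.
exact: (@hol_M _ _ _ _ h3 (@hol_V _ (fun t => 1 - cexp t * z0) _ h h2)).
Qed.

Let Gcont x y : x <= 0 -> ccont G (x +i* y).
Proof.
move=> x0; apply: (@ccont_comp g (fun t => cayleyV (cexp t * z0))).
  by apply: gc; apply: cayleyV_HP; exact: nsqt1.
by apply: hol_ccont; exact: hol_arg.
Qed.

(** The circle of parameter [x] has the radius of the exceptional point. At most one [x] is of this
    kind. *)
Let bad x := nsq (cayley p) = expR x ^+ 2 * nsq z0.

Let Ghol x y : x <= 0 -> ~ bad x -> hol G (x +i* y).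
Proof.
move=> x0 nb; apply: (@hol_comp _ g (fun t => cayleyV (cexp t * z0))).
  exact: hol_arg.
apply: gh; first by apply: cayleyV_HP; exact: nsqt1.
by apply/eqP => e; apply: nb; rewrite /bad -e cayleyVK ?nsqt1// nsqt.
Qed.

Let u x y := Re (G (x +i* y)).
Let v x y := Im (G (x +i* y)).
Let I x := RI (u x) 0 (2 * pi).

Let pi20 : 0 <= 2 * pi :> R.
Proof. by rewrite mulr_ge0// pi_ge0. Qed.

Let cu x a b : x <= 0 -> conton (u x) a b.
Proof. by move=> x0 y _; apply: ccont_x; exact: Gcont. Qed.

Let G2pi x : G (x +i* (2 * pi)) = G (x +i* 0).
Proof.
rewrite /G; congr (g (cayleyV (_ * _))).
by rewrite /cexp !cE mulr_natl cos2pi sin2pi cos0 sin0.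
Qed.

Let RI0 a b : RI (fun=> 0 : R) a b = 0.
Proof. by rewrite /RI Rintegral_cst//= mul0r. Qed.

(** In the rectangle theorem on [[a, b]] by [[0, 2 pi]] the horizontal sides cancel by periodicity,
    which leaves the difference of the two vertical integrals. *)
Let Iconst a b : a <= b -> b <= 0 -> (forall x, a <= x <= b -> ~ bad x) -> I a = I b.
Proof.
move=> ab b0 nb; have := @goursat R u v a b 0 (2 * pi) ab pi20 _.
rewrite /bdry => H.
have {}H : RI (fun y => u b y - u a y) 0 (2 * pi) + RI (fun x => v x 0 - v x (2 * pi)) a b = 0.
  apply: H => x y /[dup] xab /andP[ax xb] _.
  have /holP[L cL] : hol G (x +i* y) by apply: Ghol; [exact: le_trans b0|exact: nb].
  exact: (cdiff_CR cL).
have e2 : RI (fun x => v x 0 - v x (2 * pi)) a b = 0.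
  transitivity (RI (fun=> 0 : R) a b); last exact: RI0.
  by congr RI; apply/funext => x; rewrite /v G2pi subrr.
rewrite e2 addr0 in H.
have a0 : a <= 0 by exact: le_trans b0.
rewrite -[LHS]add0r -H /I -(RI_D (g := u a)); last 2 first.
- by apply: conton_B; exact: cu.
- exact: cu.
by congr RI; apply/funext => y; rewrite subrK.
Qed.

Let Idist x x' e : x <= 0 -> x' <= 0 ->
  (forall y, 0 <= y <= 2 * pi -> `|u x' y - u x y| <= e) ->
  `|I x' - I x| <= e * (2 * pi).
Proof.
move=> x0 x'0 h.
have -> : I x' - I x = RI (fun y => u x' y - u x y) 0 (2 * pi) - 0 * (2 * pi - 0).
  rewrite mul0r subr0; apply: (addIr (I x)); rewrite subrK /I -RI_D; last 2 first.
  - by apply: conton_B; exact: cu.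
  - exact: cu.
  by congr RI; apply/funext => y; rewrite subrK.
rewrite -[X in _ <= e * X]subr0; apply: RI_bound => //.
  by apply: conton_B; exact: cu.
by move=> y hy; rewrite subr0; exact: h.
Qed.

(** Compactness of [[0, 2 pi]] makes the continuity in [x] uniform along the circle. *)
Let Icont x e : x <= 0 -> 0 < e -> exists2 d, 0 < d &
  forall x', x' <= 0 -> `|x' - x| < d -> `|I x' - I x| <= e.
Proof.
move=> x0 e0; have pi0 := pi_gt0 R.
have e2 : 0 < e / (2 * pi) by rewrite divr_gt0// mulr_gt0.
have /compact_near_coveringP/(_ R (nbhs x) (fun x' y => `|u x' y - u x y| <= e / (2 * pi))) :=
  @segment_compact R 0 (2 * pi).
move=> /(_ _ _)H.
have : \forall x' \near nbhs x, `[0, 2 * pi]%classic `<=` (fun y => `|u x' y - u x y| <= e / (2 * pi)).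
  apply: H => y _.
  have [d d0 hd] := Gcont y x0 (divr_gt0 e2 (ltr0n _ 2)).
  exists (ball y (d / 2), ball x (d / 2)) => /=.
    by split; apply/nbhs_ballP; exists (d / 2) => //=; rewrite divr_gt0.
  move=> [y' x'] /= [hy hx]; rewrite /ball/= in hy hx.
  have hh a b : `|x - a| < d / 2 -> `|y - b| < d / 2 ->
      `|u a b - u x y| <= e / (2 * pi) / 2.
    move=> ha hb; have := hd ((a - x) +i* (b - y)).
    have -> : (x +i* y) + ((a - x) +i* (b - y)) = a +i* b by apply: eqC; rewrite !cE; ring.
    move=> hk; have {}hk := hk (le_lt_trans (normc_le _) _).
    apply: le_trans (hk _); first by rewrite /u -ReN -ReD Re_le_normc.
    by rewrite !cE distrC [`|b - y|]distrC; lra.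
  have h1 := hh x' y' hx hy.
  have h2 := hh x y'; rewrite subrr normr0 in h2; have {}h2 := h2 (divr_gt0 d0 (ltr0n _ 2)) hy.
  rewrite (_ : _ - _ = (u x' y' - u x y) - (u x y' - u x y)); last by ring.
  by apply: le_trans (ler_normB _ _) _; lra.
move=> /nbhs_ballP[d /= d0 hd]; exists d => // x' x'0 xd.
have -> : e = e / (2 * pi) * (2 * pi) by rewrite divfK// gt_eqF// mulr_gt0.
apply: Idist => // y hy; apply: (hd x'); first by rewrite /ball/= distrC.
by rewrite /= in_itv.
Qed.

Let bad_uniq x x' : bad x -> bad x' -> x = x'.
Proof.
rewrite /bad => -> /mulIf h; apply: expR_inj; apply/eqP.
by rewrite -(@eqrXn2 _ 2) ?expR_ge0//; apply/eqP/h; rewrite nsq_eq0.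
Qed.

(** The circular integral is constant on each side of the bad radius, and its continuity there glues
    the two constants: mere continuity at the exceptional point is enough. *)
Let Iall x : x <= 0 -> I x = I 0.
Proof.
move=> x0; have [[b [xb b0 hb]]|nb] := pselect (exists b, [/\ x <= b, b <= 0 & bad b]); last first.
  by apply: Iconst => // y /andP[xy y0] hy; apply: nb; exists y.
have close y : y <= 0 -> x <= y -> I y = I b.
  move=> y0 xy; apply/eqP; rewrite -subr_eq0 -normr_le0; apply/ler_addgt0Pl => e e0.
  rewrite addr0; have [d d0 hd] := Icont b0 e0.
  have [yb|by_|->] := ltgtP y b; last by rewrite subrr normr0 ltW.
  (* A parameter between [y] and [b], close to [b] but distinct from it: constancy joins it to [y],
     continuity joins it to [b]. *)
  - pose t := Num.max y (b - d / 2).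
    have [t1 [t2 t3]] : y <= t /\ (t < b /\ `|t - b| < d).
      rewrite /t; case: (leP y (b - d / 2)) => h; split; rewrite ?lexx//; split => //; try lra.
        by rewrite ltr_norml; apply/andP; split; lra.
      by rewrite ltr_norml; apply/andP; split; lra.
    rewrite (@Iconst y t)//; last 2 first.
    + by apply: ltW; exact: lt_le_trans b0.
    + by move=> k /andP[_ kt] /(bad_uniq hb) kb; move: kt; rewrite -kb leNgt t2.
    by apply: hd => //; apply: ltW; exact: lt_le_trans b0.
  - pose t := Num.min y (b + d / 2).
    have [t1 [t2 t3]] : t <= y /\ (b < t /\ `|t - b| < d).
      rewrite /t; case: (leP y (b + d / 2)) => h; split; rewrite ?lexx//; try lra; split => //; try lra.
        by rewrite ltr_norml; apply/andP; split; lra.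
      by rewrite ltr_norml; apply/andP; split; lra.
    rewrite -(@Iconst t y)//; last first.
      by move=> k /andP[tk _] /(bad_uniq hb) kb; move: tk; rewrite -kb leNgt t2.
    by apply: hd => //; exact: le_trans y0.
by rewrite (close x x0 (lexx _)) (close 0 (lexx _) x0).
Qed.

Let Ilim e : 0 < e -> exists2 x, x <= 0 & `|I x - Re (g cI) * (2 * pi)| <= e * (2 * pi).
Proof.
move=> e0; have iHP : HP cI by rewrite HPE /cI /= ltr01.
have [d d0 hd] := gc iHP e0.
have m0 : 0 < Num.min (d / 4) (1 / 2) by rewrite lt_min !divr_gt0.
pose r := Num.min (d / 4) (1 / 2).
have rd : r <= d / 4 by rewrite /r ge_min lexx.
have r2 : r <= 1 / 2 by rewrite /r ge_min lexx orbT.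
pose x := ln (r / 2); have x0 : x <= 0 by apply: ln_le0; lra.
exists x => //.
have := @RI_bound R (u x) 0 (2 * pi) (Re (g cI)) e pi20 (cu x0) _.
rewrite subr0; apply => y _.
pose t := cexp (x +i* y) * z0.
have tn : N t < r.
  have -> : N t = expR x * N z0.
    by rewrite /t Normc.normcM; congr (_ * _); rewrite normcE nsq_cexp sqrtr_sqr ger0_norm// expR_ge0.
  have : expR x = r / 2 by rewrite lnK// posrE divr_gt0.
  move=> ->; have z1 : N z0 <= 1 by rewrite normcE -[leRHS]sqrtr1 ler_wsqrtr// ltW.
  have := ler_piMr (ltW (divr_gt0 m0 (ltr0n _ 2))) z1; rewrite -/r in m0 *; lra.
have t1 : 1 - t != 0.
  apply/eqP => /(congr1 Re); have := le_lt_trans (Re_le_normc t) tn.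
  by rewrite ltr_norml !cE => /andP[] *; lra.
have Nt : 1 / 2 <= N (1 - t).
  have := Re_le_normc (1 - t); have := le_lt_trans (Re_le_normc t) tn.
  rewrite ltr_norml => /andP[_ h]; apply: le_trans.
  have e1 : Re (1 - t) = 1 - Re t by rewrite ReD ReN.
  by rewrite e1; have := ler_norm (1 - Re t); lra.
have Nt0 : 0 < N (1 - t) by apply: lt_le_trans Nt; lra.
have -> : u x y = Re (g (cI + cI * 2 * t / (1 - t))).
  by rewrite /u /G -/t; congr (Re (g _)); rewrite /cayleyV; field.
rewrite -ReN -ReD; apply: le_trans (Re_le_normc _) _; apply: hd.
rewrite !Normc.normcM Normc.normcV.
have -> : N cI = 1 by rewrite normcE /nsq /cI !cE expr0n expr1n add0r sqrtr1.
have -> : N 2 = 2.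
  rewrite normcE (_ : nsq 2 = 2 ^+ 2); first by rewrite sqrtr_sqr ger0_norm.
  by rewrite -[X in nsq X]/(1 + 1 : C) /nsq !cE; ring.
rewrite mul1r ltr_pdivrMr// -(Normc.normcM (cexp _)) -/t.
by have := ler_wpM2l (ltW d0) Nt; lra.
Qed.

Lemma mean_value_cayley : RI (fun y => Re (g (cayleyV (cexp (0 +i* y) * z0)))) 0 (2 * pi) =
  Re (g cI) * (2 * pi).
Proof.
apply/eqP; rewrite -subr_eq0 -normr_le0; apply/ler_addgt0Pl => e e0; rewrite addr0.
have pi0 : 0 < 2 * pi :> R by rewrite mulr_gt0// pi_gt0.
have [x x0] := Ilim (divr_gt0 e0 pi0).
by rewrite (Iall x0) divfK// gt_eqF.
Qed.

Lemma mean_value_int :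
  (\int[@lebesgue_measure R]_(y in `[0%R, (2 * pi)%R])
     (Re (g (cayleyV (cexp (0 +i* y) * z0))))%:E)%E = (Re (g cI) * (2 * pi))%:E.
Proof.
rewrite -mean_value_cayley /RI /Rintegral fineK//.
by apply: integrable_fin_num => //; apply: conton_integrable; exact: cu.
Qed.

End Circle.
End MeanValue.

(** * Signed hyperbolic integrals *)

Section SignedIntegral.
Variable R : realType.
Local Notation m2 := (@lebesgue_measure R \x @lebesgue_measure R)%E.
Local Notation C2 := (@complex_of_pair R).
Local Notation HP := (@upper_half_plane R).
Local Notation UH := (@UH R).
Implicit Types (P Q : R[i] -> R).

Definition hi P := mC P /\ (hint (fun z => `|P z|%R) < +oo)%E.
Definition rint P : R := fine (hint P).

Lemma mC_abs P : mC P -> mC (fun z => `|P z|).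
Proof. by move=> mP; exact: (measurableT_comp (@normr_measurable R setT) mP). Qed.

Lemma mC_weight P : mC P -> measurable_fun UH (fun p => (P (C2 p) * p.2 ^- 2)%:E).
Proof.
move=> mP; apply/measurable_EFinP; apply: measurable_funM; last exact: measurable_invsq.
exact: measurable_funS mP.
Qed.

Lemma hint_mono P Q : mC P -> mC Q -> (forall z, HP z -> 0 <= P z <= Q z) ->
  (hint P <= hint Q)%E.
Proof.
move=> mP mQ h; apply: ge0_le_integral.
- exact: measurable_UH.
- move=> p pU; have /andP[p0 _] := h _ pU.
  by rewrite lee_fin mulr_ge0// invr_ge0 sqr_ge0.
- exact: mC_weight.
- exact: mC_weight.
- move=> p pU; have /andP[_ pq] := h _ pU.
  by rewrite lee_fin ler_wpM2r// invr_ge0 sqr_ge0.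
Qed.

Lemma hint_ge0 P : (forall z, HP z -> 0 <= P z) -> (0 <= hint P)%E.
Proof.
by move=> h; apply: integral_ge0 => p pU; rewrite lee_fin mulr_ge0 ?h// invr_ge0 sqr_ge0.
Qed.

Lemma hi_integrable P : hi P -> m2.-integrable UH (fun p => (P (C2 p) * p.2 ^- 2)%:E).
Proof.
move=> [mP hP]; apply/integrableP; split; first exact: mC_weight.
apply: le_lt_trans hP; rewrite le_eqVlt; apply/orP; left; apply/eqP.
apply: eq_integral => p _; rewrite abse_EFin normrM; congr (_ * _)%:E.
by rewrite ger0_norm// invr_ge0 sqr_ge0.
Qed.

Lemma rintK P : hi P -> (rint P)%:E = hint P.
Proof.
move=> hP; rewrite /rint fineK//; apply: integrable_fin_num; first exact: measurable_UH.
exact: hi_integrable.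
Qed.

Lemma hi_dom P Q : mC P -> mC Q -> (hint Q < +oo)%E ->
  (forall z, HP z -> `|P z| <= Q z) -> hi P.
Proof.
move=> mP mQ hQ h; split => //; apply: le_lt_trans hQ.
apply: hint_mono => //; first exact: mC_abs.
by move=> z /h ->; rewrite normr_ge0.
Qed.

Lemma hi_ge0 P : mC P -> (forall z, HP z -> 0 <= P z) -> (hint P < +oo)%E -> hi P.
Proof. by move=> mP P0 h; apply: (hi_dom mP mP h) => z /P0; move/ger0_norm ->. Qed.

Lemma hi_Z k P : hi P -> hi (fun z => k * P z).
Proof.
move=> hP; split; first by apply: mC_M => //; [exact: mC_cst|exact: hP.1].
have /integrableP[_] : m2.-integrable UH (fun p => k%:E * (P (C2 p) * p.2 ^- 2)%R%:E)%E.
  by apply: integrableZl; [exact: measurable_UH|exact: hi_integrable].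
 apply: le_lt_trans; rewrite le_eqVlt; apply/orP; left; apply/eqP.
apply: eq_integral => p _; rewrite abseM !abse_EFin !normrM -EFinM mulrA; congr (_ * _)%:E.
by rewrite [in RHS]ger0_norm// invr_ge0 sqr_ge0.
Qed.

Lemma rint_Z k P : hi P -> rint (fun z => k * P z) = k * rint P.
Proof.
move=> hP; apply: EFin_inj; rewrite EFinM !rintK//; last exact: hi_Z.
rewrite /hint -integralZl//; [|exact: measurable_UH|exact: hi_integrable].
by apply: eq_integral => p _; rewrite -EFinM mulrA.
Qed.

Lemma hi_D P Q : hi P -> hi Q -> hi (fun z => P z + Q z).
Proof.
move=> hP hQ; split; first by apply: mC_D; [exact: hP.1|exact: hQ.1].
have /integrableP[_] : m2.-integrable UH
    ((fun p => (P (C2 p) * p.2 ^- 2)%R%:E) \+ (fun p => (Q (C2 p) * p.2 ^- 2)%R%:E))%E.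
  by apply: integrableD; [exact: measurable_UH|exact: hi_integrable|exact: hi_integrable].
 apply: le_lt_trans; rewrite le_eqVlt; apply/orP; left; apply/eqP.
apply: eq_integral => p _ /=; rewrite -mulrDl normrM; congr (_ * _)%:E.
by rewrite [in RHS]ger0_norm// invr_ge0 sqr_ge0.
Qed.

Lemma rint_D P Q : hi P -> hi Q -> rint (fun z => P z + Q z) = rint P + rint Q.
Proof.
move=> hP hQ; apply: EFin_inj; rewrite EFinD !rintK//; last exact: hi_D.
rewrite /hint -integralD_EFin//; [|exact: measurable_UH|exact: hi_integrable|exact: hi_integrable].
by apply: eq_integral => p _ /=; rewrite mulrDl.
Qed.

Lemma eq_hi P Q : (forall z, HP z -> P z = Q z) -> mC Q -> hi P -> hi Q.
Proof.
move=> e mQ [_ h]; split => //; apply: le_lt_trans h.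
by rewrite le_eqVlt; apply/orP; left; apply/eqP/eq_hint => z /e ->.
Qed.

Lemma eq_rint P Q : (forall z, HP z -> P z = Q z) -> rint P = rint Q.
Proof. by move=> /eq_hint; rewrite /rint => ->. Qed.

Lemma rint_ge0 P : (forall z, HP z -> 0 <= P z) -> 0 <= rint P.
Proof. by move=> /hint_ge0; exact: fine_ge0. Qed.

Lemma rint_le P Q : hi P -> hi Q -> (forall z, HP z -> P z <= Q z) -> rint P <= rint Q.
Proof.
move=> hP hQ h; rewrite -subr_ge0 -mulN1r -rint_Z// -rint_D//; last exact: hi_Z.
by apply: rint_ge0 => z /h; rewrite mulN1r subr_ge0.
Qed.

Lemma hint_parts P : mC P ->
  hint P = (hint (fun z => Num.max (P z) 0)%R - hint (fun z => Num.max (- P z) 0)%R)%E.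
Proof.
move=> mP; rewrite [LHS]integralE; congr (_ - _)%E; apply: eq_integral => p pU.
  by rewrite funeposE -EFin_max maxr_pMl ?mul0r// invr_ge0 sqr_ge0.
by rewrite funenegE -EFinN -EFin_max -mulNr maxr_pMl ?mul0r// invr_ge0 sqr_ge0.
Qed.

Lemma mC_max0 P : mC P -> mC (fun z => Num.max (P z) 0).
Proof. by move=> mP; exact: (@measurable_maxr _ _ _ _ (P \o C2) (cst 0) mP (measurable_cst _)). Qed.

(** Invariance is only known for nonnegative integrands so far; positive and negative parts are
    transported separately. *)
Lemma hint_subst_signed (T : R[i] -> R[i]) :
  (forall Q, mC Q -> (forall z, 0 <= Q z) -> hint (Q \o T) = hint Q) ->
  (forall Q, mC Q -> mC (Q \o T)) -> forall P, mC P -> hint (P \o T) = hint P.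
Proof.
move=> hT mT P mP; rewrite hint_parts; last exact: mT.
rewrite (hT (fun z => Num.max (P z) 0)); last 2 first.
- exact: mC_max0.
- by move=> z; rewrite le_max lexx orbT.
rewrite (hT (fun z => Num.max (- P z) 0)); last 2 first.
- by apply: mC_max0; exact: mC_N.
- by move=> z; rewrite le_max lexx orbT.
by rewrite [RHS]hint_parts.
Qed.

Lemma hint_mobius_signed A P : \det A = 1 -> mC P -> hint (P \o mobius A) = hint P.
Proof.
move=> dA mP; apply: hint_subst_signed => // Q mQ; last exact: mC_mobius.
by move=> Q0; exact: hint_mobius.
Qed.

Lemma hint_affine_signed (a b : R) P : 0 < a -> mC P ->
  hint (fun z => P (a%:C%C * z + b%:C%C)) = hint P.
Proof.
move=> a0 mP; apply: (@hint_subst_signed (fun z => a%:C%C * z + b%:C%C)) => // Q mQ.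
  by move=> Q0; exact: hint_affine.
have [h1 h2] := mCC_D (mCC_M (mCC_cst a%:C%C) (@mCC_id R)) (mCC_cst b%:C%C).
exact: mC_comp.
Qed.

End SignedIntegral.

Section FubiniSets.
Local Open Scope ereal_scope.
Context d1 d2 (X : measurableType d1) (Y : measurableType d2) (R : realType).
Variable m1 : {sigma_finite_measure set X -> \bar R}.
Variable m2 : {sigma_finite_measure set Y -> \bar R}.

Lemma fubini_setX (f : X * Y -> \bar R) (A : set X) (B : set Y) :
  measurable A -> measurable B -> measurable_fun (A `*` B) f ->
  \int[m1]_(x in A) \int[m2]_(y in B) `|f (x, y)| < +oo ->
  \int[m1]_(x in A) \int[m2]_(y in B) f (x, y) =
  \int[m2]_(y in B) \int[m1]_(x in A) f (x, y).
Proof.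
move=> mA mB mf hf; pose g := f \_ (A `*` B).
have mAB : measurable (A `*` B) by exact: measurableX.
have mg : measurable_fun setT g by apply/(measurable_restrictT _ mAB).
have rowE (k : \bar R -> \bar R) : k 0 = 0 -> \int[m1]_x \int[m2]_y k (g (x, y)) =
    \int[m1]_(x in A) \int[m2]_(y in B) k (f (x, y)).
  move=> k0; rewrite [RHS]integral_mkcond; apply: eq_integral => x _; rewrite patchE.
  case: ifPn => xA.
    rewrite [RHS]integral_mkcond; apply: eq_integral => y _.
    by rewrite /g !patchE in_setX xA /=; case: ifP.
  by rewrite integral0_eq// => y _; rewrite /g patchE in_setX (negbTE xA).
have colE : \int[m2]_y \int[m1]_x g (x, y) = \int[m2]_(y in B) \int[m1]_(x in A) f (x, y).
  rewrite [RHS]integral_mkcond; apply: eq_integral => y _; rewrite patchE.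
  case: ifPn => yB.
    rewrite [RHS]integral_mkcond; apply: eq_integral => x _.
    by rewrite /g !patchE in_setX yB andbT.
  by rewrite integral0_eq// => x _; rewrite /g patchE in_setX (negbTE yB) andbF.
rewrite -(rowE id)// -colE; apply: Fubini; apply/integrable12ltyP => //.
by rewrite (rowE (fun x => `|x|)) ?abse0.
Qed.

End FubiniSets.

Section PlaneMeasure.
Variable R : realType.
Local Notation mu := (@lebesgue_measure R).

(* A copy of the product measure: unification resolves [mu \x mu] only to
   the sigma-finite structure meant for products of subprobabilities. *)
Definition plane_measure : set (measurableTypeR R * measurableTypeR R)%type -> \bar R :=
  (mu \x mu)%E.

HB.instance Definition _ := Measure.copy plane_measure (mu \x mu)%E.

Lemma plane_measure_sigma_finite : sigma_finite setT plane_measure.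
Proof.
have /sigma_finiteP[F [TF ndF Foo]] := sigma_finiteT mu.
exists (fun n => F n `*` F n).
  apply/seteqP; split => // -[x y] _.
  have : [set: measurableTypeR R] x by []. rewrite TF => -[n _ Fx].
  have : [set: measurableTypeR R] y by []. rewrite TF => -[k _ Fy].
  exists (maxn n k) => //; split.
    by move: x Fx; exact/subsetPset/ndF/leq_maxl.
  by move: y Fy; exact/subsetPset/ndF/leq_maxr.
move=> n; have [mF Fn] := Foo n; split; first exact: measurableX.
by rewrite /plane_measure product_measure1E// lte_mul_pinfty// ge0_fin_numE.
Qed.

HB.instance Definition _ := Measure_isSigmaFinite.Build _ _ _ plane_measure
  plane_measure_sigma_finite.

End PlaneMeasure.

(** * Averaging over the rotations about [i] *)

Section Rotation.
Variable R : realType.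
Local Notation mu := (@lebesgue_measure R).
Local Notation m2 := (@lebesgue_measure R \x @lebesgue_measure R)%E.
Local Notation C2 := (@complex_of_pair R).
Local Notation C := R[i].
Local Notation Re := (@complex.Re R).
Local Notation Im := (@complex.Im R).
Local Notation HP := (@upper_half_plane R).
Local Notation cI := (@cI R).
Local Open Scope complex_scope.

Definition rot (t : R) : 'M[R]_2 := \matrix_(i, j)
  if i == 0 then (if j == 0 then cos t else sin t) else (if j == 0 then - sin t else cos t).

Lemma det_rot t : \det (rot t) = 1.
Proof. by rewrite det2 !mxE /= -(cos2Dsin2 t); ring. Qed.

Lemma mobius_rot (t : R) (w : C) :
  mobius (rot t) w = ((cos t)%:C * w + (sin t)%:C) / ((- sin t)%:C * w + (cos t)%:C).
Proof. by rewrite /mobius !mxE. Qed.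

Lemma rot_den_neq0 (t : R) (w : C) : HP w -> (- sin t)%:C * w + (cos t)%:C != 0.
Proof.
move=> w0; apply/eqP => e; have h1 := congr1 Im e; have h2 := congr1 Re e.
rewrite !cE in h1 h2; have s0 : sin t = 0.
  by apply/eqP; rewrite -oppr_eq0 -(mulIr_eq0 _ (mulIf (lt0r_neq0 w0))); apply/eqP; lra.
move: h2 (cos2Dsin2 t); rewrite s0 => h2; have -> : cos t = 0 by lra.
by rewrite expr0n addr0 => /eqP; rewrite eq_sym oner_eq0.
Qed.

Lemma cexpI (t : R) : cexp (0 +i* t) = cos t +i* sin t.
Proof. by rewrite /cexp !cE expR0 !mul1r. Qed.

Lemma rot_HP (t : R) (w : C) : HP w -> HP (mobius (rot t) w).
Proof.
move=> w0; have n0 := rot_den_neq0 t w0; rewrite HPE mobius_rot.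
have -> : Im (((cos t)%:C * w + (sin t)%:C) / ((- sin t)%:C * w + (cos t)%:C)) =
   Im w / nsq ((- sin t)%:C * w + (cos t)%:C).
  rewrite !cE; set n := nsq _; rewrite -[Im w in RHS]mul1r -(cos2Dsin2 t).
  by have : n != 0; [rewrite nsq_eq0|move=> h; field].
by rewrite divr_gt0// nsq_gt0.
Qed.

(** The stabiliser of [i] becomes the group of rotations of the disc, with the angle doubled, whence
    [t / 2]. *)
Lemma cayley_rot (t : R) (w : C) : HP w ->
  mobius (rot (t / 2)) w = cayleyV (cexp (0 +i* t) * cayley w).
Proof.
move=> w0; rewrite -[LHS]cayleyK; last exact: rot_HP.
congr cayleyV; have n0 := rot_den_neq0 (t / 2) w0; rewrite mobius_rot.
have e2 : cexp (0 +i* t) = cexp (0 +i* (t / 2)) * cexp (0 +i* (t / 2)).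
  by rewrite -cexpD; congr cexp; apply: eqC; rewrite !cE; field.
rewrite e2 cexpI; set c := cos (t / 2); set s := sin (t / 2) in n0 *.
have cs : c ^+ 2 + s ^+ 2 = 1 by exact: cos2Dsin2.
have E1 : (c +i* s) * (c -i* s) = 1.
  by apply: eqC; rewrite !cE -?cs; ring.
have wi := addI_neq0 w0; rewrite /cayley.
set D := _ + c%:C in n0 *.
have e3 : (c%:C * w + s%:C) / D - cI = (c +i* s) * (w - cI) / D.
  by apply: (mulIf n0); rewrite mulrBl !divfK// /D; apply: eqC; rewrite /cI !cE; ring.
have e4 : (c%:C * w + s%:C) / D + cI = (c -i* s) * (w + cI) / D.
  by apply: (mulIf n0); rewrite mulrDl !divfK// /D; apply: eqC; rewrite /cI !cE; ring.
have E0 : c -i* s != 0 by apply/eqP => e; move/eqP: E1; rewrite e mulr0 eq_sym oner_eq0.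
rewrite e3 e4; have -> : c +i* s = (c -i* s)^-1 by rewrite -[LHS]mulr1 -(mulfV E0) mulrA E1 mul1r.
by field; rewrite wi n0 E0.
Qed.

Variables (g : C -> C) (p : C) (chi : R -> R).
Hypothesis gc : forall w, HP w -> ccont g w.
Hypothesis gh : forall w, HP w -> w != p -> hol g w.
Hypothesis mg : mCC g.
Hypothesis mchi : measurable_fun [set: R] chi.

Local Notation rho := (fun w => nsq (cayley w)).

Lemma mCC_cayley : mCC (@cayley R).
Proof.
by apply: mCC_M; [|apply: mCC_V]; apply: mCC_D; (exact: mCC_id || exact: mCC_cst).
Qed.

Lemma mC_chi : mC (fun w => chi (rho w)).
Proof.
have [h1 h2] := mCC_cayley.
rewrite /mC; apply: (measurableT_comp mchi); exact: (mC_comp (@mC_nsq R) h1 h2).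
Qed.

Let G (q : R * (R * R)) := Re (g (mobius (rot (q.1 / 2)) (C2 q.2))).

Let mG : measurable_fun [set: R * (R * R)] G.
Proof.
pose a (q : R * (R * R)) := mobius (rot (q.1 / 2)) (C2 q.2).
have m1 : measurable_fun [set: R * (R * R)] (fun q => q.1 / 2).
  by apply: measurable_funM => //; exact: measurable_fst.
have mc : measurable_fun [set: R * (R * R)] (fun q => cos (q.1 / 2)).
  by apply: (measurableT_comp _ m1); apply: continuous_measurable_fun; exact: continuous_cos.
have ms : measurable_fun [set: R * (R * R)] (fun q => sin (q.1 / 2)).
  by apply: (measurableT_comp _ m1); apply: continuous_measurable_fun; exact: continuous_sin.
have mx : measurable_fun [set: R * (R * R)] (fun q => q.2.1).
  by apply: (measurableT_comp measurable_fst); exact: measurable_snd.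
have my : measurable_fun [set: R * (R * R)] (fun q => q.2.2).
  by apply: (measurableT_comp measurable_snd); exact: measurable_snd.
have mM (f h : R * (R * R) -> R) : measurable_fun [set: R * (R * R)] f -> measurable_fun setT h ->
   measurable_fun [set: R * (R * R)] (fun q => f q * h q : R) by exact: measurable_funM.
have mD (f h : R * (R * R) -> R) : measurable_fun [set: R * (R * R)] f -> measurable_fun setT h ->
   measurable_fun [set: R * (R * R)] (fun q => f q + h q : R) by exact: measurable_funD.
have mB (f h : R * (R * R) -> R) : measurable_fun [set: R * (R * R)] f -> measurable_fun setT h ->
   measurable_fun [set: R * (R * R)] (fun q => f q - h q : R) by exact: measurable_funB.
have mV (f : R * (R * R) -> R) : measurable_fun [set: R * (R * R)] f ->
   measurable_fun [set: R * (R * R)] (fun q => (f q)^-1 : R).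
  by move=> h; exact: (measurableT_comp (@measurable_inv R) h).
pose n q : R := (cos (q.1 / 2) - sin (q.1 / 2) * q.2.1) * (cos (q.1 / 2) - sin (q.1 / 2) * q.2.1)
  + (sin (q.1 / 2) * q.2.2) * (sin (q.1 / 2) * q.2.2).
have mn : measurable_fun [set: R * (R * R)] n.
  by apply: (mD); apply: (mM); (apply: (mB) => //; exact: (mM)) || exact: (mM).
have nE q : n q = nsq ((- sin (q.1 / 2))%:C * C2 q.2 + (cos (q.1 / 2))%:C).
  by rewrite /n /nsq !cE /=; ring.
have -> : G = (fun p => Re (g (C2 p))) \o (fun q => (Re (a q), Im (a q))).
  have aE q : C2 (Re (a q), Im (a q)) = a q by case: (a q).
  by apply/funext => q; rewrite /G [RHS]/comp aE.
apply: (measurableT_comp mg.1); apply: measurable_fun_pair.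
- have -> : (fun q => Re (a q)) = (fun q => ((cos (q.1 / 2) * q.2.1 + sin (q.1 / 2)) *
     (cos (q.1 / 2) - sin (q.1 / 2) * q.2.1) - (cos (q.1 / 2) * q.2.2) * (sin (q.1 / 2) * q.2.2)) / n q).
    by apply/funext => q; rewrite /a mobius_rot nE !cE /=; ring.
  apply: (mM); last exact: (mV).
  apply: (mB); last by apply: (mM); exact: (mM).
  by apply: (mM); [apply: (mD) => //; exact: (mM)|apply: (mB) => //; exact: (mM)].
- have -> : (fun q => Im (a q)) = (fun q => ((cos (q.1 / 2) * q.2.1 + sin (q.1 / 2)) *
     (sin (q.1 / 2) * q.2.2) + (cos (q.1 / 2) * q.2.2) * (cos (q.1 / 2) - sin (q.1 / 2) * q.2.1)) / n q).
    by apply/funext => q; rewrite /a mobius_rot nE !cE /=; ring.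
  apply: (mM); last exact: (mV).
  apply: (mD); last by apply: (mM); [exact: (mM)|apply: (mB) => //; exact: (mM)].
  by apply: (mM); [apply: (mD) => //; exact: (mM)|exact: (mM)].
Qed.

Let avg w : HP w ->
  (\int[mu]_(t in `[0%R, (2 * pi)%R]) (Re (g (mobius (rot (t / 2)) w)))%:E)%E =
  (Re (g cI) * (2 * pi))%:E.
Proof.
move=> w0; under eq_integral do rewrite (cayley_rot _ w0).
have [z0|z0] := eqVneq (cayley w) 0; last first.
  by have := mean_value_int gc gh (nsq_cayley w0) z0.
have e t : cayleyV (cexp (0 +i* t) * cayley w) = cI.
  by rewrite z0 mulr0 /cayleyV addr0 subr0 divr1 mulr1.
under eq_integral do rewrite e.
have pi20 : 0 <= 2 * pi :> R by rewrite mulr_ge0// pi_ge0.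
rewrite integral_cst//= lebesgue_measure_itv/= lte_fin.
by rewrite mulr_gt0 ?pi_gt0// -EFinD subr0 EFinM.
Qed.

(** All rotated integrands have the same integral, because rotations about [i] preserve area and
    [rho]. Averaging over the angle and exchanging the integrals replaces [Re (g w)] by its mean
    over a circle about [i], which is [Re (g cI)]. *)
Theorem rotation_average :
  hi (fun w => Re (g w) * chi (rho w)) -> hi (fun w => chi (rho w)) ->
  rint (fun w => Re (g w) * chi (rho w)) = Re (g cI) * rint (fun w => chi (rho w)).
Proof.
move=> hP hchi; pose P w := Re (g w) * chi (rho w).
have pi0 : 0 < 2 * pi :> R by rewrite mulr_gt0// pi_gt0.
have mI : measurable (`[0%R, (2 * pi)%R]%classic : set R) by [].
have muI : mu (`[0%R, (2 * pi)%R]%classic : set R) = (2 * pi)%:E.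
  by rewrite /= lebesgue_measure_itv/= lte_fin pi0 -EFinD subr0.
have rhoE (t : R) (w : C) : HP w -> rho (mobius (rot (t / 2)) w) = rho w.
  move=> w0; rewrite cayley_rot// cayleyVK; first by rewrite nsqM nsq_cexp expR0 expr1n mul1r.
  by rewrite nsqM nsq_cexp expR0 expr1n mul1r nsq_cayley.
pose F (q : R * (R * R)) := (G q * chi (rho (C2 q.2)) * q.2.2 ^- 2)%:E.
have FE t : (\int[m2]_(q in @UH R) F (t, q))%E = hint (P \o mobius (rot (t / 2))).
  by apply: eq_integral => q /set_mem qU; rewrite /F /G /P /= rhoE.
have FaE t : (\int[m2]_(q in @UH R) `|F (t, q)|)%E = hint ((fun w => `|P w|) \o mobius (rot (t / 2))).
  apply: eq_integral => q /set_mem qU; rewrite /F /G /P /= rhoE// normrM; congr (_ * _)%:E.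
  by rewrite ger0_norm// invr_ge0 sqr_ge0.
have mF : measurable_fun (`[0%R, (2 * pi)%R] `*` @UH R) F.
  apply/measurable_EFinP; apply: measurable_funM.
    apply: measurable_funM; first exact: measurable_funS mG.
    apply: (@measurable_funS _ _ _ _ setT) => //.
    exact: (measurableT_comp mC_chi measurable_snd).
  apply: (@measurable_funS _ _ _ _ setT) => //.
  have mV2 : measurable_fun [set: R * (R * R)] ((fun p : R * R => p.2 ^- 2) \o snd).
    by apply: measurableT_comp; [exact: measurable_invsq|exact: measurable_snd].
  exact: mV2.
have hint_abs t : hint ((fun w => `|P w|) \o mobius (rot (t / 2))) = hint (fun w => `|P w|).
  by apply: hint_mobius_signed; [exact: det_rot|apply: mC_abs; exact: hP.1].
have hint_P t : hint (P \o mobius (rot (t / 2))) = (rint P)%:E.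
  by rewrite rintK//; apply: hint_mobius_signed; [exact: det_rot|exact: hP.1].
have H : (\int[mu]_(x in `[0%R, (2 * pi)%R]) \int[m2]_(y in @UH R) `|F (x, y)| < +oo ->
    \int[mu]_(x in `[0%R, (2 * pi)%R]) \int[m2]_(y in @UH R) F (x, y) =
    \int[m2]_(y in @UH R) \int[mu]_(x in `[0%R, (2 * pi)%R]) F (x, y))%E.
  exact: (@fubini_setX _ _ (measurableTypeR R) (measurableTypeR R * measurableTypeR R)%type R
    mu (@plane_measure R) F _ _ mI (@measurable_UH R) mF).
move: H.
have -> : (\int[mu]_(x in `[0%R, (2 * pi)%R]) \int[m2]_(y in @UH R) `|F (x, y)| =
   hint (fun w => `|P w|%R) * (2 * pi)%R%:E)%E.
  under eq_integral do rewrite FaE hint_abs.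
  by rewrite integral_cst//; congr (_ * _)%E; exact: muI.
have -> : (\int[mu]_(x in `[0%R, (2 * pi)%R]) \int[m2]_(y in @UH R) F (x, y) =
   (rint P * (2 * pi))%R%:E)%E.
  under eq_integral do rewrite FE hint_P.
  by rewrite integral_cst// EFinM; congr (_ * _)%E; exact: muI.
have -> : (\int[m2]_(y in @UH R) \int[mu]_(x in `[0%R, (2 * pi)%R]) F (x, y))%E =
    hint (fun w => (Re (g cI) * (2 * pi)) * chi (rho w))%R.
  apply: eq_integral => q /set_mem qU; rewrite /F /G /=.
  have mGq : measurable_fun [set: R] (fun t => Re (g (mobius (rot (t / 2)) (C2 q)))).
    have h : measurable_fun [set: R] (G \o (fun t : R => (t, q))).
      by apply: (measurableT_comp mG); exact: measurable_fun_pair.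
    exact: h.
  have cintg : mu.-integrable `[0%R, (2 * pi)%R] (fun t => (Re (g (mobius (rot (t / 2)) (C2 q))))%:E).
    apply/integrableP; split.
      apply/measurable_EFinP.
      by apply: measurable_funS mGq.
    rewrite integral_fin_num_abs ?avg//.
    by apply: measurable_funS mGq.
  under eq_integral do rewrite -mulrA mulrC EFinM.
  by rewrite integralZl// avg// -EFinM; congr EFin; ring.
have fin : (hint (fun w => `|P w|%R) * (2 * pi)%R%:E < +oo)%E.
  rewrite lte_mul_pinfty ?ltry//; first exact: hint_ge0.
  rewrite ge0_fin_numE; [exact: hP.2|exact: hint_ge0].
move=> /(_ fin) H.
rewrite -rintK in H; last exact: hi_Z.
move: H => [] ; rewrite rint_Z// => H; apply: (mulIf (lt0r_neq0 pi0)); rewrite H; ring.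
Qed.

End Rotation.

(** * Frame operators *)

Section MonotoneSeq.
Variable R : realType.

Lemma nonincreasing_limit (a : nat -> R) :
  (forall n, 0 <= a n) -> (forall n, a n.+1 <= a n) ->
  exists l, forall e, 0 < e -> exists n0, forall n, (n0 <= n)%N -> l <= a n <= l + e.
Proof.
move=> a0 aS; have am m n : (m <= n)%N -> a n <= a m.
  move=> /subnKC <-; elim: (n - m)%N => [|k ih]; first by rewrite addn0.
  by rewrite addnS; exact: le_trans ih.
have hi : has_inf (range a) by split; [exists (a 0%N), 0%N|exists 0 => _ [n _ <-]].
exists (inf (range a)) => e e0.
have [_ [n0 _ <-] h] := inf_adherent e0 hi; exists n0 => n /am h2.
rewrite (le_trans h2 (ltW h)) andbT; apply: ge_inf; first exact: hi.2.
by exists n.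
Qed.

Lemma eps_eq0 (x : R) : (forall e, 0 < e -> `|x| <= e) -> x = 0.
Proof.
by move=> h; apply/eqP; rewrite -normr_le0; apply/ler_addgt0Pl => e /h; rewrite addr0.
Qed.

End MonotoneSeq.

Section Frame.
Variables (R : realType) (V : lmodType R) (ip : V -> V -> R).
Hypothesis ipC : forall x y, ip x y = ip y x.
Hypothesis ipD : forall x y z, ip (x + y) z = ip x z + ip y z.
Hypothesis ipZ : forall a x z, ip (a *: x) z = a * ip x z.
Hypothesis ip_ge0 : forall x, 0 <= ip x x.
Hypothesis ip_eq0 : forall x, ip x x = 0 -> x = 0.

Definition cvto (f : nat -> V) x := forall e, 0 < e -> exists n0, forall n,
  (n0 <= n)%N -> ip (f n - x) (f n - x) <= e.

Hypothesis complete : forall f : nat -> V,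
  (forall e, 0 < e -> exists n0, forall m n, (n0 <= m)%N -> (n0 <= n)%N ->
     ip (f m - f n) (f m - f n) <= e) -> exists x, cvto f x.

(** Stated for semidefinite forms because it is applied to [(T x, y)], which degenerates on the
    kernel of [T]. *)
Lemma form_cs (F : V -> V -> R) : (forall x y, F x y = F y x) ->
  (forall x y z, F (x + y) z = F x z + F y z) ->
  (forall a x z, F (a *: x) z = a * F x z) -> (forall x, 0 <= F x x) ->
  forall x y, F x y ^+ 2 <= F x x * F y y.
Proof.
move=> FC FD FZ F0 x y.
have q t : 0 <= F x x + 2 * t * F x y + t ^+ 2 * F y y.
  have := F0 (x + t *: y).
  rewrite !(FD, FZ) ![F _ (x + _)]FC !(FD, FZ) [F y x]FC; congr (_ <= _); ring.
have [yy|yy] := eqVneq (F y y) 0.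
  have [->|xy] := eqVneq (F x y) 0; first by rewrite expr0n mulr_ge0.
  have := q (- (F x x + 1) / (2 * F x y)).
  have -> : 2 * (- (F x x + 1) / (2 * F x y)) * F x y = - (F x x + 1) by field.
  by rewrite yy mulr0 addr0 => h; exfalso; lra.
have y0 : 0 < F y y by rewrite lt_neqAle eq_sym yy F0.
have := q (- F x y / F y y).
have -> : F x x + 2 * (- F x y / F y y) * F x y + (- F x y / F y y) ^+ 2 * F y y =
  (F x x * F y y - F x y ^+ 2) / F y y by field.
by rewrite pmulr_lge0 ?invr_gt0// subr_ge0.
Qed.

Lemma ip_cs x y : ip x y ^+ 2 <= ip x x * ip y y.
Proof. exact: form_cs. Qed.

Lemma ipDr x y z : ip x (y + z) = ip x y + ip x z.
Proof. by rewrite ipC ipD ![ip _ x]ipC. Qed.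
Lemma ipZr a x y : ip x (a *: y) = a * ip x y.
Proof. by rewrite ipC ipZ [ip y x]ipC. Qed.
Lemma ipN x y : ip (- x) y = - ip x y.
Proof. by rewrite -scaleN1r ipZ mulN1r. Qed.
Lemma ipNr x y : ip x (- y) = - ip x y.
Proof. by rewrite ipC ipN ipC. Qed.
Lemma ip0x y : ip 0 y = 0.
Proof. by rewrite -(scale0r 0) ipZ mul0r. Qed.
Definition ipE := (ipD, ipDr, ipN, ipNr, ipZ, ipZr).

Lemma ip_suml n (f : nat -> V) y : ip (\sum_(k < n) f k) y = \sum_(k < n) ip (f k) y.
Proof.
elim: n => [|n ih]; first by rewrite !big_ord0 ip0x.
by rewrite !big_ord_recr /= ipD ih.
Qed.

Lemma ip_ext x y : (forall z, ip x z = ip y z) -> x = y.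
Proof.
move=> h; apply/eqP; rewrite -subr_eq0; apply/eqP/ip_eq0.
by rewrite ipD ipN h subrr.
Qed.

Lemma cvto_ip f x y : cvto f x -> forall e, 0 < e -> exists n0, forall n,
  (n0 <= n)%N -> `|ip (f n) y - ip x y| <= e.
Proof.
move=> fx e e0; have y1 : 0 < ip y y + 1 by rewrite ltr_pwDr// ip_ge0.
have [n0 hn] := fx (e ^+ 2 / (ip y y + 1)) (divr_gt0 (exprn_gt0 2 e0) y1).
exists n0 => n /hn h; have := ip_cs (f n - x) y; rewrite ipD ipN => h2.
rewrite -[leRHS]ger0_norm ?(ltW e0)// -ler_sqr ?nnegrE//.
rewrite !real_normK ?num_real//; apply: le_trans h2 _.
apply: le_trans (ler_wpM2r (ip_ge0 y) h) _.
by rewrite mulrAC ler_pdivrMr// ler_pM2l ?exprn_gt0// lerDl.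
Qed.

Variable v : nat -> V.
Hypothesis bessel : forall x n, \sum_(k < n) ip x (v k) ^+ 2 <= ip x x.

Let TN x n := \sum_(k < n) ip x (v k) *: v k.

Let q x n := \sum_(k < n) ip x (v k) ^+ 2.

Let ip_TN x n y : ip (TN x n) y = \sum_(k < n) ip x (v k) * ip y (v k).
Proof.
by rewrite /TN (@ip_suml n (fun k => ip x (v k) *: v k)); apply: eq_bigr => k _;
  rewrite ipZ [ip (v k) y]ipC.
Qed.

Let q_mono x m n : (m <= n)%N -> q x m <= q x n.
Proof.
move=> /subnKC <-; elim: (n - m)%N => [|k ih]; first by rewrite addn0.
by rewrite addnS /q big_ord_recr /=; apply: le_trans ih _; rewrite lerDl sqr_ge0.
Qed.

(** For [y] the difference, [(y, y)] is the sum of the products of the coefficients of [x] and of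
    [y]; twice a product is at most the sum of the squares, and the squares for [y] are absorbed by
    Bessel's inequality for [y] itself. *)
Let TN_tail x m n : (m <= n)%N -> ip (TN x n - TN x m) (TN x n - TN x m) <= q x n - q x m.
Proof.
move=> mn; set y := TN x n - TN x m.
have sub (c d : nat -> R) : \sum_(k < n) c k * d k - \sum_(k < m) c k * d k =
    \sum_(m <= k < n) c k * d k.
  rewrite -(big_mkord xpredT (fun k => c k * d k)) -(big_mkord xpredT (fun k => c k * d k)).
  by rewrite (big_cat_nat (leq0n m) mn)/= addrAC subrr add0r.
have e1 : ip y y = \sum_(m <= k < n) ip x (v k) * ip y (v k).
  by rewrite {1}/y ipD ipN !ip_TN (sub (fun k => ip x (v k)) (fun k => ip y (v k))).
have e2 : \sum_(m <= k < n) ip y (v k) * ip y (v k) <= ip y y.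
  apply: le_trans (bessel y n); rewrite -sub lerBlDr.
  under [X in _ <= X + _]eq_bigr do rewrite expr2.
  by rewrite lerDl sumr_ge0// => k _; rewrite -expr2 sqr_ge0.
have e3 : q x n - q x m = \sum_(m <= k < n) ip x (v k) * ip x (v k).
  by rewrite /q -sub; congr (_ - _); apply: eq_bigr => k _; rewrite expr2.
have : 2 * ip y y <= (q x n - q x m) + \sum_(m <= k < n) ip y (v k) * ip y (v k).
  rewrite {1}e1 e3 mulr_sumr -big_split /=; apply: ler_sum => k _.
  have := sqr_ge0 (ip x (v k) - ip y (v k)); rewrite -subr_ge0 => h.
  by rewrite -subr_ge0; apply: le_trans h _; rewrite subr0 le_eqVlt; apply/orP; left; apply/eqP; ring.
lra.
Qed.

Let T_ex x : exists y, cvto (TN x) y.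
Proof.
apply: complete => e e0.
have [l hl] := @nonincreasing_limit _ (fun n => ip x x - q x n)
  (fun n => ltac:(by rewrite subr_ge0; exact: bessel))
  (fun n => ltac:(by rewrite lerD2l lerN2; exact: q_mono)).
have [n0 hn] := hl e e0; exists n0 => m n hm0 hn0.
wlog mn : m n hm0 hn0 / (m <= n)%N => [hw|].
  have [/hw|/ltnW/hw] := leqP m n; first exact.
  by move=> /(_ hn0 hm0); rewrite -[TN x n - _]opprB ipN ipNr opprK.
rewrite -[TN x m - _]opprB ipN ipNr opprK; apply: le_trans (TN_tail x mn) _.
by have /andP[? ?] := hn m hm0; have /andP[? ?] := hn n hn0; lra.
Qed.

Definition frameT x : V := sval (cid (T_ex x)).
Local Notation T := frameT.

Lemma frameT_cvg x : cvto (TN x) (T x). Proof. exact: (svalP (cid (T_ex x))). Qed.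

Lemma frameT_sym x y : ip (T x) y = ip x (T y).
Proof.
apply/eqP; rewrite -subr_eq0; apply/eqP/eps_eq0 => e e0.
have e2 : 0 < e / 2 by rewrite divr_gt0.
have [n1 h1] := cvto_ip y (frameT_cvg x) e2; have [n2 h2] := cvto_ip x (frameT_cvg y) e2.
have {}h1 := h1 (n1 + n2)%N (leq_addr _ _); have {}h2 := h2 (n1 + n2)%N (leq_addl _ _).
have e1 : ip (TN x (n1 + n2)) y = ip (TN y (n1 + n2)) x.
  by rewrite !ip_TN; apply: eq_bigr => k _; rewrite mulrC.
rewrite [ip x _]ipC; rewrite e1 in h1.
set a := ip (TN y (n1 + n2)) x in h1 h2.
rewrite (_ : _ - _ = (a - ip (T y) x) - (a - ip (T x) y)); last by ring.
by apply: le_trans (ler_normB _ _) _; lra.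
Qed.

Lemma frameTD x y : T (x + y) = T x + T y.
Proof. by apply: ip_ext => z; rewrite frameT_sym !ipD !frameT_sym. Qed.
Lemma frameTZ a x : T (a *: x) = a *: T x.
Proof. by apply: ip_ext => z; rewrite frameT_sym !ipZ !frameT_sym. Qed.
Lemma frameTN x : T (- x) = - T x.
Proof. by rewrite -scaleN1r frameTZ scaleN1r. Qed.

Lemma frame_form x e : 0 < e -> exists n0, forall n, (n0 <= n)%N ->
  `|q x n - ip (T x) x| <= e.
Proof.
move=> e0; have [n0 hn] := cvto_ip x (frameT_cvg x) e0; exists n0 => n /hn.
by rewrite ip_TN /q; under eq_bigr do rewrite -expr2.
Qed.

Lemma frame_single x k1 : (forall k, k != k1 -> ip x (v k) = 0) -> T x = ip x (v k1) *: v k1.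
Proof.
move=> h; apply: ip_ext => y; apply/eqP; rewrite -subr_eq0; apply/eqP/eps_eq0 => e e0.
have [n0 hn] := cvto_ip y (frameT_cvg x) e0.
have := hn (k1.+1 + n0)%N (leq_addl _ _); rewrite ip_TN distrC.
have kn : (k1 < k1.+1 + n0)%N by rewrite leq_addr.
rewrite (bigD1 (Ordinal kn))//= big1 ?addr0; first by rewrite ipZ [ip (v k1) y]ipC.
by move=> j jk; rewrite h ?mul0r.
Qed.

Lemma frame_form_ub x n : q x n <= ip (T x) x.
Proof.
apply/ler_addgt0Pl => e e0; have [n0 hn] := frame_form x e0.
have := hn (n + n0)%N (leq_addl _ _); have := q_mono x (leq_addr n0 n).
rewrite ler_norml => ? /andP[]; lra.
Qed.

Lemma frame_ge0 x : 0 <= ip (T x) x.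
Proof. by apply: le_trans (frame_form_ub x 0); rewrite /q big_ord0. Qed.

Lemma frame_le x : ip (T x) x <= ip x x.
Proof.
apply/ler_addgt0Pl => e e0; have [n0 /(_ n0 (leqnn _))] := frame_form x e0.
by have := bessel x n0; rewrite -/(q x n0) ler_norml => ? /andP[]; lra.
Qed.

Lemma frame_coef x k : ip x (v k) ^+ 2 <= ip (T x) x.
Proof.
apply: le_trans (frame_form_ub x k.+1); rewrite /q big_ord_recr /= lerDr sumr_ge0// => i _.
exact: sqr_ge0.
Qed.

(** Cauchy-Schwarz for the form [(T x, y)] at [y = T x], combined with [T <= 1], gives
    [T^2 <= T]. *)
Lemma frame_sq x : ip (T x) (T x) <= ip (T x) x.
Proof.
have := @form_cs (fun x y => ip (T x) y) _ _ _ frame_ge0 x (T x).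
have h1 a b : ip (T a) b = ip (T b) a by rewrite frameT_sym ipC.
move=> /(_ h1) h2; have {}h2 := h2 (fun x y z => ltac:(by rewrite frameTD ipD))
  (fun a x z => ltac:(by rewrite frameTZ ipZ)).
have := frame_le (T x); have := frame_ge0 x; have := ip_ge0 (T x).
set a := ip (T x) (T x) in h2 *; set b := ip (T x) x in h2 *.
set c := ip (T (T x)) (T x) in h2 *; move=> a0 b0 ca; nra.
Qed.

Definition frameB x := x - T x.
Local Notation B := frameB.

Lemma frameB_sym x y : ip (B x) y = ip x (B y).
Proof. by rewrite /B !ipE frameT_sym. Qed.
Lemma frameTB x : T (B x) = B (T x).
Proof. by rewrite /B frameTD frameTN. Qed.

Lemma iterB_sym n x y : ip (iter n B x) y = ip x (iter n B y).
Proof. by elim: n x y => //= n ih x y; rewrite frameB_sym ih -iterSr. Qed.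
Lemma iterBT n x : T (iter n B x) = iter n B (T x).
Proof. by elim: n => //= n <-; rewrite frameTB. Qed.

(** The moments of the spectral measure of [B] at [x]. Their monotonicity replaces the spectral
    theorem. *)
Let a x n := ip (iter n B x) x.

Let aE x m n : ip (iter m B x) (iter n B x) = a x (m + n).
Proof. by rewrite /a -iterB_sym -iterD addnC. Qed.

Let half_case (P : nat -> Prop) : (forall k, P (k + k)%N) -> (forall k, P (k + k).+1) ->
  forall n, P n.
Proof.
move=> h1 h2 n; rewrite -[n]odd_double_half -addnn; case: (odd n) => /=.
  by rewrite add1n.
by rewrite add0n.
Qed.

Let a_ge0 x n : 0 <= a x n.
Proof.
apply: (half_case (P := fun n => 0 <= a x n)) => k; first by rewrite -aE.
by rewrite -addSn -aE iterS /B ipE ipN subr_ge0 frame_le.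
Qed.

Let aT x m n : ip (T (iter m B x)) (iter n B x) = a x (m + n) - a x (m + n).+1.
Proof.
rewrite -aE -[(m + n).+1]/(m.+1 + n)%N -aE iterS {2}/B ipE ipN; ring.
Qed.

(** With [y = B^k x], the difference is [(T y, y)] for even index and [(T y, y) - (T y, T y)] for
    odd index; the latter is nonnegative since [T^2 <= T]. *)
Let aS x n : a x n.+1 <= a x n.
Proof.
rewrite -subr_ge0; apply: (half_case (P := fun n => 0 <= a x n - a x n.+1)) => k.
  by rewrite -aT frame_ge0.
by rewrite -addSn -aT iterS frameTB /B ipE ipN subr_ge0 frameT_sym frame_sq.
Qed.

Lemma iterB_norm x n : ip (iter n B x) (iter n B x) = ip (iter (n + n) B x) x.
Proof. by rewrite aE. Qed.

(** The quantity is the difference of two consecutive terms of a convergent sequence of moments. *)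
Lemma iterBT_small x e : 0 < e -> exists n0, forall n, (n0 <= n)%N ->
  0 <= ip (iter n B (T x)) x <= e.
Proof.
move=> e0; have [l hl] := nonincreasing_limit (a_ge0 x) (aS x).
have [n0 hn] := hl e e0; exists n0 => n h0; rewrite -iterBT.
have := aT x n 0; rewrite addn0 /= => ->; rewrite subr_ge0 aS /=.
by have /andP[? ?] := hn n h0; have /andP[? ?] := hn n.+1 (leqW h0); lra.
Qed.

(** The squared distance from [B^m x] to [B^n x] is [a (2m) + a (2n) - 2 a (m+n)], so the iterates
    converge. Moreover [T B^n x] tends to 0, its squared norm being at most a difference of
    consecutive moments; the limit is thus orthogonal to all frame vectors. *)
Lemma frame_total (tot : forall y, (forall n, ip y (v n) = 0) -> y = 0) x e :
  0 < e -> exists n0, forall n, (n0 <= n)%N -> ip (iter n B x) (iter n B x) <= e.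
Proof.
move=> e0; have [l hl] := nonincreasing_limit (a_ge0 x) (aS x).
have [y hy] : exists y, cvto (fun n => iter n B x) y.
  apply: complete => d d0; have [n0 hn] := hl (d / 2) (divr_gt0 d0 (ltr0n _ 2)).
  exists n0 => m n hm h.
  rewrite !ipE !aE [(n + m)%N]addnC.
  have /andP[? ?] := hn (m + m)%N (leq_trans hm (leq_addr _ _)).
  have /andP[? ?] := hn (n + n)%N (leq_trans h (leq_addr _ _)).
  have /andP[? ?] := hn (m + n)%N (leq_trans hm (leq_addr _ _)).
  lra.
suff y0 : y = 0.
  have [n0 hn] := hy e e0; exists n0 => n /hn; by rewrite y0 subr0.
apply: tot => k; apply/eqP; rewrite -sqrf_eq0 eq_le sqr_ge0 andbT.
suff <- : ip (T y) y = 0 by exact: frame_coef.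
apply: eps_eq0 => d d0; rewrite frameT_sym.
have d2 : 0 < d / 2 by rewrite divr_gt0.
have [n1 h1] := cvto_ip (T y) hy d2.
have y1 : 0 < ip y y + 1 by rewrite ltr_pwDr// ip_ge0.
have dd : 0 < (d / 2) ^+ 2 / (ip y y + 1) by rewrite divr_gt0// exprn_gt0.
have [n2 h2] := hl _ dd.
pose n := (n1 + n2)%N; have {}h1 := h1 n (leq_addr _ _).
have h3 : `|ip (iter n B x) (T y)| <= d / 2.
  rewrite -frameT_sym -[leRHS]ger0_norm ?(ltW d2)// -ler_sqr ?nnegrE//.
  rewrite !real_normK ?num_real//; apply: le_trans (ip_cs _ _) _.
  have h4 : ip (T (iter n B x)) (T (iter n B x)) <= (d / 2) ^+ 2 / (ip y y + 1).
    apply: le_trans (frame_sq _) _; rewrite aT.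
    have nn : (n2 <= n + n)%N by rewrite /n -addnA (leq_trans (leq_addl n1 n2))// leq_add2l leq_addr.
    have /andP[? ?] := h2 _ nn; have /andP[? ?] := h2 _ (leqW nn); lra.
  apply: le_trans (ler_wpM2r (ip_ge0 y) h4) _.
  by rewrite mulrAC ler_pdivrMr// ler_pM2l ?exprn_gt0// lerDl.
rewrite (_ : ip y (T y) = ip (iter n B x) (T y) - (ip (iter n B x) (T y) - ip y (T y))); last by ring.
by apply: le_trans (ler_normB _ _) _; lra.
Qed.

(** The partial sums of the Neumann series of [T^-1]; the series itself need not converge. *)
Definition frameS n x := \sum_(k < n) iter k B x.
Local Notation S := frameS.

Lemma frameTS n x : T (S n x) = x - iter n B x.
Proof.
elim: n => [|n ih]; first by rewrite /S big_ord0 /= subrr -(scale0r (0 : V)) frameTZ !scale0r.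
rewrite /S big_ord_recr /= frameTD -/(S n x) ih.
have -> : B (iter n B x) = iter n B x - T (iter n B x) by [].
by rewrite opprB addrA addrAC.
Qed.

Lemma frameS_ip n x y : ip (S n x) y = ip x (S n y).
Proof.
rewrite /S (@ip_suml n (fun k => iter k B x)) ipC (@ip_suml n (fun k => iter k B y)).
by apply: eq_bigr => k _; rewrite iterB_sym ipC.
Qed.

Lemma frameST n x : S n (T x) = T (S n x).
Proof. by apply: ip_ext => y; rewrite frameS_ip frameT_sym !frameTS !ipE iterB_sym. Qed.

(* The form on the left is not manifestly positive; those on the right are, which
   makes Tonelli applicable to them. *)
Lemma frameS_polar n x : 4 * ip (T (S n x)) x =
  ip (T (S n x + x)) (S n x + x) - ip (T (S n x - x)) (S n x - x).
Proof.
rewrite !(frameTD, frameTN) !ipE [ip (T x) (S n x)]frameT_sym [ip x (T (S n x))]ipC; ring.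
Qed.

(** Apply the hypothesis to [S n e]: since [T S_n = 1 - B^n] and the moments are nonnegative,
    [l t^2 <= t] for [t = (S_n e, e)]. *)
Lemma frameS_trace_le (l : R) e n : 0 < l -> (forall x, l * ip x e ^+ 2 <= ip (T x) x) ->
  l * ip (S n e) e <= 1.
Proof.
move=> l0 h; have := h (S n e); rewrite frameTS ipE ipN [ip e _]ipC.
set t := ip (S n e) e.
have : 0 <= ip (iter n B e) (S n e).
  rewrite ipC /S (@ip_suml n (fun k => iter k B e)) sumr_ge0// => k _.
  by rewrite aE a_ge0.
have : 0 <= t.
  by rewrite /t /S (@ip_suml n (fun k => iter k B e)) sumr_ge0// => k _; exact: a_ge0.
move=> t0 b0 h2; have [->|tn] := eqVneq t 0; first by rewrite mulr0.
have tp : 0 < t by rewrite lt_neqAle eq_sym tn.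
rewrite -(ler_pM2r tp) mul1r -mulrA -expr2; lra.
Qed.

(** The vector [x] is a preimage of [l *: e], so [l^2 (S_n e, e) = (S_n T x, T x) = l - (B^n T x,
    x)], and the last term tends to 0. *)
Lemma frameS_trace_lim (l : R) e x : 0 < l -> T x = l *: e -> ip x e = 1 ->
  forall d, 0 < d -> exists n0, forall n, (n0 <= n)%N -> 1 - d <= l * ip (S n e) e.
Proof.
move=> l0 Tx xe d d0; have [n0 hn] := iterBT_small x (mulr_gt0 d0 l0).
exists n0 => n /hn /andP[_ h].
have e1 : l ^+ 2 * ip (S n e) e = l - ip (iter n B (T x)) x.
  have <- : ip (S n (T x)) (T x) = l ^+ 2 * ip (S n e) e.
    by rewrite frameS_ip {1}Tx ipZ -frameS_ip Tx ipZr; ring.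
  rewrite frameST frameTS ipE ipN [ip (iter n B x) _]ipC -iterB_sym; congr (_ - _).
  by rewrite Tx ipZr xe mulr1.
have l1 : l * (1 - d) <= l * (l * ip (S n e) e).
  by rewrite mulrA -expr2 e1; lra.
by rewrite ler_pM2l in l1.
Qed.

End Frame.

(** * The reproducing formula *)

Section ComplexContinuity.
Variable R : realType.
Local Notation C := R[i].
Local Notation N := (@Normc.normc R).
Local Open Scope complex_scope.

Lemma ccontM (f g : C -> C) z : ccont f z -> ccont g z -> ccont (fun w => f w * g w) z.
Proof.
move=> cf cg e e0; set a := N (f z); set b := N (g z).
have a0 : 0 <= a by exact: normc_ge0.
have b0 : 0 <= b by exact: normc_ge0.
have k0 : 0 < 1 + a + b by lra.
pose t := Num.min 1 (e / (1 + a + b)).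
have t0 : 0 < t by rewrite lt_min ltr01 divr_gt0.
have t1 : t <= 1 by rewrite ge_min lexx.
have te : t * (1 + a + b) <= e by rewrite -ler_pdivlMr// ge_min lexx orbT.
have [d1 d10 h1] := cf t t0; have [d2 d20 h2] := cg t t0.
exists (Num.min d1 d2); first by rewrite lt_min d10.
move=> h; rewrite lt_min => /andP[/h1 {}h1 /h2 {}h2].
rewrite (_ : _ - _ = (f (z + h) - f z) * (g (z + h) - g z) + (f (z + h) - f z) * g z +
  f z * (g (z + h) - g z)); last by ring.
apply: le_trans (le_normcD _ _) _; apply: le_trans (lerD (le_normcD _ _) (lexx _)) _.
rewrite !Normc.normcM -/a -/b; set x := N _ in h1 *; set y := N _ in h2 *.
have x0 : 0 <= x by exact: normc_ge0.
have y0 : 0 <= y by exact: normc_ge0.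
have p1 : x * y <= t by rewrite -[t]mulr1 ler_pM// (le_trans h2).
have p2 : x * b <= t * b by rewrite ler_wpM2r.
have p3 : a * y <= a * t by rewrite ler_wpM2l.
lra.
Qed.

End ComplexContinuity.

Section Kernel.
Variables (R : realType) (s : R).
Hypothesis s1 : 1 < s.
Local Notation C := R[i].
Local Notation Re := (@complex.Re R).
Local Notation Im := (@complex.Im R).
Local Notation HP := (@upper_half_plane R).
Local Notation cI := (@cI R).
Local Notation N := (@Normc.normc R).
Local Open Scope complex_scope.

Let s0 : 0 < s. Proof. exact: lt_trans s1. Qed.

Lemma clogJ (z : C) : clog z^* = (clog z)^*.
Proof.
apply: eqC; rewrite /clog !cE; first by congr ln; rewrite !normcE nsqJ.
by rewrite mulNr atanN.
Qed.

Lemma cexpJ (z : C) : cexp z^* = (cexp z)^*.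
Proof. by apply: eqC; rewrite /cexp !cE ?cosN// sinN mulrN. Qed.

Lemma cpowJ (a : R) (z : C) : cpow a z^* = (cpow a z)^*.
Proof.
by rewrite /cpow clogJ -cexpJ; congr cexp; apply: eqC; rewrite !cE; ring.
Qed.

Lemma mCC_cpow (a : R) (T : C -> C) : mCC T -> mCC (fun z => cpow a (T z)).
Proof.
move=> [m1 m2].
have ml : mC (fun z => ln (N (T z))).
  apply: (@mC_comp1 _ _ (fun z => N (T z))); first exact: measurable_ln.
  have -> : (fun z => N (T z)) = (fun z => Num.sqrt (nsq (T z))).
    by apply/funext => z; rewrite normcE.
  apply: (@mC_comp1 _ (@Num.sqrt R) (fun z => nsq (T z))).
    by apply: continuous_measurable_fun; exact: sqrt_continuous.
  exact: (mC_comp (@mC_nsq R) m1 m2).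
have ma : mC (fun z => atan (Im (T z) / Re (T z))).
  apply: (@mC_comp1 _ _ (fun z => Im (T z) / Re (T z))).
    by apply: continuous_measurable_fun; exact: continuous_atan.
  by apply: mC_M => //; exact: mC_V.
have me : mC (fun z => expR (a * ln (N (T z)))).
  apply: (@mC_comp1 _ _ (fun z => a * ln (N (T z)))); first exact: measurable_expR.
  by apply: mC_M => //; exact: mC_cst.
have mt : mC (fun z => a * atan (Im (T z) / Re (T z))).
  by apply: mC_M => //; exact: mC_cst.
have mcos : measurable_fun [set: R] (@cos R).
  by apply: continuous_measurable_fun; exact: continuous_cos.
have msin : measurable_fun [set: R] (@sin R).
  by apply: continuous_measurable_fun; exact: continuous_sin.
have E z : cpow a (T z) = (expR (a * ln (N (T z))) * cos (a * atan (Im (T z) / Re (T z))))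
    +i* (expR (a * ln (N (T z))) * sin (a * atan (Im (T z) / Re (T z)))).
  by rewrite /cpow /cexp /clog !cE !mul0r subr0 addr0.
split; (apply: mC_eq; [by move=> z; rewrite E|]).
  exact: (mC_M me (mC_comp1 mcos mt)).
exact: (mC_M me (mC_comp1 msin mt)).
Qed.

Definition cK : R := (s - 1) / (4 * pi).
Lemma cK_gt0 : 0 < cK.
Proof. by rewrite divr_gt0 ?subr_gt0// mulr_gt0// pi_gt0. Qed.

Definition kq (u w : C) : C := (0 -i* 2^-1) * (w - u^*).
Definition ker (u w : C) : C := cK%:C * cpow (- s) (kq u w).

Lemma Re_kq u w : Re (kq u w) = (Im u + Im w) / 2.
Proof. by rewrite /kq !cE; field. Qed.

Lemma Re_kq_gt0 u w : HP u -> HP w -> 0 < Re (kq u w).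
Proof. by move=> u0 w0; rewrite Re_kq divr_gt0// addr_gt0. Qed.

Lemma nsq_kq u w : nsq (kq u w) = nsq (w - u^*) / 4.
Proof. by rewrite nsqM /nsq !cE; field. Qed.

Lemma ker_neq0 u w : ker u w != 0.
Proof. by rewrite mulf_neq0 ?cpow_neq0// fmorph_eq0 gt_eqF// cK_gt0. Qed.

Lemma nsq_ker u w : HP u -> HP w -> nsq (ker u w) = cK ^+ 2 * (nsq (w - u^*) / 4) `^ (- s).
Proof. by move=> u0 w0; rewrite nsqM nsqR nsq_cpow ?Re_kq_gt0// nsq_kq. Qed.

Lemma ker_diag u : HP u -> ker u u = (cK * Im u `^ (- s))%:C.
Proof.
move=> u0; rewrite /ker; have -> : kq u u = (Im u)%:C by apply: eqC; rewrite /kq !cE; field.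
by rewrite cpow_real// -rmorphM.
Qed.

Lemma hol_ker u w : HP u -> HP w -> hol (ker u) w.
Proof.
move=> u0 w0; have hq : hol (kq u) w.
  exact: (@hol_M _ (fun=> 0 -i* 2^-1) _ _ (@hol_cst R _ _)
    (@hol_D _ id _ _ (@hol_id R w) (@hol_cst R (- u^*) w))).
have := @hol_comp _ (cpow (- s)) (kq u) w hq (@hol_cpow R (- s) (kq u w) (Re_kq_gt0 u0 w0)).
exact: (@hol_M _ (fun=> cK%:C) _ _ (@hol_cst R _ _)).
Qed.

Lemma mCC_ker u : mCC (ker u).
Proof.
apply: mCC_M; first exact: mCC_cst.
apply: mCC_cpow; apply: mCC_M; first exact: mCC_cst.
by apply: mCC_D; [exact: mCC_id|exact: mCC_cst].
Qed.

Definition L2 (f : C -> C) := mCC f /\ (hint (fun w => (nsq (f w) * Im w `^ s)%R) < +oo)%E.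

Lemma mC_nsqf (f : C -> C) : mCC f -> mC (fun w => nsq (f w)).
Proof. by move=> [m1 m2]; exact: (mC_comp (@mC_nsq R) m1 m2). Qed.

Lemma mC_dens (f : C -> C) : mCC f -> mC (fun w => nsq (f w) * Im w `^ s).
Proof. by move=> mf; apply: mC_M; [exact: mC_nsqf|apply: mC_powR; exact: mC_Im]. Qed.

Lemma L2_hi f : L2 f -> hi (fun w => nsq (f w) * Im w `^ s).
Proof.
by move=> [mf h]; apply: hi_ge0 => // [|w _]; [exact: mC_dens|rewrite mulr_ge0 ?nsq_ge0 ?powR_ge0].
Qed.

Lemma L2_dom (f g : C -> C) (k : R) : mCC f -> L2 g -> (forall w, HP w -> nsq (f w) <= k * nsq (g w)) -> L2 f.
Proof.
move=> mf hg h; split => //.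
have hk := hi_Z k (L2_hi hg).
have := hi_integrable hk; move=> _; have [mk hk2] := hk.
apply: le_lt_trans hk2; apply: hint_mono; [exact: mC_dens|exact: mC_abs|] => w w0.
rewrite mulr_ge0 ?nsq_ge0 ?powR_ge0//=; apply: le_trans (ler_norm _).
by rewrite mulrA ler_wpM2r ?powR_ge0// h.
Qed.

Lemma L2_Z a f : L2 f -> L2 (fun w => a * f w).
Proof.
move=> hf; apply: (@L2_dom _ f (nsq a)) => //; last by move=> w _; rewrite nsqM.
by apply: mCC_M; [exact: mCC_cst|exact: hf.1].
Qed.

Lemma nsqD_le (z w : C) : nsq (z + w) <= 2 * (nsq z + nsq w).
Proof.
rewrite /nsq !cE -subr_ge0; set a := Re z; set b := Re w; set c := Im z; set d := Im w.
have -> : 2 * (a ^+ 2 + c ^+ 2 + (b ^+ 2 + d ^+ 2)) - ((a + b) ^+ 2 + (c + d) ^+ 2) =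
  (a - b) ^+ 2 + (c - d) ^+ 2 by ring.
by rewrite addr_ge0 ?sqr_ge0.
Qed.

Lemma L2_bound2 (f g h : C -> C) (k : R) : mCC f -> L2 g -> L2 h ->
  (forall w, HP w -> nsq (f w) <= k * (nsq (g w) + nsq (h w))) -> L2 f.
Proof.
move=> mf hg hh H; split => //.
have hk := hi_Z k (hi_D (L2_hi hg) (L2_hi hh)); have [mk hk2] := hk.
apply: le_lt_trans hk2; apply: hint_mono; [exact: mC_dens|exact: mC_abs|] => w w0.
rewrite mulr_ge0 ?nsq_ge0 ?powR_ge0//=; apply: le_trans (ler_norm _).
by rewrite -mulrDl mulrA ler_wpM2r ?powR_ge0// H.
Qed.

Lemma L2_D f g : L2 f -> L2 g -> L2 (fun w => f w + g w).
Proof.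
move=> hf hg; apply: (@L2_bound2 _ f g 2) => //; last by move=> w _; exact: nsqD_le.
by apply: mCC_D; [exact: hf.1|exact: hg.1].
Qed.

Lemma reMJ_le (z w : C) : `|Re (z * w^*)| <= nsq z + nsq w.
Proof.
rewrite /nsq !cE ler_norml; set a := Re z; set b := Re w; set c := Im z; set d := Im w.
have := sqr_ge0 (a + b); have := sqr_ge0 (c + d); have := sqr_ge0 (a - b).
have := sqr_ge0 (c - d); have := sqr_ge0 a; have := sqr_ge0 b; have := sqr_ge0 c.
have := sqr_ge0 d.
have -> : (a + b) ^+ 2 = a ^+ 2 + 2 * (a * b) + b ^+ 2 by ring.
have -> : (c + d) ^+ 2 = c ^+ 2 + 2 * (c * d) + d ^+ 2 by ring.
have -> : (a - b) ^+ 2 = a ^+ 2 - 2 * (a * b) + b ^+ 2 by ring.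
have -> : (c - d) ^+ 2 = c ^+ 2 - 2 * (c * d) + d ^+ 2 by ring.
by rewrite mulrN opprK => *; apply/andP; split; lra.
Qed.

Lemma mC_reJ (f g : C -> C) : mCC f -> mCC g -> mC (fun w => Re (f w * (g w)^*)).
Proof. by move=> mf mg; have [] := mCC_M mf (mCC_J mg). Qed.

Lemma hi_ip (f g : C -> C) (h : C -> R) : L2 f -> L2 g -> mC h -> (forall w, HP w -> `|h w| <= 1) ->
  hi (fun w => Re (f w * (g w)^*) * h w * Im w `^ s).
Proof.
move=> hf hg mh h1; have [m h2] := hi_D (L2_hi hf) (L2_hi hg).
apply: (hi_dom (Q := fun w => nsq (f w) * Im w `^ s + nsq (g w) * Im w `^ s)) => //.
- apply: mC_M; last by apply: mC_powR; exact: mC_Im.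
  by apply: mC_M => //; apply: mC_reJ; [exact: hf.1|exact: hg.1].
- apply: le_lt_trans h2; apply: hint_mono => //; first exact: mC_abs.
  move=> w _; rewrite ler_norm andbT addr_ge0// mulr_ge0 ?nsq_ge0 ?powR_ge0//.
- move=> w w0; rewrite -mulrDl normrM [X in _ * X <= _]ger0_norm ?powR_ge0//.
  rewrite ler_wpM2r ?powR_ge0// normrM -[leRHS]mulr1 ler_pM//; first exact: reMJ_le.
  exact: h1.
Qed.

(** The square of the pseudohyperbolic distance. *)
Definition rhoc (u w : C) : R := nsq ((w - u) / (w - u^*)).

Let affine_HP (x y : R) (w : C) : 0 < y -> HP w -> HP (y%:C * w + x%:C).
Proof. by move=> y0 w0; rewrite HPE !cE mul0r !addr0 mulr_gt0. Qed.

Let affine_Im (x y : R) (w : C) : Im (y%:C * w + x%:C) = y * Im w.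
Proof. by rewrite !cE mul0r !addr0. Qed.

Lemma mCC_affine (f : C -> C) (x y : R) : mCC f -> mCC (fun w => f (y%:C * w + x%:C)).
Proof.
move=> [m1 m2]; have [h1 h2] := mCC_D (mCC_M (mCC_cst y%:C) (@mCC_id R)) (mCC_cst x%:C).
by split; [exact: (mC_comp m1)|exact: (mC_comp m2)].
Qed.

Lemma L2_affine (f : C -> C) (x y : R) : 0 < y -> L2 f -> L2 (fun w => f (y%:C * w + x%:C)).
Proof.
move=> y0 hf; have [mf h] := hf; have mfa := mCC_affine x y mf.
split => //; have hh := hi_Z (y `^ (- s)) (L2_hi hf); have [mh hh2] := hh.
apply: le_lt_trans hh2; rewrite -(@hint_affine_signed R y x _ y0 (mC_abs mh)).
apply: hint_mono.
- exact: mC_dens.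
- have [h1 h2] := mCC_D (mCC_M (mCC_cst y%:C) (@mCC_id R)) (mCC_cst x%:C).
  exact: (mC_comp (mC_abs mh) h1 h2).
- move=> w w0; rewrite mulr_ge0 ?nsq_ge0 ?powR_ge0//=; apply: le_trans (ler_norm _).
  rewrite affine_Im powRM ?(ltW y0) ?(ltW w0)// powRN.
  set k := nsq _; rewrite (_ : _ * (k * _) = k * Im w `^ s)//.
  by field; rewrite gt_eqF// powR_gt0.
Qed.

Lemma ker_affine u w : HP u -> HP w ->
  ker u ((Im u)%:C * w + (Re u)%:C) = (Im u `^ (- s))%:C * ker cI w.
Proof.
move=> u0 w0; rewrite /ker.
have -> : kq u ((Im u)%:C * w + (Re u)%:C) = (Im u)%:C * kq cI w.
  by apply: eqC; rewrite /kq /cI !cE; ring.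
have k0 : 0 < Re (kq cI w) by apply: Re_kq_gt0 => //; rewrite HPE /cI /= ltr01.
have k1 : 0 < Re ((Im u)%:C * kq cI w) by rewrite ReM ReR ImR mul0r subr0 mulr_gt0.
have u1 : 0 < Re (Im u)%:C by [].
rewrite (cpowM _ u1 k0 k1) (cpow_real _ u0).
by rewrite mulrCA.
Qed.

Lemma rhoc_affine (u w : C) : HP u -> HP w ->
  rhoc u ((Im u)%:C * w + (Re u)%:C) = nsq (cayley w).
Proof.
move=> u0 w0; rewrite /rhoc /cayley; congr nsq.
have -> : (Im u)%:C * w + (Re u)%:C - u = (Im u)%:C * (w - cI).
  by apply: eqC; rewrite /cI !cE; ring.
have -> : (Im u)%:C * w + (Re u)%:C - u^* = (Im u)%:C * (w + cI).
  by apply: eqC; rewrite /cI !cE; ring.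
rewrite -mulf_div divff ?mul1r// fmorph_eq0 gt_eqF//.
Qed.

Lemma rho1 (w : C) : HP w -> 1 - nsq (cayley w) = 4 * Im w / (Re w ^+ 2 + (Im w + 1) ^+ 2).
Proof.
move=> w0; have h := addI_neq0 w0; rewrite -nsq_gt0 in h.
have e : nsq (w + cI) = Re w ^+ 2 + (Im w + 1) ^+ 2 by rewrite /nsq /cI !cE addr0.
rewrite /cayley nsqM nsqV -e -{1}[1](divff (lt0r_neq0 h)) -mulrBl; congr (_ / _).
by rewrite /nsq /cI !cE; ring.
Qed.

Lemma ker_dens (w : C) : HP w -> nsq (ker cI w) * Im w `^ s = cK ^+ 2 * (1 - nsq (cayley w)) `^ s.
Proof.
move=> w0; have iH : HP cI by rewrite HPE /cI /= ltr01.
rewrite nsq_ker// -mulrA; congr (_ * _).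
have e : nsq (w - cI^*) = Re w ^+ 2 + (Im w + 1) ^+ 2.
  by rewrite /nsq /cI !cE oppr0 addr0 opprK.
have n0 : 0 < nsq (w - cI^*) by rewrite e ltr_wpDl ?sqr_ge0// exprn_gt0// addr_gt0.
rewrite rho1// -e.
have -> : 4 * Im w / nsq (w - cI^*) = (nsq (w - cI^*) / 4)^-1 * Im w by field; rewrite gt_eqF.
have p4 : 0 < nsq (w - cI^*) / 4 by rewrite divr_gt0.
rewrite powRN [RHS]powRM ?invr_ge0 ?(ltW w0) ?(ltW p4)//; congr (_ * _).
apply: (mulfI (lt0r_neq0 (powR_gt0 s p4))); rewrite mulfV ?gt_eqF ?powR_gt0//.
by rewrite -powRM ?invr_ge0 ?(ltW p4)// mulfV ?gt_eqF// powR1.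
Qed.

Lemma L2_ker_cI : L2 (ker cI).
Proof.
split; first exact: mCC_ker.
rewrite (@eq_hint _ _ (fun w => cK ^+ 2 * (4 * Im w / (Re w ^+ 2 + (Im w + 1) ^+ 2)) `^ s)); last first.
  by move=> w w0; rewrite ker_dens// rho1.
have mW : mC (fun w => (4 * Im w / (Re w ^+ 2 + (Im w + 1) ^+ 2)) `^ s).
  apply: mC_powR; apply: mC_M; first by apply: mC_M; [exact: mC_cst|exact: mC_Im].
  apply: mC_V; apply: mC_D; first by apply: mC_X; exact: mC_Re.
  by apply: mC_X; apply: mC_D; [exact: mC_Im|exact: mC_cst].
have hW : hi (fun w => (4 * Im w / (Re w ^+ 2 + (Im w + 1) ^+ 2)) `^ s).
  by apply: hi_ge0 => // [w _|]; [exact: powR_ge0|rewrite hint_kernel// ltry].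
by rewrite -rintK ?ltry//; exact: hi_Z.
Qed.

Lemma L2_ker u : HP u -> L2 (ker u).
Proof.
move=> u0; have y0 : 0 < (Im u)^-1 by rewrite invr_gt0.
have := L2_Z (Im u `^ (- s))%:C (L2_affine (- Re u / Im u) y0 L2_ker_cI) => h.
apply: (@L2_dom _ _ 1 (mCC_ker u) h) => w w0; rewrite mul1r.
set w' := _ * w + _.
have hw' : HP w' by exact: affine_HP.
have -> // : ker u w = (Im u `^ (- s))%:C * ker cI w'.
rewrite -ker_affine//; congr ker.
have uC : (Im u)%:C != 0 :> C by rewrite fmorph_eq0 gt_eqF.
rewrite /w' rmorphM rmorphN /= fmorphV; field.
by [].
Qed.

(** The fraction of the mass of the kernel that the radial weight [psi] retains, normalised so that
    the constant weight 1 gives 1. *)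
Definition cpsi (psi : R -> R) : R :=
  cK * rint (fun w : C => (1 - nsq (cayley w)) `^ s * psi (nsq (cayley w))).

Lemma hi_chi (psi : R -> R) : measurable_fun [set: R] psi -> (forall r, 0 <= psi r <= 1) ->
  hi (fun w : C => (1 - nsq (cayley w)) `^ s * psi (nsq (cayley w))).
Proof.
move=> mpsi psi0; have [m1 m2] := @mCC_cayley R.
have mr : mC (fun w : C => nsq (cayley w)) by exact: (mC_comp (@mC_nsq R) m1 m2).
have mW : mC (fun w : C => (1 - nsq (cayley w)) `^ s).
  by apply: mC_powR; apply: mC_D; [exact: mC_cst|exact: mC_N].
apply: (hi_dom (Q := fun w => (1 - nsq (cayley w)) `^ s)) => //.
- by apply: mC_M => //; exact: (mC_comp1 mpsi mr).
- rewrite (@eq_hint _ _ (fun w => (4 * Im w / (Re w ^+ 2 + (Im w + 1) ^+ 2)) `^ s)).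
    by rewrite hint_kernel// ltry.
  by move=> w w0; rewrite rho1.
- move=> w _; have /andP[h1 h2] := psi0 (nsq (cayley w)).
  by rewrite ger0_norm ?mulr_ge0 ?powR_ge0// ler_piMr ?powR_ge0.
Qed.

Lemma cpsi1 : cpsi (fun=> 1) = 1.
Proof.
rewrite /cpsi (@eq_rint _ _ (fun w => (4 * Im w / (Re w ^+ 2 + (Im w + 1) ^+ 2)) `^ s)).
  rewrite /rint hint_kernel//= /cK; have := pi_gt0 R => pi0.
  have h1 : s - 1 != 0 by rewrite gt_eqF// subr_gt0.
  have h2 : 4 * pi != 0 :> R by rewrite gt_eqF// mulr_gt0.
  by rewrite -(invf_div (4 * pi) (s - 1)) mulVf// mulf_neq0// invr_eq0.
by move=> w w0; rewrite mulr1 rho1.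
Qed.

Section ReproduceAtI.
Variables (f : C -> C) (p : C) (psi : R -> R).
Hypothesis fL2 : L2 f.
Hypothesis fc : forall w, HP w -> ccont f w.
Hypothesis fh : forall w, HP w -> w != p -> hol f w.
Hypothesis mpsi : measurable_fun [set: R] psi.
Hypothesis psi0 : forall r, 0 <= psi r <= 1.

Let iH : HP cI. Proof. by rewrite HPE /cI /= ltr01. Qed.

(** Write [f * ker^*] as [(f / ker) * |ker|^2]. With the weight, [|ker|^2] is radial about [i], so
    the rotation average evaluates the holomorphic quotient [f / ker] at [i]. *)
Lemma reproduce_at_I :
  rint (fun w => Re (f w * (ker cI w)^*) * psi (nsq (cayley w)) * Im w `^ s) =
  cpsi psi * Re (f cI).
Proof.
pose g w := f w / ker cI w.
have gE w : HP w -> Re (f w * (ker cI w)^*) * psi (nsq (cayley w)) * Im w `^ s =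
    cK ^+ 2 * (Re (g w) * ((1 - nsq (cayley w)) `^ s * psi (nsq (cayley w)))).
  move=> w0; have k0 := ker_neq0 cI w.
  have -> : f w * (ker cI w)^* = g w * (nsq (ker cI w))%:C.
    by rewrite -mulJ mulrA divfK.
  have -> : Re (g w * (nsq (ker cI w))%:C) = Re (g w) * nsq (ker cI w).
    by move: (g w) (nsq _) => x y; rewrite !cE mulr0 subr0.
  have := ker_dens w0; set n := nsq (ker cI w); set y := Im w `^ s => e.
  transitivity (Re (g w) * (n * y) * psi (nsq (cayley w))); first by ring.
  by rewrite e; ring.
have mg : mCC g by apply: mCC_M; [exact: fL2.1|apply: mCC_V; exact: mCC_ker].
have gc w : HP w -> ccont g w.
  move=> w0; apply: ccontM; first exact: fc.
  by apply: hol_ccont; apply: hol_V; [exact: ker_neq0|exact: hol_ker].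
have gh w : HP w -> w != p -> hol g w.
  move=> w0 wp; apply: (@hol_M _ f (fun w => (ker cI w)^-1)); first exact: fh.
  by apply: hol_V; [exact: ker_neq0|exact: hol_ker].
have mchi : measurable_fun [set: R] (fun r : R => (1 - r) `^ s * psi r).
  apply: measurable_funM => //.
  apply: (measurableT_comp (@measurable_powR R s) (g := fun r : R => 1 - r)).
  exact: measurable_funB.
have hP : hi (fun w => Re (g w) * ((1 - nsq (cayley w)) `^ s * psi (nsq (cayley w)))).
  have [mr1 mr2] := @mCC_cayley R.
  have mr : mC (fun w : C => nsq (cayley w)) by exact: (mC_comp (@mC_nsq R) mr1 mr2).
  have := @hi_ip f (ker cI) (fun w => psi (nsq (cayley w))) fL2 L2_ker_cI (mC_comp1 mpsi mr).
  move=> /(_ _)h; have {}h := h (fun w _ => ltac:(by have /andP[? ?] := psi0 (nsq (cayley w)); rewrite ger0_norm)).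
  apply: (eq_hi _ _ (hi_Z (cK ^- 2) h)).
    move=> w w0; rewrite gE// mulrA mulVf ?mul1r//.
    by rewrite expf_eq0 /= gt_eqF// cK_gt0.
  apply: mC_M; first exact: mg.1.
  exact: (mC_comp1 mchi mr).
rewrite (eq_rint gE) rint_Z// (rotation_average gc gh mg mchi hP (hi_chi mpsi psi0)).
rewrite /cpsi /g ker_diag// /cI /= powR1 mulr1.
have -> : Re (f (0 +i* 1) / cK%:C) = Re (f (0 +i* 1)) / cK.
  by rewrite -fmorphV !cE mulr0 subr0.
by field; rewrite gt_eqF// cK_gt0.
Qed.

End ReproduceAtI.

(* [psi = 1] is the reproducing formula, indicators localise it; the exceptional
   point [p] is there for quotients by a Blaschke factor, which are only known to
   be continuous at its zero. *)
Theorem reproduce (f : C -> C) (p : C) (psi : R -> R) (u : C) : L2 f ->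
  (forall w, HP w -> ccont f w) -> (forall w, HP w -> w != p -> hol f w) ->
  measurable_fun [set: R] psi -> (forall r, 0 <= psi r <= 1) -> HP u ->
  rint (fun w => Re (f w * (ker u w)^*) * psi (rhoc u w) * Im w `^ s) = cpsi psi * Re (f u).
Proof.
move=> fL2 fc fh mpsi psi0 u0; pose T w := (Im u)%:C * w + (Re u)%:C.
have TH w : HP w -> HP (T w) by exact: affine_HP.
have uC : (Im u)%:C != 0 :> C by rewrite fmorph_eq0 gt_eqF.
have TI : T cI = u by apply: eqC; rewrite /T /cI !cE; ring.
have Thol w : hol T w.
  exact: (@hol_D _ _ _ _ (@hol_M _ (fun=> (Im u)%:C) id w (@hol_cst R _ _) (@hol_id R w))
    (@hol_cst R (Re u)%:C w)).
have := @reproduce_at_I (f \o T) ((p - (Re u)%:C) / (Im u)%:C) psi (L2_affine (Re u) u0 fL2).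
move=> H; have {}H := H _ _ mpsi psi0.
rewrite /= TI in H; rewrite -H; last 2 first.
- by move=> w w0; apply: ccont_comp; [exact: fc (TH _ w0)|exact: hol_ccont].
- move=> w w0 wp; apply: hol_comp; first exact: Thol.
  apply: fh; first exact: TH.
  by apply: contra wp => /eqP <-; rewrite /T addrK mulrAC divff// mul1r.
have mP : mC (fun w => Re (f w * (ker u w)^*) * psi (rhoc u w) * Im w `^ s).
  apply: mC_M; last by apply: mC_powR; exact: mC_Im.
  apply: mC_M; first by apply: mC_reJ; [exact: fL2.1|exact: mCC_ker].
  apply: mC_comp1 => //; apply: mC_nsqf; apply: mCC_M; [|apply: mCC_V];
    by apply: mCC_D; (exact: mCC_id || exact: mCC_cst).
rewrite /rint; congr fine; apply: etrans (esym (hint_affine_signed (Re u) u0 mP)) _.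
apply: eq_hint => w w0.
rewrite -/(T w) ker_affine// rhoc_affine// affine_Im powRM ?(ltW u0) ?(ltW w0)// powRN.
have -> : Re (f (T w) * ((Im u `^ s)^-1%:C * ker cI w)^*) =
   (Im u `^ s)^-1 * Re (f (T w) * (ker cI w)^*).
  by move: (f (T w)) (ker cI w) => x y; rewrite !cE; ring.
by field; rewrite gt_eqF// powR_gt0.
Qed.

End Kernel.

(** * The weighted Bergman space *)

Section Limits.
Variable R : realType.
Local Notation C2 := (@complex_of_pair R).
Local Notation C := R[i].
Local Notation Re := (@complex.Re R).
Local Notation Im := (@complex.Im R).
Local Notation HP := (@upper_half_plane R).
Local Notation N := (@Normc.normc R).
Local Notation m2 := (@lebesgue_measure R \x @lebesgue_measure R)%E.
Local Open Scope complex_scope.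

(** Optimising in [t] turns a pointwise weighted bound into a product of integrals; [A = 0] calls
    for a large [t] instead of the optimal one. *)
Lemma sqr_le_weighted (x A B : R) : 0 <= A -> 0 <= B ->
  (forall t, 0 < t -> `|x| <= t * A + B / t) -> x ^+ 2 <= 4 * (A * B).
Proof.
move=> A0 B0 h; have [->|x0] := eqVneq x 0; first by rewrite expr0n !mulr_ge0.
have n0 : 0 < `|x| by rewrite normr_gt0.
rewrite -(real_normK (num_real x)); set n := `|x| in n0 h *.
have [A1|A1] := eqVneq A 0.
  have t0 : 0 < 2 * B / n + 1 by rewrite ltr_wpDl// divr_ge0 ?mulr_ge0// ltW.
  have := h _ t0; rewrite A1 mulr0 add0r ler_pdivlMr// mulrDr mulr1.
  by rewrite mulrC divfK ?gt_eqF//; lra.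
have Ap : 0 < A by rewrite lt_neqAle eq_sym A1.
have := h (n / (2 * A)) (divr_gt0 n0 (mulr_gt0 (ltr0n _ 2) Ap)).
have -> : n / (2 * A) * A = n / 2 by field.
have -> : B / (n / (2 * A)) = 2 * (A * B) / n by field; rewrite A1 gt_eqF.
move=> h2; have : n / 2 <= 2 * (A * B) / n by lra.
by rewrite ler_pdivlMr// expr2; lra.
Qed.

Lemma cauchy_real_cvg (a : nat -> R) :
  (forall e, 0 < e -> exists n0, forall m n, (n0 <= m)%N -> (n0 <= n)%N -> `|a m - a n| <= e) ->
  exists l : R, a n @[n --> \oo] --> l.
Proof.
move=> h; apply/cvg_ex/cauchy_cvgP/cauchy_exP => e e0.
have [n0 hn] := h (e / 2) (divr_gt0 e0 (ltr0n _ 2)); exists (a n0).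
exists n0 => // n /= h2; rewrite /ball/=; apply: le_lt_trans (hn n0 n (leqnn _) h2) _.
by lra.
Qed.

Lemma cvg_eps (a : nat -> R) (l : R) : a n @[n --> \oo] --> l ->
  forall e, 0 < e -> exists n0, forall n, (n0 <= n)%N -> `|a n - l| <= e.
Proof.
move=> /cvgrPdist_le h e /h[n0 _ hn]; exists n0 => n h2.
by rewrite distrC; exact: hn.
Qed.

Lemma hint_fatou (P : nat -> C -> R) Q (e : R) : (forall m, mC (P m)) -> mC Q ->
  (forall m w, 0 <= P m w) -> (forall w, HP w -> P m w @[m --> \oo] --> Q w) ->
  (forall m, (hint (P m) <= e%:E)%E) -> (hint Q <= e%:E)%E.
Proof.
move=> mP mQ P0 cP hP.
pose F m p := (P m (C2 p) * p.2 ^- 2)%:E.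
have := @fatou _ _ R m2 (@UH R) (@measurable_UH R) F (fun m => mC_weight (mP m)).
have F0 m p : UH p -> (0 <= F m p)%E.
  by move=> _; rewrite lee_fin mulr_ge0// invr_ge0 sqr_ge0.
move=> /(_ F0) h.
have -> : hint Q = (\int[m2]_(p in @UH R) limn_einf (F ^~ p))%E.
  apply: eq_integral => p /set_mem pU.
  have c : F ^~ p @ \oo --> (Q (C2 p) * p.2 ^- 2)%:E.
    by apply: cvg_EFin; [exact: nearW|apply: cvgM; [exact: cP|exact: cvg_cst]].
  by have [-> _] := cvg_limn_einf_sup c.
apply: le_trans h _; rewrite limn_einf_lim; apply: lime_le; first exact: is_cvg_einfs.
apply: nearW => k; apply: le_trans (hP k).
by apply: ereal_inf_lbound; exists k => /=.
Qed.

(* Values off the half-plane are junk; setting them to 0 makes Leibniz equality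
   of functions the right notion. *)
Definition cut (f : C -> C) (w : C) : C := if 0 < Im w then f w else 0.

Lemma cutE f w : HP w -> cut f w = f w.
Proof. by rewrite /cut HPE => ->. Qed.

Lemma cut_out f w : ~ HP w -> cut f w = 0.
Proof. by rewrite /cut HPE => /negP/negbTE ->. Qed.

(** The function is constant on the squares of a grid, so any preimage is a countable union of
    squares, whatever [G] is. *)
Lemma measurable_floor_grid (G : int -> int -> R) (k : R) : 0 < k ->
  measurable_fun [set: R * R] (fun p => G (Num.floor (k * p.1)) (Num.floor (k * p.2))).
Proof.
move=> k0 _ Y mY; rewrite setTI.
pose A (i : int) : set R := [set x | Num.floor (k * x) = i].
have mA i : measurable (A i).
  have -> : A i = (fun x => k * x) @^-1` `[i%:~R, (i + 1)%:~R[%classic.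
    apply/seteqP; split => x /=; rewrite in_itv/=.
      by move=> <-; exact: floor_itv.
    by move=> h; apply: floor_def.
  rewrite -[X in measurable X]setTI.
  by apply: (measurable_funM (measurable_cst k) (@measurable_id _ _ setT)).
pose B (ij : int * int) : set (R * R) := if `[< Y (G ij.1 ij.2) >] then A ij.1 `*` A ij.2 else set0.
have -> : (fun p => G (Num.floor (k * p.1)) (Num.floor (k * p.2))) @^-1` Y = \bigcup_ij B ij.
  apply/seteqP; split => [[x y] /= h|[x y] [[i j] _]].
    by exists (Num.floor (k * x), Num.floor (k * y)) => //=; rewrite /B /=; case: asboolP.
  rewrite /B /=; case: asboolP => //= h [hx hy].
  by rewrite (hx : Num.floor (k * x) = i) (hy : Num.floor (k * y) = j).
apply: countable_bigcupT_measurable; first exact: countableP.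
by move=> [i j]; rewrite /B; case: ifP => _ //; exact: measurableX.
Qed.

Lemma mCC_cut_cont (f : C -> C) : (forall w, HP w -> ccont f w) -> mCC (cut f).
Proof.
move=> fc.
pose x n (t : R) : R := (Num.floor (n.+1%:R * t))%:~R / n.+1%:R.
(* The sample point is a corner of the grid square of [w]. The upper corner is chosen, for it lies
   in the half-plane whenever [w] does. *)
pose W n w : C := x n (Re w) +i* (x n (Im w) + n.+1%:R^-1).
have xb n t : x n t <= t < x n t + n.+1%:R^-1.
  have n0 : 0 < n.+1%:R :> R by rewrite ltr0n.
  rewrite /x -[X in _ + X]mul1r -mulrDl ler_pdivrMr// ltr_pdivlMr//.
  by have := floor_itv (n.+1%:R * t); rewrite intrD [t * _]mulrC.
have posE (w : C) : \1_[set y : R | 0 < y] (Im w) = if 0 < Im w then 1 else 0 :> R.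
  rewrite indicE (_ : (Im w \in _) = (0 < Im w)); first by case: ifP.
  by apply/idP/idP => [/set_mem|/mem_set].
have key (part : C -> R) : (forall z, `|part z| <= N z) -> (forall z w, part (z - w) = part z - part w) ->
    mC (fun w => \1_[set y | 0 < y] (Im w) * part (f w)).
  move=> pN pB.
  suff : measurable_fun [set: R * R] (fun p => \1_[set y | 0 < y] p.2 * part (f (C2 p))) by [].
  apply: (measurable_fun_cvg (h :=
    fun n (p : R * R) => \1_[set y | 0 < y] p.2 * part (f (W n (C2 p))))).
    move=> n; apply: measurable_funM.
      apply: (measurableT_comp (@measurable_indic _ _ R setT _ _)) => //.
      have -> : [set y : R | 0 < y] = `]0, +oo[%classic by apply/seteqP; split => y /=; rewrite in_itv/= andbT.
      by [].
    apply: (@measurable_floor_grid (fun i j => part (f ((i%:~R / n.+1%:R) +i* (j%:~R / n.+1%:R + n.+1%:R^-1))))).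
    by rewrite ltr0n.
  move=> [a b] _ /=; rewrite indicE; have [b0|b0] := boolP (b \in [set y : R | 0 < y]); last first.
    by under eq_fun do rewrite mul0r; rewrite mul0r; exact: cvg_cst.
  under eq_fun do rewrite mul1r; rewrite mul1r.
  apply/cvgrPdist_le => e e0.
  have [d d0 hd] := fc (a +i* b) (set_mem b0) e e0.
  have [n0 hn0] : exists n0 : nat, 2 / d < n0%:R.
    by exists (Num.truncn (2 / d)).+1; rewrite truncnS_gt// divr_ge0// ltW.
  exists n0 => // n /= nn.
  have np : 0 < n.+1%:R :> R by rewrite ltr0n.
  have nd : 2 * n.+1%:R^-1 < d.
    rewrite ltr_pdivrMr// mulrC -ltr_pdivrMr//; apply: lt_le_trans hn0 _.
    by rewrite ler_nat ltnW.
  have /andP[a1 a2] := xb n a; have /andP[b1 b2] := xb n b.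
  rewrite distrC -pB; apply: le_trans (pN _) _.
  have -> : W n (a +i* b) = (a +i* b) + ((x n a - a) +i* (x n b + n.+1%:R^-1 - b)).
    by apply: eqC; rewrite /W !cE; ring.
  apply: hd; apply: le_lt_trans (normc_le _) _; rewrite !cE.
  set v := n.+1%:R^-1 in a2 b2 nd *.
  by rewrite ler0_norm ?subr_le0// ger0_norm ?subr_ge0 ?(ltW b2)//; lra.
split.
  apply: mC_eq (key Re (@Re_le_normc R) (fun z w => ltac:(by rewrite ReD ReN))).
  by move=> w; rewrite posE /cut; case: ifP => _; rewrite ?mul1r ?mul0r.
apply: mC_eq (key Im (@Im_le_normc R) (fun z w => ltac:(by rewrite ImD ImN))).
by move=> w; rewrite posE /cut; case: ifP => _; rewrite ?mul1r ?mul0r.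
Qed.

End Limits.

Section BergmanSpace.
Variables (R : realType) (s : R).
Hypothesis s1 : 1 < s.
Local Notation C := R[i].
Local Notation Re := (@complex.Re R).
Local Notation Im := (@complex.Im R).
Local Notation HP := (@upper_half_plane R).
Local Notation cI := (@cI R).
Local Notation N := (@Normc.normc R).
Local Notation ker := (@ker R s).
Local Notation L2 := (@L2 R s).
Local Notation cK := (@cK R s).
Local Open Scope complex_scope.

(* The real part of the Hermitian product: the space is used as a real Hilbert
   space, complex linearity being recovered by [equiv_mulI]. *)
Definition ip (f g : C -> C) : R := rint (fun w => Re (f w * (g w)^*) * Im w `^ s).

Lemma hi_ip1 f g : L2 f -> L2 g -> hi (fun w => Re (f w * (g w)^*) * Im w `^ s).
Proof.
move=> hf hg; have := @hi_ip R s f g (fun=> 1) hf hg (mC_cst 1).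
move=> /(_ (fun w _ => ltac:(by rewrite normr1))).
apply: eq_hi; first by move=> w _; rewrite mulr1.
by apply: mC_M; [apply: mC_reJ; [exact: hf.1|exact: hg.1]|apply: mC_powR; exact: mC_Im].
Qed.

Lemma eq_ip f f' g g' : (forall w, HP w -> f w = f' w) -> (forall w, HP w -> g w = g' w) ->
  ip f g = ip f' g'.
Proof. by move=> ef eg; apply: eq_rint => w w0; rewrite ef// eg. Qed.

Lemma ip_sym f g : ip f g = ip g f.
Proof. by apply: eq_rint => w _; congr (_ * _); rewrite !cE; ring. Qed.

Lemma ip_add f g h : L2 f -> L2 g -> L2 h -> ip (fun w => f w + g w) h = ip f h + ip g h.
Proof.
move=> hf hg hh; rewrite /ip -rint_D//; [|exact: hi_ip1|exact: hi_ip1].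
by apply: eq_rint => w _; rewrite -mulrDl -ReD -mulrDl.
Qed.

Lemma ip_scale (r : R) f g : L2 f -> L2 g -> ip (fun w => r%:C * f w) g = r * ip f g.
Proof.
move=> hf hg; rewrite /ip -rint_Z//; last exact: hi_ip1.
by apply: eq_rint => w _; rewrite !cE; ring.
Qed.

Lemma ip_mulC (a : C) f g : ip (fun w => a * f w) g = ip f (fun w => a^* * g w).
Proof. by apply: eq_rint => w _; congr (_ * _); rewrite !cE; ring. Qed.

Lemma ip_nsq f : ip f f = rint (fun w => nsq (f w) * Im w `^ s).
Proof. by apply: eq_rint => w _; rewrite mulJ. Qed.

Lemma ip_pos f : 0 <= ip f f.
Proof. by rewrite ip_nsq; apply: rint_ge0 => w _; rewrite mulr_ge0 ?nsq_ge0 ?powR_ge0. Qed.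

Lemma ip_hint f : L2 f -> (ip f f)%:E = hint (fun w => nsq (f w) * Im w `^ s).
Proof. by move=> hf; rewrite ip_nsq rintK//; exact: L2_hi. Qed.

Lemma ip_le f g (k : R) : L2 f -> L2 g -> (forall w, HP w -> nsq (f w) <= k * nsq (g w)) ->
  ip f f <= k * ip g g.
Proof.
move=> hf hg h; rewrite !ip_nsq -rint_Z; last exact: L2_hi.
apply: rint_le; [exact: L2_hi|by apply: hi_Z; exact: L2_hi|] => w w0.
by rewrite mulrA ler_wpM2r ?powR_ge0// h.
Qed.

(** A crude Cauchy-Schwarz inequality for bare functions, which form no module at this stage; the
    sharp constant comes with the vector space structure. *)
Lemma ip_cs4 f g : L2 f -> L2 g -> ip f g ^+ 2 <= 4 * (ip f f * ip g g).
Proof.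
move=> hf hg; apply: sqr_le_weighted => [||t t0]; [exact: ip_pos|exact: ip_pos|].
rewrite [ip g g / t]mulrC !ip_nsq -!rint_Z; [|exact: L2_hi|exact: L2_hi].
have hF := hi_Z t (L2_hi hf); have hG := hi_Z t^-1 (L2_hi hg).
rewrite -rint_D//; have hR := hi_D hF hG; have hfg := hi_ip1 hf hg.
have bound w : HP w -> `|Re (f w * (g w)^*) * Im w `^ s| <=
    t * (nsq (f w) * Im w `^ s) + t^-1 * (nsq (g w) * Im w `^ s).
  move=> w0; rewrite normrM [X in _ * X <= _]ger0_norm ?powR_ge0//.
  rewrite !mulrA -mulrDl ler_wpM2r ?powR_ge0//.
  have r0 : 0 < Num.sqrt t by rewrite sqrtr_gt0.
  have rr : Num.sqrt t ^+ 2 = t by rewrite sqr_sqrtr// ltW.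
  have := reMJ_le ((Num.sqrt t)%:C * f w) ((Num.sqrt t)^-1%:C * g w).
  rewrite !nsqM !nsqR rr exprVn rr; congr (`|_| <= _).
  rewrite !cE; field; rewrite gt_eqF//.
have h1 : ip f g <= rint (fun z => t * (nsq (f z) * Im z `^ s) + t^-1 * (nsq (g z) * Im z `^ s)).
  by apply: rint_le => // w /bound; rewrite ler_norml => /andP[].
have h2 : - ip f g <= rint (fun z => t * (nsq (f z) * Im z `^ s) + t^-1 * (nsq (g z) * Im z `^ s)).
  rewrite -mulN1r /ip -rint_Z//; apply: rint_le => //; first exact: hi_Z.
  by move=> w /bound; rewrite ler_norml mulN1r => /andP[]; lra.
by rewrite ler_norml; apply/andP; split; lra.
Qed.

(** The reproducing identity takes the place of holomorphy, because it passes to limits in norm,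
    which makes completeness direct. Testing against all complex [a] recovers the value [f u] from a
    real product. *)
Definition X0 (f : C -> C) := [/\ L2 f, forall w, ~ HP w -> f w = 0 &
  forall u a, HP u -> Re (f u * a^*) = ip f (fun w => a * ker u w)].

Let L2k u a : HP u -> L2 (fun w => a * ker u w).
Proof. by move=> u0; apply: L2_Z; exact: L2_ker. Qed.

Lemma X0_add f g : X0 f -> X0 g -> X0 (fun w => f w + g w).
Proof.
move=> [lf of_ rf] [lg og rg]; split; first exact: L2_D.
  by move=> w h; rewrite of_// og// addr0.
by move=> u a u0; rewrite mulrDl ReD rf// rg// ip_add//; exact: L2k.
Qed.

Lemma X0_mulC a f : X0 f -> X0 (fun w => a * f w).
Proof.
move=> [lf of_ rf]; split; first exact: L2_Z.
  by move=> w h; rewrite of_// mulr0.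
move=> u b u0; rewrite ip_mulC.
have -> : Re (a * f u * b^*) = Re (f u * (a^* * b)^*) by rewrite !cE; ring.
by rewrite rf//; congr ip; apply/funext => w; rewrite mulrA.
Qed.

Lemma L2_cut f : L2 f -> mCC (cut f) -> L2 (cut f).
Proof. by move=> hf mf; apply: (@L2_dom R s _ f 1) => // w w0; rewrite cutE// mul1r. Qed.

Theorem X0_hol f p : L2 f -> (forall w, HP w -> ccont f w) ->
  (forall w, HP w -> w != p -> hol f w) -> X0 (cut f).
Proof.
move=> lf fc fh; have lc := L2_cut lf (mCC_cut_cont fc).
split => // [w h|u a u0]; first exact: cut_out.
rewrite cutE// (_ : ip _ _ = ip f (fun w => a * ker u w)); last first.
  by apply: eq_ip => // w w0; rewrite cutE.
have := @reproduce R s s1 (fun w => a^* * f w) p (fun=> 1) u (L2_Z _ lf).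
move=> H; have {}H := H _ _ (measurable_cst _) (fun=> ltac:(by rewrite ler01 lexx)) u0.
rewrite (cpsi1 s1) mul1r in H; rewrite mulrC -H.
- by apply: eq_rint => w w0; move: (f w) (ker u w) => x y; rewrite !cE; ring.
- move=> w w0; apply: ccontM; last exact: fc.
  by apply: hol_ccont; exact: hol_cst.
- move=> w w0 wp; exact: (@hol_M _ (fun=> a^*) f w (@hol_cst R _ _) (fh w w0 wp)).
Qed.

Lemma X0_ker u a : HP u -> X0 (cut (fun w => a * ker u w)).
Proof.
move=> u0; have h w : HP w -> hol (fun w => a * ker u w) w.
  by move=> w0; exact: (@hol_M _ (fun=> a) _ w (@hol_cst R _ _) (@hol_ker R s u w u0 w0)).
apply: (@X0_hol _ cI); first exact: L2k.
  by move=> w /h; exact: hol_ccont.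
by move=> w w0 _; exact: h.
Qed.

Lemma X0_ext f g : (forall w, HP w -> f w = g w) -> X0 f -> X0 g -> f = g.
Proof.
move=> e [_ hf _] [_ hg _]; apply/funext => w.
by have [/e//|h] := pselect (HP w); rewrite hf// hg.
Qed.

Lemma X0_0 : X0 (fun=> 0).
Proof.
have iH : HP cI by rewrite HPE /cI /= ltr01.
have -> : (fun=> 0 : C) = (fun w => 0 * cut (fun w => 0 * ker cI w) w).
  by apply/funext => w; rewrite mul0r.
by apply: X0_mulC; exact: X0_ker.
Qed.

Definition XP (f : C -> C) := `[< X0 f >].
(* The proof that [1 < s] is recorded in the type so that it can be inferred
   when the module structure is. *)
Definition bspace (_ : 1 < s) := {f : C -> C | XP f}.
Local Notation XT := (bspace s1).

HB.instance Definition _ := SubChoice.on XT.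

Lemma XT_X0 (f : XT) : X0 (val f). Proof. exact/asboolP/(valP f). Qed.
Definition mkX f (h : X0 f) : XT := Sub f (introT (asboolP _) h).

Definition XT_zero := mkX X0_0.
Definition XT_add (f g : XT) := mkX (X0_add (XT_X0 f) (XT_X0 g)).
Definition XT_mulC (a : C) (f : XT) := mkX (X0_mulC a (XT_X0 f)).
Definition XT_opp (f : XT) := XT_mulC (-1) f.

Lemma XT_addA : associative XT_add.
Proof. by move=> f g h; apply: val_inj; apply/funext => w /=; rewrite addrA. Qed.
Lemma XT_addC : commutative XT_add.
Proof. by move=> f g; apply: val_inj; apply/funext => w /=; rewrite addrC. Qed.
Lemma XT_add0 : left_id XT_zero XT_add.
Proof. by move=> f; apply: val_inj; apply/funext => w /=; rewrite add0r. Qed.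
Lemma XT_addN : left_inverse XT_zero XT_opp XT_add.
Proof. by move=> f; apply: val_inj; apply/funext => w /=; rewrite mulN1r addNr. Qed.

HB.instance Definition _ := GRing.isZmodule.Build XT XT_addA XT_addC XT_add0 XT_addN.

Definition XT_scale (r : R) (f : XT) := XT_mulC r%:C f.

Lemma XT_scaleA a b f : XT_scale a (XT_scale b f) = XT_scale (a * b) f.
Proof. by apply: val_inj; apply/funext => w /=; rewrite mulrA -rmorphM. Qed.
Lemma XT_scale1 : left_id 1 XT_scale.
Proof. by move=> f; apply: val_inj; apply/funext => w /=; rewrite mul1r. Qed.
Lemma XT_scaleDr : right_distributive XT_scale +%R.
Proof. by move=> a f g; apply: val_inj; apply/funext => w /=; rewrite mulrDr. Qed.
Lemma XT_scaleDl f : {morph XT_scale^~ f : a b / a + b}.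
Proof. by move=> a b; apply: val_inj; apply/funext => w /=; rewrite rmorphD mulrDl. Qed.

HB.instance Definition _ := GRing.Zmodule_isLmodule.Build R XT
  XT_scaleA XT_scale1 XT_scaleDr XT_scaleDl.

Definition xip (f g : XT) : R := ip (val f) (val g).

Lemma XT_L2 (f : XT) : L2 (val f). Proof. by have [] := XT_X0 f. Qed.

Lemma xipC f g : xip f g = xip g f. Proof. exact: ip_sym. Qed.
Lemma xipD f g h : xip (f + g) h = xip f h + xip g h.
Proof. by apply: ip_add; exact: XT_L2. Qed.
Lemma xipZ a f g : xip (a *: f) g = a * xip f g.
Proof. by apply: ip_scale; exact: XT_L2. Qed.
Lemma xip_ge0 f : 0 <= xip f f. Proof. exact: ip_pos. Qed.

Definition kerX u (u0 : HP u) (a : C) : XT := mkX (X0_ker a u0).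

Lemma xip_ker (f : XT) u (u0 : HP u) a : xip f (kerX u0 a) = Re (val f u * a^*).
Proof.
have [_ _ h] := XT_X0 f; rewrite h//; apply: eq_ip => // w w0.
by rewrite /= cutE.
Qed.

Lemma kerXE u (u0 : HP u) a w : HP w -> val (kerX u0 a) w = a * ker u w.
Proof. by move=> w0; rewrite /= cutE. Qed.

Lemma xip_kerK u (u0 : HP u) a : xip (kerX u0 a) (kerX u0 a) = nsq a * (cK * Im u `^ (- s)).
Proof.
rewrite xip_ker kerXE// ker_diag//.
by rewrite mulrAC mulJ -rmorphM.
Qed.

Lemma xip_cs f g : xip f g ^+ 2 <= xip f f * xip g g.
Proof. exact: (form_cs xipC xipD xipZ xip_ge0). Qed.

Lemma xip_bound (f : XT) u : HP u -> nsq (val f u) <= cK * Im u `^ (- s) * xip f f.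
Proof.
move=> u0; have := xip_cs f (kerX u0 (val f u)).
rewrite xip_ker mulJ xip_kerK; set n := nsq _.
have n0 : 0 <= n by exact: nsq_ge0.
rewrite ReR => h; have [n1|n1] := eqVneq n 0.
  rewrite n1; apply: mulr_ge0; last exact: xip_ge0.
  by apply: mulr_ge0; [exact: ltW (cK_gt0 s1)|exact: powR_ge0].
have np : 0 < n by rewrite lt_neqAle eq_sym n1.
rewrite -(ler_pM2l np) -expr2; apply: le_trans h _.
by rewrite le_eqVlt; apply/orP; left; apply/eqP; ring.
Qed.

Lemma xip_eq0 f : xip f f = 0 -> f = 0.
Proof.
move=> h; apply: val_inj; apply: X0_ext; [|exact: XT_X0|exact: XT_X0] => w w0.
have := xip_bound f w0; rewrite h mulr0 => h2; apply/eqP.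
by rewrite -nsq_eq0 eq_le h2 nsq_ge0.
Qed.

Lemma L2_small f e : mCC f -> (hint (fun w => (nsq (f w) * Im w `^ s)%R) <= e%:E)%E ->
  L2 f /\ ip f f <= e.
Proof.
move=> mf h; have lf : L2 f by split => //; exact: le_lt_trans h (ltry _).
by split => //; rewrite -lee_fin ip_hint.
Qed.

(** Evaluations are bounded, so a Cauchy sequence converges pointwise; Fatou's lemma upgrades this
    to convergence in norm, under which the reproducing identity persists. *)
Lemma X0_complete (f : nat -> XT) :
  (forall e, 0 < e -> exists n0, forall m n, (n0 <= m)%N -> (n0 <= n)%N ->
     xip (f m - f n) (f m - f n) <= e) -> exists x, cvto xip f x.
Proof.
move=> cau.
have sub m n w : val (f m - f n) w = val (f m) w - val (f n) w by rewrite /= mulN1r.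
have subf m n : val (f m - f n) = (fun w => val (f m) w - val (f n) w).
  by apply/funext => w; rewrite sub.
have pw w : HP w -> forall e, 0 < e -> exists n0, forall m n, (n0 <= m)%N -> (n0 <= n)%N ->
    N (val (f m) w - val (f n) w) <= e.
  move=> w0 e e0; have k0 : 0 < cK * Im w `^ (- s) by apply: mulr_gt0; [exact: cK_gt0|exact: powR_gt0].
  have [n0 hn] := cau _ (divr_gt0 (exprn_gt0 2 e0) k0); exists n0 => m n hm h.
  rewrite -ler_sqr ?nnegrE ?normc_ge0 ?(ltW e0)// normc_sqr -sub.
  apply: le_trans (xip_bound _ w0) _; rewrite mulrC -ler_pdivlMr//; exact: hn.
have lim w : exists l : C, (HP w -> (fun n => Re (val (f n) w)) @ \oo --> Re l) /\
     (HP w -> (fun n => Im (val (f n) w)) @ \oo --> Im l) /\ (~ HP w -> l = 0).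
  have [w0|h] := pselect (HP w); last by exists 0.
  have [a ha] : exists a : R, (fun n => Re (val (f n) w)) @ \oo --> a.
    apply: cauchy_real_cvg => e /(pw w w0)[n0 hn]; exists n0 => m n hm h.
    by apply: le_trans (hn m n hm h); rewrite -ReN -ReD Re_le_normc.
  have [b hb] : exists b : R, (fun n => Im (val (f n) w)) @ \oo --> b.
    apply: cauchy_real_cvg => e /(pw w w0)[n0 hn]; exists n0 => m n hm h.
    by apply: le_trans (hn m n hm h); rewrite -ImN -ImD Im_le_normc.
  by exists (a +i* b).
have [F hF] := choice lim.
have mF : mCC F.
  have cutm (part : C -> R) : (forall n, mC (fun w => part (val (f n) w))) ->
      (forall w, (fun n => part (val (f n) w)) @ \oo --> part (F w)) -> mC (fun w => part (F w)).
    by move=> h1 h2; apply: (measurable_fun_cvg h1) => p _; exact: h2.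
  have out w n : ~ HP w -> val (f n) w = 0 by have [_ h _] := XT_X0 (f n); exact: h.
  split; apply: cutm => [n|w].
  - exact: (XT_L2 (f n)).1.1.
  - have [w0|w0] := pselect (HP w); first by have [h _] := hF w; exact: h.
    have [_ [_ ->]] := hF w; last by [].
    by under eq_fun do rewrite (out _ _ w0); exact: cvg_cst.
  - exact: (XT_L2 (f n)).1.2.
  - have [w0|w0] := pselect (HP w); first by have [_ [h _]] := hF w; exact: h.
    have [_ [_ ->]] := hF w; last by [].
    by under eq_fun do rewrite (out _ _ w0); exact: cvg_cst.
have close e : 0 < e -> exists n0, forall n, (n0 <= n)%N ->
    L2 (fun w => val (f n) w - F w) /\ ip (fun w => val (f n) w - F w) (fun w => val (f n) w - F w) <= e.
  move=> e0; have [n0 hn] := cau e e0; exists n0 => n h.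
  have mS m : mCC (fun w => val (f n) w - val (f m) w).
    by rewrite -subf; exact: (XT_L2 (f n - f m)).1.
  have mD : mCC (fun w => val (f n) w - F w).
    have := mCC_D (XT_L2 (f n)).1 (mCC_M (mCC_cst (-1)) mF).
    by under eq_fun do rewrite mulN1r.
  apply: L2_small => //.
  apply: (@hint_fatou R (fun m w => nsq (val (f n) w - val (f (n0 + m)%N) w) * Im w `^ s)).
  - by move=> m; exact: mC_dens.
  - exact: mC_dens.
  - by move=> m w; rewrite mulr_ge0 ?nsq_ge0 ?powR_ge0.
  - move=> w w0; have [h1 [h2 _]] := hF w; have {}h1 := h1 w0; have {}h2 := h2 w0.
    have s1' : (fun m => Re (val (f (n0 + m)%N) w)) @ \oo --> Re (F w).
      by have := h1; rewrite -(cvg_shiftn n0); under eq_fun do rewrite addnC.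
    have s2' : (fun m => Im (val (f (n0 + m)%N) w)) @ \oo --> Im (F w).
      by have := h2; rewrite -(cvg_shiftn n0); under eq_fun do rewrite addnC.
    rewrite /nsq !cE; under eq_fun do rewrite !cE.
    apply: cvgM; last exact: cvg_cst.
    by apply: cvgD; rewrite expr2; under eq_fun do rewrite expr2;
      (apply: cvgM; apply: cvgB => //; exact: cvg_cst).
  - move=> m; have := hn n (n0 + m)%N h (leq_addr _ _).
    rewrite /xip -lee_fin ip_hint; last exact: XT_L2.
    by rewrite subf.
have [n1 hn1] := close 1 ltr01; have {hn1} [lD _] := hn1 n1 (leqnn _).
have FE g : F = (fun w => g w + (-1) * (g w - F w)).
  by apply/funext => w; rewrite mulN1r opprB addrCA subrr addr0.
have lF : L2 F.
  by rewrite (FE (val (f n1))); apply: L2_D; [exact: XT_L2|exact: L2_Z].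
have X0F : X0 F.
  split => // [w h|u a u0]; first by have [_ [_ ->]] := hF w.
  apply/eqP; rewrite -subr_eq0; apply/eqP/eps_eq0 => e e0.
  have kk0 : 0 < 4 * (ip (fun w => a * ker u w) (fun w => a * ker u w) + 1).
    by rewrite mulr_gt0// ltr_wpDl// ip_pos.
  have e2 : 0 < e / 2 by rewrite divr_gt0.
  have [n2 h2] := close ((e / 2) ^+ 2 / (4 * (ip (fun w => a * ker u w) (fun w => a * ker u w) + 1)))
     (divr_gt0 (exprn_gt0 2 e2) kk0).
  have c1 : (fun n => Re (val (f n) u * a^*)) @ \oo --> Re (F u * a^*).
    have [h1 [h1' _]] := hF u; have {}h1 := h1 u0; have {}h1' := h1' u0.
    rewrite !cE; under eq_fun do rewrite !cE.
    by apply: cvgB; apply: cvgM => //; exact: cvg_cst.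
  have [n3 h3] := cvg_eps c1 e2.
  pose n := (n2 + n3)%N; have {}h3 := h3 n (leq_addl _ _).
  have {h2} [l2 h2] := h2 n (leq_addr _ _).
  have [_ _ rep] := XT_X0 (f n); have {}rep := rep u a u0.
  have h4 : `|ip (fun w => val (f n) w - F w) (fun w => a * ker u w)| <= e / 2.
    rewrite -[leRHS]ger0_norm ?(ltW e2)// -ler_sqr ?nnegrE//.
    rewrite !real_normK ?num_real//; apply: le_trans (ip_cs4 l2 (L2k a u0)) _.
    have k0 := ip_pos (fun w => a * ker u w); set k := ip _ _ in k0 kk0 h2 *.
    move: h2; set d := ip _ _; rewrite ler_pdivlMr// => h2.
    by have := ip_pos (fun w => val (f n) w - F w); rewrite -/d => d0; nra.
  have h5 : ip (val (f n)) (fun w => a * ker u w) - ip F (fun w => a * ker u w) =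
      ip (fun w => val (f n) w - F w) (fun w => a * ker u w).
    apply/eqP; rewrite subr_eq; apply/eqP; rewrite -ip_add//; last exact: L2k.
    by apply: eq_ip => // w _; rewrite subrK.
  rewrite (_ : _ - _ = (ip (val (f n)) (fun w => a * ker u w) - ip F (fun w => a * ker u w)) -
    (Re (val (f n) u * a^*) - Re (F u * a^*))); last by rewrite rep; ring.
  by apply: le_trans (ler_normB _ _) _; rewrite h5; lra.
exists (mkX X0F) => e e0; have [n0 hn] := close e e0; exists n0 => n /hn[_ h].
by apply: le_trans h; rewrite /xip le_eqVlt; apply/orP; left; apply/eqP/eq_ip => w _ /=; rewrite mulN1r.
Qed.

End BergmanSpace.

(** * Holomorphy of the elements and division by Blaschke factors *)

Section BergmanHolomorphic.
Variables (R : realType) (s : R).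
Hypothesis s1 : 1 < s.
Local Notation C := R[i].
Local Notation Re := (@complex.Re R).
Local Notation Im := (@complex.Im R).
Local Notation HP := (@upper_half_plane R).
Local Notation cI := (@cI R).
Local Notation N := (@Normc.normc R).
Local Notation ker := (@ker R s).
Local Notation L2 := (@L2 R s).
Local Notation X0 := (@X0 R s).
Local Notation ip := (@ip R s).
Local Open Scope complex_scope.

Lemma ip_right_linear (f D : C -> C) : L2 f -> L2 D ->
  exists L : C, forall b, Re (L * b^*) = ip f (fun w => b * D w).
Proof.
move=> hf hD; exists (ip f D +i* ip f (fun w => cI * D w)) => b.
have hiD := L2_Z cI hD; rewrite [RHS]ip_sym.
have -> : ip (fun w => b * D w) f =
    ip (fun w => (Re b)%:C * D w + (Im b)%:C * (cI * D w)) f.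
  apply: eq_ip => // w _; rewrite mulrA -mulrDl; congr (_ * _).
  by apply: eqC; rewrite /cI !cE; ring.
rewrite ip_add//; [|exact: L2_Z|exact: L2_Z].
rewrite !ip_scale// [ip D f]ip_sym [ip _ f]ip_sym !cE; ring.
Qed.

Lemma Im_le_N_kq u w : HP u -> HP w -> Im u <= N (w - u^*).
Proof.
move=> u0 w0; have := Im_le_normc (w - u^*); apply: le_trans.
by rewrite !cE opprK; apply: le_trans (ler_norm _); rewrite lerDr ltW.
Qed.

Lemma sub_conj_neq0 (u w : C) : HP u -> HP w -> w - u^* != 0.
Proof.
move=> u0 w0; apply/eqP => /(congr1 Im); rewrite !cE opprK => h.
by have := addr_gt0 w0 u0; rewrite h ltxx.
Qed.

(** Differentiate the kernel in place of the function: [K_(u+h) = K_u + h^* D + E] with [|E|] at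
    most a small multiple of [|h| |K_u|]. Pairing with [f], the term [D] yields the derivative [L],
    and [E] is controlled by Cauchy-Schwarz. *)
Theorem X0_holo f u : X0 f -> HP u -> hol f u.
Proof.
move=> [lf of_ rf] u0; have lk := L2_ker s1 u0.
have [L0 cL0] := (holP _ _).1 (@hol_cpow R (- s) 1 ltr01).
have cp1 : cpow (- s) (1 : C) = 1 by have := @cpow_real R (- s) 1 ltr01; rewrite powR1.
(* The derivative of [K_u] in the conjugate of [u]; [L0] is that of the power function at 1. *)
pose D w := ker u w * (- L0 / (w - u^*)).
have mD : mCC D.
  apply: mCC_M; first exact: mCC_ker.
  apply: mCC_M; first exact: mCC_cst.
  by apply: mCC_V; apply: mCC_D; [exact: mCC_id|exact: mCC_cst].
have Nu w : HP w -> 0 < N (w - u^*) by move=> w0; exact: lt_le_trans u0 (Im_le_N_kq u0 w0).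
have lD : L2 D.
  apply: (@L2_dom R s D (ker u) (nsq L0 / Im u ^+ 2)) => // w w0.
  rewrite /D nsqM mulrC ler_wpM2r ?nsq_ge0// nsqM nsqN nsqV ler_wpM2l ?nsq_ge0//.
  rewrite lef_pV2 ?posrE ?exprn_gt0// -?normc_sqr ?exprn_gt0 ?Nu//.
  by rewrite ler_sqr ?nnegrE ?normc_ge0 ?(ltW u0)//; exact: Im_le_N_kq.
have [L hL] := ip_right_linear lf lD.
apply/holP; exists L => e e0.
pose M := 4 * (ip f f * ip (ker u) (ker u)) / Im u ^+ 2.
have M0 : 0 <= M by rewrite divr_ge0 ?sqr_ge0// mulr_ge0// mulr_ge0 ?ip_pos.
have M1 : 0 < M + 1 by rewrite ltr_wpDl.
have [d d0 hd] := cL0 (e / (M + 1)) (divr_gt0 e0 M1).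
exists (Num.min (d * Im u) (Im u)); first by rewrite lt_min u0 mulr_gt0.
move=> h; rewrite lt_min => /andP[hd1 hd2].
have u'0 : HP (u + h).
  rewrite HPE ImD; have := le_lt_trans (Im_le_normc h) hd2.
  by rewrite ltr_norml => /andP[]; lra.
(* The relative change of [w - u^*] when [u] moves to [u + h]. It is at most [|h| / Im u] uniformly
   in [w]. *)
pose t w := - h^* / (w - u^*).
have Nt w : HP w -> N (t w) <= N h / Im u.
  move=> w0; rewrite /t Normc.normcM Normc.normcV normcN.
  rewrite [N h^*]normcE nsqJ -normcE ler_wpM2l ?normc_ge0//.
  by rewrite lef_pV2 ?posrE ?Nu//; exact: Im_le_N_kq.
pose E w := ker u w * (cpow (- s) (1 + t w) - cpow (- s) 1 - L0 * t w).
have kE w : HP w -> ker (u + h) w = E w + ker u w + h^* * D w.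
  move=> w0; have n0 := sub_conj_neq0 u0 w0.
  have -> : h^* * D w = ker u w * (L0 * t w) by rewrite /D /t; field.
  have -> : E w + ker u w + ker u w * (L0 * t w) = ker u w * cpow (- s) (1 + t w).
    by rewrite /E cp1; ring.
  rewrite /ker -mulrA; congr (_ * _); rewrite -cpowM.
  - by congr cpow; rewrite /kq /t rmorphD; field.
  - exact: Re_kq_gt0.
  - have : `|Re (t w)| < 1.
      apply: le_lt_trans (Re_le_normc _) _; apply: le_lt_trans (Nt w w0) _.
      by rewrite ltr_pdivrMr// mul1r.
    by rewrite ReD Re1 ltr_norml => /andP[]; lra.
  - have -> : kq u w * (1 + t w) = kq (u + h) w by rewrite /kq /t rmorphD; field.
    exact: Re_kq_gt0.
have mE : mCC E.
  apply: mCC_M; first exact: mCC_ker.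
  have mt : mCC t.
    apply: mCC_M; first exact: mCC_cst.
    by apply: mCC_V; apply: mCC_D; [exact: mCC_id|exact: mCC_cst].
  have mn (a : C -> C) : mCC a -> mCC (fun w => - a w).
    move=> ma; have := mCC_M (mCC_cst (-1)) ma; by under eq_fun do rewrite mulN1r.
  apply: mCC_D; last by apply: (mn); apply: mCC_M => //; exact: mCC_cst.
  apply: mCC_D; last exact: mCC_cst.
  by apply: mCC_cpow; apply: mCC_D => //; exact: mCC_cst.
pose k := (e / (M + 1) * (N h / Im u)) ^+ 2.
have Ele w : HP w -> nsq (E w) <= k * nsq (ker u w).
  move=> w0; rewrite /E nsqM mulrC ler_wpM2r ?nsq_ge0// -normc_sqr /k.
  rewrite ler_sqr ?nnegrE ?normc_ge0//; last first.
    by rewrite mulr_ge0 ?divr_ge0 ?normc_ge0// ltW.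
  apply: le_trans (hd (t w) _) _.
    by apply: le_lt_trans (Nt w w0) _; rewrite ltr_pdivrMr.
  by rewrite ler_wpM2l ?Nt// divr_ge0// ltW.
have lE : L2 E by apply: (@L2_dom R s E (ker u) k).
set Del := f (u + h) - f u - L * h.
have reE (b : C) : Re ((f (u + h) - f u - L * h) * b^*) =
    Re (f (u + h) * b^*) - Re (f u * b^*) - Re (L * (b * h^*)^*) by rewrite !cE; ring.
have Deq : nsq Del = ip f (fun w => Del * E w).
  have e1 := rf _ Del u'0; have e2 := rf _ Del u0.
  have e3 := hL (Del * h^*).
  have -> : nsq Del = Re (Del * Del^*) by rewrite mulJ.
  have -> : Re (Del * Del^*) = Re (f (u + h) * Del^*) - Re (f u * Del^*) - Re (L * (Del * h^*)^*).
    exact: reE.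
  rewrite e1 e2 e3 [ip f (fun w => Del * ker (u + h) w)]ip_sym.
  have -> : ip (fun w => Del * ker (u + h) w) f =
     ip (fun w => Del * E w + (Del * ker u w + Del * h^* * D w)) f.
    by apply: eq_ip => // w w0; rewrite kE//; ring.
  have l1 : L2 (fun w => Del * E w) by exact: L2_Z.
  have l2 : L2 (fun w => Del * ker u w) by exact: L2_Z.
  have l3 : L2 (fun w => Del * h^* * D w) by exact: L2_Z.
  rewrite (ip_add l1 (L2_D l2 l3) lf) (ip_add l2 l3 lf).
  by rewrite ![ip f _]ip_sym; ring.
have cs := ip_cs4 lf (L2_Z Del lE); rewrite -Deq in cs.
have le2 : ip (fun w => Del * E w) (fun w => Del * E w) <= nsq Del * k * ip (ker u) (ker u).
  apply: ip_le => //; first exact: L2_Z.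
  by move=> w w0; rewrite nsqM -mulrA ler_wpM2l ?nsq_ge0// Ele.
rewrite -ler_sqr ?nnegrE ?normc_ge0//; last by apply: mulr_ge0; [exact: ltW|exact: normc_ge0].
rewrite normc_sqr.
set n := nsq Del in cs le2 *.
have n0 : 0 <= n by exact: nsq_ge0.
have [->|n1] := eqVneq n 0; first by rewrite sqr_ge0.
have np : 0 < n by rewrite lt_neqAle eq_sym n1.
have h1 : n <= M * (e / (M + 1)) ^+ 2 * N h ^+ 2.
  rewrite -(ler_pM2l np) -expr2; apply: le_trans cs _.
  apply: le_trans (ler_wpM2l _ (ler_wpM2l (ip_pos s f) le2)) _ => //.
  rewrite le_eqVlt; apply/orP; left; apply/eqP; rewrite /k.
  set q := e / (M + 1); rewrite /M; move: q (N h) => q y.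
  by field; rewrite gt_eqF.
apply: le_trans h1 _; rewrite [leRHS]exprMn ler_wpM2r ?sqr_ge0//.
rewrite exprMn mulrCA ler_piMr ?sqr_ge0//.
rewrite exprVn ler_pdivrMr ?exprn_gt0// mul1r; nra.
Qed.

Lemma near_HP (w : C) : HP w -> \forall t \near (w : C^o), HP t.
Proof.
move=> w0; apply/nearP; exists (Im w) => // t td; rewrite HPE.
have := le_lt_trans (Im_le_normc _) td; rewrite ltr_norml !cE => /andP[]; lra.
Qed.

Lemma hol_cut (f : C -> C) w : HP w -> hol f w -> hol (cut f) w.
Proof.
move=> w0; apply: hol_ext; apply: filterS (near_HP w0) => t t0; by rewrite cutE.
Qed.

Lemma ccont_cut (f : C -> C) w : HP w -> ccont f w -> ccont (cut f) w.
Proof.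
move=> w0 cf e e0; have [d d0 hd] := cf e e0; exists (Num.min d (Im w)).
  by rewrite lt_min d0.
move=> h; rewrite lt_min => /andP[h1 h2]; rewrite !cutE//; first exact: hd.
rewrite HPE ImD; have := le_lt_trans (Im_le_normc h) h2.
by rewrite ltr_norml => /andP[]; lra.
Qed.

Lemma cut_cut (f : C -> C) : cut (cut f) = cut f.
Proof. by apply/funext => w; rewrite /cut; case: (0 < Im w). Qed.

Lemma X0_of_hol (f : C -> C) p : (hint (fun w => (nsq (f w) * Im w `^ s)%R) < +oo)%E ->
  (forall w, HP w -> ccont f w) -> (forall w, HP w -> w != p -> hol f w) -> X0 (cut f).
Proof.
move=> hf fc fh; rewrite -cut_cut; apply: (@X0_hol R s s1 (cut f) p).
- split; first exact: mCC_cut_cont.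
  by apply: le_lt_trans hf; rewrite le_eqVlt; apply/orP; left; apply/eqP/eq_hint => w w0; rewrite cutE.
- by move=> w w0; apply: ccont_cut => //; exact: fc.
- by move=> w w0 wp; apply: hol_cut => //; exact: fh.
Qed.

Definition blaschke (z w : C) : C := (w - z) / (w - z^*).

(** The quotient extends continuously to [z] by the derivative of [f], which is all that the
    reproducing formula asks at an exceptional point; only its square integrability needs an
    estimate. *)
Lemma X0_divide f z : X0 f -> HP z -> f z = 0 ->
  exists2 g, X0 g & forall w, HP w -> f w = blaschke z w * g w.
Proof.
move=> Xf z0 fz; have [L cL] := (holP _ _).1 (X0_holo Xf z0).
have lf : L2 f by have [] := Xf.
pose g w := (if w == z then L else f w / (w - z)) * (w - z^*).
have hpoly w : hol (fun w => w - z^*) w.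
  exact: (@hol_D _ id _ _ (@hol_id R w) (@hol_cst R (- z^*) w)).
have gh w : HP w -> w != z -> hol g w.
  move=> w0 wz; apply: (@hol_M _ (fun w => if w == z then L else f w / (w - z)) _ w _ (hpoly w)).
  have h1 : hol (fun w => w - z) w.
    exact: (@hol_D _ id _ _ (@hol_id R w) (@hol_cst R (- z) w)).
  have wz0 : w - z != 0 by rewrite subr_eq0.
  apply: (@hol_ext _ (fun w => f w / (w - z))); last first.
    exact: (@hol_M _ _ _ w (X0_holo Xf w0) (@hol_V _ (fun w => w - z) w wz0 h1)).
  apply/nearP; exists (N (w - z)); first by rewrite normcE sqrtr_gt0 nsq_gt0.
  move=> t td; case: eqP => // tz; move: td; rewrite tz -normcN opprB ltxx //.
have gcz : ccont g z.
  apply: ccontM; last exact: hol_ccont.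
  move=> e e0; have [d d0 hd] := cL e e0; exists d => // h hd1; rewrite eqxx.
  case: eqVneq => [_|hz]; first by rewrite subrr Normc.normc0 ltW.
  have h0 : h != 0 by apply: contra hz => /eqP ->; rewrite addr0.
  have := hd h hd1; rewrite fz subr0 => hh.
  have -> : f (z + h) / (z + h - z) - L = (f (z + h) - L * h) / h.
    by rewrite [z + h]addrC addrK; field.
  by rewrite Normc.normcM Normc.normcV ler_pdivrMr// normcE sqrtr_gt0 nsq_gt0.
have gc w : HP w -> ccont g w.
  by have [->//|wz w0] := eqVneq w z; apply: hol_ccont; exact: gh.
have [d1 d10 h1] := gcz 1 ltr01.
have kz0 : 0 < N (ker z z) by rewrite normcE sqrtr_gt0 nsq_gt0 ker_neq0.
have [d2 d20 h2] := hol_ccont (@hol_ker R s z z z0 z0) (divr_gt0 kz0 (ltr0n _ 2)).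
pose d := Num.min d1 d2; have d0 : 0 < d by rewrite lt_min d10.
have lk := L2_ker s1 z0.
(* Near [z] the quotient is bounded and dominated by the kernel at [z], which is bounded below there
   ([K1]); away from [z] the inverse Blaschke factor is bounded ([K2]). *)
pose K1 := ((N (g z) + 1) / (N (ker z z) / 2)) ^+ 2.
pose K2 := (1 + 2 * Im z / d) ^+ 2.
have gfin : (hint (fun w => (nsq (g w) * Im w `^ s)%R) < +oo)%E.
  have mg : mCC (cut g) by exact: mCC_cut_cont.
  have [_] : L2 (cut g).
    apply: (@L2_bound2 R s (cut g) f (ker z) (K1 + K2)) => // w w0; rewrite cutE//.
    have K10 : 0 <= K1 by exact: sqr_ge0.
    have K20 : 0 <= K2 by exact: sqr_ge0.
    have nf := nsq_ge0 (f w); have nk := nsq_ge0 (ker z w).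
    have [wd|wd] := ltP (N (w - z)) d.
      suff : nsq (g w) <= K1 * nsq (ker z w) by nra.
      have [wd1 wd2] : N (w - z) < d1 /\ N (w - z) < d2.
        by move: wd; rewrite /d lt_min => /andP.
      have := h1 _ wd1; have := h2 _ wd2; rewrite [z + _]addrC subrK => h2' h1'.
      have a1 : N (g w) <= N (g z) + 1.
        have := le_normcD (g w - g z) (g z); rewrite subrK; lra.
      have a2 : N (ker z z) / 2 <= N (ker z w).
        have := le_normcD (ker z w) (- (ker z w - ker z z)); rewrite normcN.
        by rewrite opprB addrC subrK; lra.
      have kk : 0 < N (ker z z) / 2 by rewrite divr_gt0.
      rewrite -!normc_sqr /K1 -exprMn ler_sqr ?nnegrE ?normc_ge0//; last first.
        apply: mulr_ge0; last exact: normc_ge0.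
        by apply: divr_ge0; [rewrite addr_ge0 ?normc_ge0|exact: ltW].
      rewrite -mulrA -[leLHS]mulr1; apply: ler_pM => //; first exact: normc_ge0.
      by rewrite mulrC ler_pdivlMr// mul1r.
    suff : nsq (g w) <= K2 * nsq (f w) by nra.
    have wz : w != z by apply/eqP => e; move: wd; rewrite e subrr Normc.normc0 leNgt d0.
    have nz : 0 < N (w - z) by apply: lt_le_trans d0 wd.
    rewrite /g (negbTE wz) -!normc_sqr /K2 -exprMn ler_sqr ?nnegrE ?normc_ge0//; last first.
      by rewrite mulr_ge0 ?normc_ge0// addr_ge0// divr_ge0 ?mulr_ge0 ?ltW.
    rewrite !Normc.normcM Normc.normcV -mulrA [leRHS]mulrC ler_wpM2l ?normc_ge0//.
    rewrite mulrC ler_pdivrMr//; have := le_normcD (w - z) (z - z^*).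
    have -> : w - z + (z - z^*) = w - z^* by ring.
    have -> : N (z - z^*) = 2 * Im z.
      rewrite normcE /nsq !cE (_ : _ + _ = (2 * Im z) ^+ 2); last by ring.
      by rewrite sqrtr_sqr ger0_norm//; apply: mulr_ge0 => //; exact: ltW.
    move=> h; apply: le_trans h _.
    have -> : (1 + 2 * Im z / d) * N (w - z) = N (w - z) + 2 * Im z / d * N (w - z) by ring.
    rewrite lerD2l.
    rewrite mulrAC ler_pdivlMr//; apply: ler_wpM2l => //.
    by apply: mulr_ge0 => //; exact: ltW.
  apply: le_lt_trans; rewrite le_eqVlt; apply/orP; left; apply/eqP/eq_hint => w w0.
  by rewrite cutE.
exists (cut g); first exact: (X0_of_hol gfin gc gh).
move=> w w0; rewrite cutE// /g /blaschke; have n0 := sub_conj_neq0 z0 w0.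
case: eqVneq => [->|wz]; first by rewrite fz subrr !mul0r.
have wz0 : w - z != 0 by rewrite subr_eq0.
set a := w - z in wz0 *; set b := w - z^* in n0 *.
have -> : a / b * (f w / a * b) = f w * (a / a) * (b / b) by ring.
by rewrite !divff// !mulr1.
Qed.

End BergmanHolomorphic.

(** * Local bounds and order of vanishing *)

Section LocalBound.
Variables (R : realType) (s : R).
Hypothesis s1 : 1 < s.
Local Notation C := R[i].
Local Notation Re := (@complex.Re R).
Local Notation Im := (@complex.Im R).
Local Notation HP := (@upper_half_plane R).
Local Notation C2 := (@complex_of_pair R).
Local Notation m2 := (@lebesgue_measure R \x @lebesgue_measure R)%E.
Local Notation cI := (@cI R).
Local Notation N := (@Normc.normc R).
Local Notation ker := (@ker R s).
Local Notation L2 := (@L2 R s).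
Local Notation cK := (@cK R s).
Local Notation X0 := (@X0 R s).
Local Notation ip := (@ip R s).
Local Open Scope complex_scope.

Lemma indic01 (A : set R) (r : R) : 0 <= (\1_A r : R) <= 1.
Proof. by rewrite indicE; case: (_ \in _); rewrite ?lexx ?ler01. Qed.

Lemma mC_rhoc (u : C) : mC (rhoc u).
Proof.
apply: mC_nsqf; apply: mCC_M; [|apply: mCC_V];
  by apply: mCC_D; (exact: mCC_id || exact: mCC_cst).
Qed.

(** The reproducing formula localised to [A] expresses [cpsi * |f u|^2] as the product of [f] cut
    off to [A] with a multiple of the kernel at [u]; then Cauchy-Schwarz with its constant 4. *)
Lemma local_bound f u (A : set R) : X0 f -> HP u -> measurable A ->
  cpsi s \1_A ^+ 2 * (nsq (f u) * Im u `^ s) <=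
  4 * cK * rint (fun w => nsq (f w) * \1_A (rhoc u w) * Im w `^ s).
Proof.
move=> Xf u0 mA; have lf : L2 f by have [] := Xf.
have mi : measurable_fun [set: R] (\1_A : R -> R) by exact: measurable_indic.
have mr := mC_comp1 mi (mC_rhoc u).
pose g w := f w * (\1_A (rhoc u w))%:C.
have mg : mCC g by apply: mCC_M; [exact: lf.1|split; [exact: mr|exact: mC_cst]].
have nsqg w : nsq (g w) = nsq (f w) * \1_A (rhoc u w).
  rewrite nsqM nsqR; congr (_ * _); rewrite indicE.
  by case: (_ \in _); rewrite ?expr1n ?expr0n.
have lg : L2 g.
  apply: (@L2_dom R s g f 1) => // w _; rewrite nsqg mul1r ler_piMr ?nsq_ge0//.
have ac := @reproduce R s s1 (fun w => (f u)^* * f w) cI \1_A u (L2_Z _ lf).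
have {ac} rep := ac
  (fun w w0 => ccontM (hol_ccont (@hol_cst R (f u)^* w)) (hol_ccont (X0_holo s1 Xf w0)))
  (fun w w0 _ => @hol_M _ (fun=> (f u)^*) f w (@hol_cst R _ _) (X0_holo s1 Xf w0))
  mi (indic01 A) u0.
have e1 : cpsi s \1_A * nsq (f u) = ip g (fun w => f u * ker u w).
  have -> : nsq (f u) = Re ((f u)^* * f u) by rewrite mulrC mulJ.
  rewrite -rep; apply: eq_rint => w _; congr (_ * _).
  by rewrite /g; move: (\1_A (rhoc u w) : R) (f u) (f w) (ker u w) => b x y v; rewrite !cE; ring.
have lk := L2_ker s1 u0; have cs := ip_cs4 lg (L2_Z (f u) lk).
have kk : ip (fun w => f u * ker u w) (fun w => f u * ker u w) = nsq (f u) * (cK * Im u `^ (- s)).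
  rewrite -(xip_kerK s1 u0 (f u)); apply: eq_ip => w w0; by rewrite kerXE.
rewrite -e1 kk in cs.
have gg : ip g g = rint (fun w => nsq (f w) * \1_A (rhoc u w) * Im w `^ s).
  by rewrite ip_nsq; apply: eq_rint => w _; rewrite nsqg.
rewrite -gg; have [n0|n0] := eqVneq (nsq (f u)) 0.
  rewrite n0 mul0r mulr0; apply: mulr_ge0; last exact: ip_pos.
  by apply: mulr_ge0 => //; exact: ltW (cK_gt0 s1).
have np : 0 < nsq (f u) by rewrite lt_neqAle eq_sym n0 nsq_ge0.
have y0 : 0 < Im u `^ s by exact: powR_gt0.
rewrite -(ler_pM2l np).
rewrite powRN in cs; move: cs; set n := nsq (f u) in np *; set y := Im u `^ s in y0 *.
move: (cpsi s \1_A) (ip g g) => c G cs.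
have -> : n * (c ^+ 2 * (n * y)) = (c * n) ^+ 2 * y by ring.
apply: le_trans (ler_wpM2r (ltW y0) cs) _.
by rewrite le_eqVlt; apply/orP; left; apply/eqP; field; rewrite gt_eqF.
Qed.

(** The integrand is positive on a rectangle, and a vanishing integral would make that rectangle
    negligible. *)
Lemma cpsi_gt0 (A : set R) (x1 x2 y1 y2 : R) : measurable A -> x1 < x2 -> 0 < y1 -> y1 < y2 ->
  (forall w, x1 <= Re w <= x2 -> y1 <= Im w <= y2 -> A (nsq (cayley w))) -> 0 < cpsi s \1_A.
Proof.
move=> mA x12 y10 y12 hA; have mi : measurable_fun [set: R] (\1_A : R -> R) by exact: measurable_indic.
have hchi := hi_chi s1 mi (indic01 A); set chi := (fun w : C => _) in hchi.
have chi0 w : 0 <= chi w.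
  by rewrite /chi mulr_ge0 ?powR_ge0//; have /andP[] := indic01 A (nsq (cayley w)).
rewrite /cpsi -/chi mulr_gt0 ?cK_gt0// lt_neqAle eq_sym; apply/andP; split; last first.
  by apply: rint_ge0 => w _.
apply/eqP => r0; have h0 : hint chi = 0%E by rewrite -rintK// r0.
have h0a : (\int[m2]_(p in @UH R) `|(chi (C2 p) * p.2 ^- 2)%:E| = 0)%E.
  rewrite -h0; apply: eq_integral => p _; rewrite gee0_abs// lee_fin mulr_ge0//.
  by rewrite invr_ge0 sqr_ge0.
have [_ H] := @ae_eq_integral_abs _ _ R m2 (@UH R) (@measurable_UH R)
  (fun p => (chi (C2 p) * p.2 ^- 2)%:E) (mC_weight hchi.1).
have [Nn [mN N0 hN]] := (ae_eq_integral_abs m2 (@measurable_UH R) (mC_weight hchi.1)).1 h0a.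
pose B : set (R * R) := `[x1, x2] `*` `[y1, y2].
have BN : B `<=` Nn.
  move=> [x y] [/=]; rewrite !in_itv/= => hx hy; apply: hN => /= h.
  have yp : 0 < y by apply: lt_le_trans y10 _; case/andP: hy.
  have Hw : HP (x +i* y) by [].
  have := h Hw; move=> [] /eqP; apply/negP; rewrite mulf_neq0//; last first.
    by rewrite invr_eq0 expf_eq0 /= gt_eqF.
  rewrite /chi mulf_neq0//.
    rewrite gt_eqF// powR_gt0// subr_gt0; exact: nsq_cayley.
  by rewrite indicE mem_set ?oner_eq0//; exact: hA.
have mB : measurable B by exact: measurableX.
have : (m2 B <= m2 Nn)%E by apply: le_measure; rewrite ?inE.
rewrite N0 /B product_measure1E//= !lebesgue_measure_itv/= !lte_fin x12 y12 -!EFinD -EFinM lee_fin.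
by rewrite leNgt mulr_gt0// subr_gt0.
Qed.

Lemma nsq_add4 (u w : C) : nsq (w - u^*) = nsq (w - u) + 4 * Im w * Im u.
Proof. by rewrite /nsq !cE; ring. Qed.

Lemma rhoc_lt1 (u w : C) : HP u -> HP w -> 1 - rhoc u w = 4 * Im w * Im u / nsq (w - u^*).
Proof.
move=> u0 w0; have n0 := sub_conj_neq0 u0 w0; rewrite -nsq_eq0 in n0.
rewrite /rhoc nsqM nsqV -{1}[1](divff n0) -mulrBl; congr (_ / _).
by rewrite nsq_add4; ring.
Qed.

Lemma near_cpsi_gt0 (d : R) : 0 < d -> 0 < cpsi s \1_[set r | r < d].
Proof.
move=> d0; pose e := Num.min (d / 2) (1 / 2).
have e0 : 0 < e by rewrite lt_min !divr_gt0.
have ed : e <= d / 2 by rewrite /e ge_min lexx.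
have e2 : e <= 1 / 2 by rewrite /e ge_min lexx orbT.
apply: (@cpsi_gt0 _ (- e) e (1 - e) 1); try lra.
  have -> : [set r | r < d] = `]-oo, d[%classic by apply/seteqP; split => r /=; rewrite in_itv.
  by [].
move=> w /andP[x1 x2] /andP[y1 y2] /=.
have w0 : HP w by rewrite HPE; lra.
have n1 : 1 <= nsq (w + cI).
  by rewrite /nsq /cI !cE; have := sqr_ge0 (Re w + 0); nra.
rewrite /cayley nsqM nsqV ltr_pdivrMr ?(lt_le_trans ltr01)//.
apply: (@lt_le_trans _ _ d); last by rewrite ler_peMr// ltW.
have -> : nsq (w - cI) = Re w ^+ 2 + (1 - Im w) ^+ 2 by rewrite /nsq /cI !cE; ring.
have h1 : Re w ^+ 2 <= e * e by rewrite expr2; nra.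
have h2 : (1 - Im w) ^+ 2 <= e * e by rewrite expr2; nra.
have h3 : e * e <= e / 2 by have := ler_wpM2l (ltW e0) e2; lra.
lra.
Qed.

Lemma far_cpsi_gt0 (D : R) : D < 1 -> 0 < cpsi s \1_[set r | D <= r].
Proof.
move=> D1; apply: (@cpsi_gt0 _ 0 1 ((1 - D) / 8) ((1 - D) / 4)); try lra.
  have -> : [set r | D <= r] = `[D, +oo[%classic by apply/seteqP; split => r /=; rewrite in_itv/= andbT.
  by [].
move=> w _ /andP[y1 y2] /=; have w0 : HP w by rewrite HPE; lra.
suff : 1 - nsq (cayley w) <= 1 - D by lra.
rewrite rho1//; have n1 : 1 <= Re w ^+ 2 + (Im w + 1) ^+ 2.
  by have := sqr_ge0 (Re w); rewrite HPE in w0; nra.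
rewrite ler_pdivrMr ?(lt_le_trans ltr01)//; apply: (@le_trans _ _ (1 - D)); first by lra.
by rewrite ler_peMr//; lra.
Qed.

(** Near the boundary as seen from [u] is near the boundary as seen from [z]. The triangle
    inequality compares [|w - u^*|] with [|w - z^*|], whence [1 - rhoc z w <= k (1 - rhoc u w)]. *)
Lemma blaschke_far (z u : C) (r : R) : HP z -> HP u -> r < 1 ->
  exists2 D, D < 1 & forall w, HP w -> D <= rhoc u w -> r <= nsq (blaschke z w).
Proof.
move=> z0 u0 r1; pose k := (1 + N (z - u) / Im z) ^+ 2 * (Im z / Im u).
have q0 : 0 < 1 + N (z - u) / Im z.
  by rewrite ltr_pwDl// divr_ge0 ?normc_ge0//; exact: ltW.
have k0 : 0 < k by rewrite mulr_gt0 ?exprn_gt0// divr_gt0.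
exists (1 - (1 - r) / k); first by rewrite ltrBlDr ltrDl divr_gt0// subr_gt0.
move=> w w0; rewrite lerBlDr -lerBlDl => h.
have {}h : k * (1 - rhoc u w) <= 1 - r.
  by rewrite mulrC -ler_pdivlMr//; lra.
have : 1 - rhoc z w <= k * (1 - rhoc u w); last by rewrite -[nsq (blaschke z w)]/(rhoc z w); lra.
have nu : 0 < nsq (w - u^*) by rewrite nsq_gt0 sub_conj_neq0.
have nz : 0 < nsq (w - z^*) by rewrite nsq_gt0 sub_conj_neq0.
rewrite !rhoc_lt1// mulrA ler_pdivlMr// mulrAC ler_pdivrMr//.
have h1 : nsq (w - u^*) <= (1 + N (z - u) / Im z) ^+ 2 * nsq (w - z^*).
  rewrite -!normc_sqr -exprMn ler_sqr ?nnegrE ?normc_ge0//; last first.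
    by apply: mulr_ge0; [exact: ltW|exact: normc_ge0].
  have := le_normcD (w - z^*) (z - u)^*.
  have -> : w - z^* + (z - u)^* = w - u^* by apply: eqC; rewrite !cE; ring.
  have -> : N (z - u)^* = N (z - u) by rewrite !normcE nsqJ.
  move=> h1; apply: le_trans h1 _; rewrite mulrDl mul1r lerD2l mulrAC ler_pdivlMr//.
  by apply: ler_wpM2l; [exact: normc_ge0|exact: Im_le_N_kq].
have -> : k * (4 * Im w * Im u) * nsq (w - z^*) =
   4 * Im w * Im z * ((1 + N (z - u) / Im z) ^+ 2 * nsq (w - z^*)).
  by rewrite /k; set q := 1 + _; field; rewrite gt_eqF.
by apply: ler_wpM2l => //; rewrite !mulr_ge0//; exact: ltW.
Qed.

(* If all quotients [f / b ^ m] belonged to the space, the local bound on an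
   annulus around [u] where [r <= |b|], [|b u| < r], would give
   [|f u| <= C (|b u| / r) ^ m], hence [f u = 0]. *)
Theorem vanishing_order f z : X0 f -> HP z -> (exists2 w, HP w & f w != 0) ->
  exists m g, [/\ X0 g, forall w, HP w -> f w = blaschke z w ^+ m * g w & g z != 0].
Proof.
move=> Xf z0 [u u0 fu]; apply: contrapT => no.
have all_m m : exists2 g, X0 g & forall w, HP w -> f w = blaschke z w ^+ m * g w.
  elim: m => [|m [g Xg fg]]; first by exists f => // w _; rewrite expr0 mul1r.
  have gz : g z = 0.
    by apply/eqP; apply: contrapT => /negP gz; apply: no; exists m, g.
  have [h Xh gh] := X0_divide s1 Xg z0 gz; exists h => // w w0.
  by rewrite fg// gh// mulrA -exprSr.
have lf : L2 f by have [] := Xf.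
pose r0 := nsq (blaschke z u).
have r00 : 0 <= r0 by exact: nsq_ge0.
have r01 : r0 < 1.
  rewrite -subr_gt0 -/(rhoc z u) rhoc_lt1// divr_gt0 ?nsq_gt0 ?sub_conj_neq0//.
  by rewrite !mulr_gt0.
(* Any value strictly between [r0] and 1 would do. *)
pose r := (1 + r0) / 2; have rp : 0 < r by rewrite /r; lra.
have [D D1 hD] := @blaschke_far z u r z0 u0 ltac:(rewrite /r; lra).
have c0 := far_cpsi_gt0 D1; set A := [set _ | _] in c0.
have mA : measurable A.
  have -> : A = `[D, +oo[%classic by apply/seteqP; split => t /=; rewrite in_itv/= andbT.
  by [].
have y0 : 0 < Im u `^ s by exact: powR_gt0.
pose K := 4 * cK * ip f f / (cpsi s \1_A ^+ 2 * Im u `^ s).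
have den0 : 0 < cpsi s \1_A ^+ 2 * Im u `^ s by rewrite mulr_gt0 ?exprn_gt0.
have cKp := cK_gt0 s1.
have K0 : 0 <= K.
  apply: divr_ge0; last exact: ltW.
  by apply: mulr_ge0; [apply: mulr_ge0 => //; exact: ltW|exact: ip_pos].
have bound m : nsq (f u) <= (r0 / r) ^+ m * K.
  have [g Xg fg] := all_m m; have lg : L2 g by have [] := Xg.
  rewrite fg// nsqM (_ : nsq (_ ^+ m) = r0 ^+ m); last first.
    by rewrite /r0; elim: (m) => [|k ih]; rewrite ?expr0 ?nsqR ?expr1n// !exprS nsqM ih.
  rewrite expr_div_n -mulrA ler_wpM2l ?exprn_ge0//.
  rewrite mulrC ler_pdivlMr ?exprn_gt0// /K ler_pdivlMr//.
  have := local_bound Xg u0 mA; move=> lb.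
  rewrite [nsq (g u) * _ * _]mulrAC (_ : nsq (g u) * _ = cpsi s \1_A ^+ 2 * (nsq (g u) * Im u `^ s)); last by ring.
  apply: le_trans (ler_wpM2r (exprn_ge0 m (ltW rp)) lb) _.
  rewrite -[X in X <= _]mulrA; apply: ler_wpM2l; first by apply: mulr_ge0 => //; exact: ltW.
  rewrite mulrC ip_nsq -rint_Z; last first.
    have mi : measurable_fun [set: R] (\1_A : R -> R) by exact: measurable_indic.
    have := hi_ip lg lg (mC_comp1 mi (mC_rhoc u))
      (fun w _ => ltac:(by have /andP[? ?] := indic01 A (rhoc u w); rewrite ger0_norm)).
    apply: eq_hi => [w _|]; first by rewrite mulJ.
    apply: mC_M; last by apply: mC_powR; exact: mC_Im.
    by apply: mC_M; [apply: mC_nsqf; exact: lg.1|exact: (mC_comp1 mi (mC_rhoc u))].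
  apply: rint_le.
  - apply: hi_Z; have mi : measurable_fun [set: R] (\1_A : R -> R) by exact: measurable_indic.
    have := hi_ip lg lg (mC_comp1 mi (mC_rhoc u))
      (fun w _ => ltac:(by have /andP[? ?] := indic01 A (rhoc u w); rewrite ger0_norm)).
    apply: eq_hi => [w _|]; first by rewrite mulJ.
    apply: mC_M; last by apply: mC_powR; exact: mC_Im.
    by apply: mC_M; [apply: mC_nsqf; exact: lg.1|exact: (mC_comp1 mi (mC_rhoc u))].
  - exact: L2_hi.
  - move=> w w0; rewrite mulrA ler_wpM2r ?powR_ge0// fg// nsqM.
    rewrite (_ : nsq (_ ^+ m) = nsq (blaschke z w) ^+ m); last first.
      by elim: (m) => [|k ih]; rewrite ?expr0 ?nsqR ?expr1n// !exprS nsqM ih.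
    rewrite indicE; have [rA|_] := boolP (_ \in A); last first.
      by rewrite !mulr0 mulr_ge0 ?exprn_ge0 ?nsq_ge0.
    rewrite mulr1 ler_wpM2r ?nsq_ge0// lerXn2r ?nnegrE ?nsq_ge0 ?(ltW rp)//.
    by apply: hD => //; exact: (set_mem rA).
have f0 : nsq (f u) = 0.
  apply: eps_eq0 => e e0; rewrite ger0_norm ?nsq_ge0//.
  have q1 : `|r0 / r| < 1.
    have q0 : 0 <= r0 / r by apply: divr_ge0 => //; exact: ltW.
    by rewrite (ger0_norm q0) ltr_pdivrMr// mul1r /r; lra.
  have [n0 hn] := cvg_eps (cvg_expr q1) (divr_gt0 e0 (ltr_pwDr ltr01 K0)).
  have := hn n0 (leqnn _); rewrite subr0 => /(le_trans (ler_norm _)) h.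
  apply: le_trans (bound n0) _; apply: le_trans (ler_wpM2r K0 h) _.
  by rewrite mulrAC ler_pdivrMr ?ltr_pwDr// ler_pM2l// lerDl.
by move/eqP: f0; rewrite nsq_eq0 (negbTE fu).
Qed.

End LocalBound.

Lemma ord2P (i : 'I_2) : i = 0 \/ i = 1.
Proof. by case: i => -[|[|//]] ?; [left|right]; apply: val_inj. Qed.

(** * The action of PSL2 and its discrete subgroups *)

Section Action.
Variable R : realType.
Local Notation C := R[i].
Local Notation Re := (@complex.Re R).
Local Notation Im := (@complex.Im R).
Local Notation HP := (@upper_half_plane R).
Local Open Scope complex_scope.

Definition jden (A : 'M[R]_2) (w : C) : C := (A 1 0)%:C * w + (A 1 1)%:C.

Lemma jden_neq0 A w : \det A = 1 -> HP w -> jden A w != 0.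
Proof.
rewrite det2 => dA w0; apply/eqP => e; have h1 := congr1 Im e; have h2 := congr1 Re e.
rewrite /jden !cE in h1 h2; have s0 : A 1 0 = 0.
  apply/eqP; have : A 1 0 * Im w = 0 by lra.
  by move=> /eqP; rewrite mulf_eq0 (gt_eqF w0) orbF.
have d0 : A 1 1 = 0 by move: h2; rewrite s0; lra.
by move/eqP: dA; rewrite s0 d0 !mulr0 subrr eq_sym oner_eq0.
Qed.

Lemma Im_mobius A w : \det A = 1 -> HP w -> Im (mobius A w) = Im w / nsq (jden A w).
Proof.
move=> dA w0; have n0 := jden_neq0 dA w0; rewrite det2 in dA.
rewrite /mobius -/(jden A w) !cE; set n := nsq _.
have nn : n != 0 by rewrite nsq_eq0.
rewrite /jden ?cE -[Im w in RHS]mul1r -dA; by field.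
Qed.

Lemma mobius_HP A w : \det A = 1 -> HP w -> HP (mobius A w).
Proof.
move=> dA w0; rewrite HPE Im_mobius// divr_gt0// nsq_gt0; exact: jden_neq0.
Qed.

Lemma mulmx2 (A B : 'M[R]_2) i j : (A *m B) i j = A i 0 * B 0 j + A i 1 * B 1 j.
Proof. by rewrite mxE !big_ord_recl big_ord0 addr0; congr (_ * B _ _ + A _ _ * B _ _); apply: val_inj. Qed.

Lemma mobius_mul A B w : \det A = 1 -> \det B = 1 -> HP w ->
  mobius (A *m B) w = mobius A (mobius B w).
Proof.
move=> dA dB w0; have nB := jden_neq0 dB w0.
have nA := jden_neq0 dA (mobius_HP dB w0).
have e1 : jden (A *m B) w = jden A (mobius B w) * jden B w.
  by rewrite /jden /mobius !mulmx2 !rmorphD !rmorphM /=; rewrite /jden in nB; field.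
rewrite {1 2}/mobius -/(jden (A *m B) w) -/(jden A (mobius B w)) e1.
rewrite /mobius -/(jden B w) !mulmx2 !rmorphD !rmorphM /=.
set j := jden A _ in nA *; rewrite /jden in nB *.
by field; rewrite nA nB.
Qed.

Lemma mobius1 w : mobius (1%:M : 'M[R]_2) w = w.
Proof. by rewrite /mobius !mxE /= !mul1r mul0r addr0 add0r divr1. Qed.

Lemma det_repr (g : PSL2 R) : \det (val (repr g)) = 1.
Proof. exact: (eqP (valP (repr g))). Qed.

Lemma act_HP (g : PSL2 R) w : HP w -> HP (psl2_act g w).
Proof. by apply: mobius_HP; exact: det_repr. Qed.

Lemma act_mul (g h : PSL2 R) w : HP w ->
  psl2_act (PSL2_mul g h) w = psl2_act g (psl2_act h w).
Proof. by move=> w0; rewrite /PSL2_mul psl2_act_pi /= mobius_mul// det_repr. Qed.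

Lemma act_one w : psl2_act (PSL2_one R) w = w.
Proof. by rewrite /PSL2_one psl2_act_pi /= mobius1. Qed.

Lemma actK (g : PSL2 R) w : HP w -> psl2_act (PSL2_inv g) (psl2_act g w) = w.
Proof. by move=> w0; rewrite -act_mul// PSL2_mulV act_one. Qed.

Lemma actVK (g : PSL2 R) w : HP w -> psl2_act g (psl2_act (PSL2_inv g) w) = w.
Proof. by move=> w0; rewrite -act_mul// PSL2_Vmul act_one. Qed.

Lemma sub_conj_mobius A u w : \det A = 1 -> HP u -> HP w ->
  mobius A w - (mobius A u)^* = (w - u^*) / (jden A w * (jden A u)^*).
Proof.
move=> dA u0 w0; have n1 := jden_neq0 dA w0; have n2 := jden_neq0 dA u0.
have n2' : (jden A u)^* != 0 by rewrite -nsq_eq0 nsqJ nsq_eq0.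
have -> : ((mobius A u)^*)%R = ((A 0 0)%:C * u^* + (A 0 1)%:C) / (jden A u)^*.
  rewrite /mobius -/(jden A u) rmorphM fmorphV; congr (_ / _).
  by apply: eqC; rewrite !cE; ring.
have e : ((jden A u)^*)%R = (A 1 0)%:C * u^* + (A 1 1)%:C by apply: eqC; rewrite /jden !cE; ring.
rewrite det2 in dA.
have dC : (A 0 0)%:C * (A 1 1)%:C - (A 0 1)%:C * (A 1 0)%:C = 1 :> C.
  by rewrite -!rmorphM -rmorphB dA.
have {1}-> : w - u^* = ((A 0 0)%:C * (A 1 1)%:C - (A 0 1)%:C * (A 1 0)%:C) * (w - u^*).
  by rewrite dC mul1r.
rewrite /mobius -/(jden A w).
apply: (mulIf (mulf_neq0 n1 n2')); rewrite divfK ?mulf_neq0//.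
set a := _ + (A 0 1)%:C; set b := _ + (A 0 1)%:C.
have -> : (a / jden A w - b / (jden A u)^*) * (jden A w * (jden A u)^*) =
   a * (jden A u)^* - b * jden A w by field; rewrite n1 n2'.
by rewrite e /a /b /jden; ring.
Qed.

Lemma sub_mobius A u w : \det A = 1 -> HP u -> HP w ->
  mobius A w - mobius A u = (w - u) / (jden A w * jden A u).
Proof.
move=> dA u0 w0; have n1 := jden_neq0 dA w0; have n2 := jden_neq0 dA u0.
rewrite det2 in dA.
have dC : (A 0 0)%:C * (A 1 1)%:C - (A 0 1)%:C * (A 1 0)%:C = 1 :> C.
  by rewrite -!rmorphM -rmorphB dA.
have {1}-> : w - u = ((A 0 0)%:C * (A 1 1)%:C - (A 0 1)%:C * (A 1 0)%:C) * (w - u).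
  by rewrite dC mul1r.
rewrite /mobius -/(jden A w) -/(jden A u).
apply: (mulIf (mulf_neq0 n1 n2)); rewrite divfK ?mulf_neq0//.
set a := _ + (A 0 1)%:C; set b := _ + (A 0 1)%:C.
have -> : (a / jden A w - b / jden A u) * (jden A w * jden A u) =
   a * jden A u - b * jden A w by field; rewrite n1 n2.
by rewrite /a /b /jden; ring.
Qed.

Lemma rhoc_mobius A u w : \det A = 1 -> HP u -> HP w ->
  rhoc (mobius A u) (mobius A w) = rhoc u w.
Proof.
move=> dA u0 w0.
have e1 : nsq (mobius A w - (mobius A u)^*) =
    nsq (w - u^*) / (nsq (jden A w) * nsq (jden A u)).
  by rewrite sub_conj_mobius// nsqM nsqV nsqM; congr (_ / (_ * _)); exact: nsqJ.
have e2 : nsq (mobius A w - mobius A u) = nsq (w - u) / (nsq (jden A w) * nsq (jden A u)).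
  by rewrite sub_mobius// nsqM nsqV nsqM.
have e0 x y : rhoc x y = nsq (y - x) / nsq (y - x^*) by rewrite /rhoc nsqM nsqV.
rewrite !e0 e1 e2; have n1 := jden_neq0 dA w0; have n2 := jden_neq0 dA u0; have n3 := sub_conj_neq0 u0 w0.
rewrite -nsq_eq0 in n1; rewrite -nsq_eq0 in n2; rewrite -nsq_eq0 in n3.
by field; rewrite n1 n2 n3.
Qed.

Lemma clogM3 (a b d : C) : 0 < Re a -> 0 < Re b -> 0 < Re d -> 0 < Re (a * b * d) ->
  clog (a * b * d) = clog a + clog b + clog d.
Proof.
move=> a0 b0 d0 abd; apply: cexp_inj; last by rewrite !cexpD !cexp_clog.
have := clog_Im a; have := clog_Im b; have := clog_Im d; have := clog_Im (a * b * d).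
rewrite !ImD !ltr_norml => /andP[a1 a2] /andP[b1 b2] /andP[c1 c2] /andP[d1 d2].
by have p0 := pi_gt0 R; apply/andP; split; lra.
Qed.

Lemma cpowM3 (t : R) (a b d : C) : 0 < Re a -> 0 < Re b -> 0 < Re d -> 0 < Re (a * b * d) ->
  cpow t (a * b * d) = cpow t a * cpow t b * cpow t d.
Proof. by move=> *; rewrite /cpow clogM3// !mulrDr !cexpD. Qed.

(* A unimodular multiple of [cz + d] lies in the right half-plane, where the
   branch of the power function is multiplicative enough. *)
Lemma rotate_jden A : \det A = 1 -> exists2 k : C, nsq k = 1 &
  forall w, HP w -> 0 < Re (k * jden A w).
Proof.
rewrite det2 => dA; have [c0|c0|c0] := ltgtP (A 1 0) 0.
- exists (0 +i* 1); first by rewrite /nsq !cE expr0n expr1n add0r.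
  move=> w w0; have : 0 < - A 1 0 * Im w by rewrite mulr_gt0// oppr_gt0.
  by rewrite /jden !cE; lra.
- exists (0 -i* 1); first by rewrite /nsq !cE expr0n sqrrN expr1n add0r.
  move=> w w0; have : 0 < A 1 0 * Im w by rewrite mulr_gt0.
  by rewrite /jden !cE; lra.
- have d0 : A 1 1 != 0.
    apply/eqP => d0; move/eqP: dA; rewrite c0 d0 !mulr0 subrr eq_sym oner_eq0 //.
  exists (Num.sg (A 1 1))%:C; first by rewrite nsqR sqr_sg d0.
  move=> w w0; rewrite /jden c0 !cE !mul0r !subr0 add0r -normrEsg.
  by rewrite normr_gt0.
Qed.

Section Cocycle.
Variable s : R.
Hypothesis s1 : 1 < s.
Local Notation ker := (@ker R s).

(* [J] is an automorphy factor: [f \mapsto (f \o act) * J] preserves the kernel. *)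
Definition symmetry (act : C -> C) (J : C -> C) :=
  [/\ forall w, HP w -> HP (act w) &
      forall u w, HP u -> HP w -> ker (act u) (act w) * J w * (J u)^* = ker u w].

(** [kq u w] is the product of [kq] at the image points with [k * jden A w] and the conjugate of
    [k * jden A u], since [|k| = 1]. All three factors and the product lie in the right half-plane,
    so the power splits. *)
Lemma symmetry_mobius A : \det A = 1 -> exists J, symmetry (mobius A) J.
Proof.
move=> dA; have [k k1 hk] := rotate_jden dA.
exists (fun w => cpow (- s) (k * jden A w)); split; first by move=> w; exact: mobius_HP.
move=> u w u0 w0; have ku := hk u u0; have kw := hk w w0.
have n1 := jden_neq0 dA w0; have n2 := jden_neq0 dA u0.
have n2' : (jden A u)^* != 0 by rewrite -nsq_eq0 nsqJ nsq_eq0.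
have kk : k * k^* = 1 by rewrite mulJ k1.
have e : kq u w = kq (mobius A u) (mobius A w) * (k * jden A w) * (k * jden A u)^*.
  rewrite /kq sub_conj_mobius// rmorphM.
  transitivity ((0 -i* 2^-1) * (w - u^*) * (k * k^*)); first by rewrite kk mulr1.
  by field; rewrite n1 n2'.
have kuJ : 0 < Re (k * jden A u)^* by rewrite ReJ.
have q0 := Re_kq_gt0 (mobius_HP dA u0) (mobius_HP dA w0).
have q1 := Re_kq_gt0 u0 w0; rewrite e in q1.
have -> : ker u w = (cK s)%:C * cpow (- s) (kq u w) by [].
have -> : ker (mobius A u) (mobius A w) =
  (cK s)%:C * cpow (- s) (kq (mobius A u) (mobius A w)) by [].
have cJ : ((cpow (- s) (k * jden A u))^*)%R = cpow (- s) (k * jden A u)^*.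
  by rewrite cpowJ.
rewrite e cpowM3// -!mulrA; congr (_ * (_ * _)).
by congr (_ * _); exact: cJ.
Qed.

(* Makes multiplication by [i] one of the symmetries. *)
Lemma symmetry_I : symmetry id (fun=> 0 +i* 1).
Proof.
split => // u w _ _; rewrite -mulrA mulJ.
by rewrite (_ : nsq _ = 1) ?mulr1// /nsq !cE expr0n expr1n add0r.
Qed.

(** The symmetry of the kernel read on the diagonal. *)
Lemma symmetry_Im act J w : symmetry act J -> HP w ->
  Im (act w) `^ s = nsq (J w) * Im w `^ s.
Proof.
move=> [hH h] w0; have := h w w w0 w0; rewrite -mulrA mulJ !ker_diag//; last exact: hH.
rewrite -rmorphM => /(congr1 Re); rewrite !cE !powRN.
have p1 : 0 < Im w `^ s by exact: powR_gt0.
have p2 : 0 < Im (act w) `^ s by apply: powR_gt0; exact: hH.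
have c0 := cK_gt0 s1.
set a := _ `^ s in p1 *; set b := _ `^ s in p2 *; set n := nsq _ => h2.
apply: (mulfI (x := cK s / (a * b))); first by rewrite gt_eqF// divr_gt0// mulr_gt0.
have -> : cK s / (a * b) * b = cK s * a^-1 by field; rewrite !gt_eqF.
by rewrite -h2; field; rewrite !gt_eqF.
Qed.

End Cocycle.
End Action.

(** * Discrete subgroups: countability and isolated orbits *)

Section Discrete.
Variable R : realType.
Variable G : set (PSL2 R).
Hypothesis Gclosed : group_closed (mem G).
Hypothesis Gdisc : discrete_subset G.
Local Notation C := R[i].
Local Notation Im := (@complex.Im R).
Local Notation HP := (@upper_half_plane R).
Local Notation N := (@Normc.normc R).
Local Open Scope complex_scope.
Local Open Scope quotient_scope.

Lemma G1 : G (PSL2_one R).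
Proof. by have [/set_mem] := Gclosed. Qed.

Lemma GV g : G g -> G (PSL2_inv g).
Proof. by move=> /mem_set h; apply: set_mem; exact: (group_closedV Gclosed). Qed.

Lemma GM g h : G g -> G h -> G (PSL2_mul g h).
Proof. by move=> /mem_set hg /mem_set hh; apply: set_mem; exact: (group_closedM Gclosed). Qed.

Lemma discrete_entries : exists2 e : R, 0 < e & forall A : SL2 R,
  (forall i j, `|val A i j - (1%:M : 'M[R]_2) i j| < e) -> G (\pi_(PSL2 R) A) ->
  \pi_(PSL2 R) A = PSL2_one R.
Proof.
have h := Gdisc G1.
have : nbhs (SL2_one R) [set A : SL2 R | G (\pi_(PSL2 R) A) -> \pi_(PSL2 R) A = PSL2_one R].
  exact: (@pi_continuous _ {eq_quot (SL2_eqpm (R := R))} (SL2_one R) _ h).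
rewrite nbhsE => -[B [[A oA AB] B1] BP].
have A1 : A (1%:M : 'M[R]_2) by move: B1; rewrite -AB.
have /nbhs_ballP[e /= e0 he] := open_nbhs_nbhs (conj oA A1).
exists e => // S hS GS; apply: BP => //; rewrite -AB; apply: he.
split => // i j; rewrite /ball /= distrC; exact: hS.
Qed.

Lemma invmx2 (H : 'M[R]_2) : \det H = 1 -> forall i j, exists k l, `|(invmx H) i j| = `|H k l|.
Proof.
move=> dH; pose K : 'M[R]_2 := \matrix_(i, j) if i == 0 then (if j == 0 then H 1 1 else - H 0 1)
   else (if j == 0 then - H 1 0 else H 0 0).
have uH : H \in unitmx by rewrite unitmxE dH unitr1.
have KH : K *m H = 1%:M.
  rewrite det2 in dH; apply/matrixP => i j; rewrite mulmx2 !mxE /=.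
  have [->|->] : i = 0 \/ i = 1 by exact: ord2P.
    have [->|->] /= : j = 0 \/ j = 1 by exact: ord2P.
      by rewrite -dH; ring.
    by ring.
  have [->|->] /= : j = 0 \/ j = 1 by exact: ord2P.
    by ring.
  by rewrite -dH; ring.
have -> : invmx H = K by rewrite -[LHS]mul1mx -KH mulmxK.
move=> i j; rewrite mxE; case: ifP => _; case: ifP => _.
- by exists 1, 1.
- by exists 0, 1; rewrite normrN.
- by exists 1, 0; rewrite normrN.
- by exists 0, 0.
Qed.

Let ent (g : PSL2 R) i j := val (repr g) i j.

(** The product [h^-1 g] is close to the identity: a unimodular inverse has the same entries up to
    order and sign, so each entry of [h^-1 (g - h)] is at most [2 M eta]. *)
Lemma close_eq (e M eta : R) : (forall A : SL2 R,
  (forall i j, `|val A i j - (1%:M : 'M[R]_2) i j| < e) -> G (\pi_(PSL2 R) A) ->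
  \pi_(PSL2 R) A = PSL2_one R) -> 0 <= M -> 2 * M * eta < e ->
  forall g h, G g -> G h -> (forall i j, `|ent h i j| <= M) ->
  (forall i j, `|ent g i j - ent h i j| <= eta) -> g = h.
Proof.
move=> he M0 Me g h Gg Gh hM gh.
pose A := SL2_mul (SL2_inv (repr h)) (repr g).
have piA : \pi_(PSL2 R) A = PSL2_mul (PSL2_inv h) g.
  by rewrite /A PSL2_piM PSL2_piV !reprK.
have A1 : \pi_(PSL2 R) A = PSL2_one R.
  apply: he; last by rewrite piA; apply: GM => //; exact: GV.
  move=> i j; have dh := det_repr h.
  have uH : val (repr h) \in unitmx by rewrite unitmxE dh unitr1.
  have -> : val A i j - (1%:M : 'M[R]_2) i j =
      (invmx (val (repr h)) *m (val (repr g) - val (repr h))) i j.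
    by rewrite mulmxBr mulVmx// !mxE.
  rewrite mulmx2; apply: le_lt_trans (ler_normD _ _) _; rewrite !normrM.
  have inv k : `|(invmx (val (repr h))) i k| <= M.
    by have [a [b ->]] := invmx2 dh i k; exact: hM.
  have dif k : `|(val (repr g) - val (repr h)) k j| <= eta.
    by rewrite !mxE; exact: gh.
  have p k : `|(invmx (val (repr h))) i k| * `|(val (repr g) - val (repr h)) k j| <= M * eta.
    by apply: ler_pM.
  by have := p 0; have := p 1; lra.
rewrite piA in A1.
by rewrite -(PSL2_1mul h) -A1 PSL2_mulA PSL2_Vmul PSL2_mul1.
Qed.

(** Pigeonhole: the entries are sorted into cells of side [eta], and two group elements in the same
    cells coincide. *)
Lemma finite_bounded (M : R) : 0 <= M ->
  finite_set [set g | G g /\ forall i j, `|ent g i j| <= M].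
Proof.
move=> M0; have [e e0 he] := discrete_entries.
pose eta := e / (2 * M + 1).
have M1 : 0 < 2 * M + 1 by rewrite ltr_wpDl// mulr_ge0.
have eta0 : 0 < eta by rewrite divr_gt0.
have Me : 2 * M * eta < e.
  by rewrite /eta mulrA ltr_pdivrMr// mulrDr mulr1 mulrC ltrDl.
set S := [set g | _].
pose K := Num.truncn (2 * M / eta).
pose c g i j : 'I_K.+1 := inord (Num.truncn ((ent g i j + M) / eta)).
pose f g := (c g 0 0, c g 0 1, (c g 1 0, c g 1 1)).
have injf : {in S &, injective f}.
  move=> g h /set_mem[Gg gM] /set_mem[Gh hM] [e00 e01 e10 e11].
  apply: (close_eq he M0 Me Gg Gh hM) => i j.
  have pos x : `|x| <= M -> 0 <= (x + M) / eta.
    by rewrite ler_norml => /andP[? ?]; rewrite divr_ge0 ?(ltW eta0)//; lra.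
  have small x : `|x| <= M -> (Num.truncn ((x + M) / eta) < K.+1)%N.
    move=> hx; rewrite ltnS; apply: le_truncn.
    by rewrite ler_pM2r ?invr_gt0//; move: hx; rewrite ler_norml => /andP[]; lra.
  have key x y : `|x| <= M -> `|y| <= M ->
      (inord (Num.truncn ((x + M) / eta)) : 'I_K.+1) = inord (Num.truncn ((y + M) / eta)) ->
      `|x - y| <= eta.
    move=> hx hy /(congr1 val); rewrite /= !inordK ?small// => exy.
    have /andP[x1 x2] := truncn_itv (pos x hx); have /andP[y1 y2] := truncn_itv (pos y hy).
    rewrite exy in x1 x2; set k := Num.truncn _ in x1 x2 y1 y2.
    have d : `|(x + M) / eta - (y + M) / eta| <= 1.
      by rewrite -natr1 in x2 y2; rewrite ler_norml; apply/andP; split; lra.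
    move: d; rewrite -mulrBl normrM [`|eta^-1|]ger0_norm ?invr_ge0 ?(ltW eta0)//.
    by rewrite ler_pdivrMr// mul1r (_ : x + M - (y + M) = x - y)//; ring.
  have [->|i1] : i = 0 \/ i = 1 by exact: ord2P.
    have [->|j1] : j = 0 \/ j = 1 by exact: ord2P.
      exact: key.
    by rewrite j1; exact: key.
  have [->|j1] : j = 0 \/ j = 1 by exact: ord2P.
    by rewrite i1; exact: key.
  by rewrite i1 j1; exact: key.
by rewrite -(eq_finite_set (inj_card_eq injf)); exact: finite_finset.
Qed.

Lemma countable_G : countable G.
Proof.
have GE : G `<=` \bigcup_(n : nat) [set g | G g /\ forall i j, `|ent g i j| <= n%:R].
  move=> g Gg; pose b := `|ent g 0 0| + `|ent g 0 1| + `|ent g 1 0| + `|ent g 1 1|.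
  have b0 : 0 <= b by rewrite /b !addr_ge0.
  exists (Num.truncn b).+1 => //; split=> // i j.
  apply: (@le_trans _ _ b); last by apply/ltW; rewrite truncnS_gt.
  have [n1 n2 n3 n4] : [/\ 0 <= `|ent g 0 0|, 0 <= `|ent g 0 1|, 0 <= `|ent g 1 0| & 0 <= `|ent g 1 1|].
    by [].
  have [->|i1] : i = 0 \/ i = 1 by exact: ord2P.
    have [->|->] : j = 0 \/ j = 1 by exact: ord2P.
      by rewrite /b; lra.
    by rewrite /b; lra.
  rewrite i1; have [->|->] : j = 0 \/ j = 1 by exact: ord2P.
    by rewrite /b; lra.
  by rewrite /b; lra.
apply: (sub_countable (subset_card_le GE)); apply: bigcup_countable => //.
by move=> n _; apply: finite_set_countable; exact: finite_bounded.
Qed.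

(** Only finitely many [g] bring [z] close to itself: then [|cz + d|^2 = Im z / Im (g z)] is at most
    2, the numerator is bounded as well, and both bound the entries. The minimum of the finitely
    many nonzero displacements remains. *)
Lemma orbit_isolated z : HP z -> exists2 d : R, 0 < d &
  forall g, G g -> psl2_act g z != z -> d <= N (psl2_act g z - z).
Proof.
move=> z0.
(* The sum of the bounds for the entries [c], [d], [a] and [b], in this order. *)
pose M := 2 / Im z + (2 + 2 / Im z * N z) + (N z + 1) * 2 / Im z +
  ((N z + 1) * 2 + (N z + 1) * 2 / Im z * N z).
have Nz := normc_ge0 z; have iz : 0 < (Im z)^-1 by rewrite invr_gt0.
have m1 : 0 <= 2 / Im z by rewrite mulr_ge0// ltW.
have m2 : 0 <= 2 / Im z * N z by rewrite mulr_ge0.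
have m3 : 0 <= (N z + 1) * 2 / Im z by rewrite !mulr_ge0 ?addr_ge0// ltW.
have m4 : 0 <= (N z + 1) * 2 / Im z * N z by rewrite mulr_ge0.
have M0 : 0 <= M by rewrite /M; lra.
have /finite_seqP[l lE] := finite_bounded M0.
have [d d0 hd] : exists2 d : R, 0 < d & forall g, g \in l -> psl2_act g z != z ->
    d <= N (psl2_act g z - z).
  elim: l {lE} => [|g l [d d0 hd]]; first by exists 1.
  have [gz|gz] := eqVneq (psl2_act g z) z.
    exists d => // h; rewrite inE => /orP[/eqP ->|]; last exact: hd.
    by rewrite gz eqxx.
  exists (Num.min d (N (psl2_act g z - z))).
    by rewrite lt_min d0 normcE sqrtr_gt0 nsq_gt0 subr_eq0.
  move=> h; rewrite inE => /orP[/eqP -> _|hl hz]; first by rewrite ge_min lexx orbT.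
  by rewrite ge_min hd.
exists (Num.min d (Num.min (Im z / 2) 1)).
  by rewrite !lt_min d0 ltr01 andbT divr_gt0.
move=> g Gg gz; rewrite leNgt !lt_min; apply/negP => /andP[h1 /andP[h2 h3]].
suff : g \in l by move=> /hd /(_ gz); rewrite leNgt h1.
suff : [set` l] g by [].
rewrite -lE; split => //.
have dA := det_repr g; set A := val (repr g) in dA.
have act : psl2_act g z = mobius A z by [].
rewrite act in h1 h2 h3 gz.
have jn := jden_neq0 dA z0; have jp : 0 < nsq (jden A z) by rewrite nsq_gt0.
have Ig : Im z / 2 < Im (mobius A z).
  have := le_lt_trans (Im_le_normc _) h2; rewrite !cE ltr_norml => /andP[]; lra.
have j2 : nsq (jden A z) <= 2.
  rewrite Im_mobius// ltr_pdivlMr// in Ig; rewrite HPE in z0.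
  rewrite -(ler_pM2l (_ : 0 < Im z / 2)) ?divr_gt0//; apply: le_trans (ltW Ig) _; lra.
have Nj : N (jden A z) <= 2.
  rewrite -ler_sqr ?nnegrE ?normc_ge0// normc_sqr; apply: le_trans j2 _; lra.
have num : (A 0 0)%:C * z + (A 0 1)%:C = mobius A z * jden A z by rewrite /mobius divfK.
have Nnum : N ((A 0 0)%:C * z + (A 0 1)%:C) <= (N z + 1) * 2.
  rewrite num Normc.normcM ler_pM ?normc_ge0//.
  have := le_normcD (mobius A z - z) z; rewrite subrK; lra.
have row (a b : R) (K : R) : N (a%:C * z + b%:C) <= K ->
    `|a| <= K / Im z /\ `|b| <= K + K / Im z * N z.
  move=> h; have a1 : `|a| <= K / Im z.
    rewrite ler_pdivlMr//; apply: le_trans h; apply: le_trans (Im_le_normc _).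
    by rewrite !cE mul0r !addr0 normrM (gtr0_norm z0).
  split => //; have := le_normcD (a%:C * z + b%:C) (- (a%:C * z)).
  rewrite addrC addKr normcN Normc.normcM.
  have nR (x : R) : N x%:C = `|x| by rewrite normcE nsqR sqrtr_sqr.
  by rewrite !nR => h4; have := ler_wpM2r Nz a1; lra.
have [c1 d1] := row _ _ _ Nj; have [a1 b1] := row _ _ _ Nnum.
have [B1 B2 B3 B4] : [/\ 2 / Im z <= M, 2 + 2 / Im z * N z <= M, (N z + 1) * 2 / Im z <= M &
    (N z + 1) * 2 + (N z + 1) * 2 / Im z * N z <= M].
  by rewrite /M; split; lra.
move=> i j; rewrite /ent -/A.
have [->|->] : i = 0 \/ i = 1 by exact: ord2P.
  have [->|->] : j = 0 \/ j = 1 by exact: ord2P.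
    exact: le_trans a1 B3.
  exact: le_trans b1 B4.
have [->|->] : j = 0 \/ j = 1 by exact: ord2P.
  exact: le_trans c1 B1.
exact: le_trans d1 B2.
Qed.

End Discrete.

(** * Unfolding *)

Section Unfolding.
Variable R : realType.
Variable G : set (PSL2 R).
Hypothesis Gclosed : group_closed (mem G).
Hypothesis Gdisc : discrete_subset G.
Local Notation C := R[i].
Local Notation C2 := (@complex_of_pair R).
Local Notation Re := (@complex.Re R).
Local Notation Im := (@complex.Im R).
Local Notation HP := (@upper_half_plane R).
Local Notation UH := (@UH R).
Local Notation N := (@Normc.normc R).
Local Notation act := (@psl2_act R).
Local Notation mu := (@lebesgue_measure R).
Local Notation m2 := (@lebesgue_measure R \x @lebesgue_measure R)%E.
Local Notation cK := (@cK R).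
Local Open Scope complex_scope.
Local Open Scope quotient_scope.

Lemma esum_mull h (a : PSL2 R -> \bar R) : G h ->
  (\esum_(g in G) a (PSL2_mul h g) = \esum_(g in G) a g)%E.
Proof.
move=> Gh; apply/esym/(reindex_esum G G (PSL2_mul h)); split.
- by move=> g Gg; exact: (GM Gclosed).
- by move=> g g' _ _ /(congr1 (PSL2_mul (PSL2_inv h))); rewrite !PSL2_mulA PSL2_mulV !PSL2_mul1.
- move=> g Gg; exists (PSL2_mul (PSL2_inv h) g); first by apply: (GM Gclosed) => //; exact: (GV Gclosed).
  by rewrite PSL2_mulA PSL2_Vmul PSL2_mul1.
Qed.

Lemma inv_inv (g : PSL2 R) : PSL2_inv (PSL2_inv g) = g.
Proof. by rewrite -[LHS]PSL2_mul1 -(PSL2_Vmul g) -PSL2_mulA PSL2_Vmul PSL2_1mul. Qed.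

Lemma esum_inv (a : PSL2 R -> \bar R) :
  (\esum_(g in G) a (PSL2_inv g) = \esum_(g in G) a g)%E.
Proof.
apply/esym/(reindex_esum G G (@PSL2_inv R)); split.
- by move=> g Gg; exact: (GV Gclosed).
- by move=> g g' _ _ /(congr1 (@PSL2_inv R)); rewrite !inv_inv.
- by move=> g Gg; exists (PSL2_inv g); [exact: (GV Gclosed)|exact: inv_inv].
Qed.

Lemma PSL2_eq_one (g : PSL2 R) : val (repr g) = 1%:M \/ val (repr g) = - 1%:M -> g = PSL2_one R.
Proof.
move=> h; rewrite -[g]reprK; apply/PSL2_eqP; rewrite /SL2_eqpm /=.
by case: h => ->; rewrite eqxx ?orbT.
Qed.

(** Fixed points solve [c w^2 + (d - a) w - b = 0]; a nonreal solution has real part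
    [(a - d) / 2c]. *)
Definition fixed_line (g : PSL2 R) : R :=
  (val (repr g) 0 0 - val (repr g) 1 1) / (2 * val (repr g) 1 0).

Lemma fixed_on_line g w : HP w -> act g w = w -> g <> PSL2_one R -> Re w = fixed_line g.
Proof.
move=> w0 gw g1; rewrite HPE in w0; set A := val (repr g).
have dA : \det A = 1 by exact: det_repr.
have jn := jden_neq0 dA w0.
have e : (A 0 0)%:C * w + (A 0 1)%:C = w * jden A w.
  by rewrite -{2}gw /psl2_act /mobius -/A -/(jden A w) divfK.
have eI := congr1 Im e; have eR := congr1 Re e; rewrite /jden !cE in eI eR.
have e2 : 2 * A 1 0 * Re w = A 0 0 - A 1 1.
  apply: (mulIf (x := Im w)); first by rewrite gt_eqF.
  by lra.
have [c0|c0] := eqVneq (A 1 0) 0; last by rewrite /fixed_line -/A -e2; field.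
exfalso; apply: g1; apply: PSL2_eq_one.
rewrite c0 in e2 eR eI.
have ad : A 0 0 = A 1 1 by lra.
have b0 : A 0 1 = 0 by move: eR; rewrite ad; lra.
have d2 : (A 1 1 - 1) * (A 1 1 + 1) = 0 by rewrite det2 ad c0 b0 in dA; lra.
have ext k : A 1 1 = k -> A = k%:M.
  move=> ak; apply/matrixP => i j; rewrite !mxE.
  have [->|->] : i = 0 \/ i = 1 by exact: ord2P.
    have [->|->] : j = 0 \/ j = 1 by exact: ord2P.
      by rewrite ad ak eqxx mulr1n.
    by rewrite b0.
  have [->|->] : j = 0 \/ j = 1 by exact: ord2P.
    by rewrite c0.
  by rewrite ak eqxx mulr1n.
move/eqP: d2; rewrite mulf_eq0 subr_eq0 addr_eq0 => /orP[/eqP/ext h|/eqP/ext h].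
  by left.
by right; rewrite -/A h; apply/matrixP => i j; rewrite !mxE mulNrn.
Qed.

Variables (B : set nat) (gn : nat -> PSL2 R).
Hypothesis gnB : set_bij B G gn.

Lemma esum_enum (a : PSL2 R -> \bar R) : (forall g, (0 <= a g)%E) ->
  (\esum_(g in G) a g = \sum_(n <oo | n \in B) a (gn n))%E.
Proof. by move=> a0; rewrite (reindex_esum B G gn)// nneseries_esum// set_mem_set. Qed.

Lemma gn_in n : B n -> G (gn n).
Proof. by have [h _ _] := gnB; exact: h. Qed.

Lemma gn_inj m n : B m -> B n -> gn m = gn n -> m = n.
Proof. by have [_ h _] := gnB => *; apply: h => //; exact: mem_set. Qed.

Lemma gn_surj g : G g -> exists2 n, B n & gn n = g.
Proof. by have [_ _ h] := gnB; exact: h. Qed.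

Let fixed : set (R * R) := (fixed_line @` G) `*` setT.

Let linesE : fixed_line @` G = \bigcup_(n in B) [set fixed_line (gn n)].
Proof.
apply/seteqP; split => x.
  by move=> [g Gg <-]; have [n Bn <-] := gn_surj Gg; exists n.
by move=> [n Bn /= ->]; exists (gn n) => //; exact: gn_in.
Qed.

Let measurable_lines : measurable (fixed_line @` G).
Proof. by rewrite linesE; apply: bigcup_measurable. Qed.

Let countable_lines : countable (fixed_line @` G).
Proof. by apply: sub_countable (countable_G Gclosed Gdisc); exact: card_image_le. Qed.

Let measurable_fixed : measurable fixed.
Proof. exact: measurableX. Qed.

Let fixed0 : m2 fixed = 0%E.
Proof.
rewrite /fixed product_measure1E// -[RHS](mul0e (mu setT)); congr (_ * _)%E.
exact: countable_lebesgue_measure0.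
Qed.

Section Domain.
Variable F : set C.
Hypothesis fundF : fundamental_domain G F.

Let FHP w : F w -> HP w. Proof. by have [h _ _] := fundF; exact: h. Qed.

Lemma mC_fund : mC (\1_F : C -> R).
Proof.
have [_ mF _] := fundF.
exact: (@measurable_indic _ _ _ _ (C2 @^-1` F) mF).
Qed.

(** The preimage of [F] under the [n]-th group element, stripped of the fixed lines so that distinct
    translates are disjoint. *)
Let translate n : set (R * R) :=
  if n \in B then [set p | UH p /\ F (act (gn n) (C2 p))] `\` fixed else set0.

Let measurable_preim n : measurable [set p | UH p /\ F (act (gn n) (C2 p))].
Proof.
have -> : [set p | UH p /\ F (act (gn n) (C2 p))] =
    UH `&` ((\1_F : C -> R) \o act (gn n) \o C2) @^-1` [set 1].
  apply/seteqP; split => p [h1] /= h2; split => //.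
    by rewrite indicE mem_set.
  move: h2; rewrite indicE; case: (boolP (_ \in _)) => [/set_mem//|_ /eqP].
  by rewrite eq_sym oner_eq0.
apply: measurableI; first exact: measurable_UH.
have := @mC_mobius R (val (repr (gn n))) _ mC_fund.
by move=> /(_ measurableT [set 1] (measurable_set1 1)); rewrite setTI.
Qed.

Let measurable_translate n : measurable (translate n).
Proof.
rewrite /translate; case: ifP => // _; apply: measurableD => //.
Qed.

Let trivIset_translate : trivIset setT translate.
Proof.
move=> m n _ _ [p]; rewrite /translate; case: ifP => [/set_mem Bm|_ []//].
case: ifP => [/set_mem Bn|_ []//] [[[pU Fm] np] [[_ Fn] _]].
have pH : HP (C2 p) by exact: pU.
have [_ _ /(_ (C2 p) pH)[w [_ uw]]] := fundF.
have e : act (gn m) (C2 p) = act (gn n) (C2 p).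
  rewrite -(uw (act (gn m) (C2 p))); last first.
    by split => //; exists (gn m) => //; exact: gn_in.
  by apply: uw; split => //; exists (gn n) => //; exact: gn_in.
pose h := PSL2_mul (PSL2_inv (gn n)) (gn m).
have Gh : G h by apply: (GM Gclosed); [apply: (GV Gclosed)|]; exact: gn_in.
have hp : act h (C2 p) = C2 p by rewrite act_mul// e actK.
apply: gn_inj => //.
have [h1|h1] := pselect (h = PSL2_one R).
  by rewrite -[LHS]PSL2_mul1 -(PSL2_Vmul (gn n)) -PSL2_mulA -/h h1 PSL2_1mul.
exfalso; apply: np; split => //=; exists h => //.
by rewrite -(fixed_on_line pH hp h1).
Qed.

Let cover_translate : \bigcup_n translate n = UH `\` fixed.
Proof.
apply/seteqP; split => p.
  by move=> [n _]; rewrite /translate; case: ifP => // _ [[]].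
move=> [pU np]; have pH : HP (C2 p) by exact: pU.
have [_ _ /(_ (C2 p) pH)[w [[Fw [g Gg gw]] _]]] := fundF.
have [n Bn ng] := gn_surj Gg; exists n => //.
by rewrite /translate mem_set//; split => //; split => //; rewrite ng gw.
Qed.

(* Points fixed by a nontrivial element lie on countably many vertical lines, so
   that the translates of [F] tile the half-plane up to a null set. *)
Lemma unfold (Psi : C -> R) : mC Psi -> (forall w, 0 <= Psi w) ->
  (\esum_(g in G) hint (fun w => (\1_F w * Psi (act (PSL2_inv g) w))%R) = hint Psi)%E.
Proof.
move=> mP P0; rewrite esum_enum; last first.
  by move=> g; apply: hint_ge0 => w _; rewrite mulr_ge0// indicE ler0n.
pose f p : \bar R := (Psi (C2 p) * p.2 ^- 2)%:E.
have mf D : measurable D -> D `<=` UH -> measurable_fun D f.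
  by move=> mD DU; apply: (measurable_funS (@measurable_UH R)) => //; exact: mC_weight.
have f0 p : (0 <= f p)%E by rewrite lee_fin mulr_ge0// invr_ge0 sqr_ge0.
have neg D : measurable D -> D `<=` UH -> (\int[m2]_(p in D `\` fixed) f p = \int[m2]_(p in D) f p)%E.
  move=> mD DU; apply/esym/(@ge0_negligible_integral _ _ _ m2 D fixed f) => //; exact: mf.
transitivity (\int[m2]_(p in UH `\` fixed) f p)%E; last by apply: neg => //; exact: measurable_UH.
rewrite -cover_translate ge0_integral_bigcup//; last first.
  apply: mf; first exact: bigcupT_measurable.
  by rewrite cover_translate; exact: subDsetl.
rewrite eseries_mkcond; apply: eq_eseriesr => n _; rewrite /translate.
case: ifP => [/set_mem Bn|_]; last by rewrite integral_set0.
have dn : \det (val (repr (gn n))) = 1 by exact: det_repr.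
set E := [set p | _].
have mE : measurable E.
  exact: measurable_preim.
transitivity (hint (fun w => \1_F (act (gn n) w) * Psi w)).
  pose P w := \1_F w * Psi (act (PSL2_inv (gn n)) w).
  have mP1 : mC P by apply: mC_M; [exact: mC_fund|exact: mC_mobius].
  rewrite -/P -(@hint_mobius_signed _ (val (repr (gn n))) P)//.
  by apply: eq_hint => w w0; rewrite /P /= actK.
rewrite neg//; last by move=> p [].
have -> : E = UH `&` E by apply/esym/setIidr => p [].
rewrite /hint integral_mkcondr; apply: eq_integral => p /set_mem pU.
rewrite patchE /f indicE; case: (boolP (p \in E)) => [/set_mem[_ h]|h].
  by rewrite mem_set// mul1r.
rewrite memNset ?mul0r// => h2; apply: (negP h); apply: mem_set; split => //.
Qed.

End Domain.

Lemma hyperbolic_areaE F : F `<=` HP -> hyperbolic_area F = hint (\1_F : C -> R).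
Proof.
move=> FH; rewrite /hyperbolic_area /hint.
have -> : C2 @^-1` F = UH `&` C2 @^-1` F by apply/esym/setIidr => p /FH.
rewrite integral_mkcondr; apply: eq_integral => p _.
rewrite patchE indicE; case: (boolP (p \in _)) => [/set_mem h|/negP h].
  by rewrite mem_set// mul1r.
by rewrite memNset ?mul0r// => h2; apply: h; exact: mem_set.
Qed.

(** Unfold the indicator of each domain over the other: the piece for [g] in one sum is the
    translate of the piece for [g^-1] in the other. *)
Lemma fund_area_eq F F' : fundamental_domain G F -> fundamental_domain G F' ->
  hint (\1_F : C -> R) = hint (\1_F' : C -> R).
Proof.
move=> fF fF'; have i0 (E : set C) w : 0 <= (\1_E : C -> R) w by rewrite indicE ler0n.
rewrite -(unfold fF' (mC_fund fF) (i0 F)) -(unfold fF (mC_fund fF') (i0 F')) -[RHS]esum_inv.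
apply: eq_esum => g Gg; rewrite inv_inv.
pose P w : R := \1_F' w * \1_F (act (PSL2_inv g) w).
have mP : mC P by apply: mC_M; [exact: mC_fund|apply: mC_mobius; exact: mC_fund].
rewrite -/P -(@hint_mobius_signed _ (val (repr g)) P) ?det_repr//.
by apply: eq_hint => w w0; rewrite /P /= actK// mulrC.
Qed.

Lemma covolumeE F : fundamental_domain G F -> covolume G = hint (\1_F : C -> R).
Proof.
move=> fF; rewrite /covolume (_ : [set _ | _ in _] = [set hint (\1_F : C -> R)]) ?ereal_inf1//.
apply/seteqP; split => [x [F' fF' <-]|x ->].
  by rewrite hyperbolic_areaE; [apply: fund_area_eq|case: fF'].
by exists F => //; apply: hyperbolic_areaE; case: fF.
Qed.

(** The infimum over no domains at all would be infinite. *)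
Lemma covolume_fund : (covolume G < +oo)%E -> exists F, fundamental_domain G F.
Proof.
move=> h; apply: contrapT => no; move: h; rewrite /covolume.
have -> : fundamental_domain G = set0.
  by apply/seteqP; split => F // hF; apply: no; exists F.
by rewrite image_set0 ereal_inf0 ltxx.
Qed.

(** If [F] were negligible, unfolding the bounded function [Psi] would give integral 0. *)
Lemma fund_area_gt0 F (Psi : C -> R) (M : R) : fundamental_domain G F -> mC Psi ->
  (forall w, 0 <= Psi w) -> (forall w, HP w -> Psi w <= M) -> (0 < hint Psi)%E ->
  (0 < hint (\1_F : C -> R))%E.
Proof.
move=> fF mP P0 PM hP; have i0 w : 0 <= (\1_F : C -> R) w by rewrite indicE ler0n.
rewrite lt_neqAle hint_ge0 ?andbT//; apply/eqP => h0.
have hF : hi (\1_F : C -> R).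
  by apply: hi_ge0 => //; [exact: mC_fund|rewrite -h0].
move: hP; rewrite -(unfold fF mP P0) esum1 ?ltxx// => g Gg.
have [F0 _ _] := fF.
have mQ : mC (fun w => \1_F w * Psi (act (PSL2_inv g) w) : R).
  by apply: mC_M; [exact: mC_fund|exact: mC_mobius].
apply/eqP; rewrite eq_le; apply/andP; split; last first.
  by apply: hint_ge0 => w _; rewrite mulr_ge0.
apply: (@le_trans _ _ (hint (fun w => M * \1_F w))).
  apply: hint_mono => //; first by have [] := hi_Z M hF.
  move=> w w0; rewrite mulr_ge0//= [leRHS]mulrC; apply: ler_wpM2l => //.
  by apply: PM; exact: act_HP.
by rewrite -rintK; [rewrite rint_Z// /rint -h0 mulr0|exact: hi_Z].
Qed.

Variable z : C.
Hypothesis z0 : HP z.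
Hypothesis zfree : forall g, G g -> act g z = z -> g = PSL2_one R.

Lemma rhoc_near (u w : C) (d : R) : HP u -> HP w -> 0 < d -> d <= 1 / 2 -> rhoc u w < d ->
  nsq (w - u) <= 8 * d * (Im w * Im u).
Proof.
move=> u0 w0 d0 d1; have n0 := sub_conj_neq0 u0 w0; rewrite -nsq_gt0 in n0.
rewrite /rhoc nsqM nsqV ltr_pdivrMr// nsq_add4.
have p0 : 0 < Im w * Im u by exact: mulr_gt0.
set n := nsq _; set y := Im w * Im u in p0 *; rewrite -mulrA -/y => h.
have nn : 0 <= n by exact: nsq_ge0.
have h1 := ler_wpM2r nn d1; lra.
Qed.

(** Invariance of [rhoc] reduces the claim to a disc about [z] itself. A common point with the disc
    about [h z] would bring [h z] within Euclidean distance [e] of [z], contrary to the isolation of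
    the orbit. *)
Lemma near_disjoint : exists2 d : R, 0 < d & forall g h w, G g -> G h -> HP w ->
  rhoc (act g z) w < d -> rhoc (act h z) w < d -> g = h.
Proof.
have [e e0 he] := orbit_isolated Gclosed Gdisc z0.
(* The bound 1/16 makes heights in a disc comparable up to a factor 2. The squared distance from [z]
   to [h z] is then at most [160 d (Im z)^2], below [e^2]. *)
pose d := Num.min (1 / 16) (e ^+ 2 / (200 * Im z ^+ 2)).
have y2 : 0 < Im z ^+ 2 by rewrite exprn_gt0.
have c200 : 0 < 200 * Im z ^+ 2 by rewrite mulr_gt0.
have ee0 : 0 < e ^+ 2 by rewrite exprn_gt0.
have d0 : 0 < d by rewrite lt_min (divr_gt0 ee0 c200) divr_gt0.
have d1 : d <= 1 / 16 by rewrite ge_min lexx.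
have d2 : 200 * (d * Im z ^+ 2) <= e ^+ 2.
  by rewrite mulrCA -(ler_pdivlMr _ _ c200) ge_min lexx orbT.
have key h w : G h -> HP w -> rhoc z w < d -> rhoc (act h z) w < d -> h = PSL2_one R.
  move=> Gh w0 r1 r2; apply: zfree => //; apply/eqP; apply: contraT => hz.
  have q0 : HP (act h z) by exact: act_HP.
  have dh : d <= 1 / 2 by lra.
  have n1 := rhoc_near z0 w0 d0 dh r1; have n2 := rhoc_near q0 w0 d0 dh r2.
  have sq (u : C) : (Im w - Im u) ^+ 2 <= nsq (w - u).
    by rewrite /nsq !cE lerDr sqr_ge0.
  have s1 := le_trans (sq z) n1; have s2 := le_trans (sq _) n2.
  set q := act h z in r2 hz q0 n2 s2 *; rewrite HPE in w0 q0.
  have y0 : 0 < Im z by exact: z0.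
  have dy (y y' : R) : 0 < y -> 0 < y' -> 8 * d * (y * y') <= y * y' / 2.
    move=> p1 p2; have := ler_wpM2r (ltW (mulr_gt0 p1 p2)) d1; lra.
  have b1 : Im w <= 2 * Im z.
    rewrite leNgt; apply/negP => c; have := dy _ _ w0 y0.
    have : Im w / 2 * (Im w / 2) < (Im w - Im z) ^+ 2.
      by rewrite -expr2 ltr_pXn2r ?nnegrE//; lra.
    have := ltr_pM2l w0 (2 * Im z) (Im w); rewrite c => c2; lra.
  have b2 : Im q <= 2 * Im w.
    rewrite leNgt; apply/negP => c; have := dy _ _ w0 q0.
    have : Im q / 2 * (Im q / 2) < (Im w - Im q) ^+ 2.
      by rewrite -[_ ^+ 2]sqrrN opprB -expr2 ltr_pXn2r ?nnegrE//; lra.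
    have := ltr_pM2l q0 (2 * Im w) (Im q); rewrite c => c2; lra.
  have m1 : Im w * Im z <= 2 * Im z ^+ 2.
    by have := ler_wpM2r (ltW y0) b1; lra.
  have m2' : Im w * Im q <= 8 * Im z ^+ 2.
    have b3 : Im q <= 4 * Im z by lra.
    have := ler_pM (ltW w0) (ltW q0) b1 b3; rewrite expr2; lra.
  have nq : nsq (q - z) <= 2 * (nsq (w - z) + nsq (w - q)).
    have := nsqD_le (w - z) (- (w - q)); rewrite nsqN.
    by rewrite (_ : w - z + - (w - q) = q - z) //; ring.
  have m3 := ler_wpM2l (ltW d0) m1; have m4 := ler_wpM2l (ltW d0) m2'.
  have dz : 0 < d * Im z ^+ 2 by exact: mulr_gt0.
  have := he _ Gh hz; rewrite -/q -ler_sqr ?nnegrE ?normc_ge0 ?(ltW e0)// normc_sqr; lra.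
exists d => // g h w Gg Gh w0 r1 r2.
pose k := PSL2_mul (PSL2_inv g) h; pose v := act (PSL2_inv g) w.
have Gi := GV Gclosed Gg; have v0 : HP v by exact: act_HP.
have := @rhoc_mobius R (val (repr (PSL2_inv g))) _ _ (det_repr _) (act_HP g z0) w0.
rewrite -!/(psl2_act _ _) actK// => e1.
have := @rhoc_mobius R (val (repr (PSL2_inv g))) _ _ (det_repr _) (act_HP h z0) w0.
rewrite -!/(psl2_act _ _) -act_mul// => e2.
have k1 : k = PSL2_one R.
  by apply: (key _ v) => //; [exact: (GM Gclosed)|rewrite /v e1|rewrite /v e2].
by rewrite -[RHS]PSL2_mul1 -(PSL2_Vmul g) -PSL2_mulA -/k k1 PSL2_1mul.
Qed.

Let p n := act (gn n) z.
Let p0 n : HP (p n). Proof. exact: act_HP. Qed.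

(** The local bounds at the orbit points live on disjoint discs of equal size, so their sum is at
    most the full norm. *)
Lemma orbit_bessel (s : R) : 1 < s -> exists2 c, 0 < c & forall f, X0 s f -> forall n,
  \sum_(k < n | nat_of_ord k \in B) nsq (f (p k)) * Im (p k) `^ s <= c * ip s f f.
Proof.
move=> s1; have [d d0 hd] := near_disjoint.
pose A := [set r : R | r < d]; have mA : measurable A.
  by have -> : A = `]-oo, d[%classic by apply/seteqP; split => r /=; rewrite in_itv.
have c0 : 0 < cpsi s \1_A by exact: near_cpsi_gt0.
have K0 := cK_gt0 s1.
exists (4 * cK s / cpsi s \1_A ^+ 2); first by rewrite divr_gt0 ?exprn_gt0// mulr_gt0.
move=> f Xf n; have lf : L2 s f by have [] := Xf.
rewrite mulrAC ler_pdivlMr ?exprn_gt0// mulr_suml.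
pose D u w : R := nsq (f w) * \1_A (rhoc u w) * Im w `^ s.
have hiD u : hi (D u).
  apply: (hi_dom (Q := fun w => nsq (f w) * Im w `^ s)); last first.
  - move=> w w0; have /andP[i0 i1] := indic01 A (rhoc u w).
    rewrite /D ger0_norm; last by rewrite !mulr_ge0 ?nsq_ge0 ?powR_ge0.
    rewrite ler_wpM2r ?powR_ge0//; have := ler_wpM2l (nsq_ge0 (f w)) i1; by rewrite mulr1.
  - by have [] := lf.
  - by apply: mC_dens; have [] := lf.
  apply: mC_M; last by apply: mC_powR; exact: mC_Im.
  by apply: mC_M; [apply: mC_nsqf; have [] := lf|apply: mC_indic => //; exact: mC_rhoc].
have hiS m : hi (fun w => \sum_(k < m | nat_of_ord k \in B) D (p k) w) /\
   rint (fun w => \sum_(k < m | nat_of_ord k \in B) D (p k) w) =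
   \sum_(k < m | nat_of_ord k \in B) rint (D (p k)).
  elim: m => [|m [ih1 ih2]].
    under eq_fun do rewrite big_ord0; rewrite big_ord0.
    have h0 : hi (fun=> 0 : R).
      apply: (eq_hi _ _ (hi_Z 0 (hiD z))); [by move=> w _; rewrite mul0r|exact: mC_cst].
    by split => //; have := rint_Z 0 h0; rewrite !mul0r.
  have e w : \sum_(k < m.+1 | nat_of_ord k \in B) D (p k) w =
     \sum_(k < m | nat_of_ord k \in B) D (p k) w + (if m \in B then D (p m) w else 0).
    by rewrite big_mkcond big_ord_recr /= -big_mkcond.
  under eq_fun do rewrite e.
  rewrite [X in _ /\ _ = X]big_mkcond big_ord_recr /= -big_mkcond.
  case: ifP => mB; last by under eq_fun do rewrite addr0; rewrite addr0.
  by split; [exact: hi_D|rewrite rint_D// ih2].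
have [hS rS] := hiS n.
apply: (@le_trans _ _ (4 * cK s * rint (fun w => \sum_(k < n | nat_of_ord k \in B) D (p k) w))).
  rewrite rS mulr_sumr; apply: ler_sum => k _; rewrite mulrC.
  exact: local_bound.
apply: ler_wpM2l; first by rewrite mulr_ge0// ltW.
rewrite ip_nsq; apply: rint_le => //; first exact: L2_hi.
move=> w w0; rewrite -mulr_suml ler_wpM2r ?powR_ge0// -mulr_sumr.
rewrite -[leRHS]mulr1 ler_wpM2l ?nsq_ge0//.
have [[k [kn kB kr]]|no] := pselect (exists k, [/\ (k < n)%N, k \in B & rhoc (p k) w < d]).
  rewrite (bigD1 (Ordinal kn))//= big1 ?addr0; first by have /andP[] := indic01 A (rhoc (p k) w).
  move=> j /andP[jB /eqP jk]; rewrite indicE memNset// => jr; apply: jk; apply: val_inj => /=.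
  apply: gn_inj; [exact: set_mem|exact: set_mem|].
  by apply: (hd _ _ w) => //; apply: gn_in; exact: set_mem.
rewrite big1 ?ler01// => j jB; rewrite indicE memNset// => jr; apply: no.
by exists j.
Qed.

End Unfolding.

(** * The frame operator of an orbit *)

Section Spectral.
Variables (R : realType) (s : R).
Hypothesis s1 : 1 < s.
Variable G : set (PSL2 R).
Hypothesis Gclosed : group_closed (mem G).
Hypothesis Gdisc : discrete_subset G.
Local Notation C := R[i].
Local Notation C2 := (@complex_of_pair R).
Local Notation Re := (@complex.Re R).
Local Notation Im := (@complex.Im R).
Local Notation HP := (@upper_half_plane R).
Local Notation UH := (@UH R).
Local Notation act := (@psl2_act R).
Local Notation cI := (@cI R).
Local Notation m2 := (@lebesgue_measure R \x @lebesgue_measure R)%E.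
Local Notation XT := (bspace s1).
Local Open Scope complex_scope.

Variables (B : set nat) (gn : nat -> PSL2 R).
Hypothesis gnB : set_bij B G gn.

Lemma hint_esum (P : PSL2 R -> C -> R) (Q : C -> R) : (forall g, mC (P g)) ->
  (forall g w, 0 <= P g w) -> (forall w, (Q w)%:E = \esum_(g in G) (P g w)%:E)%E ->
  mC Q /\ (hint Q = \esum_(g in G) hint (P g))%E.
Proof.
move=> mP P0 QE; pose f n p : \bar R := (if n \in B then P (gn n) (C2 p) else 0)%:E.
have mf n : measurable_fun [set: R * R] (f n).
  apply/measurable_EFinP; case: (n \in B); [exact: mP|exact: measurable_cst].
have f0 n p : (0 <= f n p)%E by rewrite lee_fin; case: ifP.
have Qf p : ((Q (C2 p))%:E = \sum_(n <oo) f n p)%E.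
  rewrite QE (esum_enum gnB); last by move=> g; rewrite lee_fin.
  by rewrite eseries_mkcond; apply: eq_eseriesr => n _; rewrite /f; case: ifP.
split.
  apply/measurable_EFinP; rewrite (_ : EFin \o _ = fun p => \sum_(n <oo) f n p)%E; last first.
    by apply/funext => p /=; exact: Qf.
  by apply: ge0_emeasurable_sum.
rewrite (esum_enum gnB); last by move=> g; apply: hint_ge0.
rewrite /hint; transitivity (\int[m2]_(p in UH) \sum_(n <oo) ((p.2 ^- 2)%:E * f n p))%E.
  by apply: eq_integral => p _; rewrite EFinM Qf muleC -nneseriesZl.
rewrite integral_nneseries; [|exact: measurable_UH| |]; last 2 first.
- move=> n; have mi : measurable_fun UH (fun p : R * R => (p.2 ^- 2)%:E).
    by apply/measurable_EFinP; exact: measurable_invsq.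
  exact: (emeasurable_funM mi (measurable_funTS (mf n))).
- by move=> n p _; rewrite mule_ge0// lee_fin invr_ge0 sqr_ge0.
rewrite [RHS]eseries_mkcond; apply: eq_eseriesr => n _; rewrite /f; case: ifP => _.
  by apply: eq_integral => p _; rewrite -EFinM mulrC.
by apply: integral0_eq => p _; rewrite mule0.
Qed.

(** The translate of [x] by [h] with automorphy factor [J] is [y]. A relation, since for an
    arbitrary [J] the translate need not be formed inside the space. *)
Definition rel h (J : C -> C) (x y : XT) :=
  forall w, HP w -> val x (act h w) * J w = val y w.

Definition equivariant (A : XT -> XT) := forall h J x y, G h -> symmetry s (act h) J ->
  rel h J x y -> rel h J (A x) (A y).

Lemma valD (x y : XT) w : val (x + y) w = val x w + val y w. Proof. by []. Qed.
Lemma valN (x : XT) w : val (- x) w = - val x w. Proof. exact: mulN1r. Qed.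
Lemma valZ (a : R) (x : XT) w : val (a *: x) w = a%:C * val x w. Proof. by []. Qed.

Lemma XT_ext (x y : XT) : (forall w, HP w -> val x w = val y w) -> x = y.
Proof. by move=> h; apply: val_inj; apply: (X0_ext h); exact: XT_X0. Qed.

Lemma equiv_id : equivariant id.
Proof. by []. Qed.

Lemma equiv_comp A A' : equivariant A -> equivariant A' -> equivariant (A \o A').
Proof. by move=> hA hA' h J x y Gh sJ r; apply: hA => //; exact: hA'. Qed.

Lemma equiv_add A A' : equivariant A -> equivariant A' -> equivariant (fun x => A x + A' x).
Proof.
move=> hA hA' h J x y Gh sJ r w w0; rewrite !valD mulrDl.
by congr (_ + _); [exact: (hA h J)|exact: (hA' h J)].
Qed.

Lemma equiv_opp A : equivariant A -> equivariant (fun x => - A x).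
Proof.
by move=> hA h J x y Gh sJ r w w0; rewrite !valN mulNr; congr (- _); exact: (hA h J).
Qed.

Lemma equiv_iter A n : equivariant A -> equivariant (iter n A).
Proof.
by move=> hA; elim: n => [|n ih]; [exact: equiv_id|exact: (@equiv_comp A (iter n A))].
Qed.

(** The identity map with constant factor [i] is a symmetry, so equivariance includes complex
    linearity. *)
Lemma equiv_mulI A x : equivariant A -> A (XT_mulC cI x) = XT_mulC cI (A x).
Proof.
move=> hA; apply: XT_ext => w w0.
have sI : symmetry s (act (PSL2_one R)) (fun=> 0 +i* 1).
  rewrite (_ : act (PSL2_one R) = id); first exact: symmetry_I.
  by apply/funext => v; exact: act_one.
have r : rel (PSL2_one R) (fun=> 0 +i* 1) x (XT_mulC cI x).
  by move=> v v0; rewrite act_one mulrC.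
by rewrite -(hA _ _ _ _ (G1 Gclosed) sI r w w0) act_one mulrC.
Qed.

Definition good (A : XT -> XT) := [/\ forall x y, A (x + y) = A x + A y,
  forall (a : R) x, A (a *: x) = a *: A x, forall x y, xip (A x) y = xip x (A y) & equivariant A].

Lemma good_mulC A a x : good A -> A (XT_mulC a x) = XT_mulC a (A x).
Proof.
move=> [AD AZ _ Ae].
have e (y : XT) : XT_mulC a y = Re a *: y + Im a *: XT_mulC cI y.
  apply: XT_ext => w _; rewrite valD !valZ /= mulrA -mulrDl; congr (_ * _).
  by apply: eqC; rewrite /cI !cE; ring.
by rewrite !e AD !AZ equiv_mulI.
Qed.

Definition Kv (w : C) : XT := if pselect (HP w) is left h then kerX s1 h 1 else 0.

Lemma KvE w (w0 : HP w) : Kv w = kerX s1 w0 1.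
Proof.
rewrite /Kv; case: pselect => // h.
by apply: XT_ext => v v0; rewrite !kerXE.
Qed.

Lemma good_kerX A w (w0 : HP w) a : good A -> A (kerX s1 w0 a) = XT_mulC a (A (Kv w)).
Proof.
move=> hA; rewrite -(good_mulC _ _ hA); congr A; apply: XT_ext => v v0.
by rewrite kerXE// KvE /= cutE// mul1r.
Qed.

Lemma good_swap A u w : good A -> HP u -> HP w -> val (A (Kv u)) w = (val (A (Kv w)) u)^*.
Proof.
move=> hA u0 w0; have [_ _ Ai _] := hA.
have key a : Re (val (A (Kv u)) w * a^*) = Re (a * val (A (Kv w)) u).
  rewrite -(xip_ker _ w0) Ai good_kerX// xipC (KvE u0) xip_ker.
  by rewrite /= rmorph1 mulr1.
by have := key 1; have := key cI; rewrite /cI !cE => h1 h2; apply: eqC; rewrite !cE; lra.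
Qed.

Lemma good_cocycle A h J u w : good A -> G h -> symmetry s (act h) J -> HP u -> HP w ->
  val (A (Kv (act h u))) (act h w) * J w * (J u)^* = val (A (Kv u)) w.
Proof.
move=> hA Gh sJ u0 w0; have [_ _ _ Ae] := hA; have [hHP hJ] := sJ; have hu := hHP u u0.
have r : rel h J (kerX s1 hu (J u)^*) (Kv u).
  move=> v v0; rewrite (KvE u0) !kerXE//; last exact: hHP.
  by rewrite mul1r -(hJ u v u0 v0); ring.
have := Ae _ _ _ _ Gh sJ r w w0; rewrite good_kerX//= => <-; ring.
Qed.

(** The squared modulus of the integral kernel of [A]. The weights absorb the automorphy factors and
    make it invariant under the diagonal action. *)
Definition dens (A : XT -> XT) u w := nsq (val (A (Kv u)) w) * (Im u `^ s * Im w `^ s).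

Lemma dens_sym A u w : good A -> HP u -> HP w -> dens A u w = dens A w u.
Proof.
by move=> hA u0 w0; rewrite /dens (good_swap hA u0 w0) nsqJ [_ `^ s * _]mulrC.
Qed.

Lemma dens_act A h u w : good A -> G h -> HP u -> HP w ->
  dens A (act h u) (act h w) = dens A u w.
Proof.
move=> hA Gh u0 w0; have [J sJ] := symmetry_mobius s (det_repr h).
rewrite /dens -(good_cocycle hA Gh sJ u0 w0) !nsqM nsqJ.
rewrite (symmetry_Im s1 sJ u0) (symmetry_Im s1 sJ w0); ring.
Qed.

Lemma mC_dens_act A u : mC (dens A u).
Proof.
apply: mC_M; first by apply: mC_nsqf; have [] := XT_L2 (A (Kv u)).
by apply: mC_M; [exact: mC_cst|apply: mC_powR; exact: mC_Im].
Qed.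

Lemma dens_ge0 A u w : 0 <= dens A u w.
Proof. by rewrite !mulr_ge0 ?nsq_ge0 ?powR_ge0. Qed.


End Spectral.

Lemma form_polar (R : realType) (V : zmodType) (F : V -> V -> R) :
  (forall x y, F x y = F y x) -> (forall x y t, F (x + y) t = F x t + F y t) ->
  forall u v, 4 * F u v = F (u + v) (u + v) - F (u - v) (u - v).
Proof.
move=> FC FD; have F0 t : F 0 t = 0 by have := FD 0 0 t; rewrite addr0; lra.
have FN x t : F (- x) t = - F x t by have := FD x (- x) t; rewrite subrr F0; lra.
have FDr t x y : F t (x + y) = F t x + F t y by rewrite FC FD !(FC t).
have FNr t x : F t (- x) = - F t x by rewrite FC FN FC.
by move=> u v; rewrite !FD !FDr !FN !FNr (FC v u); ring.
Qed.

(** * The trace of the frame operator over a fundamental domain *)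

Section FrameOperator.
Variables (R : realType) (s : R).
Hypothesis s1 : 1 < s.
Variable G : set (PSL2 R).
Hypothesis Gclosed : group_closed (mem G).
Hypothesis Gdisc : discrete_subset G.
Local Notation C := R[i].
Local Notation Re := (@complex.Re R).
Local Notation Im := (@complex.Im R).
Local Notation HP := (@upper_half_plane R).
Local Notation act := (@psl2_act R).
Local Notation cI := (@cI R).
Local Notation cK := (@cK R s).
Local Notation XT := (bspace s1).
Local Notation Kv := (Kv s1).
Local Notation rel := (@rel R s s1).
Local Notation equivariant := (@equivariant R s s1 G).
Local Notation good := (@good R s s1 G).
Local Notation dens := (@dens R s s1).
Local Open Scope complex_scope.

Variables (B : set nat) (gn : nat -> PSL2 R).
Hypothesis gnB : set_bij B G gn.


Variable z : C.
Hypothesis z0 : HP z.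
Hypothesis zfree : forall g, G g -> act g z = z -> g = PSL2_one R.

Let p n := act (gn n) z.
Let p0 n : HP (p n). Proof. exact: act_HP. Qed.

Variable c : R.
Hypothesis c0 : 0 < c.
Hypothesis hc : forall f, X0 s f -> forall n,
  \sum_(k < n | nat_of_ord k \in B) nsq (f (p k)) * Im (p k) `^ s <= c * ip s f f.

(* Two real vectors for each orbit point, for the real and imaginary parts of the
   evaluation. *)
Definition frame_vec n : XT := if n./2 \in B
  then kerX s1 (p0 n./2) ((Num.sqrt (Im (p n./2) `^ s / c))%:C * (if odd n then cI else 1)) else 0.
Local Notation vec := frame_vec.

Let weight_ge0 (w : C) : 0 <= Im w `^ s / c.
Proof. by rewrite divr_ge0 ?powR_ge0// ltW. Qed.

Lemma xip_vec (x : XT) n : n \in B ->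
  xip x (vec n.*2) ^+ 2 + xip x (vec n.*2.+1) ^+ 2 = Im (p n) `^ s / c * nsq (val x (p n)).
Proof.
move=> nB; rewrite /vec /= uphalf_double doubleK nB odd_double /= !xip_ker.
rewrite -[Im (p n) `^ s / c in RHS]sqr_sqrtr//; set r := Num.sqrt _.
by rewrite /nsq /cI !cE; ring.
Qed.

Lemma frame_sum (x : XT) n : \sum_(k < n.*2) xip x (vec k) ^+ 2 =
  \sum_(k < n | nat_of_ord k \in B) Im (p k) `^ s / c * nsq (val x (p k)).
Proof.
elim: n => [|n ih]; first by rewrite !big_ord0.
rewrite doubleS !big_ord_recr /= ih [in RHS]big_mkcond big_ord_recr /= -big_mkcond -addrA.
congr (_ + _); case: ifP => nB; first exact: xip_vec.
rewrite /vec /= uphalf_double doubleK nB /xip.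
have -> : ip s (val x) (val (0 : XT)) = 0.
  by rewrite -/(xip x 0) xipC -(scale0r (0 : XT)) xipZ mul0r.
by rewrite expr0n addr0.
Qed.

Lemma frame_bessel (x : XT) n : \sum_(k < n) xip x (vec k) ^+ 2 <= xip x x.
Proof.
apply: (@le_trans _ _ (\sum_(k < n.*2) xip x (vec k) ^+ 2)).
  rewrite -addnn big_split_ord /= lerDl sumr_ge0// => i _; exact: sqr_ge0.
rewrite frame_sum; have := hc (XT_X0 x) n; rewrite mulrC -ler_pdivrMr// => h.
apply: le_trans h; rewrite mulr_suml le_eqVlt; apply/orP; left; apply/eqP.
by apply: eq_bigr => k _; ring.
Qed.

Let hC := @xipC R s s1.
Let hD := @xipD R s s1.
Let hZ := @xipZ R s s1.
Let hG := @xip_ge0 R s s1.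
Let hE := @xip_eq0 R s s1.
Let hX := @X0_complete R s s1.
Let fT := frameT hC hD hZ hX frame_bessel.

(* Locked, for otherwise unification unfolds the limit defining [frameT]. *)
Definition frame_op : XT -> XT := locked fT.
Local Notation T := frame_op.
Definition frame_compl (x : XT) : XT := x - T x.
Local Notation Bo := frame_compl.
Definition frame_neumann n (x : XT) : XT := \sum_(k < n) iter k Bo x.
Local Notation S := frame_neumann.

Let TE : T = fT. Proof. by rewrite /T -lock. Qed.
Let BE : Bo = frameB hC hD hZ hX frame_bessel.
Proof. by apply/funext => x; rewrite /frame_compl TE. Qed.
Let SE : S = frameS hC hD hZ hX frame_bessel.
Proof. by apply/funext => n; apply/funext => x; rewrite /frame_neumann BE. Qed.

Let TD (x y : XT) : T (x + y) = T x + T y.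
Proof. rewrite TE; exact: (frameTD hC hD hZ hG hE hX frame_bessel). Qed.
Let TZ (a : R) (x : XT) : T (a *: x) = a *: T x.
Proof. rewrite TE; exact: (frameTZ hC hD hZ hG hE hX frame_bessel). Qed.
Let TN (x : XT) : T (- x) = - T x.
Proof. rewrite TE; exact: (frameTN hC hD hZ hG hE hX frame_bessel). Qed.
Let Tsym (x y : XT) : xip (T x) y = xip x (T y).
Proof. rewrite TE; exact: (frameT_sym hC hD hZ hG hX frame_bessel). Qed.
Let Tge0 (x : XT) : 0 <= xip (T x) x.
Proof. rewrite TE; exact: (frame_ge0 hC hD hZ hG hX frame_bessel). Qed.
Let Tsq (x : XT) : xip (T x) (T x) <= xip (T x) x.
Proof. rewrite TE; exact: (frame_sq hC hD hZ hG hE hX frame_bessel). Qed.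
Let Tform (x : XT) (e : R) : 0 < e -> exists n0, forall n, (n0 <= n)%N ->
  `|\sum_(k < n) xip x (vec k) ^+ 2 - xip (T x) x| <= e.
Proof. rewrite TE; exact: (frame_form hC hD hZ hG hX frame_bessel). Qed.
Let TS n (x : XT) : T (S n x) = x - iter n Bo x.
Proof. rewrite SE BE TE; exact: (frameTS hC hD hZ hG hE hX frame_bessel). Qed.
Let Spolar n (x : XT) : 4 * xip (T (S n x)) x =
  xip (T (S n x + x)) (S n x + x) - xip (T (S n x - x)) (S n x - x).
Proof. rewrite SE TE; exact: (frameS_polar hC hD hZ hG hE hX frame_bessel). Qed.
Let Bsym n (x y : XT) : xip (iter n Bo x) y = xip x (iter n Bo y).
Proof. rewrite BE; exact: (iterB_sym hC hD hZ hG hX frame_bessel). Qed.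
Let Bnorm n (x : XT) : xip (iter n Bo x) (iter n Bo x) = xip (iter (n + n) Bo x) x.
Proof. rewrite BE; exact: (iterB_norm hC hD hZ hG hX frame_bessel). Qed.
Let xipDr (x y t : XT) : xip x (y + t) = xip x y + xip x t.
Proof. exact: (ipDr hC hD). Qed.
Let xipN (x y : XT) : xip (- x) y = - xip x y.
Proof. exact: (ipN hZ). Qed.
Let xipNr (x y : XT) : xip x (- y) = - xip x y.
Proof. exact: (ipNr hC hZ). Qed.
Let xipZr (a : R) (x y : XT) : xip x (a *: y) = a * xip x y.
Proof. exact: (ipZr hC hZ). Qed.

Definition wform (x : XT) (g : PSL2 R) : R := Im (act g z) `^ s / c * nsq (val x (act g z)).

Lemma wform_ge0 x g : 0 <= wform x g.
Proof. by rewrite mulr_ge0// nsq_ge0. Qed.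

(** The quadratic form of [T] becomes an unordered sum over the group, free of the enumeration; left
    translation can then act on it. *)
Lemma frame_esum (x : XT) : ((xip (T x) x)%:E = \esum_(g in G) (wform x g)%:E)%E.
Proof.
rewrite (esum_enum gnB); last by move=> g; rewrite lee_fin wform_ge0.
apply/esym/cvg_lim => //.
have -> : (fun n => \sum_(0 <= k < n | k \in B) (wform x (gn k))%:E)%E =
    (fun n => (\sum_(k < n.*2) xip x (vec k) ^+ 2)%:E).
  by apply/funext => n; rewrite sumEFin frame_sum big_mkord.
apply: cvg_EFin; first by near=> n.
apply/cvgrPdist_le => e e0; have [n0 hn] := Tform x e0.
exists n0 => // n /= h; rewrite distrC; apply: hn.
by apply: leq_trans h _; rewrite -addnn leq_addr.
Unshelve. all: by end_near. Qed.

Lemma wform_rel h J (x y : XT) : G h -> symmetry s (act h) J -> rel h J x y ->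
  xip (T x) x = xip (T y) y.
Proof.
move=> Gh sJ r; apply: EFin_inj; rewrite !frame_esum -(esum_mull Gclosed (fun g => (wform x g)%:E) Gh).
apply: eq_esum => g Gg; congr _%:E; have gz : HP (act g z) by exact: act_HP.
rewrite /wform act_mul// (symmetry_Im s1 sJ gz) -(r _ gz) nsqM; ring.
Qed.

(** Translation preserves the quadratic form of [T], hence its bilinear form by polarisation;
    testing against kernel functions gives the values of [T x] and [T y]. *)
Lemma equiv_T : equivariant T.
Proof.
have bil h J x y x' y' : G h -> symmetry s (act h) J -> rel h J x y -> rel h J x' y' ->
    xip (T x) x' = xip (T y) y'.
  move=> Gh sJ r r'.
  have pol u v : 4 * xip (T u) v = xip (T (u + v)) (u + v) - xip (T (u - v)) (u - v).
    apply: (@form_polar _ _ (fun x y => xip (T x) y)) => [a b|a b d].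
      rewrite Tsym.
      exact: xipC.
    rewrite TD.
    exact: xipD.
  have rD : rel h J (x + x') (y + y').
    by move=> w w0; rewrite !valD mulrDl r// r'.
  have rB : rel h J (x - x') (y - y').
    by move=> w w0; rewrite !valD !valN mulrDl mulNr r// r'.
  apply: (mulfI (x := 4)) => //; rewrite !pol.
  by rewrite (wform_rel Gh sJ rD) (wform_rel Gh sJ rB).
move=> h J x y Gh sJ r u u0; have [hHP hJ] := sJ; have hu := hHP u u0.
have key a : Re (val (T x) (act h u) * J u * a^*) = Re (val (T y) u * a^*).
  rewrite -(xip_ker _ u0) -(bil h J x y (kerX s1 hu (a * (J u)^*)) (kerX s1 u0 a) Gh sJ r).
    by rewrite xip_ker rmorphM /= conjCK mulrA [_ * J u * _]mulrAC.
  move=> v v0; rewrite !kerXE//; last exact: hHP.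
  by rewrite -(hJ u v u0 v0); ring.
by have := key 1; have := key cI; rewrite /cI !cE => h1 h2; apply: eqC; rewrite !cE; lra.
Qed.

Lemma equiv_B : equivariant Bo.
Proof. exact: (equiv_add (@equiv_id _ _ _ _) (equiv_opp equiv_T)). Qed.

Lemma good_iterB n : good (iter n Bo).
Proof.
split.
- elim: n => //= n ih x y; by rewrite ih /frame_compl TD opprD addrACA.
- elim: n => //= n ih a x; by rewrite ih /frame_compl TZ scalerBr.
- exact: Bsym.
- exact: equiv_iter equiv_B.
Qed.

Lemma good_add A A' : good A -> good A' -> good (fun x => A x + A' x).
Proof.
move=> [a1 a2 a3 a4] [b1 b2 b3 b4]; split.
- by move=> x y; rewrite a1 b1 addrACA.
- by move=> a x; rewrite a2 b2 scalerDr.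
- by move=> x y; rewrite xipD xipDr a3 b3.
- exact: equiv_add.
Qed.

Lemma good_id : good id.
Proof. by split => // *; exact: equiv_id. Qed.

Lemma good_opp A : good A -> good (fun x => - A x).
Proof.
move=> [a1 a2 a3 a4]; split.
- by move=> x y; rewrite a1 opprD.
- by move=> a x; rewrite a2 scalerN.
- by move=> x y; rewrite xipN xipNr a3.
- exact: equiv_opp.
Qed.

Lemma good_S n : good (S n).
Proof.
elim: n => [|n ih].
  have -> : S 0 = fun x => x + - x by apply/funext => x; rewrite /frame_neumann big_ord0 subrr.
  by apply: good_add; [exact: good_id|apply: good_opp; exact: good_id].
have -> : S n.+1 = fun x => S n x + iter n Bo x by apply/funext => x; rewrite /frame_neumann big_ord_recr.
by apply: good_add => //; exact: good_iterB.
Qed.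

Lemma xip_Kv w : HP w -> xip (Kv w) (Kv w) = cK * Im w `^ (- s).
Proof. by move=> w0; rewrite (KvE s1 w0) xip_kerK /nsq !cE expr1n expr0n addr0 mul1r. Qed.

Section Domain.
Variable F : set C.
Hypothesis fundF : fundamental_domain G F.

Let FHP w : F w -> HP w. Proof. by have [h _ _] := fundF; exact: h. Qed.

Definition kform (A : XT -> XT) w := \1_F w * (Im w `^ s * xip (T (A (Kv w))) (A (Kv w))).

(** The term of [g] involves [A K_w] at [g z]. Hermitian symmetry and invariance of [dens] turn it
    into a value at [g^-1 w] of one function attached to [z], which is the shape that unfolding
    wants. *)
Lemma kform_esum A w : good A ->
  ((kform A w)%:E = \esum_(g in G) (\1_F w * (c^-1 * dens A z (act (PSL2_inv g) w)))%R%:E)%E.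
Proof.
move=> hA; rewrite /kform; have [Fw|Fw] := pselect (F w); last first.
  rewrite indicE memNset// mul0r esum1// => g _; by rewrite mul0r.
rewrite indicE mem_set// !mul1r; have w0 := FHP Fw.
set r := Num.sqrt (Im w `^ s).
have rr : r * r = Im w `^ s by rewrite -expr2 sqr_sqrtr// powR_ge0.
have -> : Im w `^ s * xip (T (A (Kv w))) (A (Kv w)) =
    xip (T (r *: A (Kv w))) (r *: A (Kv w)) by rewrite TZ xipZ xipZr mulrA rr.
rewrite frame_esum; apply: eq_esum => g Gg; congr _%:E.
have gz : HP (act g z) by exact: act_HP.
rewrite mul1r -(dens_act Gclosed hA Gg z0) ?actVK//; last exact: act_HP.
rewrite (dens_sym Gclosed hA)// /dens /wform valZ nsqM nsqR expr2 rr; ring.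
Qed.

Lemma kform_int A : good A ->
  hi (kform A) /\ rint (kform A) = Im z `^ s / c * xip (A (Kv z)) (A (Kv z)).
Proof.
move=> hA; pose Psi v := c^-1 * dens A z v.
have mP : mC Psi by apply: mC_M; [exact: mC_cst|exact: mC_dens_act].
have P0 v : 0 <= Psi v by rewrite mulr_ge0 ?dens_ge0// invr_ge0 ltW.
have i0 w : 0 <= (\1_F : C -> R) w by rewrite indicE ler0n.
have [mk hk] := @hint_esum _ _ _ _ gnB (fun g w => \1_F w * Psi (act (PSL2_inv g) w)) (kform A)
  (fun g => mC_M (mC_fund fundF) (mC_mobius (val (repr (PSL2_inv g))) mP))
  (fun g w => mulr_ge0 (i0 w) (P0 _)) (fun w => kform_esum w hA).
rewrite (unfold Gclosed Gdisc gnB fundF mP P0) in hk.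
have hP : hint Psi = (Im z `^ s / c * xip (A (Kv z)) (A (Kv z)))%:E.
  have hL := L2_hi (XT_L2 (A (Kv z))).
  rewrite -/(ip s _ _) /xip ip_nsq -rint_Z// rintK; last exact: hi_Z.
  by apply: eq_hint => v _; rewrite /Psi /dens; ring.
rewrite hP in hk; split; last by rewrite /rint hk.
apply: hi_ge0 => //; last by rewrite hk ltry.
move=> w _; rewrite mulr_ge0// mulr_ge0 ?powR_ge0//.
Qed.

(** On [F] this equals [y^s (T S_n K_w, K_w)]. *)
Definition ktrace n w := \1_F w * (cK - Im w `^ s * xip (iter n Bo (Kv w)) (Kv w)).

(** Polarisation writes the density as a difference of two positive ones, for the operators
    [S_n + 1] and [S_n - 1]; each is unfolded, and the results recombine by the same identity at
    [z]. *)
Lemma ktrace_int n : hi (ktrace n) /\ rint (ktrace n) = Im z `^ s / c * xip (S n (Kv z)) (Kv z).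
Proof.
have gp := good_add (good_S n) good_id; have gm := good_add (good_S n) (good_opp good_id).
have [hp rp] := kform_int gp; have [hm rm] := kform_int gm.
have e : ktrace n = fun w => 4^-1 * (kform (fun x => S n x + id x) w + -1 * kform (fun x => S n x + - id x) w).
  apply/funext => w; rewrite /ktrace /kform.
  have [Fw|Fw] := pselect (F w); last by rewrite indicE memNset// !mul0r mulr0 addr0 mulr0.
  rewrite indicE mem_set// !mul1r mulN1r -mulrBr /=.
  have pw : Im w `^ s != 0 by rewrite gt_eqF// powR_gt0//; exact: FHP.
  have := Spolar n (Kv w); rewrite TS xipD xipN xip_Kv; last exact: FHP.
  by rewrite powRN => <-; field.
rewrite e; split; first by apply: hi_Z; apply: hi_D => //; exact: hi_Z.
rewrite rint_Z; last by apply: hi_D => //; exact: hi_Z.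
rewrite rint_D//; last exact: hi_Z.
rewrite rint_Z// rp rm /= !(xipD, xipDr, xipN, xipNr) [xip (Kv z) (S n _)]xipC; field.
by rewrite gt_eqF.
Qed.

Lemma iterB_le n (x : XT) : xip (iter n Bo x) (iter n Bo x) <= xip x x.
Proof.
elim: n => //= n ih; apply: le_trans ih; set y := iter n Bo x.
rewrite /frame_compl !(xipD, xipDr, xipN, xipNr) [xip y (T y)]xipC.
by have := Tsq y; have := Tge0 y; lra.
Qed.

Lemma ktrace_ge0 n w : 0 <= ktrace (n + n) w.
Proof.
rewrite /ktrace; have [Fw|Fw] := pselect (F w); last by rewrite indicE memNset// mul0r.
rewrite indicE mem_set// mul1r subr_ge0; have w0 := FHP Fw.
rewrite -Bnorm.
have pw : 0 < Im w `^ s by exact: powR_gt0.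
by have := iterB_le n (Kv w); rewrite xip_Kv// powRN -ler_pdivlMl// mulrC.
Qed.

Lemma unit_index : exists2 n1, n1 \in B & gn n1 = PSL2_one R.
Proof. by have [n Bn ng] := gn_surj gnB (G1 Gclosed); exists n => //; exact: mem_set. Qed.

(** The frame vector of even index at the unit of the group is the normalised kernel at [z], so its
    single term already bounds [(T x, x)] from below as the trace estimate demands. *)
Lemma ktrace_le1 n : rint (ktrace (n + n)) <= 1.
Proof.
have [n1 Bn1 g1] := unit_index.
have [_ ->] := ktrace_int (n + n).
have l0 : 0 < Im z `^ s / c by rewrite divr_gt0// powR_gt0.
rewrite SE; apply: (frameS_trace_le hG hE) => // x.
apply: le_trans (frame_coef hC hD hZ hG hX frame_bessel x n1.*2).
rewrite (KvE s1 z0) xip_ker /vec doubleK Bn1 odd_double xip_ker /p g1 act_one.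
rewrite -[Im z `^ s / c in leLHS]sqr_sqrtr ?(ltW l0)// -exprMn.
by rewrite le_eqVlt; apply/orP; left; apply/eqP; congr (_ ^+ 2); rewrite !cE; ring.
Qed.

Definition vanishes (f : C -> C) := forall g, G g -> f (act g z) = 0.

(** Vanishing on the orbit is orthogonality to the frame, so the defects [B^(2n) K_w] tend to 0 and
    the densities tend to [cK] on [F]; Fatou transfers the bound 1. *)
Theorem area_le_of_total : (forall x : XT, vanishes (val x) -> x = 0) ->
  (hint (fun w => \1_F w * cK)%R <= 1)%E.
Proof.
move=> tot; apply: (@hint_fatou R (fun n => ktrace (n + n))).
- by move=> n; have [[]] := ktrace_int (n + n).
- by apply: mC_M; [exact: mC_fund fundF|exact: mC_cst].
- by move=> n w; exact: ktrace_ge0.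
- move=> w w0; apply/cvgrPdist_le => e e0.
  have pw : 0 < Im w `^ s by exact: powR_gt0.
  have vtot (y : XT) : (forall n, xip y (vec n) = 0) -> y = 0.
    move=> h; apply: tot => g Gg; have [n Bn <-] := gn_surj gnB Gg.
    have := xip_vec y (mem_set Bn); rewrite !h expr0n addr0 => /esym/eqP.
    rewrite mulf_eq0 gt_eqF/=; last by rewrite divr_gt0// powR_gt0//; exact: p0.
    by rewrite nsq_eq0 => /eqP.
  have [n0 hn] := frame_total hC hD hZ hG hE hX frame_bessel vtot (Kv w) (divr_gt0 e0 pw).
  exists n0 => // n /= /hn; rewrite -BE Bnorm => h.
  rewrite /ktrace -mulrBr opprB addrC subrK normrM.
  have := xip_ge0 (iter n Bo (Kv w)); rewrite Bnorm => h0.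
  apply: (@le_trans _ _ `|Im w `^ s * xip (iter (n + n) Bo (Kv w)) (Kv w)|).
    rewrite -[leRHS]mul1r ler_wpM2r// indicE; case: (_ \in _); rewrite ?normr1 ?normr0//.
  by rewrite ger0_norm ?mulr_ge0 ?powR_ge0// mulrC -ler_pdivlMr.
- move=> n; have [hk _] := ktrace_int (n + n).
  by rewrite -(rintK hk) lee_fin ktrace_le1.
Qed.

Definition kdef n w := Im w `^ s * xip (iter (n + n) Bo (Kv w)) (Kv w).

(** Hermitian symmetry makes the diagonal values real, so the square of the defect is [dens] on the
    diagonal, which is invariant. *)
Lemma kdef_act h n w : G h -> HP w -> kdef n (act h w) = kdef n w.
Proof.
move=> Gh w0; have hw : HP (act h w) by exact: act_HP.
have hA := good_iterB (n + n).
have k0 v : 0 <= kdef n v by rewrite mulr_ge0 ?powR_ge0// -Bnorm xip_ge0.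
have kE v : HP v -> kdef n v ^+ 2 = dens (iter (n + n) Bo) v v.
  move=> v0; rewrite /kdef /dens {2}(KvE s1 v0) xip_ker rmorph1 mulr1.
  have := good_swap Gclosed hA v0 v0 => /(congr1 Im); rewrite !cE => h1.
  have h2 : Im (val (iter (n + n) Bo (Kv v)) v) = 0 by lra.
  by rewrite /nsq h2; ring.
by apply/eqP; rewrite -(eqrXn2 (n := 2))// !kE// (dens_act Gclosed hA).
Qed.

(** A function vanishing on the orbit is killed by [T], hence fixed by [B^n]; Cauchy-Schwarz against
    [B^n] of the kernel at [w] gives the bound. *)
Lemma kdef_bound (x : XT) n w : vanishes (val x) -> HP w ->
  nsq (val x w) * Im w `^ s <= xip x x * kdef n w.
Proof.
move=> vx w0; set a := val x w; have hA := good_iterB n.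
have Tx : T x = 0.
  apply: xip_eq0; apply/eqP; rewrite eq_le xip_ge0 andbT; apply: le_trans (Tsq x) _.
  rewrite -lee_fin frame_esum esum1// => g Gg.
  have n0 : nsq (0 : C) = 0 by apply/eqP; rewrite nsq_eq0.
  by rewrite /wform vx// n0 mulr0.
have Bx : iter n Bo x = x.
  by elim: n {hA} => //= n ->; rewrite /frame_compl Tx subr0.
have e1 : nsq a = xip x (iter n Bo (kerX s1 w0 a)).
  by rewrite -Bsym Bx xip_ker mulJ.
have e2 : xip (iter n Bo (kerX s1 w0 a)) (iter n Bo (kerX s1 w0 a)) =
    nsq a * xip (iter (n + n) Bo (Kv w)) (Kv w).
  rewrite Bnorm (good_kerX Gclosed _ _ (good_iterB (n + n))) xip_ker (KvE s1 w0) xip_ker /=.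
  by rewrite rmorph1 mulr1 mulrAC mulJ !cE; ring.
have := xip_cs x (iter n Bo (kerX s1 w0 a)); rewrite -e1 e2 => h.
have [->|a0] := eqVneq (nsq a) 0.
  by rewrite mul0r mulr_ge0 ?xip_ge0// mulr_ge0 ?powR_ge0// -Bnorm xip_ge0.
have ap : 0 < nsq a by rewrite lt_neqAle eq_sym a0 nsq_ge0.
rewrite /kdef mulrCA [nsq a * _]mulrC ler_wpM2l ?powR_ge0//.
by rewrite -(ler_pM2l ap) -expr2 mulrCA.
Qed.

Lemma blaschke_neq0 q : HP q -> q != z -> blaschke z q != 0.
Proof.
by move=> q0 qz; rewrite mulf_neq0 ?subr_eq0// invr_eq0; exact: sub_conj_neq0.
Qed.

Theorem ktrace_ge (f : XT) d : vanishes (val f) -> f != 0 -> 0 < d ->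
  exists n, 1 - d <= rint (ktrace (n + n)).
Proof.
move=> vf f0 d0; have [n1 Bn1 g1] := unit_index.
have fn0 : exists2 w, HP w & val f w != 0.
  apply: contrapT => no; move/eqP: f0; apply; apply: XT_ext => w w0.
  by apply/eqP; apply: contraT => h; exfalso; apply: no; exists w.
have [m [g [Xg fg gz]]] := vanishing_order s1 (XT_X0 f) z0 fn0.
have gq h : G h -> h <> PSL2_one R -> g (act h z) = 0.
  move=> Gh h1; have q0 : HP (act h z) by exact: act_HP.
  have qz : act h z != z by apply/eqP => e; apply: h1; exact: zfree.
  have := vf h Gh; rewrite fg// => /eqP; rewrite mulf_eq0 expf_eq0.
  by rewrite (negbTE (blaschke_neq0 q0 qz)) andbF => /eqP.
(* Normalised to the value 1 at [z] and zero elsewhere on the orbit; being real at [z], it is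
   orthogonal also to the second frame vector there, so [T x] is a multiple of the kernel at [z]
   alone. *)
pose x : XT := XT_mulC (g z)^-1 (mkX s1 Xg).
have xz : val x z = 1 by rewrite /= mulVf.
have xq h : G h -> h <> PSL2_one R -> val x (act h z) = 0.
  by move=> Gh h1; rewrite /= gq// mulr0.
have l0 : 0 < Im z `^ s / c by rewrite divr_gt0// powR_gt0.
have vE : vec n1.*2 = Num.sqrt (Im z `^ s / c) *: Kv z.
  rewrite /vec doubleK Bn1 odd_double (KvE s1 z0); apply: XT_ext => w w0.
  by rewrite valZ !kerXE// /p g1 act_one mulr1 mul1r.
have Tx : fT x = (Im z `^ s / c) *: Kv z.
  rewrite /fT (frame_single hC hD hZ hG hE hX frame_bessel (k1 := n1.*2)).
    rewrite vE xipZr (KvE s1 z0) xip_ker xz rmorph1 mulr1 scalerA.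
    by rewrite [Re 1]/= mulr1 -expr2 sqr_sqrtr// ltW.
  move=> k kn; rewrite /vec; case: ifP => kB; last first.
    by rewrite xipC -(scale0r (0 : XT)) xipZ mul0r.
  rewrite xip_ker; have [e|e] := eqVneq k./2 n1.
    have -> : odd k.
      apply: contraT => /negbTE ok; move: kn; rewrite -[k]odd_double_half ok e add0n eqxx //.
    by rewrite /p e g1 act_one xz /cI !cE; ring.
  rewrite /p xq ?mul0r//; first by apply: (gn_in gnB); exact: set_mem.
  rewrite -g1 => h; move/eqP: e; apply; apply: (gn_inj gnB) => //; exact: set_mem.
have xe : xip x (Kv z) = 1 by rewrite (KvE s1 z0) xip_ker xz rmorph1 mulr1.
have [n0 hn] := frameS_trace_lim hG hE l0 Tx xe d0.
exists n0; have [_ ->] := ktrace_int (n0 + n0); rewrite SE; apply: hn; exact: leq_addr.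
Qed.

(** For strictness a loss independent of [n] is required. The density [h] of [f] has integral 1 on
    the half-plane, so some translate of it has positive mass on [F]; by invariance of the defect
    that translate can be subtracted from [cK]. *)
Theorem area_gt_of_vanishing (f : XT) : vanishes (val f) -> f != 0 ->
  (hint (\1_F : C -> R) < +oo)%E -> 1 < cK * rint (\1_F : C -> R).
Proof.
move=> vf f0 aF; have i0 w : 0 <= (\1_F : C -> R) w by rewrite indicE ler0n.
have hF : hi (\1_F : C -> R) by apply: hi_ge0 => //; exact: mC_fund fundF.
have ff : 0 < xip f f.
  rewrite lt_neqAle xip_ge0 andbT eq_sym; apply/eqP => h; move/eqP: f0; apply; exact: xip_eq0.
pose h w := (xip f f)^-1 * (nsq (val f w) * Im w `^ s).
have hih : hi h by apply: hi_Z; apply: L2_hi; exact: XT_L2.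
have mh : mC h by have [] := hih.
have h0 w : 0 <= h w by rewrite !mulr_ge0 ?nsq_ge0 ?powR_ge0// invr_ge0 ltW.
have h1 : rint h = 1.
  rewrite rint_Z; last by apply: L2_hi; exact: XT_L2.
  by rewrite -ip_nsq mulVf// gt_eqF.
have hk n w : HP w -> h w <= kdef n w.
  by move=> w0; rewrite /h ler_pdivrMl//; exact: kdef_bound.
have hK w : HP w -> h w <= cK.
  move=> w0; apply: le_trans (hk 0%N w w0) _; rewrite /kdef /= xip_Kv// mulrCA -powRD ?subrr.
    by rewrite powRr0 mulr1.
  by apply/implyP => _; rewrite gt_eqF.
pose P g w : R := \1_F w * h (act (PSL2_inv g) w).
have mP g : mC (P g) by apply: mC_M; [exact: mC_fund fundF|exact: mC_mobius].
have hiP g : hi (P g).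
  apply: (hi_dom (Q := fun w => cK * \1_F w)) => //.
  - by have [] := hi_Z cK hF.
  - have hh := hi_Z cK hF; rewrite -(rintK hh); exact: ltry.
  move=> w w0; have pg : 0 <= P g w by rewrite mulr_ge0.
  rewrite (ger0_norm pg) /P [leRHS]mulrC; apply: ler_wpM2l => //.
  by apply: hK; exact: act_HP.
have [g Gg Pg] : exists2 g, G g & 0 < rint (P g).
  apply: contrapT => no.
  have := unfold Gclosed Gdisc gnB fundF mh h0.
  rewrite esum1; first by rewrite -(rintK hih) h1 => /(congr1 fine) /= /esym /eqP; rewrite oner_eq0.
  move=> g Gg; rewrite -/(P g) -(rintK (hiP g)); congr _%:E.
  apply/eqP; rewrite eq_le rint_ge0 ?andbT; last by move=> w _; rewrite mulr_ge0.
  by rewrite leNgt; apply/negP => Pg; apply: no; exists g.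
suff : 1 <= cK * rint (\1_F : C -> R) - rint (P g) by lra.
apply/ler_addgt0Pl => d d0; have [n hn] := ktrace_ge vf f0 d0.
have [hkt _] := ktrace_int (n + n).
have hQ : hi (fun w => cK * \1_F w + -1 * P g w) by apply: hi_D; exact: hi_Z.
suff : rint (ktrace (n + n)) <= rint (fun w => cK * \1_F w + -1 * P g w).
  by rewrite rint_D; [rewrite !rint_Z//; lra|exact: hi_Z|exact: hi_Z].
apply: rint_le => // w w0; rewrite /ktrace /P -/(kdef n w).
have w' : HP (act (PSL2_inv g) w) by exact: act_HP.
have := hk n _ w'; rewrite kdef_act//; last exact: (GV Gclosed).
by move=> /(ler_wpM2l (i0 w)); lra.
Qed.

End Domain.

End FrameOperator.

(** * The dichotomy *)

Section Transfer.
Variables (R : realType) (alpha : R).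
Hypothesis alpha1 : -1 < alpha.
Local Notation C := R[i].
Local Notation C2 := (@complex_of_pair R).
Local Notation HP := (@upper_half_plane R).
Local Notation s := (alpha + 2).

Let s1 : 1 < s.
Proof. by rewrite -ltrBlDr (_ : 1 - 2 = -1) //; ring. Qed.

Let bergman_weight (f : C -> C) (p : R * R) : HP (C2 p) ->
  Normc.normc (f (C2 p)) ^+ 2 * p.2 `^ alpha =
  nsq (f (C2 p)) * complex.Im (C2 p) `^ s * p.2 ^- 2.
Proof.
move=> p0; have y0 : 0 < p.2 by exact: p0.
rewrite normc_sqr -mulrA; congr (_ * _); have -> : complex.Im (C2 p) = p.2 by [].
rewrite powRD; last by apply/implyP => _; rewrite gt_eqF.
by rewrite powR_mulrn ?ltW// mulfK// expf_neq0// gt_eqF.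
Qed.

Lemma bergman_X0 (f : C -> C) : bergman alpha f -> X0 s (cut f).
Proof.
move=> [hf]; set W := C2 @^-1` _ => /integrableP[_ fi].
have h w : HP w -> hol f w by exact: hf.
apply: (@X0_of_hol R s s1 f 0) => //.
- apply: le_lt_trans fi; rewrite le_eqVlt; apply/orP; left; apply/eqP.
  apply: eq_integral => p /set_mem p0; rewrite -(bergman_weight f p0) abse_EFin.
  by rewrite ger0_norm// mulr_ge0 ?powR_ge0// exprn_even_ge0.
- by move=> w w0; apply: hol_ccont; exact: h.
- by move=> w w0 _; exact: h.
Qed.

Lemma X0_bergman (f : C -> C) : X0 s f -> bergman alpha f.
Proof.
move=> Xf; split; first by move=> w w0; exact: (X0_holo s1 Xf w0).
have lf : L2 s f by have [] := Xf.
apply: eq_integrable (hi_integrable (L2_hi lf)); first exact: measurable_UH.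
by move=> p /set_mem p0; rewrite (bergman_weight f p0).
Qed.

End Transfer.

Lemma countable_enum (T : Type) (G : set T) (x0 : T) : countable G ->
  exists (B : set nat) (gn : nat -> T), set_bij B G gn.
Proof.
move=> /countable_bijP[B /card_set_bijP[e [eG einj esurj]]].
have inv n : B n -> exists g, G g /\ e g = n.
  by move=> /esurj[g Gg <-]; exists g.
pose gn n := if pselect (exists g, G g /\ e g = n) is left h then sval (cid h) else x0.
have gnP n : B n -> G (gn n) /\ e (gn n) = n.
  move=> Bn; rewrite /gn; case: pselect => [h|]; first exact: (svalP (cid h)).
  by move=> h; exfalso; apply: h; exact: inv.
exists B, gn; split.
- by move=> n /gnP[].
- by move=> m n /set_mem/gnP[_ em] /set_mem/gnP[_ en] h; rewrite -em -en h.
- move=> g Gg; exists (e g); first exact: eG.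
  have [h1 h2] := gnP _ (eG _ Gg); apply: einj => //; exact: mem_set.
Qed.

Theorem theorem1p1 (R : realType) (G : set (PSL2 R)) (z : R[i]) (alpha : R)
    (hG : fuchsian G) (hz : upper_half_plane z)
    (hfix : forall w, psl2_orbit G z w ->
       forall g, G g -> psl2_act g w = w -> g = 1%g)
    (halpha : -1 < alpha) :
  (exists f : R[i] -> R[i],
     [/\ bergman alpha f,
         exists2 w, upper_half_plane w & f w != 0 &
         forall w, psl2_orbit G z w -> f w = 0]) <->
  4 * pi / fine (covolume G) - 1 < alpha.
Proof.
have [Gclosed Gdisc cvoo] := hG.
have s1 : 1 < alpha + 2 by lra.
have zfree g : G g -> psl2_act g z = z -> g = PSL2_one R.
  move=> Gg gz; apply: (hfix z) => //; exists (PSL2_one R); last exact: act_one.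
  exact: (G1 Gclosed).
have [B [gn gnB]] := countable_enum (PSL2_one R) (countable_G Gclosed Gdisc).
have [c c0 hc] := orbit_bessel Gclosed Gdisc gnB hz zfree s1.
have [F fF] := covolume_fund cvoo.
have cvE := covolumeE Gclosed Gdisc gnB fF.
have aoo : (hint (\1_F : R[i] -> R) < +oo)%E by rewrite -cvE.
have i0 w : 0 <= (\1_F : R[i] -> R) w by rewrite indicE ler0n.
have hF : hi (\1_F : R[i] -> R) by apply: hi_ge0 => //; exact: mC_fund fF.
have K0 : 0 < cK (alpha + 2) by exact: cK_gt0.
have fE : fine (covolume G) = rint (\1_F : R[i] -> R) by rewrite cvE.
(* Positivity matters for the division by the covolume. It comes from unfolding the density of a
   nonzero kernel function, which is bounded with positive integral. *)
have a0 : 0 < fine (covolume G).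
  pose K := Kv s1 z; have KK : 0 < xip K K.
    by rewrite xip_Kv// mulr_gt0// powR_gt0.
  rewrite -lte_fin fE (rintK hF).
  apply: (fund_area_gt0 Gclosed Gdisc gnB (Psi := fun w => nsq (val K w) * complex.Im w `^ (alpha + 2))
    (M := cK (alpha + 2) * xip K K) fF).
  - by apply: mC_dens; have [] := XT_L2 K.
  - by move=> w; rewrite mulr_ge0 ?nsq_ge0 ?powR_ge0.
  - move=> w w0; have pw : 0 < complex.Im w `^ (alpha + 2) by exact: powR_gt0.
    by have := xip_bound K w0; rewrite powRN mulrAC ler_pdivlMr.
  - by rewrite -(ip_hint (XT_L2 K)) lte_fin.
have pi0 : 0 < pi :> R by exact: pi_gt0.
have -> : (4 * pi / fine (covolume G) - 1 < alpha) = (1 < cK (alpha + 2) * fine (covolume G)).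
  have -> : cK (alpha + 2) * fine (covolume G) = (alpha + 1) * fine (covolume G) / (4 * pi).
    by rewrite /cK (_ : alpha + 2 - 1 = alpha + 1) 1?mulrAC//; ring.
  have p4 : 0 < 4 * pi :> R by rewrite mulr_gt0.
  by rewrite ltrBlDr ltr_pdivrMr// ltr_pdivlMr// mul1r.
have Xv (x : bspace s1) : vanishes G z (val x) -> x != 0 -> exists f : R[i] -> R[i],
     [/\ bergman alpha f, exists2 w, upper_half_plane w & f w != 0 &
         forall w, psl2_orbit G z w -> f w = 0].
  move=> vx x0; exists (val x); split; first by apply: X0_bergman => //; exact: XT_X0.
    apply: contrapT => no; move/eqP: x0; apply; apply: XT_ext => w w0.
    by apply/eqP; apply: contraT => h; exfalso; apply: no; exists w.
  by move=> w [g Gg <-]; exact: vx.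
split => [[f [bf [w w0 fw] vf]]|h].
  pose x : bspace s1 := mkX s1 (bergman_X0 halpha bf).
  rewrite fE; apply: (area_gt_of_vanishing Gclosed Gdisc gnB hz zfree c0 hc fF (f := x)) => //.
    by move=> g Gg; rewrite /= cutE ?vf//; [exists g|exact: act_HP].
  apply/eqP => /(congr1 (fun y : bspace s1 => val y w)); rewrite /= cutE// => e.
  by move/eqP: fw.
apply: contrapT => no.
have tot (x : bspace s1) : vanishes G z (val x) -> x = 0.
  by move=> vx; apply/eqP; apply: contraT => x0; exfalso; apply: no; exact: (Xv x).
have := area_le_of_total Gclosed Gdisc gnB hz c0 hc fF tot.
have hK := hi_Z (cK (alpha + 2)) hF.
rewrite (@eq_hint _ _ (fun w => cK (alpha + 2) * \1_F w)); last by move=> w _; rewrite mulrC.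
by rewrite -(rintK hK) lee_fin rint_Z// -fE leNgt h.
Qed.
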